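(* Let $p>1$, let $\Omega\subset\mathbb{R}^n$ be a smooth bounded convex domain, and consider the problem $$\Delta^2u=\lambda(u+1)^p \ \text{ in } \Omega,\qquad u>0\ \text{ in }\Omega,\qquad u=\Delta u=0\ \text{ on }\partial\Omega,\qquad \lambda>0.$$ Let $\lambda^*$ be its critical parameter and $u^*$ its extremal solution (the unique weak solution for $\lambda=\lambda^*$). Then $u^*$ is bounded provided one of the following holds: (1) $n\le 8$ and $1<p<\infty$; (2) $9\le n\le 19$ and $1<p<\frac{n}{n-8}+\varepsilon_n$, for some suitable $\varepsilon_n>0$ (that is, for $9\le n\le 19$ there exists $\varepsilon_n>0$ such that $u^*$ is bounded for all such $p$); (3) $n\ge 20$ and $1<p<1+\frac{8p^*}{n-4}$, where $p^*$ (depending on $n$) is the smallest real root greater than $\frac{n-4}{n-8}$ of the algebraic equation in $x$ $$\begin{aligned} & 512(2-n)x^6+4(n^3-60n^2 +720n-1344)x^5-2(13n^3-424n^2+3064n-5408)x^4\\ & +2(27n^3-572n^2 + 3264n-5440)x^3- (49n^3-772n^2 +3776n-5888)x^2\\ & +4(5n^3-66n^2+288n-416)x-3(n^3 -12n^2 + 48 n - 64) = 0. \end{aligned}$$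
   Context: It is known that for this problem there is a critical value $\lambda^*\in(0,\infty)$, depending on $p$ and $\Omega$, such that: for $\lambda\in(0,\lambda^* )$ there is a minimal classical solution $u_\lambda$, and it is stable; for $\lambda=\lambda^*$ there is a unique weak solution $u^*$, called the extremal solution, and $u^*=\lim_{\lambda\to\lambda^*}u_\lambda$ (pointwise limit as $\lambda\uparrow\lambda^*$); for $\lambda>\lambda^*$ there is no weak solution. ''Bounded'' means $u^*\in L^\infty(\Omega)$. *)

(* Defs.v *)
From HB Require Import structures.
From mathcomp Require Import all_boot all_order all_algebra.
From mathcomp Require Import all_classical all_reals all_analysis.

Set Implicit Arguments.
Unset Strict Implicit.
Unset Printing Implicit Defensive.

Import Order.TTheory GRing.Theory Num.Theory.
Import numFieldNormedType.Exports.

Local Open Scope classical_set_scope.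
Local Open Scope ring_scope.

(* R^n is 'rV[R]_n. Its sigma-algebra is generated by the n coordinate
   functions, which for R^n is the Borel sigma-algebra. *)
Definition measure_rV_display : measure_display.
Proof. exact: default_measure_display. Qed.

Section measurable_rV.
Context {R : realType} {n : nat}.

Definition rV_coord (i : 'I_n) (x : 'rV[R]_n) : measurableTypeR R := x ord0 i.

Let rV_set0 : g_sigma_preimage rV_coord set0.
Proof. exact: sigma_algebra0. Qed.

Let rV_setC A : g_sigma_preimage rV_coord A -> g_sigma_preimage rV_coord (~` A).
Proof. exact: sigma_algebraC. Qed.

Let rV_bigcup (F : _^nat) : (forall i, g_sigma_preimage rV_coord (F i)) ->
  g_sigma_preimage rV_coord (\bigcup_i (F i)).
Proof. exact: sigma_algebra_bigcup. Qed.

HB.instance Definition _ := @isMeasurable.Build measure_rV_display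
  'rV[R]_n (g_sigma_preimage rV_coord) rV_set0 rV_setC rV_bigcup.

End measurable_rV.

Section rV_measurable_fun.
Context {R : realType}.

Lemma measurable_rV_coord n (i : 'I_n) :
  measurable_fun [set: 'rV[R]_n] (@rV_coord R n i).
Proof.
move=> _ Y mY; rewrite setTI; apply: sub_sigma_algebra => /=.
rewrite -bigcup_seq/=; exists i => /=; first by rewrite mem_index_enum.
by exists Y => //; rewrite setTI.
Qed.

Lemma measurable_fun_rVP d (T : measurableType d) n (f : T -> 'rV[R]_n) :
  (forall i, measurable_fun [set: T] (@rV_coord R n i \o f)) ->
  measurable_fun [set: T] f.
Proof.
move=> mf _ A mA; rewrite setTI.
have : (fun A => measurable (f @^-1` A)) A; last by [].
move: A mA; apply: smallest_sub.
  split => /= [|A mA|F mF].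
  - by rewrite preimage_set0.
  - by rewrite setTD preimage_setC; exact: measurableC.
  - by rewrite preimage_bigcup; exact: bigcup_measurable.
move=> A; rewrite -bigcup_seq => -[i _ [B mB <-]] /=.
by rewrite setTI -(setTI (f @^-1` _)); exact: mf.
Qed.

Definition rV_snoc n (z : 'rV[R]_n * measurableTypeR R) : 'rV[R]_n.+1 :=
  \row_i oapp (fun j => z.1 ord0 j) z.2 (unlift ord_max i).

Lemma measurable_rV_snoc n : measurable_fun setT (@rV_snoc n).
Proof.
apply: measurable_fun_rVP => i.
case: (unliftP ord_max i) => [j ->|->].
- rewrite (_ : _ \o _ = @rV_coord R n j \o fst).
    by apply: measurableT_comp => //; exact: measurable_rV_coord.
  by apply/funext => z; rewrite /rV_coord /= mxE liftK.
- rewrite (_ : _ \o _ = snd) //.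
  by apply/funext => z; rewrite /rV_coord /= mxE unlift_none.
Qed.

Fixpoint lebesgue_rV (n : nat) : {measure set 'rV[R]_n -> \bar R} :=
  match n return {measure set 'rV[R]_n -> \bar R} with
  | 0%N => \d_(0 : 'rV[R]_0)
  | m.+1 =>
      measure_function_pushforward__canonical__measure_function_Measure
        (lebesgue_rV m \x @lebesgue_measure R)%E (@measurable_rV_snoc m)
  end.

Lemma measurable_rV_box n (A : 'I_n -> set (measurableTypeR R)) :
  (forall i, measurable (A i)) ->
  measurable [set x : 'rV[R]_n | forall i, A i (x ord0 i)].
Proof.
move=> mA.
rewrite (_ : mkset _ = \big[setI/setT]_(i < n) (@rV_coord R n i @^-1` A i)).
  apply: bigsetI_measurable => i _; rewrite -[X in measurable X]setTI.
  exact: measurable_rV_coord.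
rewrite -bigcap_seq; apply/seteqP; split => [x Ax i _|x Ax i]; first exact: Ax.
by apply: (Ax i); rewrite /= mem_index_enum.
Qed.

Lemma lebesgue_rV_box n (A : 'I_n -> set (measurableTypeR R)) :
  (forall i, measurable (A i)) ->
  lebesgue_rV n [set x : 'rV[R]_n | forall i, A i (x ord0 i)] =
  (\prod_(i < n) lebesgue_measure (A i))%E.
Proof.
elim: n A => [|n IH] A mA.
  rewrite big_ord0 /= diracE mem_set //.
  by case.
rewrite big_ord_recr /= /pushforward.
rewrite (_ : _ @^-1` _ =
  [set x : 'rV[R]_n | forall i, A (widen_ord (leqnSn n) i) (x ord0 i)]
  `*` A ord_max); last first.
  apply/seteqP; split => [[x t] /= Axt|[x t] /= [Ax At] i].
    split => [i|]; last by have := Axt ord_max; rewrite mxE unlift_none.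
    have := Axt (lift ord_max i); rewrite mxE liftK /=.
    rewrite (_ : lift ord_max i = widen_ord (leqnSn n) i) //.
    by apply/val_inj; rewrite /= /bump leqNgt ltn_ord.
  rewrite mxE; case: (unliftP ord_max i) => [j ->|->] //=.
  rewrite (_ : lift ord_max j = widen_ord (leqnSn n) j) //.
  by apply/val_inj; rewrite /= /bump leqNgt ltn_ord.
have mA' i : measurable (A (widen_ord (leqnSn n) i)) by exact: mA.
rewrite product_measure1E ?(IH (fun i => A (widen_ord (leqnSn n) i)))//.
exact: (measurable_rV_box mA').
Qed.

End rV_measurable_fun.

Section differential_calculus.
Context {R : realType} {n : nat}.
Implicit Types (f g : 'rV[R]_n -> R) (D : set 'rV[R]_n).

Definition partial (i : 'I_n) f : 'rV[R]_n -> R :=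
  fun x => 'D_(delta_mx ord0 i) f x.

Definition partials (s : seq 'I_n) f : 'rV[R]_n -> R := foldr partial f s.

Definition laplacian f : 'rV[R]_n -> R :=
  fun x => \sum_(i < n) partial i (partial i f) x.

Definition bilaplacian f : 'rV[R]_n -> R := laplacian (laplacian f).

(* C^k(D), for D open. *)
Definition Ck (k : nat) D f := forall s : seq 'I_n, (size s <= k)%N ->
  forall x, D x ->
    {for x, continuous (partials s f)} /\
    ((size s < k)%N -> forall i, derivable (partials s f) x (delta_mx ord0 i)).

Definition smooth D f := forall k, Ck k D f.

(* C^k(closure D), for D open: the partial derivatives of order at most k
   extend continuously from D to closure D. The values of f outside of D are
   irrelevant; boundary values are those of the extension (vanish_on_bd). *)
Definition Ck_closure (k : nat) D f := Ck k D f /\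
  forall s : seq 'I_n, (size s <= k)%N -> exists g : 'rV[R]_n -> R,
    {within closure D, continuous g} /\ {in D, g =1 partials s f}.

Definition bd D : set 'rV[R]_n := closure D `\` interior D.

Definition vanish_on_bd D f :=
  forall x0, bd D x0 -> f x @[x --> within D (nbhs x0)] --> (0 : R).

Definition test_fun D f := smooth setT f /\
  exists K : set 'rV[R]_n,
    [/\ compact K, K `<=` D & forall x, ~ K x -> f x = 0].

End differential_calculus.

(* The boundary is smooth when D is, near each boundary point, the sublevel set
   of a smooth function with nonzero gradient. *)
Definition smooth_boundary (R : realType) (n : nat) (D : set 'rV[R]_n) :=
  forall x0, bd D x0 ->
    exists (V : set 'rV[R]_n) (rho : 'rV[R]_n -> R),
      [/\ open V, V x0, smooth V rho,
          exists i, partial i rho x0 != 0 &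
          forall x, V x -> (D x <-> rho x < 0)].

Definition smooth_bounded_convex_domain (R : realType) (n : nat)
    (D : set 'rV[R]_n) :=
  [/\ D !=set0, open D, bounded_set D,
      convex_set (D : set (convex_lmodType 'rV[R]_n)) & smooth_boundary D].

Section sobolev.
Context {R : realType} {n : nat}.
Implicit Types (f g : 'rV[R]_n -> R) (D : set 'rV[R]_n).
Local Notation mu := (@lebesgue_rV R n).

Definition L1 D f := mu.-integrable D (EFin \o f).

Definition L2 D f := measurable_fun D f /\ L1 D (fun x => f x ^+ 2).

Definition weak_partial (i : 'I_n) D f g :=
  forall psi, test_fun D psi ->
    \int[mu]_(x in D) (f x * partial i psi x) =
    - \int[mu]_(x in D) (g x * psi x).

(* f is in H^2(D) \cap H^1_0(D), with weak gradient G and weak Hessian H.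
   Membership in H^1_0(D) is approximability by test functions in H^1(D). *)
Definition H2_H10 D f (G : 'I_n -> 'rV[R]_n -> R)
    (H : 'I_n -> 'I_n -> 'rV[R]_n -> R) :=
  [/\ L2 D f,
      forall i, L2 D (G i) /\ weak_partial i D f (G i),
      forall i j, L2 D (H i j) /\ weak_partial j D (G i) (H i j) &
      exists psi : nat -> 'rV[R]_n -> R,
        [/\ forall k, test_fun D (psi k),
            \int[mu]_(x in D) ((f x - psi k x) ^+ 2) @[k --> \oo] --> (0 : R) &
            forall i, \int[mu]_(x in D) ((G i x - partial i (psi k) x) ^+ 2)
                        @[k --> \oo] --> (0 : R)]].

End sobolev.

Section navier_problem.
Context {R : realType} {n : nat}.
Implicit Types (u v phi : 'rV[R]_n -> R) (D : set 'rV[R]_n) (p lam : R).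
Local Notation mu := (@lebesgue_rV R n).

(* C^4(closure D) functions with phi = Delta phi = 0 on the boundary. *)
Definition C4_navier D phi :=
  [/\ Ck_closure 4 D phi, vanish_on_bd D phi & vanish_on_bd D (laplacian phi)].

Definition classical_solution p D lam u :=
  [/\ C4_navier D u, forall x, D x -> 0 < u x &
      forall x, D x -> bilaplacian u x = lam * (u x + 1) `^ p].

Definition minimal_classical_solution p D lam u :=
  classical_solution p D lam u /\
  forall v, classical_solution p D lam v -> forall x, D x -> u x <= v x.

(* Nonnegativity on H^2 \cap H^1_0 of the second variation
   \int (Delta phi)^2 - lam p (u + 1)^(p - 1) phi^2; the trace of the weak
   Hessian H is Delta phi. *)
Definition stable p D lam u :=
  forall phi G H, H2_H10 D phi G H ->
    lam * p * \int[mu]_(x in D) ((u x + 1) `^ (p - 1) * phi x ^+ 2) <=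
    \int[mu]_(x in D) ((\sum_(i < n) H i i x) ^+ 2).

Definition weak_solution p D lam u :=
  [/\ L1 D u, {ae mu, forall x, D x -> 0 < u x},
      L1 D (fun x => (u x + 1) `^ p) &
      forall phi, C4_navier D phi ->
        \int[mu]_(x in D) (u x * bilaplacian phi x) =
        lam * \int[mu]_(x in D) ((u x + 1) `^ p * phi x)].

(* The critical value lams and the extremal solution us, given by the properties
   that determine them: existence of minimal, stable classical solutions U lam
   below lams, a weak solution us at lams which is unique (up to null sets) and
   is the limit of U lam, and no weak solution above lams. *)
Definition critical_and_extremal p D (lams : R) (us : 'rV[R]_n -> R) :=
  [/\ 0 < lams,
      exists U : R -> 'rV[R]_n -> R,
        (forall lam, 0 < lam < lams ->
           minimal_classical_solution p D lam (U lam) /\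
           stable p D lam (U lam)) /\
        {ae mu, forall x, D x -> U lam x @[lam --> lams^'-] --> us x},
      weak_solution p D lams us,
      forall v, weak_solution p D lams v ->
        {ae mu, forall x, D x -> v x = us x} &
      forall lam, lams < lam -> forall v, ~ weak_solution p D lam v].

Definition essentially_bounded D u :=
  exists M : R, {ae mu, forall x, D x -> `|u x| <= M}.

Definition extremal_solution_bounded p D :=
  forall lams us, critical_and_extremal p D lams us -> essentially_bounded D us.

End navier_problem.

Definition critical_polynomial (R : realType) (n : nat) (x : R) : R :=
  let N : R := n%:R in
  512 * (2 - N) * x ^+ 6
  + 4 * (N ^+ 3 - 60 * N ^+ 2 + 720 * N - 1344) * x ^+ 5
  - 2 * (13 * N ^+ 3 - 424 * N ^+ 2 + 3064 * N - 5408) * x ^+ 4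
  + 2 * (27 * N ^+ 3 - 572 * N ^+ 2 + 3264 * N - 5440) * x ^+ 3
  - (49 * N ^+ 3 - 772 * N ^+ 2 + 3776 * N - 5888) * x ^+ 2
  + 4 * (5 * N ^+ 3 - 66 * N ^+ 2 + 288 * N - 416) * x
  - 3 * (N ^+ 3 - 12 * N ^+ 2 + 48 * N - 64).

Definition smallest_root_above (R : realType) (n : nat) (x : R) :=
  let x0 : R := (n%:R - 4) / (n%:R - 8) in
  [/\ x0 < x, critical_polynomial n x = 0 &
      forall y, x0 < y -> critical_polynomial n y = 0 -> x <= y].

(* Main.v *)
(** Write u for the minimal solution at lambda, v = - Delta u and w = u + 1.  It
    suffices to bound u uniformly for lambda near its critical value.  Testing the
    equation against a kernel that behaves like the fundamental solution of the
    bilaplacian bounds sup u by \int w^Q as soon as Q > (p - 1) n / 4 (and Q > p - 1).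
    Stability tested with v, together with Souplet's inequality
    v >= c (w^((p+1)/2) - 1), bounds \int w^(2p); this settles p < n/(n-8).

    Beyond that exponent, moving planes bound u and v near the boundary, so that one may
    test stability with z^4 U^q for a cutoff z.  The resulting
    \int (Delta (z^4 U^q))^2 is controlled through Bochner's formula for ln U, which
    bounds \int z^8 U^(2q) |grad ln U|^4 by moments containing Delta U.  With U = v and q
    slightly above 1 this gives the improvement in case (2); with U = w it gives
    \int w^(p+2q-1), the estimate closing up exactly when [closing_poly p q] is positive.
    At p = 1 + 8 x / (n - 4) and q = x this is the critical polynomial at x, up to a
    positive factor. *)
Require Import Defs.
From HB Require Import structures.
From mathcomp Require Import all_boot all_order all_algebra.
From mathcomp Require Import all_classical all_reals all_analysis.
From mathcomp Require Import measurable_realfun ring lra.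
Import Order.TTheory GRing.Theory Num.Theory.
Import numFieldNormedType.Exports.
Local Open Scope classical_set_scope.
Local Open Scope ring_scope.
Set Implicit Arguments.
Unset Strict Implicit.
Unset Printing Implicit Defensive.

(* [lra] reifies the whole context, which is slow when it is long: keep only the
   hypotheses that were moved to the goal. *)
Ltac lra_goal :=
  repeat match goal with
  | H : is_true (@Order.le _ _ _ _) |- _ => clear H
  | H : is_true (@Order.lt _ _ _ _) |- _ => clear H
  | H : is_true (_ && _) |- _ => clear H
  | H : _ = _ |- _ => clear H
  | H : _ /\ _ |- _ => clear H
  end; intros; lra.

(** No boundary integral ever occurs. A function vanishing at the boundary is replaced by a convex
    truncation of itself, which has compact support; Green's identities then become one-sided
    inequalities, and explicit nonnegative kernels of the whole space do the work of Green
    functions. The moving planes need no Hopf lemma: they advance by a maximum principle on sets of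
    small measure, itself a consequence of a kernel estimate.

    The Bochner argument runs on functions that are only C^2: the third derivatives are avoided by
    the symmetry in i, j of the integral of d_j F d_i b for compactly supported F.

    All cutoff terms live in a collar where the solutions are bounded. They are absorbed with a
    small parameter [d], so each closing condition is a strict inequality at [d = 0]. The relation p
    = 1 + 8 x / (n - 4) expresses that p + 2 q - 1 exceeds (p - 1) n / 4 exactly when q > x. At the
    left end (n - 4) / (n - 8) the polynomial is positive for n >= 20, and it is negative at 3/2,
    where the Bochner coefficient degenerates. *)

Section derive_along_lines.
Context {R : realType} {V : normedModType R}.
Implicit Types (f : V -> R) (x v : V).

Lemma is_derive_line f x v df :
  is_derive x v f df <-> is_derive (0 : R) 1 (fun t : R => f (t *: v + x)) df.
Proof.
have E : 'D_v f x = 'D_1 (fun t : R => f (t *: v + x)) 0.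
  rewrite /derive; set g1 := fun h => h^-1 *: _; set g2 := fun h => h^-1 *: _.
  suff -> : g1 = g2 by [].
  by rewrite funeqE /g1 /g2 => h /=; rewrite addr0 scale0r add0r [_%:A]mulr1.
split=> -[d dE]; apply: DeriveDef.
- exact: (proj1 (derivable1P f x v) d).
- by rewrite -E.
- exact: (proj2 (derivable1P f x v) d).
- by rewrite E.
Qed.

Lemma is_derive_compR f (h : R -> R) x v (df dh : R) :
  is_derive x v f df -> is_derive (f x) 1 h dh ->
  is_derive x v (fun y => h (f y)) (dh * df).
Proof.
move=> /is_derive_line df1 dhh; apply/is_derive_line.
apply: (is_derive1_comp (f := h) (g := fun t : R => f (t *: v + x))).
by rewrite scale0r add0r.
Qed.

End derive_along_lines.

(** * Functions of class C^0, C^1 and C^2 on a set, with explicit derivatives *)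

Section calculus.
Context {R : realType} {n : nat}.
Local Notation V := 'rV[R]_n.
Implicit Types (D : set V) (f g : V -> R) (x y v : V).

Definition ebase (i : 'I_n) : V := delta_mx ord0 i.

Definition C0 D f := forall x, D x -> {for x, continuous f}.

(** Derivatives are carried as data instead of being read off from ['D_v], so products, sums and
    compositions come with closed formulas that later algebra can rewrite. *)
Definition C1 D f (df : 'I_n -> V -> R) :=
  [/\ C0 D f, forall i, C0 D (df i) &
      forall i x, D x -> is_derive x (ebase i) f (df i x)].

Definition C2 D f (df : 'I_n -> V -> R) (d2f : 'I_n -> 'I_n -> V -> R) :=
  C1 D f df /\ forall i, C1 D (df i) (d2f i).

Lemma C0_cst D (c : R) : C0 D (fun=> c).
Proof. by move=> x _; exact: cst_continuous. Qed.

Lemma C0D D f g : C0 D f -> C0 D g -> C0 D (fun x => f x + g x).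
Proof. by move=> cf cg x Dx; exact: (continuousD (cf x Dx) (cg x Dx)). Qed.

Lemma C0N D f : C0 D f -> C0 D (fun x => - f x).
Proof. by move=> cf x Dx; exact: (continuousN (cf x Dx)). Qed.

Lemma C0B D f g : C0 D f -> C0 D g -> C0 D (fun x => f x - g x).
Proof. by move=> cf cg; apply: C0D => //; exact: C0N. Qed.

Lemma C0M D f g : C0 D f -> C0 D g -> C0 D (fun x => f x * g x).
Proof. by move=> cf cg x Dx; exact: (continuousM (cf x Dx) (cg x Dx)). Qed.

Lemma C0X D f k : C0 D f -> C0 D (fun x => f x ^+ k).
Proof.
move=> cf; elim: k => [|k IH].
  rewrite (_ : (fun x => _) = fun=> 1); first exact: C0_cst.
  by apply/funext => x; rewrite expr0.
rewrite (_ : (fun x => _) = fun x => f x * f x ^+ k); first exact: C0M.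
by apply/funext => x; rewrite exprS.
Qed.

Lemma C0_sum D (I : Type) (r : seq I) (F : I -> V -> R) :
  (forall i, C0 D (F i)) -> C0 D (fun x => \sum_(i <- r) F i x).
Proof.
move=> cF; elim: r => [|k r IH].
  rewrite (_ : (fun x => _) = fun=> 0); first exact: C0_cst.
  by apply/funext => x; rewrite big_nil.
rewrite (_ : (fun x => _) = fun x => F k x + \sum_(i <- r) F i x).
  exact: C0D.
by apply/funext => x; rewrite big_cons.
Qed.

Lemma C0_comp D f (h : R -> R) : C0 D f ->
  (forall x, D x -> {for f x, continuous h}) -> C0 D (fun x => h (f x)).
Proof. by move=> cf ch x Dx; apply: continuous_comp; [exact: cf|exact: ch]. Qed.

Lemma C0_abs D f : C0 D f -> C0 D (fun x => `|f x|).
Proof. by move=> cf; apply: C0_comp => // x _; exact: norm_continuous. Qed.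

Lemma C0S D D' f : D' `<=` D -> C0 D f -> C0 D' f.
Proof. by move=> DD' cf x /DD'; exact: cf. Qed.

Lemma near_C0 D f g : open D -> (forall x, D x -> f x = g x) -> C0 D f -> C0 D g.
Proof.
move=> oD fg cf x Dx.
have Dn : \forall y \near x, D y by exact: open_nbhs_nbhs.
rewrite /prop_for /continuous_at -fg//.
apply: cvg_trans (cf x Dx).
have E : {near nbhs x, f =1 g} by apply: filterS Dn => y Dy; rewrite fg.
exact: near_eq_cvg E.
Qed.

Lemma C0_coord D (i : 'I_n) : C0 D (fun x => x ord0 i).
Proof. by move=> x _; exact: coord_continuous. Qed.

Lemma C1_cst D (c : R) : C1 D (fun=> c) (fun _ _ => 0).
Proof.
split=> [|i|i x _]; [exact: C0_cst|exact: C0_cst|exact: is_derive_cst].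
Qed.

Lemma C1D D f g df dg : C1 D f df -> C1 D g dg ->
  C1 D (fun x => f x + g x) (fun i x => df i x + dg i x).
Proof.
move=> [f0 f1 f2] [g0 g1 g2]; split=> [|i|i x Dx]; [exact: C0D|exact: C0D|].
exact: (is_deriveD (f2 i x Dx) (g2 i x Dx)).
Qed.

Lemma C1N D f df : C1 D f df -> C1 D (fun x => - f x) (fun i x => - df i x).
Proof.
move=> [f0 f1 f2]; split=> [|i|i x Dx]; [exact: C0N|exact: C0N|].
exact: (is_deriveN (f2 i x Dx)).
Qed.

Lemma C1B D f g df dg : C1 D f df -> C1 D g dg ->
  C1 D (fun x => f x - g x) (fun i x => df i x - dg i x).
Proof. by move=> cf cg; apply: C1D => //; exact: C1N. Qed.

Lemma C1M D f g df dg : C1 D f df -> C1 D g dg ->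
  C1 D (fun x => f x * g x) (fun i x => f x * dg i x + g x * df i x).
Proof.
move=> [f0 f1 f2] [g0 g1 g2]; split=> [|i|i x Dx]; first exact: C0M.
  by apply: C0D; exact: C0M.
exact: (is_deriveM (f2 i x Dx) (g2 i x Dx)).
Qed.

Lemma C1Z D (c : R) f df : C1 D f df ->
  C1 D (fun x => c * f x) (fun i x => c * df i x).
Proof.
move=> [f0 f1 f2]; split=> [|i|i x Dx].
- by apply: C0M => //; exact: C0_cst.
- by apply: C0M => //; exact: C0_cst.
- exact: (is_deriveZ c (f2 i x Dx)).
Qed.

Lemma C1_comp D f df (h h1 : R -> R) : C1 D f df ->
  (forall x, D x -> is_derive (f x) 1 h (h1 (f x))) ->
  (forall x, D x -> {for f x, continuous h1}) ->
  C1 D (fun x => h (f x)) (fun i x => h1 (f x) * df i x).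
Proof.
move=> [f0 f1 f2] dh ch1; split=> [|i|i x Dx].
- apply: C0_comp => // x Dx.
  apply: (@differentiable_continuous _ _ _ (f x) h).
  by apply/derivable1_diffP; case: (dh x Dx).
- by apply: C0M => //; exact: C0_comp.
- by apply: is_derive_compR; [exact: f2|exact: dh].
Qed.

Lemma C1_sum D (I : Type) (r : seq I) (F : I -> V -> R) dF :
  (forall k, C1 D (F k) (dF k)) ->
  C1 D (fun x => \sum_(k <- r) F k x) (fun i x => \sum_(k <- r) dF k i x).
Proof.
move=> cF; elim: r => [|k r IH].
  have -> : (fun x => \sum_(k <- [::]) F k x) = fun=> 0.
    by apply/funext => x; rewrite big_nil.
  have -> : (fun i x => \sum_(k <- [::]) dF k i x) = fun _ _ => 0.
    by apply/funext => i; apply/funext => x; rewrite big_nil.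
  exact: C1_cst.
have -> : (fun x => \sum_(j <- k :: r) F j x) =
    fun x => F k x + \sum_(j <- r) F j x.
  by apply/funext => x; rewrite big_cons.
have -> : (fun i x => \sum_(j <- k :: r) dF j i x) =
    fun i x => dF k i x + \sum_(j <- r) dF j i x.
  by apply/funext => i; apply/funext => x; rewrite big_cons.
exact: C1D.
Qed.

Lemma C1S D D' f df : D' `<=` D -> C1 D f df -> C1 D' f df.
Proof.
move=> DD' [f0 f1 f2]; split=> [|i|i x /DD'].
- exact: C0S f0.
- exact: C0S (f1 i).
- exact: f2.
Qed.

Lemma C1_ext D f f' df df' : open D -> C1 D f df ->
  (forall x, D x -> f x = f' x) -> (forall i x, D x -> df i x = df' i x) ->
  C1 D f' df'.
Proof.
move=> oD [f0 f1 f2] ff' dff'; split=> [|i|i x Dx].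
- exact: (near_C0 oD ff' f0).
- exact: (near_C0 oD (dff' i) (f1 i)).
- rewrite -dff'//; apply: near_eq_is_derive (f2 i x Dx).
  have Dn : \forall y \near x, D y by exact: open_nbhs_nbhs.
  by apply: filterS Dn => y Dy; rewrite ff'.
Qed.

Lemma C1_coord D (k : 'I_n) :
  C1 D (fun x => x ord0 k) (fun i _ => (i == k)%:R).
Proof.
split=> [|i|i x Dx]; [exact: C0_coord|exact: C0_cst|].
have E : forall h : R, h != 0 ->
    h^-1 *: ((h *: ebase i + x) ord0 k - x ord0 k) = (i == k)%:R :> R.
  move=> h h0; rewrite /ebase !mxE eqxx /= addrK eq_sym.
  by rewrite [_ *: _]mulrA mulVf// mul1r.
have H : (fun h : R => h^-1 *: ((h *: ebase i + x) ord0 k - x ord0 k)) @ 0^' -->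
    ((i == k)%:R : R).
  apply: cvg_near_cst; near=> h; apply: E.
  by near: h; exact: nbhs_dnbhs_neq.
apply: DeriveDef; first by apply/cvg_ex; eexists; exact: H.
exact: cvg_lim H.
Unshelve. all: by end_near. Qed.

Lemma C2_C1 D f df d2f : C2 D f df d2f -> C1 D f df.
Proof. by case. Qed.

Lemma C2_C0 D f df d2f : C2 D f df d2f -> C0 D f.
Proof. by case=> -[]. Qed.

Lemma C2S D D' f df d2f : D' `<=` D -> C2 D f df d2f -> C2 D' f df d2f.
Proof. by move=> DD' [f1 f2]; split=> [|i]; [exact: C1S f1|exact: C1S (f2 i)]. Qed.

Lemma C2_ext D f f' df df' d2f d2f' : open D -> C2 D f df d2f ->
  (forall x, D x -> f x = f' x) -> (forall i x, D x -> df i x = df' i x) ->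
  (forall i j x, D x -> d2f i j x = d2f' i j x) ->
  C2 D f' df' d2f'.
Proof.
move=> oD [f1 f2] e0 e1 e2; split=> [|i]; first exact: C1_ext f1 _ _.
by apply: (C1_ext oD (f2 i)) => [x|j x]; [exact: e1|exact: e2].
Qed.

Lemma C2_cst D (c : R) : C2 D (fun=> c) (fun _ _ => 0) (fun _ _ _ => 0).
Proof. by split=> [|i]; exact: C1_cst. Qed.

Lemma C2D D f g df dg d2f d2g : C2 D f df d2f -> C2 D g dg d2g ->
  C2 D (fun x => f x + g x) (fun i x => df i x + dg i x)
       (fun i j x => d2f i j x + d2g i j x).
Proof. by move=> [f1 f2] [g1 g2]; split=> [|i]; exact: C1D. Qed.

Lemma C2Z D (c : R) f df d2f : C2 D f df d2f ->
  C2 D (fun x => c * f x) (fun i x => c * df i x) (fun i j x => c * d2f i j x).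
Proof. by move=> [f1 f2]; split=> [|i]; exact: C1Z. Qed.

Lemma C2N D f df d2f : C2 D f df d2f ->
  C2 D (fun x => - f x) (fun i x => - df i x) (fun i j x => - d2f i j x).
Proof. by move=> [f1 f2]; split=> [|i]; exact: C1N. Qed.

Lemma C2B D f g df dg d2f d2g : C2 D f df d2f -> C2 D g dg d2g ->
  C2 D (fun x => f x - g x) (fun i x => df i x - dg i x)
       (fun i j x => d2f i j x - d2g i j x).
Proof. by move=> [f1 f2] [g1 g2]; split=> [|i]; exact: C1B. Qed.

Lemma C2M D f g df dg d2f d2g : C2 D f df d2f -> C2 D g dg d2g ->
  C2 D (fun x => f x * g x) (fun i x => f x * dg i x + g x * df i x)
    (fun i j x => (f x * d2g i j x + dg i x * df j x) +
                  (g x * d2f i j x + df i x * dg j x)).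
Proof.
move=> [f1 f2] [g1 g2]; split=> [|i]; first exact: C1M.
by apply: C1D; exact: C1M.
Qed.

Lemma C2_comp D f df d2f (h h1 h2 : R -> R) : C2 D f df d2f ->
  (forall x, D x -> is_derive (f x) 1 h (h1 (f x))) ->
  (forall x, D x -> is_derive (f x) 1 h1 (h2 (f x))) ->
  (forall x, D x -> {for f x, continuous h2}) ->
  C2 D (fun x => h (f x)) (fun i x => h1 (f x) * df i x)
    (fun i j x => h1 (f x) * d2f i j x + df i x * (h2 (f x) * df j x)).
Proof.
move=> [f1 f2] dh dh1 ch2; split=> [|i].
  apply: C1_comp => // x Dx; apply: (@differentiable_continuous _ _ _ (f x) h1).
  by apply/derivable1_diffP; case: (dh1 x Dx).
apply: C1M => //; exact: C1_comp.
Qed.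

Lemma C2_coord D (k : 'I_n) :
  C2 D (fun x => x ord0 k) (fun i _ => (i == k)%:R) (fun _ _ _ => 0).
Proof. by split=> [|i]; [exact: C1_coord|exact: C1_cst]. Qed.

Lemma C2_sum D (I : Type) (r : seq I) (F : I -> V -> R) dF d2F :
  (forall k, C2 D (F k) (dF k) (d2F k)) ->
  C2 D (fun x => \sum_(k <- r) F k x) (fun i x => \sum_(k <- r) dF k i x)
    (fun i j x => \sum_(k <- r) d2F k i j x).
Proof.
move=> cF; split=> [|i]; first by apply: C1_sum => k; case: (cF k).
by apply: (@C1_sum D I r (fun k => dF k i) (fun k => d2F k i)) => k; case: (cF k).
Qed.

End calculus.

Lemma natSinv_lt_ex {R : realType} (e : R) : 0 < e -> exists k : nat, k.+1%:R^-1 < e.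
Proof.
move=> e0; exists (Num.bound e^-1); rewrite invf_plt ?posrE//.
by apply: lt_trans (archi_boundP _) _; rewrite ?ltr_nat// invr_ge0 ltW.
Qed.

(** * Cubes as neighbourhoods, and Borel measurability of open sets *)

Section rV_topology.
Context {R : realType} {n : nat}.
Local Notation V := 'rV[R]_n.
Implicit Types (x y : V) (e r : R).

Definition cube x r : set V := [set y | forall i, `|y ord0 i - x ord0 i| < r].

Lemma norm_rV_lt x e : 0 < e -> (`|x| < e) = [forall i, `|x ord0 i| < e].
Proof.
move=> e0; rewrite [`|x|]mx_normrE; apply/bigmax_ltP/forallP.
  by move=> [_ H] i; exact: (H (ord0, i)).
by move=> H; split => // -[i j] _ /=; rewrite ord1.
Qed.

Lemma norm_coord_le x i : `|x ord0 i| <= `|x|.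
Proof.
rewrite [leRHS]mx_normrE.
exact: (@le_bigmax _ _ _ 0 (fun k : 'I_1 * 'I_n => `|x k.1 k.2|) (ord0, i)).
Qed.

Lemma norm_rV_le x e : 0 <= e -> (forall i, `|x ord0 i| <= e) -> `|x| <= e.
Proof.
move=> e0 H; rewrite [leLHS]mx_normrE; apply: bigmax_le => // -[i j] _ /=.
by rewrite ord1.
Qed.

(** The norm of row vectors is the maximum norm, so its balls are cubes; topology and the measure of
    boxes thus speak of the same sets. *)
Lemma cubeE x r : 0 < r -> cube x r = [set y | `|y - x| < r].
Proof.
move=> r0; apply/seteqP; split=> y /=.
  by move=> H; rewrite norm_rV_lt//; apply/forallP => i; rewrite !mxE; exact: H.
by rewrite norm_rV_lt// => /forallP H i; have := H i; rewrite !mxE.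
Qed.

Lemma nbhs_cubeP x (A : set V) :
  nbhs x A <-> exists2 r : R, 0 < r & cube x r `<=` A.
Proof.
split.
  move=> /nbhs_ballP[r /= r0 H]; exists r => //; rewrite cubeE// => y /= yx.
  by apply: H; rewrite -ball_normE /= distrC.
move=> [r r0 H]; apply/nbhs_ballP; exists r => //= y.
by rewrite -ball_normE /= distrC => yx; apply: H; rewrite cubeE.
Qed.

Lemma open_cubeP (A : set V) :
  open A <-> forall x, A x -> exists2 r : R, 0 < r & cube x r `<=` A.
Proof.
rewrite openE; split.
  by move=> H x /H /nbhs_cubeP.
by move=> H x /H /nbhs_cubeP.
Qed.

Lemma measurable_cube x r : measurable (cube x r).
Proof.
rewrite (_ : cube x r =
  [set y : V | forall i, `](x ord0 i - r), (x ord0 i + r)[%classic (y ord0 i)]).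
  exact: (@measurable_rV_box R n
    (fun i => `](x ord0 i - r), (x ord0 i + r)[%classic) (fun=> measurable_itv _)).
apply/seteqP; split=> y /= H i; have := H i; rewrite /= in_itv /= ltr_norml; lra.
Qed.

(** The sigma-algebra is generated by the coordinates, so an open set is written as a countable
    union of cubes with rational centre and radius 1/(k+1). *)
Lemma open_measurable_rV (A : set V) : open A -> measurable A.
Proof.
move=> /open_cubeP oA.
pose T := ({ffun 'I_n -> rat} * nat)%type.
pose c (t : T) : V := \row_i ratr (t.1 i).
pose Q (t : T) := cube (c t) t.2.+1%:R^-1.
(* The union is indexed by codes of pairs (centre, radius index); a number that codes no pair, or a
   cube not contained in [A], contributes the empty set. *)
pose F k := [set x | exists2 t : T, unpickle k = Some t & Q t `<=` A /\ Q t x].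
have Fm k : measurable (F k).
  case E : (unpickle k) => [t|].
    have [tA|tA] := pselect (Q t `<=` A).
      rewrite (_ : F k = Q t); first exact: measurable_cube.
      apply/seteqP; split=> [x [t']|x Qx]; last by exists t.
      by rewrite E => -[<-] [].
    rewrite (_ : F k = set0); first exact: measurable0.
    by apply/seteqP; split=> [x [t']|//]; rewrite E => -[<-] [].
  rewrite (_ : F k = set0); first exact: measurable0.
  by apply/seteqP; split=> [x [t']|//]; rewrite E.
rewrite (_ : A = \bigcup_k F k).
  exact: bigcupT_measurable.
apply/seteqP; split=> [x /oA[r r0 rA]|x [k _ [t _ [tA /tA]]]//].
have [k kr] : exists k : nat, k.+1%:R^-1 < r / 2.
  by apply: natSinv_lt_ex; lra.
have kp : 0 < k.+1%:R^-1 :> R by rewrite invr_gt0.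
have qP i : exists q : rat, ratr q \in `](x ord0 i - k.+1%:R^-1),
    (x ord0 i + k.+1%:R^-1)[.
  have H : x ord0 i - k.+1%:R^-1 < x ord0 i + k.+1%:R^-1.
    by rewrite ltrBlDr -addrA ltrDl addr_gt0.
  exact: (rat_in_itvoo H).
have [q0 q0P] := choice qP.
pose q : {ffun 'I_n -> rat} := [ffun i => q0 i].
have qE i : `|x ord0 i - ratr (q i)| < k.+1%:R^-1.
  rewrite ffunE; have := q0P i; rewrite in_itv /= => /andP[a b].
  move: a b; move: (k.+1%:R^-1) => c1 a b; rewrite ltr_norml; lra.
exists (pickle (q, k)) => //; exists (q, k); first by rewrite pickleK.
split=> [y yQ|i]; last by rewrite /c mxE.
apply: rA => i; have := yQ i; rewrite /c mxE /= => yi; have := qE i.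
move: yi kr; move: (k.+1%:R^-1) => c1; rewrite !ltr_norml; lra.
Qed.

Lemma C0_measurable (D : set V) (f : V -> R) :
  open D -> C0 D f -> measurable_fun D f.
Proof.
move=> oD cf; move=> mD; apply: (measurability _ (RGenOInfty.measurableE R)) => //.
move=> /= _ [_ [x ->] <-]; apply: open_measurable_rV.
rewrite openE => y [Dy fy]; rewrite /interior.
have H1 : \forall z \near y, D z by exact: open_nbhs_nbhs.
have H2 : \forall z \near y, x < f z.
  have := cf y Dy; rewrite /prop_for /continuous_at => cfy.
  have /cfy : nbhs (f y) [set t | x < t].
    by apply: open_nbhs_nbhs; split; [exact: open_gt|move: fy; rewrite /= in_itv /= andbT].
  by [].
by apply: filterS2 H1 H2 => z Dz xz; split => //=; rewrite in_itv /= xz.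
Qed.

End rV_topology.

Section sfinite.
Context {R : realType}.

Lemma lebesgue_rV_sigma_finite n : sigma_finite setT (@lebesgue_rV R n).
Proof.
exists (fun k => [set x : 'rV[R]_n | forall i,
   `](- k%:R), k%:R[%classic (x ord0 i)]).
  apply/seteqP; split=> // x _.
  exists (Num.bound `|x|).+1 => // i /=; rewrite in_itv /=.
  have : `|x ord0 i| < (Num.bound `|x|).+1%:R.
    apply: le_lt_trans (norm_coord_le x i) _.
    by apply: lt_trans (archi_boundP (normr_ge0 x)) _; rewrite ltr_nat.
  by rewrite ltr_norml.
move=> k; split.
  exact: (@measurable_rV_box R n
    (fun=> `](- k%:R), k%:R[%classic) (fun=> measurable_itv _)).
have -> := @lebesgue_rV_box R n
  (fun=> (`](- k%:R : R), k%:R[%classic)) (fun=> measurable_itv _).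
set P := (X in (X < _)%E); suff /fineK <- : P \is a fin_num by rewrite ltry.
rewrite /P {P}; elim/big_ind: _ => [//|x y|i _]; first exact: fin_numM.
by rewrite lebesgue_measure_itv /=; case: ifP => _.
Qed.

End sfinite.

Section lebesgue_rV_sigma_finite_instance.
Context {R : realType}.

(** A copy of [lebesgue_rV] as a plain set function, on which the sigma-finite structure required by
    Fubini's theorem is declared. *)
Definition lebesgue_rVs (n : nat) : set 'rV[R]_n -> \bar R := lebesgue_rV n.

HB.instance Definition _ n := Measure.copy (@lebesgue_rVs n) (@lebesgue_rV R n).
HB.instance Definition _ n := Measure_isSigmaFinite.Build _ _ _
  (@lebesgue_rVs n) (@lebesgue_rV_sigma_finite R n).

End lebesgue_rV_sigma_finite_instance.

(** * The integral of a partial derivative of a function supported in a box *)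

Section box_integration.
Context {R : realType}.

Lemma lebesgue_rV_cube_lty n (x : 'rV[R]_n) r : (lebesgue_rV n (cube x r) < +oo)%E.
Proof.
have -> : cube x r =
  [set y : 'rV[R]_n | forall i, `](x ord0 i - r), (x ord0 i + r)[%classic (y ord0 i)].
  apply/seteqP; split=> y /= H i; have := H i; rewrite /= in_itv /= ltr_norml; lra.
have -> := @lebesgue_rV_box R n
  (fun i => (`](x ord0 i - r), (x ord0 i + r)[%classic)) (fun=> measurable_itv _).
set P := (X in (X < _)%E); suff /fineK <- : P \is a fin_num by rewrite ltry.
rewrite /P {P}; elim/big_ind: _ => [//|u v|i _]; first exact: fin_numM.
by rewrite lebesgue_measure_itv /=; case: ifP => _.
Qed.

Definition off_box n (B : R) (f : 'rV[R]_n -> R) :=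
  forall x : 'rV[R]_n, (exists j, B <= `|x ord0 j|) -> f x = 0.

Lemma compact_closed_box n (B : R) :
  compact [set x : 'rV[R]_n | forall i, `|x ord0 i| <= B].
Proof.
have := @rV_compact R n (fun=> `[(- B), B]%classic) (fun=> @segment_compact R (- B) B).
congr compact; apply/seteqP; split=> x /= H i; have := H i;
  by rewrite /= in_itv /= ler_norml.
Qed.

Lemma continuous_bounded_on n (K : set 'rV[R]_n) (f : 'rV[R]_n -> R) :
  compact K -> (forall x, K x -> {for x, continuous f}) ->
  exists2 M, 0 < M & forall x, K x -> `|f x| <= M.
Proof.
move=> cK cf.
have cfK : {within K, continuous f}.
  by apply: continuous_in_subspaceT => x /set_mem; exact: cf.
have /compact_bounded[M [_ mrt]] := continuous_compact cfK cK.
exists (`|M| + 1); first by rewrite ltr_pwDr.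
move=> x Kx; apply: (mrt (`|M| + 1)).
  by rewrite (le_lt_trans (ler_norm _))// ltrDl.
by exists x.
Qed.

Lemma off_box_integrable n (B : R) (f : 'rV[R]_n -> R) :
  C0 setT f -> off_box B f -> (lebesgue_rV n).-integrable setT (EFin \o f).
Proof.
move=> cf f0.
have mf : measurable_fun setT f by apply: C0_measurable => //; exact: openT.
have mQ : measurable (cube (0 : 'rV[R]_n) B) by exact: measurable_cube.
have : (lebesgue_rV n).-integrable (cube (0 : 'rV[R]_n) B) (EFin \o f).
  apply: measurable_bounded_integrable => //.
  - exact: lebesgue_rV_cube_lty.
  - exact: measurable_funTS.
  - have [|M M0 HM] := @continuous_bounded_on n _ f (@compact_closed_box n B).
      by move=> x _; exact: cf.
    exists M; split; first by rewrite num_real.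
    move=> N MN x xQ /=; apply: le_trans (ltW MN); apply: HM => i.
    by apply: ltW; have := xQ i; rewrite mxE subr0.
move/(integrable_mkcond _ mQ).1; congr (_.-integrable _ _).
apply/funext => x; rewrite /patch; case: ifPn => //; rewrite notin_setE => H.
rewrite /= f0//; apply: contrapT => H'; apply: H => i.
by rewrite mxE subr0 ltNge; apply/negP => H2; apply: H'; exists i.
Qed.

Lemma C1_affine m n (A : 'rV[R]_m -> 'rV[R]_n) (s : 'I_m -> 'I_n) f df :
  continuous A ->
  (forall (h : R) j x, A (h *: ebase j + x) = h *: ebase (s j) + A x) ->
  C1 setT f df -> C1 setT (fun x => f (A x)) (fun j x => df (s j) (A x)).
Proof.
move=> cA eA [f0 f1 f2]; split=> [x _|i x _|i x _].
- apply: (continuous_comp (f := A) (g := f)); [exact: cA|exact: f0].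
- apply: (continuous_comp (f := A) (g := df (s i))); [exact: cA|exact: f1].
- apply/is_derive_line.
  rewrite (_ : (fun t => _) = fun t : R => f (t *: ebase (s i) + A x)).
    exact: (proj1 (is_derive_line _ _ _ _) (f2 (s i) (A x) I)).
  by apply/funext => t; rewrite eA.
Qed.

Lemma continuous_rV (T : topologicalType) n (f : T -> 'rV[R]_n) (x : T) :
  (forall i, {for x, continuous (fun y => f y ord0 i)}) -> {for x, continuous f}.
Proof.
move=> H; rewrite /prop_for /continuous_at.
apply/cvgrPdist_lt => e e0.
have Hi i : \forall y \near x, `|f x ord0 i - f y ord0 i| < e.
  by move: (H i); rewrite /prop_for /continuous_at => /cvgrPdist_lt /(_ e e0).
have := @filter_forall T _ (fun i y => `|f x ord0 i - f y ord0 i| < e) (nbhs x) _ Hi.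
move=> Hn.
have E : nbhs x [set y | `|f x - f y| < e].
  apply: filterS (Hn _) => y Hy /=; rewrite norm_rV_lt//; apply/forallP => i.
  by rewrite !mxE; exact: Hy.
exact: E.
Qed.

Lemma snoc_max n (z : 'rV[R]_n * R) : rV_snoc z ord0 ord_max = z.2.
Proof. by rewrite mxE unlift_none. Qed.

Lemma snoc_lift n (z : 'rV[R]_n * R) j : rV_snoc z ord0 (lift ord_max j) = z.1 ord0 j.
Proof. by rewrite mxE liftK. Qed.

Lemma C1_snocl n (t : R) (f : 'rV[R]_n.+1 -> R) df : C1 setT f df ->
  C1 setT (fun x => f (rV_snoc (x, t))) (fun j x => df (lift ord_max j) (rV_snoc (x, t))).
Proof.
apply: (C1_affine (A := fun x => rV_snoc (x, t)) (s := lift ord_max)).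
  move=> x; apply: continuous_rV => i; case: (unliftP ord_max i) => [j ->|->].
    rewrite (_ : (fun y => _) = fun y : 'rV[R]_n => y ord0 j).
      exact: coord_continuous.
    by apply/funext => y; rewrite snoc_lift.
  rewrite (_ : (fun y => _) = fun=> t); first exact: cst_continuous.
  by apply/funext => y; rewrite snoc_max.
move=> h j x; apply/rowP => i; rewrite !mxE.
case: (unliftP ord_max i) => [k ->|->] /=.
  by rewrite !mxE /= (inj_eq lift_inj).
by rewrite (negbTE (neq_lift _ _)) mulr0 add0r.
Qed.

Lemma C1_snocr n (x : 'rV[R]_n) (f : 'rV[R]_n.+1 -> R) df : C1 setT f df ->
  forall t : R, is_derive t 1 (fun t => f (rV_snoc (x, t)))
    (df ord_max (rV_snoc (x, t))).
Proof.
move=> [_ _ f2] t; apply/is_derive_line => /=.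
rewrite (_ : (fun s : R => _) = fun s : R => f (s *: ebase ord_max + rV_snoc (x, t))).
  exact: (proj1 (is_derive_line _ _ _ _) (f2 ord_max (rV_snoc (x, t)) I)).
apply/funext => s; congr f; apply/rowP => i; rewrite !mxE.
case: (unliftP ord_max i) => [k ->|->] /=.
  by rewrite eq_sym (negbTE (neq_lift _ _)) mulr0 add0r.
by rewrite eqxx/= [s *: 1]mulr1 mulr1.
Qed.

Lemma continuous_snocr n (x : 'rV[R]_n) : continuous (fun t : R => rV_snoc (x, t)).
Proof.
move=> t; apply: continuous_rV => i; case: (unliftP ord_max i) => [j ->|->].
  rewrite (_ : (fun y => _) = fun=> x ord0 j); first exact: cst_continuous.
  by apply/funext => y; rewrite snoc_lift.
rewrite (_ : (fun y => _) = id); first by move=> ?; exact: cvg_id.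
by apply/funext => y; rewrite snoc_max.
Qed.

Lemma integral_derive_compact_R (B : R) (f df : R -> R) : 0 < B ->
  (forall t : R, is_derive t 1 f (df t)) -> continuous df ->
  (forall t, B <= `|t| -> f t = 0) -> (forall t, B <= `|t| -> df t = 0) ->
  (\int[@lebesgue_measure R]_t (df t)%:E = 0)%E.
Proof.
move=> B0 fd cd f0 d0.
have fc : continuous f.
  move=> t; apply: differentiable_continuous; apply/derivable1_diffP.
  by case: (fd t).
transitivity (\int[@lebesgue_measure R]_(t in `[(- B)%R, B]) (df t)%:E)%E.
  rewrite [RHS]integral_mkcond; apply: eq_integral => t _; rewrite /patch.
  case: ifPn => //; rewrite notin_setE /= in_itv /= => /negP.
  by rewrite -ler_norml -ltNge => /ltW/d0 ->.
rewrite (@continuous_FTC2 _ df f).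
- by rewrite !f0 ?sube0 ?normrN ?ger0_norm// ltW.
- by rewrite gtrN.
- by apply: continuous_subspaceT.
- split=> [t _||].
  + by case: (fd t).
  + by apply: cvg_at_right_filter; exact: fc.
  + by apply: cvg_at_left_filter; exact: fc.
- by move=> t _; rewrite derive1E; case: (fd t).
Qed.

(** Induction on the dimension through the splitting [rV_snoc]. Fubini allows to integrate first in
    the last coordinate, where the fundamental theorem of calculus gives zero if it is the
    differentiated one, or first in the other coordinates, where the induction hypothesis applies to
    each slice. *)
Lemma integral_partial_eq0 n (B : R) (f : 'rV[R]_n -> R) df i : 0 < B ->
  C1 setT f df -> off_box B f -> (forall j, off_box B (df j)) ->
  (\int[lebesgue_rV n]_x (df i x)%:E = 0)%E.
Proof.
move=> B0; elim: n f df i => [|n IH] f df i cf f0 df0; first by case: i.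
have dfC := let: And3 _ h _ := cf in h i.
have mdf : measurable_fun setT (df i) by apply: C0_measurable => //; exact: openT.
have idf := off_box_integrable dfC (df0 i).
have ms := @measurable_rV_snoc R n.
have mE : measurable_fun setT (EFin \o df i) by apply/measurable_EFinP.
have idfs : (@lebesgue_rVs R n \x @lebesgue_measure R)%E.-integrable setT
    (EFin \o df i \o @rV_snoc R n).
  apply/integrableP; split.
    exact: (measurableT_comp mE ms).
  have /integrableP[_] := idf.
  rewrite [X in (X < _)%E -> _](_ : _ = \int[pushforward
    (@lebesgue_rVs R n \x @lebesgue_measure R)%E (@rV_snoc R n)]_x
      `|(EFin \o df i) x|)%E//.
  rewrite (ge0_integral_pushforward ms); first by rewrite preimage_setT.
  - exact: measurableT.
  - by apply: measurableT_comp.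
  - by move=> *; exact: abse_ge0.
transitivity (\int[(@lebesgue_rVs R n \x @lebesgue_measure R)%E]_z
  (df i (rV_snoc z))%:E)%E.
  rewrite [LHS](_ : _ = \int[pushforward
    (@lebesgue_rVs R n \x @lebesgue_measure R)%E (@rV_snoc R n)]_x
      ((EFin \o df i) x))%E//.
  by rewrite (integral_pushforward ms).
case: (unliftP ord_max i) idfs => [j ->|->] idfs.
  rewrite -(integral21_prod_meas1 idfs) /fubini_G.
  apply: integral0_eq => t _.
  have [tB|tB] := leP B `|t|.
    apply: integral0_eq => x _ /=; rewrite df0//; exists ord_max.
    by rewrite snoc_max.
  apply: (IH _ _ j (C1_snocl t cf)) => [x [k xk]|k x [l xl]].
    by apply: f0; exists (lift ord_max k); rewrite snoc_lift.
  by apply: df0; exists (lift ord_max l); rewrite snoc_lift.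
rewrite -(integral12_prod_meas1 idfs) /fubini_F.
apply: integral0_eq => x _ /=.
apply: (@integral_derive_compact_R B (fun t => f (rV_snoc (x, t)))) => //.
- exact: C1_snocr.
- move=> t; apply: (continuous_comp (f := fun t => rV_snoc (x, t)) (g := df ord_max)).
    exact: continuous_snocr.
  by case: cf => _ h _; exact: h.
- by move=> t tB; apply: f0; exists ord_max; rewrite snoc_max.
- by move=> t tB; apply: df0; exists ord_max; rewrite snoc_max.
Qed.

End box_integration.

(** * Bounded continuous and compactly supported functions *)

Section bounded_continuous.
Context {R : realType} {n : nat}.
Local Notation V := 'rV[R]_n.
Implicit Types (D K : set V) (f g : V -> R) (x y : V).

Definition lap (d2f : 'I_n -> 'I_n -> V -> R) x : R := \sum_i d2f i i x.
Definition gdot (df dg : 'I_n -> V -> R) x : R := \sum_i df i x * dg i x.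

(** On a bounded open set this class is integrable and stable under products, so integrability
    obligations reduce to closure properties. *)
Definition BC D f := C0 D f /\ exists M, forall x, D x -> `|f x| <= M.

(** Only values in [D] are constrained. Together with continuity this gives boundedness ([cs_BC]),
    whatever the growth of other factors near the boundary. *)
Definition cs D f := exists2 K, compact K /\ K `<=` D &
  forall x, D x -> ~ K x -> f x = 0.

Definition itg D f := \int[lebesgue_rV n]_(x in D) f x.

Lemma BC_cst D c : BC D (fun=> c).
Proof. by split; [exact: C0_cst|exists `|c|]. Qed.

Lemma BCD D f g : BC D f -> BC D g -> BC D (fun x => f x + g x).
Proof.
move=> [cf [M fM]] [cg [N gN]]; split; first exact: C0D.
exists (M + N) => x Dx; apply: le_trans (ler_normD _ _) _.
by apply: lerD; [exact: fM|exact: gN].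
Qed.

Lemma BCN D f : BC D f -> BC D (fun x => - f x).
Proof.
move=> [cf [M fM]]; split; first exact: C0N.
by exists M => x Dx; rewrite normrN fM.
Qed.

Lemma BCB D f g : BC D f -> BC D g -> BC D (fun x => f x - g x).
Proof. by move=> bf bg; apply: BCD => //; exact: BCN. Qed.

Lemma BCM D f g : BC D f -> BC D g -> BC D (fun x => f x * g x).
Proof.
move=> [cf [M fM]] [cg [N gN]]; split; first exact: C0M.
exists (M * N) => x Dx; rewrite normrM; apply: ler_pM => //; [exact: fM|exact: gN].
Qed.

Lemma BCZ D c f : BC D f -> BC D (fun x => c * f x).
Proof. by move=> bf; apply: BCM => //; exact: BC_cst. Qed.

Lemma BCX D f k : BC D f -> BC D (fun x => f x ^+ k).
Proof.
move=> [cf [M fM]]; split; first exact: C0X.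
exists (M ^+ k) => x Dx; rewrite normrX; apply: lerXn2r; rewrite ?nnegrE//.
  exact: le_trans (normr_ge0 _) (fM x Dx).
exact: fM.
Qed.

Lemma BC_abs D f : BC D f -> BC D (fun x => `|f x|).
Proof.
move=> [cf [M fM]]; split; first exact: C0_abs.
by exists M => x Dx; rewrite normr_id fM.
Qed.

Lemma BC_sum D (I : Type) (r : seq I) (F : I -> V -> R) :
  (forall i, BC D (F i)) -> BC D (fun x => \sum_(i <- r) F i x).
Proof.
move=> cF; elim: r => [|k r IH].
  rewrite (_ : (fun x => _) = fun=> 0); first exact: BC_cst.
  by apply/funext => x; rewrite big_nil.
rewrite (_ : (fun x => _) = fun x => F k x + \sum_(i <- r) F i x).
  exact: BCD.
by apply/funext => x; rewrite big_cons.
Qed.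

Lemma C0_lap D f df d2f : C2 D f df d2f -> C0 D (lap d2f).
Proof. by move=> [_ f2]; apply: C0_sum => i; case: (f2 i) => _ h _; exact: h. Qed.

Lemma BC_le D f g : C0 D f -> BC D g -> (forall x, D x -> `|f x| <= `|g x|) -> BC D f.
Proof.
move=> cf [_ [M gM]] fg; split => //.
by exists M => x Dx; apply: le_trans (fg x Dx) (gM x Dx).
Qed.

Lemma near_BC D f g : open D -> (forall x, D x -> f x = g x) -> BC D f -> BC D g.
Proof.
move=> oD fg [cf [M fM]]; split; first exact: near_C0 fg cf.
by exists M => x Dx; rewrite -fg// fM.
Qed.

Lemma cs_BC D f : C0 D f -> cs D f -> BC D f.
Proof.
move=> cf [K [cK KD] f0]; split => //.
have [|M M0 fM] := @continuous_bounded_on R n K f cK; first by move=> x /KD; exact: cf.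
exists M => x Dx; have [/fM//|Kx] := pselect (K x).
by rewrite f0// normr0 ltW.
Qed.

Lemma csMl D f g : cs D f -> cs D (fun x => f x * g x).
Proof. by move=> [K cK f0]; exists K => // x Dx Kx; rewrite f0// mul0r. Qed.

Lemma csMr D f g : cs D g -> cs D (fun x => f x * g x).
Proof. by move=> [K cK f0]; exists K => // x Dx Kx; rewrite f0// mulr0. Qed.

Lemma csX D f k : (0 < k)%N -> cs D f -> cs D (fun x => f x ^+ k).
Proof.
by move=> k0 [K cK f0]; exists K => // x Dx Kx; rewrite f0// expr0n gtn_eqF.
Qed.

Lemma csN D f : cs D f -> cs D (fun x => - f x).
Proof. by move=> [K cK f0]; exists K => // x Dx Kx; rewrite f0// oppr0. Qed.

Lemma csD D f g : cs D f -> cs D g -> cs D (fun x => f x + g x).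
Proof.
move=> [K [cK KD] f0] [L [cL LD] g0]; exists (K `|` L).
  by split; [exact: compactU|move=> x [/KD|/LD]].
by move=> x Dx KL; rewrite f0 ?g0 ?addr0// => H; apply: KL; [right|left].
Qed.

Lemma cs_ext D f g : (forall x, D x -> f x = g x) -> cs D f -> cs D g.
Proof. by move=> fg [K cK f0]; exists K => // x Dx Kx; rewrite -fg// f0. Qed.

Lemma cs_grad D f df i : open D -> C1 D f df -> cs D f -> cs D (df i).
Proof.
move=> oD [_ _ f2] [K [cK KD] f0]; exists K => // x Dx Kx.
have oDK : open (D `&` ~` K).
  by apply: openI => //; apply: closed_openC; exact: compact_closed.
have Hn : \forall y \near x, (fun=> 0 : R) y = f y.
  have Hn : nbhs x (D `&` ~` K) by apply: open_nbhs_nbhs; split.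
  by apply: filterS Hn => y [Dy Ky]; rewrite f0.
have [_ <-] := near_eq_is_derive Hn (is_derive_cst (0 : R) x (ebase i)).
by have [_ <-] := f2 i x Dx.
Qed.

Lemma C1_local f df : (forall x, exists2 U, open U /\ U x & C1 U f df) -> C1 setT f df.
Proof.
move=> H; split=> [x _|i x _|i x _]; have [U [oU Ux] [f0 f1 f2]] := H x.
- exact: f0.
- exact: f1.
- exact: f2.
Qed.

Lemma BC_csMl D f g : C0 D f -> C0 D g -> cs D f -> BC D (fun x => f x * g x).
Proof. by move=> cf cg sf; apply: cs_BC; [exact: C0M|exact: csMl]. Qed.

End bounded_continuous.

(** * Integration by parts with compact support *)

Section domain_integration.
Context {R : realType} {n : nat} (D : set 'rV[R]_n).
Local Notation V := 'rV[R]_n.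
Hypotheses (oD : open D) (bD : bounded_set D).
Implicit Types (f g : V -> R) (x y : V).

Lemma domain_measurable : measurable D.
Proof. exact: open_measurable_rV. Qed.
Local Notation mD := domain_measurable.

Lemma bounded_set_cube : exists2 B, 0 < B & forall x, D x -> forall i, `|x ord0 i| < B.
Proof.
have [M [_ HM]] := bD; exists (`|M| + 2); first by rewrite ltr_wpDl.
move=> x Dx i; apply: le_lt_trans (norm_coord_le x i) _.
apply: (@le_lt_trans _ _ (`|M| + 1)); last by rewrite ltrD2l ltr1n.
by apply: HM => //; rewrite (le_lt_trans (ler_norm _))// ltrDl.
Qed.

Lemma domain_lty : (lebesgue_rV n D < +oo)%E.
Proof.
have [B B0 HB] := bounded_set_cube.
apply: le_lt_trans (lebesgue_rV_cube_lty (0 : V) B).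
apply: le_measure; rewrite ?inE; [exact: mD|exact: measurable_cube|].
by move=> x Dx i; rewrite mxE subr0; exact: HB.
Qed.

Lemma BC_integrable f : BC D f -> (lebesgue_rV n).-integrable D (EFin \o f).
Proof.
move=> [cf [M fM]]; apply: measurable_bounded_integrable.
- exact: mD.
- exact: domain_lty.
- exact: C0_measurable.
- exists M; split; first by rewrite num_real.
  by move=> N MN x Dx /=; apply: le_trans (fM x Dx) (ltW MN).
Qed.

Lemma eq_itg f g : (forall x, D x -> f x = g x) -> itg D f = itg D g.
Proof. by move=> fg; apply: eq_Rintegral => x /set_mem; exact: fg. Qed.

Lemma itgD f g : BC D f -> BC D g -> itg D (fun x => f x + g x) = itg D f + itg D g.
Proof.
by move=> bf bg; apply: RintegralD; [exact: mD|exact: BC_integrable|exact: BC_integrable].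
Qed.

Lemma itgZ c f : BC D f -> itg D (fun x => c * f x) = c * itg D f.
Proof. by move=> bf; apply: RintegralZl; [exact: mD|exact: BC_integrable]. Qed.

Lemma itgN f : BC D f -> itg D (fun x => - f x) = - itg D f.
Proof.
move=> bf; rewrite -[RHS]mulN1r -itgZ//; apply: eq_itg => x _.
by rewrite mulN1r.
Qed.

Lemma itgB f g : BC D f -> BC D g -> itg D (fun x => f x - g x) = itg D f - itg D g.
Proof. by move=> bf bg; rewrite itgD ?itgN//; exact: BCN. Qed.

Lemma itg_le f g : BC D f -> BC D g -> (forall x, D x -> f x <= g x) ->
  itg D f <= itg D g.
Proof.
by move=> bf bg fg; apply: le_Rintegral => //; [exact: mD|exact: BC_integrable..].
Qed.

Lemma itg_ge0 f : (forall x, D x -> 0 <= f x) -> 0 <= itg D f.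
Proof. by move=> f0; apply: Rintegral_ge0. Qed.

Lemma itg_cst c : itg D (fun=> c) = c * fine (lebesgue_rV n D).
Proof. by rewrite /itg Rintegral_cst //; exact: mD. Qed.

Lemma itg_abs f : BC D f -> `|itg D f| <= itg D (fun x => `|f x|).
Proof. by move=> bf; apply: le_normr_Rintegral; [exact: mD|exact: BC_integrable]. Qed.

Lemma itg_sum (I : Type) (r : seq I) (F : I -> V -> R) : (forall i, BC D (F i)) ->
  itg D (fun x => \sum_(i <- r) F i x) = \sum_(i <- r) itg D (F i).
Proof.
move=> bF; elim: r => [|k r IH].
  rewrite big_nil (_ : (fun x => _) = fun=> 0); first by rewrite itg_cst mul0r.
  by apply/funext => x; rewrite big_nil.
rewrite big_cons -IH -itgD//; last exact: BC_sum.
by apply: eq_itg => x _; rewrite big_cons.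
Qed.

Lemma cs_extend f df : C1 D f df -> cs D f -> exists K F dF,
  [/\ compact K, K `<=` D, C1 setT F dF,
      forall x, D x -> F x = f x /\ forall i, dF i x = df i x &
      forall x, ~ K x -> F x = 0 /\ forall i, dF i x = 0].
Proof.
move=> cf [K [cK KD] f0].
pose F x := if pselect (D x) then f x else 0.
pose dF j x := if pselect (D x) then df j x else 0.
have FD x : D x -> F x = f x by rewrite /F; case: pselect.
have dFD j x : D x -> dF j x = df j x by rewrite /dF; case: pselect.
have df0 j y : D y -> ~ K y -> df j y = 0.
  have oK : open (~` K) by apply: closed_openC; exact: compact_closed.
  move=> Dy Ky; have [_ <-] := let: And3 _ _ h := cf in h j y Dy.
  have Hn : nbhs y (D `&` ~` K) by apply: open_nbhs_nbhs; split => //; exact: openI.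
  have E : \forall z \near y, (fun=> 0 : R) z = f z.
    by apply: filterS Hn => z [Dz Kz]; rewrite f0.
  by have [_ <-] := near_eq_is_derive E (is_derive_cst (0 : R) y (ebase j)).
exists K, F, dF; split => //.
- apply: C1_local => x; have [Dx|nDx] := pselect (D x).
    exists D => //; apply: (C1_ext oD cf) => [y|j y] Dy; first by rewrite FD.
    by rewrite dFD.
  have oK : open (~` K) by apply: closed_openC; exact: compact_closed.
  exists (~` K); first by split => // /KD.
  apply: (C1_ext oK (C1_cst _ 0)) => [y Ky|j y Ky].
    by rewrite /F; case: pselect => // Dy; rewrite f0.
  by rewrite /dF; case: pselect => // Dy; rewrite df0.
- by move=> x Dx; split => [|j]; [exact: FD|exact: dFD].
- move=> x Kx; rewrite /F /dF; split => [|j]; case: pselect => // Dx; first exact: f0.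
  exact: df0.
Qed.

(** Every integration by parts below reduces to this: the extension by zero is C^1 on the whole
    space, so compact support replaces any regularity of the boundary. *)
Lemma itg_grad_eq0 f df i : C1 D f df -> cs D f -> itg D (df i) = 0.
Proof.
move=> cf sf; have [K [F [dF [_ KD cF FD F0]]]] := cs_extend cf sf.
have [B B0 HB] := bounded_set_cube.
have ob (g : V -> R) : (forall x, ~ D x -> g x = 0) -> off_box B g.
  move=> g0 x [j xj]; apply: g0 => /HB /(_ j); by rewrite ltNge xj.
have F0' x : ~ D x -> F x = 0 by move=> Dx; apply: (proj1 (F0 x _)) => /KD.
have dF0 j x : ~ D x -> dF j x = 0 by move=> Dx; apply: (proj2 (F0 x _)) => /KD.
have H := integral_partial_eq0 i B0 cF (ob _ F0') (fun j => ob _ (dF0 j)).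
rewrite /itg Rintegral_mkcond /Rintegral -[RHS](_ : fine (0%E : \bar R) = 0)// -H.
congr fine; apply: eq_integral => x _; rewrite /patch.
case: ifPn => [/set_mem Dx|]; first by rewrite (proj2 (FD x Dx)).
by rewrite notin_setE => nDx; rewrite dF0.
Qed.

Lemma ibp f g df dg i : C1 D f df -> C1 D g dg -> cs D f ->
  itg D (fun x => f x * dg i x) = - itg D (fun x => df i x * g x).
Proof.
move=> cf cg sf; have sdf := cs_grad i oD cf sf.
have [f0 f1 _] := cf; have [g0 g1 _] := cg.
apply/eqP; rewrite -addr_eq0 -itgD.
- have := itg_grad_eq0 i (C1M cf cg) (csMl g sf) => H.
  by apply/eqP; rewrite -[RHS]H; apply: eq_itg => x _; rewrite [g x * _]mulrC.
- exact: BC_csMl.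
- exact: BC_csMl.
Qed.

Lemma green f g df dg d2g : C1 D f df -> C2 D g dg d2g -> cs D f ->
  itg D (fun x => f x * lap d2g x) = - itg D (gdot df dg).
Proof.
move=> cf [cg c2g] sf; have [f0 f1 _] := cf; have [g0 g1 _] := cg.
have sdf i := cs_grad i oD cf sf.
have E x : f x * lap d2g x = \sum_i f x * d2g i i x by rewrite mulr_sumr.
rewrite (eq_itg (fun x _ => E x)) itg_sum; last first.
  by move=> i; apply: BC_csMl => //; case: (c2g i).
rewrite itg_sum; last by move=> i; apply: BC_csMl.
rewrite -sumrN; apply: eq_bigr => i _; exact: (ibp i cf (c2g i) sf).
Qed.

Lemma green2 f g df dg d2f d2g : C2 D f df d2f -> C2 D g dg d2g -> cs D f ->
  itg D (fun x => f x * lap d2g x) = itg D (fun x => lap d2f x * g x).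
Proof.
move=> cf cg sf; rewrite (green (C2_C1 cf) cg sf).
have [[f0 f1 _] c2f] := cf; have [[g0 g1 _] _] := cg.
have sdf i := cs_grad i oD (C2_C1 cf) sf.
have sd2f i := cs_grad i oD (c2f i) (sdf i).
have E x : lap d2f x * g x = \sum_i d2f i i x * g x by rewrite mulr_suml.
have -> : itg D (gdot df dg) = \sum_i itg D (fun x => df i x * dg i x).
  by apply: itg_sum => i; exact: BC_csMl.
rewrite (eq_itg (fun x _ => E x)) itg_sum; last first.
  by move=> i; apply: BC_csMl => //; case: (c2f i).
rewrite -sumrN; apply: eq_bigr => i _.
by rewrite (ibp i (c2f i) (C2_C1 cg) (sdf i)) opprK.
Qed.

End domain_integration.

(** * A convex C^2 truncation of the positive part *)

Section truncated_powers.
Context {R : realType}.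
Implicit Types (s t e : R).

Definition tpos t : R := Num.max t 0.

Lemma tposE t : tpos t = (t + `|t|) / 2.
Proof.
rewrite /tpos; have [t0|t0] := leP t 0.
  by rewrite ler0_norm// subrr mul0r.
by rewrite gtr0_norm// -mulr2n -[t *+ 2]mulr_natr mulfK.
Qed.

Lemma tpos_ge0 t : 0 <= tpos t. Proof. by rewrite le_max lexx orbT. Qed.

Lemma tpos_le t : t <= tpos t. Proof. by rewrite le_max lexx. Qed.

Lemma tpos_pos t : 0 <= t -> tpos t = t. Proof. by move=> ?; rewrite /tpos max_l. Qed.

Lemma tpos_neg t : t <= 0 -> tpos t = 0. Proof. by move=> ?; rewrite /tpos max_r. Qed.

Lemma tpos_continuous : continuous tpos.
Proof.
move=> t; rewrite (_ : tpos = fun t => (t + `|t|) * 2^-1); last first.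
  by apply/funext => u; rewrite tposE.
apply: cvgM; last exact: cvg_cst.
by apply: cvgD; [exact: cvg_id|exact: norm_continuous].
Qed.

Definition tpow k t : R := tpos t ^+ k.

Lemma tpow_continuous k : continuous (tpow k).
Proof.
move=> t; elim: k => [|k IH].
  rewrite (_ : tpow 0 = fun=> 1); first exact: cst_continuous.
  by apply/funext => u; rewrite /tpow expr0.
rewrite (_ : tpow k.+1 = fun u => tpos u * tpow k u).
  by apply: cvgM => //; exact: tpos_continuous.
by apply/funext => u; rewrite /tpow exprS.
Qed.

Lemma is_derive_tpow k t : (0 < k)%N ->
  is_derive t 1 (tpow k.+1) (k.+1%:R * tpow k t).
Proof.
move=> k0; have [t0|t0|t0] := ltgtP t 0.
- rewrite /tpow tpos_neg ?ltW// expr0n gtn_eqF// mulr0.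
  have Hn : \forall u \near t, (fun=> 0 : R) u = tpos u ^+ k.+1.
    have : nbhs t [set u | u < 0].
      by apply: open_nbhs_nbhs; split; [exact: open_lt|].
    by apply: filterS => u /= u0; rewrite tpos_neg ?ltW// expr0n.
  exact: (near_eq_is_derive Hn (is_derive_cst (0 : R) t 1)).
- rewrite /tpow tpos_pos ?ltW//.
  have Hn : \forall u \near t, u ^+ k.+1 = tpos u ^+ k.+1.
    have : nbhs t [set u | 0 < u].
      by apply: open_nbhs_nbhs; split; [exact: open_gt|].
    by apply: filterS => u /= u0; rewrite tpos_pos ?ltW.
  apply: (near_eq_is_derive Hn).
  apply: DeriveDef; first exact: exprn_derivable.
  by rewrite exp_derive /= [_ *: 1]mulr1.
- rewrite t0; apply/is_derive1_caratheodory; exists (tpow k); split.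
  + move=> z; rewrite /tpow (tpos_neg (lexx 0)) expr0n subr0 subr0 exprSr.
    have [z0|z0] := leP z 0; last by rewrite tpos_pos ?ltW.
    by rewrite tpos_neg// expr0n gtn_eqF// !mul0r.
  + exact: tpow_continuous.
  + by rewrite /tpow (tpos_neg (lexx 0)) expr0n gtn_eqF// mulr0.
Qed.

(** [hst2 e] is the tent with support [e, 3 e], top 1/e at 2 e and integral 1. Integrating twice
    from the left gives [hst e]: a convex C^2 function that vanishes up to e and equals t - 2 e from
    3 e on. [hst1 e] also serves as a cutoff profile from 0 to 1. *)
Definition hst e t : R := (6 * e ^+ 2)^-1 *
  (tpow 3 (t - e) - 2 * tpow 3 (t - 2 * e) + tpow 3 (t - 3 * e)).
Definition hst1 e t : R := (2 * e ^+ 2)^-1 *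
  (tpow 2 (t - e) - 2 * tpow 2 (t - 2 * e) + tpow 2 (t - 3 * e)).
Definition hst2 e t : R := (e ^+ 2)^-1 *
  (tpow 1 (t - e) - 2 * tpow 1 (t - 2 * e) + tpow 1 (t - 3 * e)).

Lemma is_derive_tpowB k (c : R) t : (0 < k)%N ->
  is_derive t 1 (fun u => tpow k.+1 (u - c)) (k.+1%:R * tpow k (t - c)).
Proof.
move=> k0; rewrite -[X in is_derive _ _ _ X]mulr1.
apply: (is_derive1_comp (f := tpow k.+1) (g := fun u => u - c)).
  exact: is_derive_tpow.
by rewrite -[X in is_derive _ _ _ X]subr0; apply: is_deriveB.
Qed.

Lemma is_derive_hst e t : 0 < e -> is_derive t 1 (hst e) (hst1 e t).
Proof.
move=> e0; have d c := @is_derive_tpowB 2 c t isT.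
have := is_deriveZ (6 * e ^+ 2)^-1 (is_deriveD (is_deriveB (d e)
  (is_deriveZ 2 (d (2 * e)))) (d (3 * e))).
move=> H; apply: (is_derive_eq H); rewrite /hst1 /=.
rewrite /GRing.scale /=; field; by rewrite gt_eqF.
Qed.

Lemma is_derive_hst1 e t : 0 < e -> is_derive t 1 (hst1 e) (hst2 e t).
Proof.
move=> e0; have d c := @is_derive_tpowB 1 c t isT.
have := is_deriveZ (2 * e ^+ 2)^-1 (is_deriveD (is_deriveB (d e)
  (is_deriveZ 2 (d (2 * e)))) (d (3 * e))).
move=> H; apply: (is_derive_eq H); rewrite /hst2 /=.
rewrite /GRing.scale /=; field; by rewrite gt_eqF.
Qed.

Lemma hst2_continuous e : continuous (hst2 e).
Proof.
have cB c : continuous (fun t => tpow 1 (t - c)).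
  move=> t; apply: (continuous_comp (f := fun u => u - c) (g := tpow 1)).
    by apply: cvgB; [exact: cvg_id|exact: cvg_cst].
  exact: tpow_continuous.
move=> t; apply: cvgM; first exact: cvg_cst.
apply: cvgD; last exact: cB.
apply: cvgB; first exact: cB.
by apply: cvgM; [exact: cvg_cst|exact: cB].
Qed.

Lemma hst_cases e t (P : Prop) : 0 < e ->
  (t <= e -> P) -> (e <= t <= 2 * e -> P) -> (2 * e <= t <= 3 * e -> P) ->
  (3 * e <= t -> P) -> P.
Proof.
move=> e0 h1 h2 h3 h4.
have [/h1//|t1] := leP t e; have [t2|t2] := leP t (2 * e).
  by apply: h2; rewrite (ltW t1) t2.
by have [t3|t3] := leP t (3 * e); [apply: h3; rewrite (ltW t2) t3|apply: h4; exact: ltW].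
Qed.

Lemma hst_facts e t : 0 < e ->
  [/\ t <= e -> hst e t = 0 /\ hst1 e t = 0, 3 * e <= t -> hst1 e t = 1,
      0 <= hst1 e t <= 1, 0 <= hst2 e t & tpos t - 2 * e <= hst e t <= tpos t].
Proof.
move=> e0.
have e2 : 0 < e ^+ 2 by rewrite exprn_gt0.
have i6 : 0 < (6 * e ^+ 2)^-1 by rewrite invr_gt0 mulr_gt0.
have i2 : 0 < (2 * e ^+ 2)^-1 by rewrite invr_gt0 mulr_gt0.
have i1 : 0 < (e ^+ 2)^-1 by rewrite invr_gt0.
have n0 : e != 0 by rewrite gt_eqF.
have m6 (X Y : R) : (X <= (6 * e ^+ 2)^-1 * Y) = (6 * e ^+ 2 * X <= Y).
  by rewrite mulrC ler_pdivlMr ?mulr_gt0// mulrC.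
have m6' (X Y : R) : ((6 * e ^+ 2)^-1 * Y <= X) = (Y <= 6 * e ^+ 2 * X).
  by rewrite mulrC ler_pdivrMr ?mulr_gt0// mulrC.
have m2' (Y : R) : ((2 * e ^+ 2)^-1 * Y <= 1) = (Y <= 2 * e ^+ 2).
  by rewrite mulrC ler_pdivrMr ?mulr_gt0// mul1r.
apply: (@hst_cases e t) => // [te|/andP[t1 t2]|/andP[t1 t2]|te];
  rewrite /hst /hst1 /hst2 m6 m6' m2' !(pmulr_rge0 _ i2) !(pmulr_rge0 _ i1) /tpow.
- rewrite (@tpos_neg (t - e)) ?(@tpos_neg (t - 2 * e)) ?(@tpos_neg (t - 3 * e)); try lra.
  rewrite !expr0n/= !mulr0 !subr0 !addr0 !mulr0; have t0 := tpos_ge0 t.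
  have t1 : tpos t <= e by rewrite /tpos ge_max te ltW.
  split.
  + by [].
  + by move=> H; lra.
  + by apply/andP; split; nra.
  + by [].
  + by apply/andP; split; nra.
- rewrite (@tpos_pos (t - e)) ?(@tpos_neg (t - 2 * e)) ?(@tpos_neg (t - 3 * e))
    ?(@tpos_pos t); try lra.
  rewrite !expr0n/= !mulr0 !subr0 !addr0 expr1.
  have [a [a0 a1 ->]] : exists a, [/\ 0 <= a, a <= e & t = e + a].
    by exists (t - e); split; lra.
  have q1 : 0 <= a * ((e - a) * (e + a)) by rewrite !mulr_ge0//; lra.
  have q2 : 0 <= e ^+ 2 * (e - a) by rewrite !mulr_ge0//; move: a1 a0; lra_goal.
  have q3 : 0 <= e ^+ 2 * a by rewrite !mulr_ge0//; move: a1 a0; lra_goal.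
  have q4 : 0 <= a ^+ 3 by rewrite exprn_ge0.
  have q5 : 0 <= e ^+ 3 by rewrite exprn_ge0// ltW.
  split.
  + by move=> H; (have -> : a = 0 by move: H a0; lra_goal); rewrite addr0 subrr !expr0n/= !mulr0.
  + by move=> H; lra.
  + by apply/andP; split; nra.
  + lra.
  + by apply/andP; split; nra.
- rewrite (@tpos_pos (t - e)) ?(@tpos_pos (t - 2 * e)) ?(@tpos_neg (t - 3 * e))
    ?(@tpos_pos t); try lra.
  rewrite !expr0n/= !addr0 !expr1.
  have [a [a0 a1 ->]] : exists a, [/\ 0 <= a, a <= e & t = 2 * e + a].
    by exists (t - 2 * e); split; lra.
  have q1 : 0 <= (e - a) ^+ 3 by rewrite exprn_ge0//; lra.
  have q2 : 0 <= e * a * (e - a) by rewrite !mulr_ge0//; lra.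
  have q3 : 0 <= e ^+ 2 * a by rewrite !mulr_ge0//; lra.
  have q4 : 0 <= a ^+ 3 by rewrite exprn_ge0.
  have q5 : 0 <= e ^+ 3 by rewrite exprn_ge0// ltW.
  split.
  + by move=> H; lra.
  + by move=> H; (have -> : a = e by lra); field.
  + by apply/andP; split; nra.
  + lra.
  + by apply/andP; split; nra.
- rewrite (@tpos_pos (t - e)) ?(@tpos_pos (t - 2 * e)) ?(@tpos_pos (t - 3 * e))
    ?(@tpos_pos t); try lra.
  rewrite !expr1.
  have [a [a0 ->]] : exists a, 0 <= a /\ t = 3 * e + a.
    by exists (t - 3 * e); split; lra.
  have q3 : 0 <= e ^+ 2 * a by rewrite !mulr_ge0//; lra.
  have q5 : 0 <= e ^+ 3 by rewrite exprn_ge0// ltW.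
  split.
  + by move=> H; lra.
  + by move=> H; field.
  + by apply/andP; split; nra.
  + lra.
  + by apply/andP; split; nra.
Qed.

End truncated_powers.

(** * Interior maxima and the weak maximum principle *)

Section maximum_principle.
Context {R : realType} {n : nat}.
Local Notation V := 'rV[R]_n.
Implicit Types (D : set V) (f g : V -> R) (x y : V).

Lemma is_derive_lineat f x (v : V) (t d : R) : is_derive (t *: v + x) v f d ->
  is_derive t 1 (fun s : R => f (s *: v + x)) d.
Proof.
move=> H; apply/(@is_derive_line R R).
rewrite (_ : (fun s : R => _) = fun s : R => f (s *: v + (t *: v + x))).
  exact: (proj1 (is_derive_line _ _ _ _) H).
by apply/funext => s /=; rewrite [s *: 1]mulr1 scalerDl addrA.
Qed.

Lemma line_near D x (v : V) : open D -> D x ->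
  exists2 r : R, 0 < r & forall t : R, `|t| < r -> D (t *: v + x).
Proof.
move=> /open_cubeP oD /oD [r r0 rD].
exists (r / (`|v| + 1)); first by rewrite divr_gt0// ltr_wpDl.
move=> t; rewrite ltr_pdivlMr ?ltr_wpDl// => tr; apply: rD => i.
rewrite !mxE addrK normrM; apply: le_lt_trans tr.
by rewrite ler_wpM2l// (le_trans (norm_coord_le v i))// lerDl.
Qed.

Lemma derive_pos_right (f : R -> R) (d : R) : is_derive (0 : R) 1 f d -> 0 < d -> f 0 = 0 ->
  exists2 r : R, 0 < r & forall t, 0 < t < r -> 0 < f t.
Proof.
move=> /is_derive1_caratheodory[g [gE gc g0]] d0 f0.
have : \forall t \near (0 : R), 0 < g t.
  have : nbhs (g 0) [set u | 0 < u].
    by apply: open_nbhs_nbhs; split; [exact: open_gt|rewrite /= g0].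
  by move: gc; rewrite /prop_for /continuous_at; apply.
move=> /nbhs_ballP[r /= r0 H]; exists r => // t /andP[t0 tr].
have := gE t; rewrite f0 !subr0 => ->; rewrite mulr_gt0//.
by apply: H; rewrite /ball /= sub0r normrN gtr0_norm.
Qed.

Lemma interior_max D f df d2f x0 i : open D -> C2 D f df d2f -> D x0 ->
  (forall y, D y -> f y <= f x0) -> df i x0 = 0 /\ d2f i i x0 <= 0.
Proof.
move=> oD [[f0 f1 f2] c2] Dx0 fmax; have [g0 g1 g2] := c2 i.
have [r r0 rD] := line_near (ebase i) oD Dx0.
pose F t := f (t *: ebase i + x0); pose F1 t := df i (t *: ebase i + x0).
have dF (t : R) : `|t| < r -> is_derive t 1 F (F1 t).
  by move=> /rD Dt; apply: is_derive_lineat; exact: f2.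
have dF1 : is_derive (0 : R) 1 F1 (d2f i i x0).
  by apply: is_derive_lineat; rewrite scale0r add0r; exact: g2.
have F10 : F1 0 = df i x0 by rewrite /F1 scale0r add0r.
have df0 : df i x0 = 0.
  have H0 : is_derive (0 : R) 1 F 0.
    apply: (@derive1_at_max _ F (- r) r).
    - by rewrite ge0_cp// ltW.
    - by move=> t; rewrite in_itv /= -ltr_norml => /dF[].
    - by rewrite in_itv /= oppr_lt0 r0.
    - move=> t; rewrite in_itv /= -ltr_norml => /rD Dt.
      by rewrite {2}/F scale0r add0r; exact: fmax.
  have H1 := dF 0; rewrite normr0 in H1; have [_ E1] := H1 r0; have [_ E0] := H0.
  by rewrite -F10 -E1 E0.
(* If the second derivative were positive, the first one, which is zero at [x0], would be positive
   just to the right, and the mean value theorem would produce a larger value of [f]. *)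
split => //; rewrite leNgt; apply/negP => d2.
have [s s0 H] := derive_pos_right dF1 d2 (etrans F10 df0).
pose m := Num.min r s / 2.
have m0 : 0 < m by rewrite divr_gt0// lt_min r0 s0.
have mm : m < Num.min r s by rewrite /m ltr_pdivrMr// ltr_pMr ?ltr1n// lt_min r0 s0.
have mr : m < r by rewrite (lt_le_trans mm)// ge_min lexx.
have ms : m < s by rewrite (lt_le_trans mm)// ge_min lexx orbT.
have dFm (t : R) : 0 <= t <= m -> is_derive t 1 F (F1 t).
  by move=> /andP[t0 tm]; apply: dF; rewrite ger0_norm// (le_lt_trans tm).
have [||c] := @MVT R F F1 0 m m0.
- by move=> t; rewrite in_itv /= => /andP[t0 tm]; apply: dFm; rewrite !ltW.
- apply: derivable_within_continuous => t; rewrite in_itv /= => tm.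
  by have [] := dFm t tm.
- rewrite in_itv /= subr0 => /andP[c0 cm] E.
  have : 0 < F1 c * m by rewrite mulr_gt0// H// c0 (lt_trans cm).
  rewrite -E subr_gt0 ltNge => /negP; apply.
  rewrite {2}/F scale0r add0r; apply: fmax; apply: rD.
  by rewrite gtr0_norm.
Qed.

Lemma cs_sum D (I : Type) (r : seq I) (F : I -> V -> R) :
  (forall i, cs D (F i)) -> cs D (fun x => \sum_(i <- r) F i x).
Proof.
move=> sF; elim: r => [|i r IH].
  by exists set0; [split; [exact: compact0|by []]|move=> x _ _; rewrite big_nil].
apply: (@cs_ext R n D (fun x => F i x + \sum_(j <- r) F j x)); last exact: csD.
by move=> x _; rewrite big_cons.
Qed.

Lemma cs_lap D f df d2f : open D -> C2 D f df d2f -> cs D f -> cs D (lap d2f).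
Proof.
move=> oD [c1 c2] sf; apply: cs_sum => i.
by apply: (cs_grad i oD (c2 i)); exact: cs_grad i oD c1 sf.
Qed.

(** The positive part of [f] tends to zero at the boundary, expressed without the boundary. This is
    exactly what makes [hst e] composed with [f] compactly supported, and it also makes sense on
    caps and other subsets. *)
Definition vanb D f := forall e, 0 < e -> compact [set x | D x /\ e <= f x].

Lemma vanb_max D f x1 : C0 D f -> vanb D f -> D x1 -> 0 < f x1 ->
  exists x0, [/\ D x0, 0 < f x0 & forall y, D y -> f y <= f x0].
Proof.
move=> cf vf Dx1 fx1; pose K := [set x | D x /\ f x1 <= f x].
have cK : compact K by exact: vf.
have [||x0 /set_mem[Dx0 fx0] H] := @compact_EVT_max V R f K _ cK.
- by exists x1; split.
- by apply: continuous_in_subspaceT => x /set_mem[Dx _]; exact: cf.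
exists x0; split => //; first exact: lt_le_trans fx0.
move=> y Dy; have [fy|fy] := leP (f x1) (f y).
  by apply: H; apply/mem_set; split.
by apply: le_trans fx0; exact: ltW.
Qed.

(** Strict subharmonicity is asked only where [f] is positive; it contradicts the second derivative
    test at a positive maximum directly, without perturbing [f]. *)
Lemma weak_max_principle D f df d2f : open D -> C2 D f df d2f -> vanb D f ->
  (forall x, D x -> 0 < f x -> 0 < lap d2f x) -> forall x, D x -> f x <= 0.
Proof.
move=> oD cf vf H x Dx; rewrite leNgt; apply/negP => fx.
have [x0 [Dx0 fx0 fmax]] := vanb_max (C2_C0 cf) vf Dx fx.
have := H x0 Dx0 fx0; rewrite ltNge => /negP; apply.
rewrite /lap sumr_le0// => i _.
by have [] := interior_max i oD cf Dx0 fmax.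
Qed.

Lemma vanish_on_bd_vanb D f : open D -> bounded_set D -> C0 D f ->
  vanish_on_bd D f -> vanb D f.
Proof.
move=> oD bD cf vf e e0; apply: bounded_closed_compact.
  have [M [Mr HM]] := bD; exists M; split => // N MN x [Dx _].
  exact: (HM N MN x Dx).
move=> x clx; have clD : closure D x.
  by move=> B /clx[y [[Dy _] By]]; exists y.
have [Dx|nDx] := pselect (D x).
  split => //; rewrite leNgt; apply/negP => fx.
  have Hn : nbhs x [set y | f y < e].
    have : nbhs (f x) [set u | u < e].
      by apply: open_nbhs_nbhs; split; [exact: open_lt|].
    by move: (cf x Dx); rewrite /prop_for /continuous_at; apply.
  by have [y [[_ fy] /=]] := clx _ Hn; rewrite ltNge fy.
have bx : bd D x by split => //; rewrite (interior_id _).1.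
have Hw : nbhs x [set y | D y -> f y < e].
  have : nbhs (0 : R) [set u | u < e].
    by apply: open_nbhs_nbhs; split; [exact: open_lt|].
  by move=> /(vf x bx).
by have [y [[Dy fy] /(_ Dy)]] := clx _ Hw; rewrite ltNge fy.
Qed.

Lemma vanbN D f : vanish_on_bd D f -> vanish_on_bd D (fun x => - f x).
Proof. by move=> vf x0 /vf H; rewrite -oppr0; exact: cvgN. Qed.

Lemma superharmonic_pos D f df d2f : open D -> bounded_set D ->
  C2 D f df d2f -> vanish_on_bd D f ->
  (forall x, D x -> lap d2f x < 0) -> forall x, D x -> 0 < f x.
Proof.
move=> oD bD cf vf Hl x Dx; have cNf := C2N cf.
have HlN y : D y -> 0 < lap (fun i j x => - d2f i j x) y.
  by move=> Dy; rewrite /lap sumrN oppr_gt0; exact: Hl.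
have f0 y : D y -> 0 <= f y.
  move=> Dy; rewrite -oppr_le0.
  apply: (weak_max_principle oD cNf) => //.
    by apply: vanish_on_bd_vanb => //; [exact: C2_C0 cNf|exact: vanbN].
  by move=> z Dz _; exact: HlN.
rewrite lt_neqAle f0// andbT; apply/negP => /eqP fx0.
have := HlN x Dx; rewrite ltNge => /negP; apply.
rewrite /lap sumr_le0// => i _.
have [//|_ ] := @interior_max D (fun y => - f y) _ _ x i oD cNf Dx.
  by move=> y Dy; rewrite -fx0 oppr0 oppr_le0 f0.
by [].
Qed.

End maximum_principle.

(** * Kato's inequality tested against a nonnegative function *)

Section kernel_inequality.
Context {R : realType} {n : nat} (D : set 'rV[R]_n).
Local Notation V := 'rV[R]_n.
Hypotheses (oD : open D) (bD : bounded_set D).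
Implicit Types (f g : V -> R) (x y : V).

Lemma C0_tpos f : C0 D f -> C0 D (fun x => tpos (f x)).
Proof. by move=> cf; apply: C0_comp => // x _; exact: tpos_continuous. Qed.

Lemma BC_tpos f : BC D f -> BC D (fun x => tpos (f x)).
Proof.
move=> bf; apply: (@BC_le R n D _ f); [by case: bf => + _; exact: C0_tpos|by []|].
move=> x _; rewrite ger0_norm ?tpos_ge0//.
by rewrite /tpos ge_max ler_norm normr_ge0.
Qed.

Lemma cs_hst f e : 0 < e -> vanb D f -> cs D (fun x => hst e (f x)).
Proof.
move=> e0 vf; exists [set x | D x /\ e <= f x].
  by split; [exact: vf|move=> x []].
move=> x Dx H; have [|fx] := leP (f x) e; first by case: (hst_facts (f x) e0) => h _ _ _ _ /h[].
by exfalso; apply: H; split => //; exact: ltW.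
Qed.

Lemma C2_hst f df d2f e : 0 < e -> C2 D f df d2f ->
  C2 D (fun x => hst e (f x)) (fun i x => hst1 e (f x) * df i x)
    (fun i j x => hst1 e (f x) * d2f i j x + df i x * (hst2 e (f x) * df j x)).
Proof.
move=> e0 cf; apply: (@C2_comp R n D f df d2f (hst e) (hst1 e) (hst2 e) cf) => x _.
- exact: is_derive_hst.
- exact: is_derive_hst1.
- exact: hst2_continuous.
Qed.

(* Kato's inequality: truncating the subsolution f from below by a convex
   function makes it compactly supported in D, so no boundary term occurs. *)
Lemma kato_integral f df d2f (G : V -> R) dG d2G q :
  C2 D f df d2f -> vanb D f -> BC D (fun x => tpos (f x)) ->
  BC D q -> (forall x, D x -> 0 <= q x) ->
  (forall x, D x -> 0 < f x -> - lap d2f x <= q x) ->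
  C2 D G dG d2G -> BC D G -> BC D (lap d2G) -> (forall x, D x -> 0 <= G x) ->
  itg D (fun x => tpos (f x) * - lap d2G x) <= itg D (fun x => q x * G x).
Proof.
move=> cf vf bf bq q0 fq cG bG blG G0.
set c := itg D (fun x => `|lap d2G x|).
have c0 : 0 <= c by apply: itg_ge0.
have main e : 0 < e -> itg D (fun x => tpos (f x) * - lap d2G x) <=
    itg D (fun x => q x * G x) + 2 * e * c.
  move=> e0; have ch := C2_hst e0 cf; have sh := cs_hst e0 vf.
  have bh := cs_BC (C2_C0 ch) sh.
  have bhl : BC D (fun x => hst e (f x) * lap d2G x) by apply: BCM.
  (* The truncation lies between tpos f - 2 e and tpos f, so the replacement costs at most 2 e times
     the integral [c] of the absolute Laplacian of [G]. *)
  have H1 : itg D (fun x => tpos (f x) * - lap d2G x) <=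
      itg D (fun x => - (hst e (f x) * lap d2G x)) + 2 * e * c.
    rewrite /c -itgZ//; last exact: BC_abs.
    rewrite -itgD//; [|exact: BCN|by apply: BCZ; exact: BC_abs].
    apply: itg_le => //.
    - by apply: BCM => //; exact: BCN.
    - by apply: BCD; [exact: BCN|by apply: BCZ; exact: BC_abs].
    move=> x Dx; have [_ _ _ _ /andP[h1 h2]] := hst_facts (f x) e0.
    have h3 : 0 <= tpos (f x) - hst e (f x) <= 2 * e by apply/andP; split; lra.
    rewrite -subr_ge0; have -> : - (hst e (f x) * lap d2G x) + 2 * e * `|lap d2G x| -
      tpos (f x) * - lap d2G x = (tpos (f x) - hst e (f x)) * lap d2G x +
        2 * e * `|lap d2G x| by ring.
    have := ler_norm (- lap d2G x); rewrite normrN; move: h3 => /andP[h3 h4].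
    have h5 : (tpos (f x) - hst e (f x)) * `|lap d2G x| <= 2 * e * `|lap d2G x|.
      by rewrite ler_wpM2r.
    have h6 : (tpos (f x) - hst e (f x)) * - lap d2G x <=
      (tpos (f x) - hst e (f x)) * `|lap d2G x|.
      by rewrite ler_wpM2l// -normrN ler_norm.
    move=> _; lra.
  apply: le_trans H1 _; rewrite lerD2r itgN// (green2 oD bD ch cG sh) -itgN//; last first.
    apply: cs_BC; first by apply: C0M; [exact: C0_lap ch|exact: C2_C0 cG].
    by apply: csMl; exact: (cs_lap oD ch sh).
  apply: itg_le => //.
  - apply: BCN; apply: cs_BC; first by apply: C0M; [exact: C0_lap ch|exact: C2_C0 cG].
    by apply: csMl; exact: (cs_lap oD ch sh).
  - exact: BCM.
  move=> x Dx; rewrite -mulNr ler_wpM2r ?G0//.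
  (* By convexity the term [hst2] |grad f|^2 has a favourable sign, and [hst1] in [0, 1] vanishes
     where f <= 0, so minus the Laplacian of the truncation stays below [q]. *)
  have [h1 _ /andP[h2 h3] h4 _] := hst_facts (f x) e0.
  have -> : lap (fun i j x => hst1 e (f x) * d2f i j x + df i x * (hst2 e (f x) * df j x)) x
    = hst1 e (f x) * lap d2f x + hst2 e (f x) * gdot df df x.
    rewrite /lap /gdot !mulr_sumr -big_split/=; apply: eq_bigr => i _; ring.
  have g0 : 0 <= hst2 e (f x) * gdot df df x.
    by rewrite mulr_ge0// sumr_ge0// => i _; rewrite -expr2 sqr_ge0.
  have [fx|fx] := leP (f x) 0.
    have [_ ->] := h1 (le_trans fx (ltW e0)); rewrite mul0r; have := q0 x Dx; lra.
  have := fq x Dx fx => fqx.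
  have : hst1 e (f x) * - lap d2f x <= q x.
    have [l0|l0] := leP 0 (- lap d2f x).
      by apply: le_trans fqx; rewrite ler_piMl.
    by apply: le_trans (q0 x Dx); rewrite mulr_ge0_le0// ltW.
  lra.
(* The truncation parameter now tends to zero: the error 2 e c is made smaller than any given
   [e]. *)
apply/ler_addgt0Pr => e e0.
have e1 : 0 < e / (2 * (c + 1)) by rewrite divr_gt0// mulr_gt0// ltr_wpDl.
apply: le_trans (main _ e1) _; rewrite lerD2l.
have c1 : 0 < c + 1 by rewrite ltr_wpDl.
have -> : 2 * (e / (2 * (c + 1))) * c = e * (c / (c + 1)) by field; rewrite gt_eqF.
by rewrite ler_piMr ?(ltW e0)// ler_pdivrMr// mul1r lerDl.
Qed.

End kernel_inequality.

(** * The Navier problem as a second order system *)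

Section navier_systems.
Context {R : realType} {n : nat}.
Local Notation V := 'rV[R]_n.
Implicit Types (D : set V) (f g u v : V -> R) (x y : V).

Lemma Ck_C1 k D u s : Ck k D u -> (size s < k)%N ->
  C1 D (partials s u) (fun i => partials (i :: s) u).
Proof.
move=> cu sk; split=> [x Dx|i x Dx|i x Dx].
- by have [] := cu s (ltnW sk) x Dx.
- by have [] := cu (i :: s) sk x Dx.
- by have [_ /(_ sk i) d] := cu s (ltnW sk) x Dx; exact: derivableP d.
Qed.

Lemma Ck_C2 k D u s : Ck k D u -> ((size s).+1 < k)%N ->
  C2 D (partials s u) (fun i => partials (i :: s) u)
    (fun i j => partials [:: j, i & s] u).
Proof. by move=> cu sk; split=> [|i]; apply: Ck_C1 cu _ => //; exact: ltnW. Qed.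

Lemma partial_C1 D f df i x : C1 D f df -> D x -> partial i f x = df i x.
Proof. by move=> [_ _ f2] Dx; have [_] := f2 i x Dx. Qed.

Lemma laplacian_C2 D f df d2f x : open D -> C2 D f df d2f -> D x ->
  laplacian f x = lap d2f x.
Proof.
move=> oD [c1 c2] Dx; apply: eq_bigr => i _.
rewrite -(partial_C1 i (c2 i) Dx); apply: near_eq_derive.
have : nbhs x D by exact: open_nbhs_nbhs.
by apply: filterS => y Dy; exact: partial_C1 c1 Dy.
Qed.

Lemma Ck_closure_BC k D u s : bounded_set D -> Ck_closure k D u ->
  (size s <= k)%N -> BC D (partials s u).
Proof.
move=> bD [cu ce] sk; split; first by move=> x Dx; have [] := cu s sk x Dx.
have [g [gc gE]] := ce s sk.
have ccD : compact (closure D).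
  apply: bounded_closed_compact; last exact: closed_closure.
  have [M [Mr HM]] := bD; exists (M + 1); split; first by rewrite realD ?num_real.
  move=> N MN x clx; have [y [Dy yx]] := clx _ (nbhsx_ballx x 1 ltr01).
  rewrite -ball_normE/= in yx.
  have : `|y| <= N - 1 by apply: HM => //; lra.
  move=> yN; have xyE : `|x| <= `|x - y| + `|y|.
    by rewrite -{1}(subrK y x); exact: ler_normD.
  by rewrite /=; move: yx yN xyE; lra.
have /compact_bounded[M [_ mrt]] := continuous_compact gc ccD.
exists (`|M| + 1) => x Dx; rewrite -gE ?inE//; apply: (mrt (`|M| + 1)).
  by rewrite (le_lt_trans (ler_norm _))// ltrDl.
by exists x => //; exact: subset_closure.
Qed.

Definition C2b D f df d2f := [/\ C2 D f df d2f, BC D f, forall i, BC D (df i) &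
  forall i j, BC D (d2f i j)].

(** With v = - Delta u both boundary conditions become Dirichlet conditions. All derivatives up to
    order two are bounded because u is of class C^4 up to the boundary. *)
Definition navier_system D (p lam : R) u du d2u v dv d2v :=
  [/\ C2b D u du d2u /\ C2b D v dv d2v,
      vanish_on_bd D u /\ vanish_on_bd D v,
      forall x, D x -> 0 < u x,
      forall x, D x -> v x = - lap d2u x &
      forall x, D x -> - lap d2v x = lam * (u x + 1) `^ p].

Lemma classical_navier_system p D lam u : open D -> bounded_set D ->
  classical_solution p D lam u ->
  exists du d2u v dv d2v, navier_system D p lam u du d2u v dv d2v.
Proof.
move=> oD bD [[cu vu vl] up eu]; have ck := cu.1.
have cs2 s : ((size s).+1 < 4)%N -> C2b D (partials s u) (fun i => partials (i :: s) u)
    (fun i j => partials [:: j, i & s] u).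
  move=> s4; split=> [||i|i j]; first exact: Ck_C2 ck s4.
  - by apply: Ck_closure_BC cu _ => //; rewrite ltnW// ltnW.
  - by apply: Ck_closure_BC cu _ => //; exact: ltnW.
  - by apply: Ck_closure_BC cu _.
have cu2 := cs2 [::] isT.
(* Written with [partials], [v] is convertible to minus the Laplacian of [u], so it inherits the
   second boundary condition at once. *)
pose v x := - \sum_i partials [:: i; i] u x.
have cv : C2 D v (fun j x => - \sum_i partials [:: j; i; i] u x)
    (fun j k x => - \sum_i partials [:: k; j; i; i] u x).
  apply: C2N; apply: (@C2_sum R n D _ _ (fun i => partials [:: i; i] u)
    (fun i j => partials [:: j; i; i] u) (fun i j k => partials [:: k; j; i; i] u)).
  by move=> i; have [] := cs2 [:: i; i] isT.
have bb s : (size s <= 4)%N -> BC D (partials s u).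
  by move=> s4; apply: Ck_closure_BC cu _.
eexists; eexists; exists v; eexists; eexists; split; first (split; first exact: cu2).
- split; first exact: cv.
  + by apply: BCN; apply: BC_sum => i; exact: bb.
  + by move=> j; apply: BCN; apply: BC_sum => i; exact: bb.
  + by move=> j k; apply: BCN; apply: BC_sum => i; exact: bb.
- split => //; have -> : v = fun x => - laplacian u x by [].
  exact: vanbN.
- exact: up.
- by [].
move=> x Dx; rewrite -eu// /bilaplacian.
have vE : laplacian u = fun x => - v x by apply/funext => y; rewrite opprK.
rewrite vE (laplacian_C2 oD (C2N cv) Dx) /lap.
by rewrite -sumrN; apply: eq_bigr.
Qed.

Lemma BC_comp D f (h : R -> R) m M : C0 D f -> (forall x, D x -> m <= f x <= M) ->
  (forall t, m <= t <= M -> {for t, continuous h}) -> BC D (fun x => h (f x)).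
Proof.
move=> cf fmM ch; split; first by apply: C0_comp => // x Dx; apply: ch; exact: fmM.
have cI : {within `[m, M], continuous h}.
  by apply: continuous_in_subspaceT => t /set_mem; rewrite /= in_itv /=; exact: ch.
have /compact_bounded[N [_ mrt]] := continuous_compact cI (@segment_compact R m M).
exists (`|N| + 1) => x Dx; apply: (mrt (`|N| + 1)).
  by rewrite (le_lt_trans (ler_norm _))// ltrDl.
by exists (f x) => //=; rewrite in_itv /=; exact: fmM.
Qed.

Lemma powR_continuous (a t : R) : 0 < t -> {for t, continuous (fun t : R => t `^ a)}.
Proof.
move=> t0; apply: differentiable_continuous; apply/derivable1_diffP.
by have [] := is_derive1_powR a t0.
Qed.

Lemma C2_powR D f df d2f (a : R) : C2 D f df d2f -> (forall x, D x -> 0 < f x) ->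
  C2 D (fun x => f x `^ a) (fun i x => a * f x `^ (a - 1) * df i x)
    (fun i j x => a * f x `^ (a - 1) * d2f i j x +
       df i x * (a * ((a - 1) * f x `^ (a - 1 - 1)) * df j x)).
Proof.
move=> cf f0.
apply: (C2_comp (h := fun t => t `^ a) (h1 := fun t => a * t `^ (a - 1))
  (h2 := fun t => a * ((a - 1) * t `^ (a - 1 - 1))) cf) => x Dx.
- exact: is_derive1_powR (f0 x Dx).
- exact: (is_deriveZ a (is_derive1_powR (a - 1) (f0 x Dx))).
- apply: cvgM; first exact: cvg_cst.
  apply: cvgM; first exact: cvg_cst.
  exact: powR_continuous (f0 x Dx).
Qed.

Lemma vanish_comp D f (h : R -> R) : vanish_on_bd D f -> {for 0, continuous h} ->
  h 0 = 0 -> vanish_on_bd D (fun x => h (f x)).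
Proof.
move=> vf ch h0 x0 bx; have := vf x0 bx => H.
by rewrite -h0; apply: (cvg_comp _ _ H ch).
Qed.

Lemma vanishB D f g : vanish_on_bd D f -> vanish_on_bd D g ->
  vanish_on_bd D (fun x => f x - g x).
Proof. by move=> vf vg x0 bx; rewrite -[0]subr0; apply: cvgB; [exact: vf|exact: vg]. Qed.

Lemma lapE D f df d2f (h1 h2 : V -> R) x :
  lap (fun i j x => h1 x * d2f i j x + df i x * (h2 x * df j x)) x =
  h1 x * lap d2f x + h2 x * gdot df df x :> R.
Proof. by rewrite /lap /gdot !mulr_sumr -big_split/=; apply: eq_bigr => i _; ring. Qed.

End navier_systems.

(** * Positivity of v and the lower bound of Souplet *)

Section pointwise_estimate.
Context {R : realType} {n : nat} (D : set 'rV[R]_n) (p lam : R).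
Local Notation V := 'rV[R]_n.
Hypotheses (oD : open D) (bD : bounded_set D) (p1 : 1 < p) (lam0 : 0 < lam).
Variables (u v : V -> R) (du dv : 'I_n -> V -> R) (d2u d2v : 'I_n -> 'I_n -> V -> R).
Hypothesis sys : navier_system D p lam u du d2u v dv d2v.

Lemma system_v_pos x : D x -> 0 < v x.
Proof.
have [[_ cv] [_ vv] up _ ev] := sys.
apply: (superharmonic_pos oD bD (d2f := d2v) (df := dv)) => //; first by case: cv.
move=> y Dy; rewrite -oppr_gt0 ev// mulr_gt0// powR_gt0//.
by rewrite addr_gt0// up.
Qed.

Lemma system_w_C2 : C2 D (fun x => u x + 1) du d2u.
Proof.
have [[[cu _ _ _] _] _ _ _ _] := sys.
by apply: (C2_ext oD (C2D cu (C2_cst D (1 : R)))) => // *; rewrite addr0.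
Qed.

(* Souplet: c (w^((p+1)/2) - 1) - v is subharmonic where it is positive. *)
Lemma system_v_ge x : D x ->
  Num.sqrt (2 * lam / (p + 1)) * ((u x + 1) `^ ((p + 1) / 2) - 1) <= v x.
Proof.
have [[[cu bu _ _] [cv _ _ _]] [vu vv] up eu ev] := sys.
set c := Num.sqrt _; set b := (p + 1) / 2.
have p1' := p1; have lam0' := lam0; have pp : 0 < p + 1 by lra.
(* This value of [c] balances the leading terms: since 2 b - 1 = p, the source lam w^p equals c b
   w^(b-1) times c w^b. *)
have c2 : c ^+ 2 * b = lam.
  rewrite /c /b sqr_sqrtr; first by field; rewrite gt_eqF.
  by rewrite divr_ge0 ?mulr_ge0// ltW.
have c0 : 0 < c by rewrite sqrtr_gt0 divr_gt0// mulr_gt0.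
have wp y : D y -> 0 < u y + 1 by move=> Dy; rewrite addr_gt0 ?up.
have cw := C2_powR b system_w_C2 wp.
have cF := C2B (C2Z c (C2B cw (C2_cst D (1 : R)))) cv.
move=> Dx; rewrite -subr_le0.
apply: (weak_max_principle oD cF) Dx.
  apply: vanish_on_bd_vanb => //; first exact: C2_C0 cF.
  apply: vanishB => //.
  apply: (@vanish_comp R n D u (fun t => c * ((t + 1) `^ b - 1))) => //.
    apply: cvgM; first exact: cvg_cst.
    apply: cvgB; last exact: cvg_cst.
    apply: (@continuous_comp R R R (fun t => t + 1) (fun t => t `^ b) 0).
      by apply: cvgD; [exact: cvg_id|exact: cvg_cst].
    by apply: powR_continuous; rewrite add0r.
  by rewrite add0r powR1 subrr mulr0.
move=> y Dy Fy.
have w0 := wp y Dy.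
set w := u y + 1 in Fy w0 *.
have -> : lap (fun i j x => c * (b * (u x + 1) `^ (b - 1) * d2u i j x +
    du i x * (b * ((b - 1) * (u x + 1) `^ (b - 1 - 1)) * du j x) - 0) - d2v i j x) y =
    c * (b * w `^ (b - 1) * lap d2u y +
      b * ((b - 1) * w `^ (b - 1 - 1)) * gdot du du y) - lap d2v y.
  rewrite /lap /gdot !mulr_sumr -big_split/= mulr_sumr -sumrB; apply: eq_bigr => i _.
  by rewrite -/w; ring.
have -> : - lap d2v y = lam * w `^ p by exact: ev.
have -> : lap d2u y = - v y by rewrite eu// opprK.
have g0 : 0 <= gdot du du y by rewrite sumr_ge0// => i _; rewrite -expr2 sqr_ge0.
have b1 : 1 < b by rewrite /b ltr_pdivlMr//; lra.
have wb : 0 < w `^ (b - 1) by rewrite powR_gt0.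
have wb2 : 0 <= c * (b * ((b - 1) * w `^ (b - 1 - 1)) * gdot du du y).
  by rewrite !mulr_ge0 ?powR_ge0// ?ltW// ?subr_gt0//; lra.
have wE : w `^ p = w `^ (b - 1) * w `^ b.
  rewrite -powRD; last by rewrite (gt_eqF w0) implybT.
  by congr (_ `^ _); rewrite /b; field.
have k0 : 0 < c * b * w `^ (b - 1) by rewrite !mulr_gt0//; lra.
(* The Laplacian is a nonnegative gradient term plus c b w^(b-1) (c w^b - v), and c w^b - v is the
   compared function plus [c], hence positive where that function is. *)
have : 0 < c * b * w `^ (b - 1) * (c * (w `^ b - 1) - v y + c).
  by rewrite mulr_gt0// addr_gt0.
rewrite wE -c2; lra.
Qed.

End pointwise_estimate.

(** * Regularized fundamental solutions of the bilaplacian *)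

Section biharmonic_kernels.
Context {R : realType}.
Implicit Types (t e a b : R).

Lemma ln_le_sub1 t : 0 < t -> ln t <= t - 1.
Proof.
move=> t0; have := expR_ge1Dx (ln t); rewrite lnK ?posrE//; lra.
Qed.

(** In terms of T = |x - a|^2 + e the fundamental solution |x - a|^(4-n) is T^(-(n-4)/2). For n <= 4
    it is bounded or logarithmic on bounded sets, and the small power 1/4 is a convenient common
    upper bound. *)
Definition kern_exp (n : nat) : R := if (n <= 4)%N then 4^-1 else (n%:R - 4) / 2.

(* A function g of T = |x - a|^2 + e has Laplacian
   2 n g'(T) + 4 (T - e) g''(T). *)
Definition radial_lap (n : nat) e (g1 g2 : R -> R) t : R :=
  2 * n%:R * g1 t + 4 * (t - e) * g2 t.

Definition twice_derivable (g g1 g2 : R -> R) := forall t, 0 < t ->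
  [/\ is_derive t 1 g (g1 t), is_derive t 1 g1 (g2 t) & {for t, continuous g2}].

Lemma twice_derivable_powR a : twice_derivable (fun t => t `^ a)
  (fun t => a * t `^ (a - 1)) (fun t => a * ((a - 1) * t `^ (a - 1 - 1))).
Proof.
move=> t t0; split.
- exact: is_derive1_powR.
- exact: (is_deriveZ a (is_derive1_powR (a - 1) t0)).
- apply: cvgM; first exact: cvg_cst.
  by apply: cvgM; [exact: cvg_cst|exact: powR_continuous].
Qed.

Lemma twice_derivableZ k (g g1 g2 : R -> R) : twice_derivable g g1 g2 ->
  twice_derivable (fun t => k * g t) (fun t => k * g1 t) (fun t => k * g2 t).
Proof.
move=> H t /H[d1 d2 c]; split.
- exact: (is_deriveZ k d1).
- exact: (is_deriveZ k d2).
- by apply: cvgM => //; exact: cvg_cst.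
Qed.

Lemma twice_derivableD (g g1 g2 h h1 h2 : R -> R) : twice_derivable g g1 g2 ->
  twice_derivable h h1 h2 ->
  twice_derivable (fun t => g t + h t) (fun t => g1 t + h1 t) (fun t => g2 t + h2 t).
Proof.
move=> H H' t t0; have [d1 d2 c] := H t t0; have [d1' d2' c'] := H' t t0; split.
- exact: (is_deriveD d1 d1').
- exact: (is_deriveD d2 d2').
- exact: cvgD.
Qed.

Lemma twice_derivable_affine a b :
  twice_derivable (fun t => a + b * t) (fun=> b) (fun=> 0).
Proof.
move=> t t0; split.
- have := is_deriveD (is_derive_cst a t (1 : R)) (is_deriveZ b (is_derive_id t (1 : R))).
  by move=> H; apply: (is_derive_eq H); rewrite add0r [_ *: _]mulr1.
- exact: is_derive_cst.
- exact: cst_continuous.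
Qed.

Lemma twice_derivable_ln : twice_derivable (@ln R) (fun t => t `^ (-1))
  (fun t => -1 * t `^ (-1 - 1)).
Proof.
move=> t t0; split.
- by rewrite powR_inv1 ?ltW//; exact: is_derive1_ln.
- exact: is_derive1_powR.
- by apply: cvgM; [exact: cvg_cst|exact: powR_continuous].
Qed.

Lemma twice_derivable_xln : twice_derivable (fun t => t * ln t) (fun t => ln t + 1)
  (fun t => t `^ (-1)).
Proof.
move=> t t0; split.
- have := is_deriveM (is_derive_id t (1 : R)) (is_derive1_ln t0).
  move=> H; apply: (is_derive_eq H).
  by rewrite /GRing.scale/= mulfV ?gt_eqF// mulr1 addrC.
- have := is_deriveD (is_derive1_ln t0) (is_derive_cst (1 : R) t (1 : R)).
  by move=> H; apply: (is_derive_eq H); rewrite addr0 powR_inv1// ltW.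
- exact: powR_continuous.
Qed.

Lemma powRSr t a : 0 < t -> t * t `^ a = t `^ (a + 1).
Proof.
move=> t0; rewrite -{1}(powRr1 (ltW t0)) -powRD ?(gt_eqF t0) ?implybT//.
by rewrite addrC.
Qed.

Lemma radial_lap_powR n e b t : 0 < t ->
  radial_lap n e (fun t => b * t `^ (b - 1)) (fun t => b * ((b - 1) * t `^ (b - 1 - 1))) t
  = b * (2 * n%:R + 4 * (b - 1)) * t `^ (b - 1) - 4 * b * (b - 1) * e * t `^ (b - 1 - 1).
Proof.
move=> t0; rewrite /radial_lap.
have -> : t `^ (b - 1) = t * t `^ (b - 1 - 1) by rewrite powRSr// subrK.
ring.
Qed.

(** As functions of T, [g] is a nonnegative kernel, [h] is minus its Laplacian, again nonnegative,
    and the bilaplacian of [g] dominates the concentrating density e^2 T^(-n/2-2). [B] bounds T on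
    the domain; the point is that [C] and [c] do not depend on [e]. *)
Definition kernel_pair n e (B C c : R) (g g1 g2 h h1 h2 : R -> R) :=
  [/\ twice_derivable g g1 g2, twice_derivable h h1 h2,
      forall t, 0 < t -> h t = - radial_lap n e g1 g2 t &
      forall t, e <= t <= B ->
        [/\ 0 <= g t <= C * t `^ (- kern_exp n), 0 <= h t &
            c * e ^+ 2 * t `^ (- ((n%:R + 4) / 2)) <= - radial_lap n e h1 h2 t]].

(** T^((4-n)/2) regularizes |x - a|^(4-n), and its bilaplacian is the exact multiple (n-4)(n-2) n
    (n+2) of the concentrating density. The factor [s] corrects the sign of this product; the affine
    part, biharmonic as a function of x, is free to make [g] and [h] nonnegative in low
    dimension. *)
Lemma kernel_pair_powR n e (s K1 K2 : R) : 0 < e ->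
  let m : R := (4 - n%:R) / 2 in
  exists g1 g2 h h1 h2,
  let g t := s * t `^ m + (K1 + - K2 * t) in
  [/\ twice_derivable g g1 g2, twice_derivable h h1 h2,
      forall t, 0 < t -> h t = - radial_lap n e g1 g2 t &
      forall t, 0 < t ->
        h t = - 4 * s * m * t `^ (m - 1) + 4 * s * m * (m - 1) * e * t `^ (m - 1 - 1)
              + 2 * n%:R * K2
        /\ - radial_lap n e h1 h2 t =
          s * (n%:R - 4) * (n%:R - 2) * n%:R * (n%:R + 2) * e ^+ 2 *
          t `^ (- ((n%:R + 4) / 2))].
Proof.
move=> e0 m.
have tg := twice_derivableD (twice_derivableZ s (twice_derivable_powR m))
  (twice_derivable_affine K1 (- K2)).
have th := twice_derivableD (twice_derivableD
  (twice_derivableZ (- 4 * s * m) (twice_derivable_powR (m - 1)))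
  (twice_derivableZ (4 * s * m * (m - 1) * e) (twice_derivable_powR (m - 1 - 1))))
  (twice_derivable_affine (2 * n%:R * K2) 0).
have nE : n%:R = 4 - 2 * m by rewrite /m; field.
do 5 eexists; split; [exact: tg|exact: th| |] => t t0.
  have := radial_lap_powR n e m t0; rewrite /radial_lap => E.
  rewrite -[RHS](_ : - (s * (m * (2 * n%:R + 4 * (m - 1)) * t `^ (m - 1) -
    4 * m * (m - 1) * e * t `^ (m - 1 - 1)) + 2 * n%:R * - K2) = _).
    by rewrite nE; ring.
  by rewrite -E; ring.
split; first by rewrite mul0r addr0.
have E1 := radial_lap_powR n e (m - 1) t0.
have E2 := radial_lap_powR n e (m - 1 - 1) t0.
rewrite /radial_lap in E1 E2 *.
have -> : - ((n%:R + 4) / 2) = m - 1 - 1 - 1 - 1 by rewrite nE; field.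
rewrite -[LHS](_ : - (- 4 * s * m * ((m - 1) * (2 * n%:R + 4 * (m - 1 - 1)) *
  t `^ (m - 1 - 1) - 4 * (m - 1) * (m - 1 - 1) * e * t `^ (m - 1 - 1 - 1))
  + 4 * s * m * (m - 1) * e * ((m - 1 - 1) * (2 * n%:R + 4 * (m - 1 - 1 - 1)) *
  t `^ (m - 1 - 1 - 1) - 4 * (m - 1 - 1) * (m - 1 - 1 - 1) * e *
  t `^ (m - 1 - 1 - 1 - 1))) = _).
  rewrite nE; ring.
by rewrite -E1 -E2; ring.
Qed.

Lemma powR_le_exp t B a b : 0 < t -> t <= B -> 1 <= B -> a <= b -> t `^ b <= B `^ (b - a) * t `^ a.
Proof.
move=> t0 tB B1 ab.
have -> : t `^ b = t `^ (b - a) * t `^ a.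
  by rewrite -powRD ?(gt_eqF t0) ?implybT// subrK.
rewrite ler_wpM2r ?powR_ge0//.
by rewrite ge0_ler_powR// ?subr_ge0// nnegrE ?ltW//; lra.
Qed.

Lemma powR12_le B t : 1 <= B -> 0 < t -> t <= B -> t `^ 2^-1 <= B.
Proof.
move=> B1 t0 tB; apply: (@le_trans _ _ (B `^ 2^-1)).
  by rewrite ge0_ler_powR ?nnegrE//; lra.
rewrite -[leRHS]powRr1; last lra.
by rewrite ler_powR//; lra.
Qed.

Lemma ln_powR_le t : 0 < t -> - ln t <= 4 * t `^ (- 4^-1).
Proof.
move=> t0; have := ln_le_sub1 (powR_gt0 (- 4^-1) t0); rewrite ln_powR; lra.
Qed.

Lemma kernel_pair_exists n B : (0 < n)%N -> 1 <= B -> exists2 c : R, 0 < c &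
  exists2 C : R, 0 < C & forall e, 0 < e <= 1 ->
  exists g g1 g2 h h1 h2, kernel_pair n e B C c g g1 g2 h h1 h2.
Proof.
move=> n0 B1; have B0 : 0 < B by lra.
have lnB : forall t, 0 < t <= B -> ln t <= B.
  by move=> t /andP[t0 tB]; apply: le_trans (ln_le_sub1 t0) _; lra.
have q0 t : 0 < t <= B -> 1 <= B `^ 4^-1 * t `^ (- 4^-1).
  move=> /andP[t0 tB]; have := powR_le_exp t0 tB B1 (a := - 4^-1) (b := 0).
  rewrite powRr0 sub0r opprK; apply; lra.
have Bq : 0 < B `^ 4^-1 by rewrite powR_gt0.
have [n5|n5] := leqP 5 n.
- have n5R : (5 : R) <= n%:R by rewrite ler_nat.
  exists ((n%:R - 4) * (n%:R - 2) * n%:R * (n%:R + 2)); first by rewrite !mulr_gt0//; lra.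
  exists 1 => // e /andP[e0 e1].
  have [g1 [g2 [h [h1 [h2 [tg th hE H]]]]]] := kernel_pair_powR n 1 0 0 e0.
  eexists; exists g1, g2, h, h1, h2; split; [exact: tg|exact: th|exact: hE|].
  move=> t /andP[et tB]; have t0 : 0 < t by lra.
  have [h_E l_E] := H t t0; split.
  + rewrite oppr0 mul0r !addr0 mul1r powR_ge0/= /kern_exp leqNgt n5/= mul1r.
    by rewrite le_eqVlt; apply/orP; left; apply/eqP; congr (_ `^ _); field.
  + rewrite h_E mulr0 addr0 !mulr1.
    have a1 := powR_ge0 t ((4 - n%:R) / 2 - 1).
    have a2 := powR_ge0 t ((4 - n%:R) / 2 - 1 - 1).
    move: a1 a2; set m : R := (4 - n%:R) / 2; have m0 : m < 0 by rewrite /m; move: n5R; lra_goal.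
    move=> a1 a2; have b1 : 0 <= - m * t `^ (m - 1) by rewrite mulr_ge0//; move: m0; lra_goal.
    have b2 : 0 <= m * (m - 1) * (e * t `^ (m - 1 - 1)).
      by apply: mulr_ge0; [apply: mulr_le0|apply: mulr_ge0]; move: a2 m0 e0; lra_goal.
    move: b2 b1; lra_goal.
  + by rewrite l_E; lra_goal.
- case: n n0 n5 => [//|[|[|[|[|//]]]]] _ _.
  + (* n = 1 *)
    (* [h] contains -6 T^(1/2), which the added constant 2 K dominates on (0, B]; in [g] the affine
       part becomes K (B - T), which is nonnegative there. *)
    pose K := 4 * (1 + B).
    exists 9; first by lra.
    exists ((B `^ (3 / 2) + K * B) * B `^ 4^-1).
      by rewrite mulr_gt0// addr_gt0 ?powR_gt0// !mulr_gt0//; lra.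
    move=> e /andP[e0 e1].
    have [g1 [g2 [h [h1 [h2 [tg th hE H]]]]]] := kernel_pair_powR 1 1 (K * B) K e0.
    eexists; exists g1, g2, h, h1, h2; split; [exact: tg|exact: th|exact: hE|].
    move=> t /andP[et tB]; have t0 : 0 < t by lra.
    have [h_E l_E] := H t t0.
    have m32 : (4 - 1%:R) / 2 = 3 / 2 :> R by field.
    rewrite !m32 in h_E l_E *.
    have tm : t `^ (3 / 2) <= B `^ (3 / 2).
      by rewrite ge0_ler_powR ?nnegrE//; move: tB t0; lra_goal.
    have tm0 := powR_ge0 t (3 / 2).
    have K0 : 0 < K by rewrite /K; move: B1; lra_goal.
    have KtB : 0 <= K * (B - t) by rewrite mulr_ge0//; move: tB K0; lra_goal.
    split.
    * rewrite /kern_exp/=; apply/andP; split; first (move: KtB tm0; lra_goal).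
      rewrite -mulrA; apply: (@le_trans _ _ (B `^ (3 / 2) + K * B)).
        have := mulr_ge0 (ltW K0) (ltW t0); move: tm; lra_goal.
      rewrite ler_peMr// ?q0 ?t0//.
      by rewrite addr_ge0 ?powR_ge0// mulr_ge0//; move: B1 K0; lra_goal.
    * rewrite h_E.
      have h12 : t `^ (3 / 2 - 1) <= 1 + B.
        have -> : 3 / 2 - 1 = 2^-1 :> R by field.
        by have := powR12_le B1 t0 tB; lra_goal.
      have h32 := powR_ge0 t (3 / 2 - 1 - 1).
      have := mulr_ge0 (ltW e0) h32; rewrite /K; move: h12 B1; lra_goal.
    * by rewrite l_E /=; lra_goal.
  + (* n = 2 *)
    exists 32; first by lra.
    pose K2 := B + 2; pose K1 := B * (K2 + B) + 4 * B `^ (1 + - 4^-1) .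
    exists ((K1 + B * B) * B `^ 4^-1 + 0).
      rewrite addr0 mulr_gt0// addr_gt0// ?mulr_gt0//.
      by rewrite /K1 /K2 addr_gt0 ?mulr_gt0 ?powR_gt0//; lra.
    move=> e /andP[e0 e1].
    (* The power T^((4-n)/2) is T itself in dimension 2 and is biharmonic; T ln T takes its
       place. *)
    have tg := twice_derivableD twice_derivable_xln (twice_derivable_affine K1 (- K2)).
    have th := twice_derivableD (twice_derivableD (twice_derivableZ (- 4) twice_derivable_ln)
      (twice_derivableZ (4 * e) (twice_derivable_powR (-1))))
      (twice_derivable_affine (- 8 + 4 * K2) 0).
    do 6 eexists; split; [exact: tg|exact: th| |] => t.
      move=> t0; rewrite /radial_lap/=.
      have := powRSr (-1) t0; rewrite addNr powRr0 => E.
      rewrite -[RHS](_ : - (4 * ln t + 4 - 4 * K2 + 4 * (t * t `^ (-1)) - 4 * e * t `^ (-1)) = _);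
        last by ring.
      rewrite E; ring.
    move=> /andP[et tB]; have t0 : 0 < t by lra.
    have lt := lnB t; rewrite t0 tB in lt; have {lt} lt := lt isT.
    have ltn := ln_powR_le t0.
    have tt := powRSr (- 4^-1) t0.
    have tt2 : t `^ (- 4^-1 + 1) <= B `^ (1 + - 4^-1).
      by rewrite addrC ge0_ler_powR ?nnegrE//; move: tB t0; lra_goal.
    have l1 : t * ln t <= B * B.
      have [l0|l0] := leP 0 (ln t); first by apply: ler_pM => //; move: t0; lra_goal.
      apply: (@le_trans _ _ 0); last by rewrite mulr_ge0//; move: B1; lra_goal.
      by rewrite mulr_ge0_le0//; move: l0 t0; lra_goal.
    have l2 : - (t * ln t) <= 4 * B `^ (1 + - 4^-1).
      rewrite -mulrN; apply: (@le_trans _ _ (t * (4 * t `^ (- 4^-1)))).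
        by rewrite ler_wpM2l// ltW.
      by rewrite mulrCA tt; move: tt2; lra_goal.
    have k2t : K2 * t <= B * (K2 + B).
      by rewrite /K2; nra.
    have k20 : 0 <= K2 * t by rewrite mulr_ge0// /K2; move: tB t0; lra_goal.
    have pt := powR_ge0 t (-1).
    split.
    * rewrite /kern_exp/=; apply/andP; split; first by rewrite /K1; move: k2t l2; lra_goal.
      rewrite addr0 -mulrA; apply: (@le_trans _ _ (K1 + B * B)); first (move: k20 l1; lra_goal).
      rewrite ler_peMr ?q0 ?t0// addr_ge0//; last by rewrite mulr_ge0// ltW.
      by rewrite /K1 /K2 addr_ge0 ?mulr_ge0 ?powR_ge0//; move: B1; lra_goal.
    * have := mulr_ge0 (ltW e0) pt; rewrite /K2 mul0r; move: lt; lra_goal.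
    * have E1 := radial_lap_powR 2 e (-1) t0; rewrite /radial_lap in E1 *.
      have -> : - ((2%:R + 4) / 2) = -1 - 1 - 1 :> R by field.
      have E3 := powRSr (-1 - 1) t0; rewrite subrK in E3.
      rewrite -[X in _ <= X](_ : - (- 4 * (2 * 2%:R * t `^ (-1) - 4 * (t * t `^ (-1 - 1))
         + 4 * e * t `^ (-1 - 1)) + 4 * e * (-1 * (2 * 2%:R + 4 * (-1 - 1)) * t `^ (-1 - 1) -
         4 * -1 * (-1 - 1) * e * t `^ (-1 - 1 - 1))) = _); last by rewrite -E1; ring.
      by rewrite E3; lra_goal.
  + (* n = 3 *)
    exists 15; first by lra.
    exists (B * B `^ 4^-1); first by rewrite mulr_gt0.
    move=> e /andP[e0 e1].
    have [g1 [g2 [h [h1 [h2 [tg th hE H]]]]]] := kernel_pair_powR 3 (-1) B 0 e0.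
    eexists; exists g1, g2, h, h1, h2; split; [exact: tg|exact: th|exact: hE|].
    move=> t /andP[et tB]; have t0 : 0 < t by move: et e0; lra_goal.
    have [h_E l_E] := H t t0.
    have m12 : (4 - 3%:R) / 2 = 2^-1 :> R by field.
    rewrite !m12 in h_E l_E *.
    have tm : t `^ 2^-1 <= B.
      exact: powR12_le.
    have tm0 := powR_ge0 t 2^-1.
    split.
    * rewrite /kern_exp/= oppr0 mul0r; apply/andP; split; first (move: tm; lra_goal).
      rewrite -mulrA; apply: (@le_trans _ _ B); first (move: tm0; lra_goal).
      by rewrite ler_peMr ?q0 ?t0// ltW.
    * rewrite h_E.
      have a1 := powR_ge0 t (2^-1 - 1); have a2 := mulr_ge0 (ltW e0) (powR_ge0 t (2^-1 - 1 - 1)).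
      move: a2 a1; lra_goal.
    * by rewrite l_E /=; lra_goal.
  + (* n = 4 *)
    exists 96; first by lra.
    exists (B * B `^ 4^-1 + 4); first by rewrite addr_gt0// mulr_gt0.
    move=> e /andP[e0 e1].
    (* The power T^((4-n)/2) is constant in dimension 4; - ln T, shifted by [B] to be nonnegative,
       takes its place. *)
    have tg := twice_derivableD (twice_derivableZ (-1) twice_derivable_ln)
      (twice_derivable_affine B 0).
    have th := twice_derivableD (twice_derivableZ 4 (twice_derivable_powR (-1)))
      (twice_derivableZ (4 * e) (twice_derivable_powR (-1 - 1))).
    do 6 eexists; split; [exact: tg|exact: th| |] => t.
      move=> t0; rewrite /radial_lap/=.
      have E3 := powRSr (-1 - 1) t0; rewrite subrK in E3.
      rewrite -[RHS](_ : 2 * 4%:R * t `^ (-1) - 4 * (t * t `^ (-1 - 1)) +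
        4 * e * t `^ (-1 - 1) = _); last by ring.
      rewrite E3; ring.
    move=> /andP[et tB]; have t0 : 0 < t by move: et e0; lra_goal.
    have lt := lnB t; rewrite t0 tB in lt; have {lt} lt := lt isT.
    have ltn := ln_powR_le t0.
    have pt := powR_ge0 t (-1); have pt2 := mulr_ge0 (ltW e0) (powR_ge0 t (-1 - 1)).
    split.
    * rewrite /kern_exp/= mul0r addr0; apply/andP; split; first (move: lt; lra_goal).
      have : B <= B * (B `^ 4^-1 * t `^ (- 4^-1)) by rewrite ler_peMr ?q0 ?t0// ltW.
      move: ltn; lra_goal.
    * move: pt2 pt; lra_goal.
    * have E1 := radial_lap_powR 4 e (-1) t0; have E2 := radial_lap_powR 4 e (-1 - 1) t0.
      rewrite /radial_lap in E1 E2 *.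
      have -> : - ((4%:R + 4) / 2) = -1 - 1 - 1 - 1 :> R by field.
      rewrite -[X in _ <= X](_ : - (4 * (-1 * (2 * 4%:R + 4 * (-1 - 1)) * t `^ (-1 - 1) -
         4 * -1 * (-1 - 1) * e * t `^ (-1 - 1 - 1)) + 4 * e * ((-1 - 1) * (2 * 4%:R +
         4 * (-1 - 1 - 1)) * t `^ (-1 - 1 - 1) - 4 * (-1 - 1) * (-1 - 1 - 1) * e *
         t `^ (-1 - 1 - 1 - 1))) = _); last by rewrite -E1 -E2; ring.
      lra_goal.
Qed.

End biharmonic_kernels.

(** * Functions of the squared Euclidean distance *)

Section radial_functions.
Context {R : realType} {n : nat}.
Local Notation V := 'rV[R]_n.
Implicit Types (D : set V) (f g : V -> R) (a x y : V).

Definition sqd a x : R := \sum_i (x ord0 i - a ord0 i) ^+ 2.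

Lemma sqd_ge0 a x : 0 <= sqd a x.
Proof. by apply: sumr_ge0 => i _; exact: sqr_ge0. Qed.

Lemma sqd_coord a x i : (x ord0 i - a ord0 i) ^+ 2 <= sqd a x.
Proof.
by rewrite /sqd (bigD1 i)//= lerDl sumr_ge0// => j _; exact: sqr_ge0.
Qed.

Lemma sqd_le a x r : (forall i, `|x ord0 i - a ord0 i| <= r) -> sqd a x <= n%:R * r ^+ 2.
Proof.
move=> H; apply: (@le_trans _ _ (\sum_(i < n) r ^+ 2)).
  apply: ler_sum => i _; rewrite -real_normK ?num_real//.
  by apply: lerXn2r; rewrite ?nnegrE//; apply: le_trans (H i).
by rewrite sumr_const card_ord mulr_natl.
Qed.

Lemma C2_sqd a (c : R) : C2 setT (fun x => sqd a x + c)
  (fun i x => 2 * (x ord0 i - a ord0 i)) (fun i j _ => 2 * (i == j)%:R).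
Proof.
have H (k : 'I_n) := C2B (C2_coord setT k) (C2_cst setT (a ord0 k)).
have := C2D (C2_sum (index_enum _) (fun k => C2M (H k) (H k))) (C2_cst setT c).
move=> HH; apply: (C2_ext openT HH) => [x|i x|i j x] _.
- by congr (_ + _); apply: eq_bigr => k _; rewrite expr2.
- rewrite addr0 (bigD1 i)//= eqxx big1; last first.
    by move=> k ki; rewrite eq_sym (negbTE ki) subr0 mulr0 addr0.
  by rewrite subr0 mulr1 addr0 mulr_natl mulr2n.
- rewrite addr0 (bigD1 i)//= eqxx big1; last first.
    move=> k ki; rewrite [i == k]eq_sym (negbTE ki) !subr0 !mulr0 !add0r !mul0r.
    by rewrite !addr0.
  by rewrite !subr0 !mulr0 !add0r !mul1r addr0 mulr_natl mulr2n eq_sym.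
Qed.

Lemma C2_radial a e (g g1 g2 : R -> R) : 0 < e -> twice_derivable g g1 g2 ->
  C2 setT (fun x => g (sqd a x + e))
    (fun i x => g1 (sqd a x + e) * (2 * (x ord0 i - a ord0 i)))
    (fun i j x => g1 (sqd a x + e) * (2 * (i == j)%:R) +
      (2 * (x ord0 i - a ord0 i)) *
        (g2 (sqd a x + e) * (2 * (x ord0 j - a ord0 j)))).
Proof.
move=> e0 H; have t0 x : 0 < sqd a x + e by rewrite ltr_wpDl// sqd_ge0.
by apply: (C2_comp (C2_sqd a e)) => x _; have [] := H _ (t0 x).
Qed.

Lemma lap_radial a e (g1 g2 : R -> R) x :
  lap (fun i j x => g1 (sqd a x + e) * (2 * (i == j)%:R) +
      (2 * (x ord0 i - a ord0 i)) *
        (g2 (sqd a x + e) * (2 * (x ord0 j - a ord0 j)))) x =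
  radial_lap n e g1 g2 (sqd a x + e).
Proof.
rewrite /lap big_split/= /radial_lap addrK; congr (_ + _).
  under eq_bigr do rewrite eqxx mulr1.
  by rewrite sumr_const card_ord -mulr_natr; ring.
rewrite /sqd mulr_sumr mulr_suml; apply: eq_bigr => i _; ring.
Qed.

Lemma C0T_BC D f : bounded_set D -> C0 setT f -> BC D f.
Proof.
move=> bD cf; split; first exact: C0S cf.
have [B B0 HB] := bounded_set_cube bD.
have [|M M0 fM] := @continuous_bounded_on R n _ f (@compact_closed_box R n B).
  by move=> x _; exact: cf.
by exists M => x Dx; apply: fM => i; apply: ltW; exact: HB.
Qed.

Lemma sqd_compact a r : compact [set x | sqd a x <= r].
Proof.
apply: bounded_closed_compact.
  exists (`|a| + (`|r| + 1)); split; first by rewrite !realD ?num_real.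
  move=> N HN x /= xr; apply: le_trans (ltW HN).
  apply: norm_rV_le => [|i]; first by rewrite !addr_ge0.
  rewrite -(subrK (a ord0 i) (x ord0 i)) (le_trans (ler_normD _ _))// addrC.
  apply: lerD; first exact: norm_coord_le.
  have h := le_trans (sqd_coord a x i) (le_trans xr (ler_norm _)).
  rewrite -real_normK ?num_real// in h; nra.
have cs : continuous (fun x => sqd a x).
  have := C2_C0 (C2_sqd a 0) => c x; have := c x I.
  rewrite /prop_for (_ : (fun x => sqd a x + 0) = sqd a) //.
  by apply/funext => y; rewrite addr0.
rewrite (_ : [set x | _] = sqd a @^-1` [set t | t <= r])//.
by apply: closed_comp => [x _|]; [exact: cs|exact: closed_le].
Qed.

Lemma open_cube a r : open (cube a r).
Proof.
apply/open_cubeP => x xa.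
have [r0|r0] := leP r 0.
  exists 1 => // y _ i; exfalso; have := le_lt_trans (normr_ge0 _) (xa i).
  by rewrite ltNge r0.
have m0 : \big[Num.max/0]_i `|x ord0 i - a ord0 i| < r.
  by apply: bigmax_lt => // i _; exact: xa.
exists (r - \big[Num.max/0]_i `|x ord0 i - a ord0 i|); first by rewrite subr_gt0.
move=> y yx i; have := yx i; rewrite ltrBrDr; apply: le_lt_trans.
rewrite -(subrK (x ord0 i) (y ord0 i)) -addrA (le_trans (ler_normD _ _))// addrK.
rewrite lerD2l; exact: (@le_bigmax _ _ _ 0 (fun i => `|x ord0 i - a ord0 i|) i).
Qed.

Lemma bounded_cube a r : bounded_set (cube a r).
Proof.
exists (`|a| + `|r|); split; first by rewrite !realD ?num_real.
move=> N HN x /= xr; apply: le_trans (ltW HN).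
apply: norm_rV_le => [|i]; first by rewrite !addr_ge0.
rewrite -(subrK (a ord0 i) (x ord0 i)) (le_trans (ler_normD _ _))// addrC.
apply: lerD; first exact: norm_coord_le.
by apply: le_trans (ltW (xr i)) _; exact: ler_norm.
Qed.

Lemma lebesgue_cube a r : 0 <= r -> lebesgue_rV n (cube a r) = ((2 * r) ^+ n)%:E.
Proof.
move=> r0; have -> : cube a r =
  [set y : V | forall i, `](a ord0 i - r), (a ord0 i + r)[%classic (y ord0 i)].
  apply/seteqP; split=> y /= H i; have := H i; rewrite /= in_itv /= ltr_norml; lra.
have -> := @lebesgue_rV_box R n
  (fun i => (`](a ord0 i - r), (a ord0 i + r)[%classic)) (fun=> measurable_itv _).
rewrite (eq_bigr (fun=> (2 * r)%:E)) => [|i _]; last first.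
  rewrite lebesgue_measure_itv /= lte_fin.
  case: ifPn => [h|]; first by rewrite -EFinB; congr (_%:E); ring.
  rewrite -leNgt => h; have -> : r = 0 by lra.
  by rewrite mulr0.
elim: (n) => [|m IH]; first by rewrite big_ord0 expr0.
by rewrite big_ord_recr/= IH -EFinM exprSr.
Qed.

End radial_functions.

Section subdomains.
Context {R : realType} {n : nat}.
Local Notation V := 'rV[R]_n.
Implicit Types (D E : set V) (f g : V -> R) (a x y : V).

Lemma itg_subset D E f : open D -> bounded_set D -> open E -> E `<=` D -> BC D f ->
  (forall x, D x -> 0 <= f x) -> itg E f <= itg D f.
Proof.
move=> oD bD oE ED bf f0; have bE : bounded_set E.
  by have [M [Mr HM]] := bD; exists M; split => // N MN x /ED; exact: HM.
have iD := BC_integrable oD bD bf.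
have iE : (lebesgue_rV n).-integrable E (EFin \o f).
  by apply: integrableS iD => //; exact: open_measurable_rV.
rewrite /itg /Rintegral fine_le//.
- by apply: integrable_fin_num => //; exact: open_measurable_rV.
- by apply: integrable_fin_num => //; exact: open_measurable_rV.
have mE := open_measurable_rV oE; have mD := open_measurable_rV oD.
apply: (ge0_subset_integral _ mE mD) => //.
by have /integrableP[] := iD.
Qed.

Lemma itg_ge_cube D f a r k : open D -> bounded_set D -> BC D f ->
  (forall x, D x -> 0 <= f x) -> 0 <= r -> cube a r `<=` D ->
  (forall x, cube a r x -> k <= f x) -> k * (2 * r) ^+ n <= itg D f.
Proof.
move=> oD bD bf f0 r0 aD kf.
have H := itg_subset oD bD (@open_cube R n a r) aD bf f0; apply: le_trans H.
have -> : k * (2 * r) ^+ n = itg (cube a r) (fun=> k).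
  rewrite (itg_cst (@open_cube R n a r)); congr (_ * _).
  by rewrite lebesgue_cube.
apply: itg_le => //; [exact: open_cube|exact: bounded_cube|exact: BC_cst|].
by have [cf [M fM]] := bf; split; [exact: C0S cf|exists M => x /aD; exact: fM].
Qed.

End subdomains.

(** * Concentration and integrability of radial powers *)

Section kernel_estimates.
Context {R : realType} {n : nat} (D : set 'rV[R]_n).
Local Notation V := 'rV[R]_n.
Hypotheses (oD : open D) (bD : bounded_set D).
Implicit Types (f g : V -> R) (a x y : V).

Lemma BC_radial a e (g g1 g2 : R -> R) : 0 < e -> twice_derivable g g1 g2 ->
  BC D (fun x => g (sqd a x + e)).
Proof. by move=> e0 H; apply: C0T_BC => //; exact: C2_C0 (C2_radial a e0 H). Qed.

Lemma BC_lap_radial a e (g g1 g2 : R -> R) : 0 < e -> twice_derivable g g1 g2 ->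
  BC D (lap (fun i j x => g1 (sqd a x + e) * (2 * (i == j)%:R) +
      (2 * (x ord0 i - a ord0 i)) *
        (g2 (sqd a x + e) * (2 * (x ord0 j - a ord0 j))))).
Proof. by move=> e0 H; apply: C0T_BC => //; exact: C0_lap (C2_radial a e0 H). Qed.

(** A lower bound for the mass of s^(2j) T^(-(n/2+j)), T = |x - a|^2 + s^2, on the cube of half-side
    s about a: there T <= (n + 1) s^2, the volume is (2 s)^n, and all powers of s cancel. *)
Definition mass_cst (j : nat) : R := 2 ^+ n * (n%:R + 1) `^ (- (n%:R / 2 + j%:R)).

Lemma mass_cst_gt0 j : 0 < mass_cst j.
Proof. by rewrite mulr_gt0 ?exprn_gt0// powR_gt0// ltr_wpDl. Qed.

(** A fixed fraction of [f a] is enough for the potential bounds, so no limit of approximate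
    identities is taken: [f] exceeds f(a)/2 on a small cube, and [mass_cst] bounds the mass there.
    The Laplacian uses j = 1, the bilaplacian j = 2. *)
Lemma point_mass (j : nat) f a : BC D f -> (forall x, D x -> 0 <= f x) -> D a ->
  exists2 s0 : R, 0 < s0 & forall s, 0 < s <= s0 ->
    f a / 2 * mass_cst j <= itg D (fun x => f x *
      ((s ^+ 2) ^+ j * (sqd a x + s ^+ 2) `^ (- (n%:R / 2 + j%:R)))).
Proof.
move=> bf f0 Da; have [fa0|fa0|fa] := ltgtP (f a) 0.
- by have := f0 a Da; rewrite leNgt fa0.
- have [r r0 rD] : exists2 r : R, 0 < r & cube a r `<=` [set x | D x /\ f a / 2 <= f x].
    have H1 : nbhs a D by exact: open_nbhs_nbhs.
    have H2 : nbhs a [set x | f a / 2 < f x].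
      have : nbhs (f a) [set u | f a / 2 < u].
        by apply: open_nbhs_nbhs; split; [exact: open_gt|rewrite /=; lra].
      by have [cf _] := bf; move: (cf a Da); rewrite /prop_for /continuous_at; apply.
    have [r r0 H] := proj1 (nbhs_cubeP a _) (filterI H1 H2).
    by exists r => // x /H[Dx fx]; split => //; exact: ltW.
  exists r => // s /andP[s0 sr].
  have sD : cube a s `<=` D by move=> x xa; apply: (rD x _).1 => i; exact: lt_le_trans (xa i) sr.
  have s2 : 0 < s ^+ 2 by rewrite exprn_gt0.
  pose k := f a / 2 * ((s ^+ 2) ^+ j * ((n%:R + 1) * s ^+ 2) `^ (- (n%:R / 2 + j%:R))).
  have tw := twice_derivable_powR (- (n%:R / 2 + j%:R) : R).
  have -> : f a / 2 * mass_cst j = k * (2 * s) ^+ n.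
    rewrite /k /mass_cst; set b := n%:R / 2 + j%:R.
    have -> : ((n%:R + 1) * s ^+ 2) `^ (- b) = (n%:R + 1) `^ (- b) * (s ^+ 2) `^ (- b).
      by rewrite powRM// ?addr_ge0// ltW.
    have E : (s ^+ 2) ^+ j * (s ^+ 2) `^ (- b) * s ^+ n = 1.
      have -> : s ^+ n = (s ^+ 2) `^ (n%:R / 2).
        rewrite -[s ^+ 2]powR_mulrn ?ltW// -powRrM -powR_mulrn ?ltW//.
        by congr (_ `^ _); field.
      rewrite -(powR_mulrn j (ltW s2)) -!powRD ?(gt_eqF s2) ?implybT//.
      by rewrite (_ : _ + _ = 0) ?powRr0// /b; ring.
    rewrite [(2 * s) ^+ n]exprMn; move: E; set A := (s ^+ 2) ^+ j; set B := (s ^+ 2) `^ (- b) => E.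
    transitivity (f a / 2 * (2 ^+ n * (n%:R + 1) `^ (- b)) * (A * B * s ^+ n)).
      by rewrite E mulr1.
    by move: ((n%:R + 1) `^ (- b)) (2 ^+ n : R) (s ^+ n) => *; ring.
  apply: itg_ge_cube (ltW s0) sD _ => //.
  + apply: BCM => //; apply: BCZ; exact: (BC_radial a s2 tw).
  + by move=> x Dx; rewrite mulr_ge0 ?f0// mulr_ge0 ?powR_ge0// !exprn_ge0// ltW.
  move=> x xa; have [Dx fx] := rD x (fun i => lt_le_trans (xa i) sr).
  rewrite /k; apply: ler_pM => //.
  + by rewrite divr_ge0// ltW.
  + by rewrite mulr_ge0 ?powR_ge0// !exprn_ge0// ltW.
  have t1 : 0 < sqd a x + s ^+ 2 by rewrite ltr_wpDl// sqd_ge0.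
  have t2 : 0 < (n%:R + 1) * s ^+ 2 by rewrite mulr_gt0// ltr_wpDl.
  have b0 : 0 <= n%:R / 2 + j%:R :> R by rewrite addr_ge0// divr_ge0.
  have le12 : sqd a x + s ^+ 2 <= (n%:R + 1) * s ^+ 2.
    by rewrite mulrDl mul1r lerD2r sqd_le// => i; exact: ltW (xa i).
  apply: ler_wpM2l; first by rewrite !exprn_ge0// ltW.
  rewrite !powRN lef_pV2 ?posrE ?powR_gt0//.
  by rewrite ge0_ler_powR// nnegrE ltW.
- exists 1 => // s /andP[s0 _]; rewrite fa !mul0r itg_ge0// => x Dx.
  by rewrite mulr_ge0 ?f0// mulr_ge0 ?powR_ge0// !exprn_ge0// ltW.
Qed.

Lemma hst2_le (e t : R) : 0 < e ->
  [/\ t <= e -> hst2 e t = 0, 3 * e <= t -> hst2 e t = 0 & hst2 e t <= e^-1].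
Proof.
move=> e0; have e2 : 0 < e ^+ 2 by rewrite exprn_gt0.
rewrite /hst2 /tpow !expr1.
have -> : e^-1 = (e ^+ 2)^-1 * e by field; rewrite gt_eqF.
rewrite ler_pM2l ?invr_gt0//.
apply: (@hst_cases R e t) => // [te|/andP[t1 t2]|/andP[t1 t2]|te].
- rewrite (@tpos_neg R (t - e)) ?(@tpos_neg R (t - 2 * e)) ?(@tpos_neg R (t - 3 * e)); try lra.
  by split; [move=> _; ring|move=> H; lra|lra].
- rewrite (@tpos_pos R (t - e)) ?(@tpos_neg R (t - 2 * e)) ?(@tpos_neg R (t - 3 * e)); try lra.
  by split; [move=> H; (have -> : t = e by lra); ring|move=> H; lra|lra].
- rewrite (@tpos_pos R (t - e)) ?(@tpos_pos R (t - 2 * e)) ?(@tpos_neg R (t - 3 * e)); try lra.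
  by split; [move=> H; lra|move=> H; (have -> : t = 3 * e by lra); ring|lra].
- rewrite (@tpos_pos R (t - e)) ?(@tpos_pos R (t - 2 * e)) ?(@tpos_pos R (t - 3 * e)); try lra.
  by split; [move=> H; lra|move=> _; ring|lra].
Qed.

(* The field (x - a) T^(-k) has divergence at least (n - 2 k) T^(-k). *)
Lemma itg_radial_powR (k : R) : 0 <= k -> k < n%:R / 2 -> exists2 C : R, 0 < C &
  forall a (e : R), D a -> 0 < e -> itg D (fun x => (sqd a x + e) `^ (- k)) <= C.
Proof.
move=> k0 kn; have [B0 B00 HB0] := bounded_set_cube bD.
pose B := n%:R * (2 * B0) ^+ 2 + 1.
have B1 : 1 <= B by rewrite lerDr mulr_ge0// exprn_ge0// mulr_ge0// ltW.
have Bp : 0 < B by lra.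
pose W : set V := cube 0 (B0 + 3 * B + 1).
have oW : open W := @open_cube R n _ _; have bW : bounded_set W := @bounded_cube R n _ _.
have DW : D `<=` W by move=> x Dx i; rewrite mxE subr0; have := HB0 x Dx i; lra.
have nk : 0 < n%:R - 2 * k by lra.
exists (6 * fine (lebesgue_rV n W) / (n%:R - 2 * k) + 1).
  by rewrite ltr_wpDl// divr_ge0 ?mulr_ge0 ?fine_ge0// ltW.
move=> a e Da e0.
have t0 x : 0 < sqd a x + e by rewrite ltr_wpDl// sqd_ge0.
pose P x := (sqd a x + e) `^ (- k); pose P1 x := (sqd a x + e) `^ (- k - 1).
(* The derivative of the truncation is used as a cutoff: [X] is 1 where |x - a|^2 <= B, which covers
   [D], and 0 where |x - a|^2 >= 3 B, a ball contained in [W]. *)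
pose X x := hst1 B (4 * B - (sqd a x + 0)).
pose X1 x := hst2 B (4 * B - (sqd a x + 0)).
have cX : C1 W X (fun i x => X1 x * - (2 * (x ord0 i - a ord0 i))).
  have c0 := C1B (C1_cst W (4 * B)) (C1S (@subsetT _ W) (C2_C1 (C2_sqd a 0))).
  have : C1 W (fun x => 4 * B - (sqd a x + 0)) (fun i x => - (2 * (x ord0 i - a ord0 i))).
    by apply: (C1_ext oW c0) => // i x _; rewrite sub0r.
  move=> c1; apply: (C1_comp (h := hst1 B) (h1 := hst2 B) c1) => x _.
    exact: is_derive_hst1.
  exact: hst2_continuous.
have cP : C1 W P (fun i x => - k * P1 x * (2 * (x ord0 i - a ord0 i))).
  exact: C1S (@subsetT _ W) (C2_C1 (C2_radial a e0 (twice_derivable_powR (- k)))).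
have cY i : C1 W (fun x => x ord0 i - a ord0 i) (fun j _ => (j == i)%:R).
  have := C1B (C1_coord W i) (C1_cst W (a ord0 i)) => c.
  by apply: (C1_ext oW c) => // j x _; rewrite subr0.
have sX : cs W X.
  exists [set x | sqd a x <= 3 * B].
    split; first exact: sqd_compact.
    move=> x /= xa i; rewrite mxE subr0.
    have h := le_trans (sqd_coord a x i) xa.
    have : `|x ord0 i - a ord0 i| <= 3 * B.
      rewrite -real_normK ?num_real// in h.
      have := normr_ge0 (x ord0 i - a ord0 i); nra.
    have := HB0 a Da i; rewrite !ltr_norml ler_norml; lra_goal.
  move=> x _ /= /negP; rewrite -ltNge => xa; rewrite /X addr0.
  by have [h _ _ _ _] := hst_facts (4 * B - sqd a x) Bp; have [|_ ->] := h; first lra.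
have cF i := C1M (C1M cX (cY i)) cP.
have sF i : cs W (fun x => X x * (x ord0 i - a ord0 i) * P x) by do 2 apply: csMl.
have cP1 : C0 W P1.
  apply: (C0S (@subsetT _ W)).
  exact: C2_C0 (C2_radial a e0 (twice_derivable_powR (- k - 1))).
have bXP : BC W (fun x => X x * P x).
  by apply: BC_csMl => //; [case: cX|case: cP].
have cX1 : C0 W X1.
  apply: (@C0_comp R n W (fun x => 4 * B - (sqd a x + 0)) (hst2 B)) => [|x _].
    by apply: C0B; [exact: C0_cst|exact: C0S (@subsetT _ W) (C2_C0 (C2_sqd a 0))].
  exact: hst2_continuous.
have bX1 : BC W (fun x => 2 * sqd a x * X1 x * P x).
  have b1 : BC W (fun x => sqd a x + 0) by apply: C0T_BC => //; exact: C2_C0 (C2_sqd a 0).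
  have b2 : BC W P by apply: C0T_BC => //; exact: C2_C0 (C2_radial a e0 (twice_derivable_powR (- k))).
  have b3 : BC W X1.
    split => //; exists B^-1 => x _; have [_ _ h] := hst2_le (4 * B - (sqd a x + 0)) Bp.
    by rewrite ger0_norm//; have [] := hst_facts (4 * B - (sqd a x + 0)) Bp.
  apply: (@near_BC R n W (fun x => 2 * (sqd a x + 0) * X1 x * P x)) => //.
    by move=> x _; rewrite addr0.
  by apply: BCM => //; apply: BCM => //; exact: BCZ.
have bPP : BC W (fun x => X x * (sqd a x * P1 x)).
  apply: BC_csMl => //; first by case: cX.
  apply: C0M => //; apply: (near_C0 oW (f := fun x => sqd a x + 0)).
    by move=> x _; rewrite addr0.
  exact: C0S (@subsetT _ W) (C2_C0 (C2_sqd a 0)).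
have divE x : \sum_i (X x * (x ord0 i - a ord0 i) * (- k * P1 x * (2 * (x ord0 i - a ord0 i)))
    + P x * (X x * (i == i)%:R + (x ord0 i - a ord0 i) *
      (X1 x * - (2 * (x ord0 i - a ord0 i))))) =
    n%:R * (X x * P x) - 2 * k * (X x * (sqd a x * P1 x)) - 2 * sqd a x * X1 x * P x.
  rewrite big_split/=.
  have -> : \sum_i X x * (x ord0 i - a ord0 i) * (- k * P1 x * (2 * (x ord0 i - a ord0 i))) =
      - (2 * k * (X x * (sqd a x * P1 x))).
    by rewrite /sqd mulr_suml !mulr_sumr -sumrN; apply: eq_bigr => i _; ring.
  have -> : \sum_i P x * (X x * (i == i)%:R + (x ord0 i - a ord0 i) *
      (X1 x * - (2 * (x ord0 i - a ord0 i)))) = n%:R * (X x * P x) - 2 * sqd a x * X1 x * P x.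
    under eq_bigr do rewrite eqxx mulr1 mulrDr.
    rewrite big_split/= sumr_const card_ord -mulr_natl; congr (_ + _); first by ring.
    by rewrite /sqd !(mulr_sumr, mulr_suml) -sumrN; apply: eq_bigr => i _; ring.
  ring.
have int0 : itg W (fun x => n%:R * (X x * P x) - 2 * k * (X x * (sqd a x * P1 x))
    - 2 * sqd a x * X1 x * P x) = 0.
  rewrite -(eq_itg (fun x _ => divE x)) itg_sum//; last first.
    move=> i; have [_ h _] := cF i; apply: cs_BC; first exact: h.
    exact: (cs_grad i oW (cF i) (sF i)).
  by apply: big1 => i _; exact: (itg_grad_eq0 oW bW i (cF i) (sF i)).
have X0 x : 0 <= X x <= 1 by have [_ _ ? _ _] := hst_facts (4 * B - (sqd a x + 0)) Bp.
have main : (n%:R - 2 * k) * itg W (fun x => X x * P x) <=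
    itg W (fun x => 2 * sqd a x * X1 x * P x).
  rewrite -subr_le0 -itgZ// -itgB//; last exact: BCZ.
  rewrite -int0; apply: itg_le => //.
  - by apply: BCB => //; exact: BCZ.
  - by apply: BCB => //; apply: BCB; exact: BCZ.
  move=> x Wx; have /andP[X00 _] := X0 x.
  have PE : P x = (sqd a x + e) * P1 x by rewrite /P /P1 powRSr// subrK.
  have h1 : sqd a x * P1 x <= P x by rewrite PE ler_wpM2r ?powR_ge0// lerDl ltW.
  have h2 : 0 <= k * X x * (P x - sqd a x * P1 x).
    by rewrite mulr_ge0 ?subr_ge0// mulr_ge0.
  rewrite -subr_ge0; apply: le_trans (mulr_ge0 (ler0n _ 2) h2) _.
  rewrite le_eqVlt; apply/orP; left; apply/eqP; ring.
(* The derivative of the cutoff lives where |x - a|^2 lies between B and 3 B; since B >= 1, the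
   radial power is at most 1 there, whatever [e]. *)
have bnd : itg W (fun x => 2 * sqd a x * X1 x * P x) <= 6 * fine (lebesgue_rV n W).
  rewrite -(itg_cst oW); apply: itg_le => //; first exact: BC_cst.
  move=> x _; have [h1 h2 h3] := hst2_le (4 * B - (sqd a x + 0)) Bp.
  have X10 : 0 <= X1 x by have [] := hst_facts (4 * B - (sqd a x + 0)) Bp.
  rewrite -/(X1 x) addr0 in h1 h2 h3.
  have [l1|l1] := leP (sqd a x) B.
    by rewrite h2 ?mulr0 ?mul0r//; move: l1; lra_goal.
  have [l2|l2] := leP (3 * B) (sqd a x).
    by rewrite h1 ?mulr0 ?mul0r//; move: l2; lra_goal.
  have P01 : P x <= 1.
    have h : 1 `^ k <= (sqd a x + e) `^ k by rewrite ge0_ler_powR ?nnegrE//; move: B1 l1 e0; lra_goal.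
    by rewrite /P powRN invf_le1 ?powR_gt0//; rewrite powR1 in h.
  have Pp : 0 <= P x := powR_ge0 _ _.
  have q1 : 2 * sqd a x * X1 x <= 6.
    have -> : 6 = 2 * (3 * B) * B^-1 by field; rewrite gt_eqF.
    by have S0 := sqd_ge0 a x; apply: ler_pM => //; move: S0 l2; lra_goal.
  have S0 := sqd_ge0 a x.
  have q2 : 2 * sqd a x * X1 x * P x <= 6 * P x by rewrite ler_wpM2r.
  by apply: le_trans q2 _; move: P01; lra_goal.
have DX x : D x -> X x = 1.
  move=> Dx; rewrite /X addr0; have [_ h _ _ _] := hst_facts (4 * B - sqd a x) Bp.
  apply: h; have : sqd a x <= n%:R * (2 * B0) ^+ 2.
    apply: sqd_le => i; have := HB0 x Dx i; have := HB0 a Da i.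
    rewrite !ltr_norml ler_norml; lra_goal.
  rewrite /B; lra_goal.
apply: (@le_trans _ _ (itg W (fun x => X x * P x))).
  apply: (@le_trans _ _ (itg D (fun x => X x * P x))).
    by rewrite (eq_itg (g := fun x => X x * P x))// => x Dx; rewrite DX// mul1r.
  apply: itg_subset => // x _; have /andP[X00 _] := X0 x.
  by rewrite mulr_ge0// powR_ge0.
apply: (@le_trans _ _ (6 * fine (lebesgue_rV n W) / (n%:R - 2 * k))); last by rewrite lerDl.
by rewrite ler_pdivlMr// mulrC (le_trans main).
Qed.

End kernel_estimates.

(** * Pointwise bounds by kernel integrals *)

Section potential_bounds.
Context {R : realType} {n : nat} (D : set 'rV[R]_n).
Local Notation V := 'rV[R]_n.
Hypotheses (oD : open D) (bD : bounded_set D).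
Implicit Types (f g : V -> R) (a x y : V).

(** For G = T^(1-n/2) the leading term of the Laplacian cancels, and minus the Laplacian is exactly
    n (n-2) e T^(-n/2-1), the concentrating density with j = 1. Kato's inequality then compares the
    value of [f] at [a] with the potential of [q]. *)
Lemma second_order_bound f df d2f q a M : (2 < n)%N ->
  C2 D f df d2f -> vanb D f -> BC D (fun x => tpos (f x)) -> BC D q ->
  (forall x, D x -> 0 <= q x) -> (forall x, D x -> 0 < f x -> - lap d2f x <= q x) ->
  D a -> (forall e, 0 < e <= 1 ->
    itg D (fun x => q x * (sqd a x + e) `^ (- (n%:R / 2 - 1))) <= M) ->
  n%:R * (n%:R - 2) * @mass_cst R n 1 * (f a / 2) <= M.
Proof.
move=> n2 cf vf bf bq q0 fq Da HM.
have n2R : (3 : R) <= n%:R by rewrite ler_nat.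
have k0 : (0 : R) < n%:R * (n%:R - 2) by rewrite mulr_gt0; lra.
have f0 x : D x -> 0 <= tpos (f x) by move=> _; exact: tpos_ge0.
have [s0 s00 Hs] := point_mass oD bD 1 bf f0 Da.
pose s := Num.min s0 1.
have s_gt0 : 0 < s by rewrite lt_min s00 ltr01.
have ss : 0 < s <= s0 by rewrite s_gt0 ge_min lexx.
have s1 : s <= 1 by rewrite ge_min lexx orbT.
have e0 : 0 < s ^+ 2 by rewrite exprn_gt0.
have e1 : 0 < s ^+ 2 <= 1 by rewrite e0 expr_le1// ltW.
pose b : R := - (n%:R / 2 - 1).
have tw := twice_derivable_powR b.
have cG := C2S (@subsetT _ D) (C2_radial a e0 tw).
have bG : BC D (fun x => (sqd a x + s ^+ 2) `^ b) by exact: (BC_radial bD a e0 tw).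
have bl := BC_lap_radial bD a e0 tw.
have H := kato_integral oD bD cf vf bf bq q0 fq cG bG bl (fun x _ => powR_ge0 _ _).
apply: le_trans (HM _ e1); apply: le_trans H.
apply: (@le_trans _ _ (n%:R * (n%:R - 2) * (tpos (f a) / 2 * @mass_cst R n 1))).
  rewrite -mulrA ler_pM2l// mulrC ler_wpM2r ?(ltW (@mass_cst_gt0 R n _))//.
  by rewrite ler_pM2r ?invr_gt0// tpos_le.
apply: (@le_trans _ _ (n%:R * (n%:R - 2) * itg D (fun x => tpos (f x) *
   ((s ^+ 2) ^+ 1 * (sqd a x + s ^+ 2) `^ (- (n%:R / 2 + 1)))))).
  by rewrite ler_pM2l// Hs.
have twb := twice_derivable_powR (- (n%:R / 2 + 1) : R).
rewrite -itgZ//; last first.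
  by apply: BCM => //; apply: BCZ; exact: (BC_radial bD a e0 twb).
rewrite le_eqVlt; apply/orP; left; apply/eqP; apply: eq_itg => x Dx.
have t0 : 0 < sqd a x + s ^+ 2 by rewrite ltr_wpDl// sqd_ge0.
have E := lap_radial a (s ^+ 2) (fun t => b * t `^ (b - 1))
  (fun t => b * ((b - 1) * t `^ (b - 1 - 1))) x.
rewrite radial_lap_powR//= in E; rewrite E expr1.
have -> : - (n%:R / 2 + 1) = b - 1 - 1 :> R by rewrite /b; field.
have -> : 2 * n%:R + 4 * (b - 1) = 0 :> R by rewrite /b; field.
have -> : 4 * b * (b - 1) = n%:R * (n%:R - 2) :> R by rewrite /b; field.
ring.
Qed.

Lemma domain_sqd_le : exists2 B : R, 1 <= B & forall a x, D a -> D x -> sqd a x + 1 <= B.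
Proof.
have [B0 B00 HB0] := bounded_set_cube bD.
exists (n%:R * (2 * B0) ^+ 2 + 1).
  by rewrite lerDr mulr_ge0// exprn_ge0// mulr_ge0// ltW.
move=> a x Da Dx; rewrite lerD2r; apply: sqd_le => i.
by have := HB0 x Dx i; have := HB0 a Da i; rewrite !ltr_norml ler_norml; lra.
Qed.

(** Two uses of Kato's inequality along a kernel pair: u(a) is bounded by a constant times the
    integral of u (- Delta h), this integral by that of v h = v (- Delta g), and this one by that of
    f g. Nonnegativity of both kernels is what allows dropping the boundary. *)
Lemma biharmonic_bound : (0 < n)%N -> exists2 C : R, 0 < C &
  forall u du d2u v dv d2v f, C2 D u du d2u -> C2 D v dv d2v ->
  vanb D u -> vanb D v -> BC D u -> BC D v -> BC D f ->
  (forall x, D x -> 0 <= u x) -> (forall x, D x -> 0 <= v x) ->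
  (forall x, D x -> 0 <= f x) ->
  (forall x, D x -> - lap d2u x <= v x) -> (forall x, D x -> - lap d2v x <= f x) ->
  forall a M, D a -> (forall e, 0 < e <= 1 ->
    itg D (fun x => f x * (sqd a x + e) `^ (- kern_exp n)) <= M) -> u a <= C * M.
Proof.
move=> n0; have [B B1 HB] := domain_sqd_le.
have [c c0 [C C0 HC]] := kernel_pair_exists n0 B1.
have m0 : (0 : R) < @mass_cst R n 2 := @mass_cst_gt0 R n 2.
exists (2 * C / (c * @mass_cst R n 2)); first by rewrite divr_gt0 ?mulr_gt0.
move=> u du d2u v dv d2v f cu cv vu vv bu bv bf u0 v0 f0 uv vf a M Da HM.
have bup : BC D (fun x => tpos (u x)) by exact: BC_tpos.
have bvp : BC D (fun x => tpos (v x)) by exact: BC_tpos.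
have [s0 s00 Hs] := point_mass oD bD 2 bu u0 Da.
pose s := Num.min s0 1.
have s_gt0 : 0 < s by rewrite lt_min s00 ltr01.
have ss : 0 < s <= s0 by rewrite s_gt0 ge_min lexx.
have s1 : s <= 1 by rewrite ge_min lexx orbT.
set e := s ^+ 2; have e0 : 0 < e by rewrite exprn_gt0.
have e1 : 0 < e <= 1 by rewrite e0 expr_le1// ltW.
have [g [g1 [g2 [h [h1 [h2 [tg th hE H]]]]]]] := HC e e1.
have tB x : D x -> e <= sqd a x + e <= B.
  move=> Dx; rewrite lerDr sqd_ge0/=; apply: le_trans (HB a x Da Dx).
  by rewrite lerD2l; case/andP: e1.
have t0 x : 0 < sqd a x + e by rewrite ltr_wpDl// sqd_ge0.
have cg := C2S (@subsetT _ D) (C2_radial a e0 tg).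
have ch := C2S (@subsetT _ D) (C2_radial a e0 th).
have bg := BC_radial bD a e0 tg; have bh := BC_radial bD a e0 th.
have blg := BC_lap_radial bD a e0 tg; have blh := BC_lap_radial bD a e0 th.
have h0 x : D x -> 0 <= h (sqd a x + e) by move=> Dx; have [_] := H _ (tB x Dx).
have g0 x : D x -> 0 <= g (sqd a x + e).
  by move=> Dx; have [/andP[]] := H _ (tB x Dx).
have K1 := kato_integral oD bD cu vu bup bv v0 (fun x Dx _ => uv x Dx) ch bh blh h0.
have K2 := kato_integral oD bD cv vv bvp bf f0 (fun x Dx _ => vf x Dx) cg bg blg g0.
have twb := twice_derivable_powR (- (n%:R / 2 + 2%:R) : R).
have bkb := BC_radial bD a e0 twb.
have tk := twice_derivable_powR (- kern_exp n : R).
have bk := BC_radial bD a e0 tk.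
have step1 : c * (u a / 2 * @mass_cst R n 2) <= itg D (fun x => tpos (u x) * - lap
  (fun i j x => h1 (sqd a x + e) * (2 * (i == j)%:R) + (2 * (x ord0 i - a ord0 i)) *
        (h2 (sqd a x + e) * (2 * (x ord0 j - a ord0 j)))) x).
  have := ler_wpM2l (ltW c0) (Hs s ss) => H1; apply: le_trans H1 _.
  rewrite -itgZ//; last first.
    by apply: BCM => //; exact: BCZ.
  apply: itg_le => //.
  - by apply: BCZ; apply: BCM => //; exact: BCZ.
  - by apply: BCM => //; exact: BCN.
  move=> x Dx; rewrite tpos_pos ?u0// mulrCA ler_wpM2l ?u0// lap_radial -/e.
  have [_ _] := H _ (tB x Dx); rewrite [in X in _ -> X]mulrA.
  by (have -> : - ((n%:R + 4) / 2) = - (n%:R / 2 + 2%:R) :> R by field).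
have step2 : itg D (fun x => v x * h (sqd a x + e)) <= itg D (fun x => f x * g (sqd a x + e)).
  apply: le_trans K2; apply: itg_le => //.
  - exact: BCM.
  - by apply: BCM => //; exact: BCN.
  move=> x Dx; rewrite tpos_pos ?v0// lap_radial.
  by rewrite (hE _ (t0 x)).
have step3 : itg D (fun x => f x * g (sqd a x + e)) <= C * M.
  apply: (@le_trans _ _ (C * itg D (fun x => f x * (sqd a x + e) `^ (- kern_exp n)))).
    rewrite -itgZ//; last exact: BCM.
    apply: itg_le => //; [exact: BCM|by apply: BCZ; exact: BCM|].
    move=> x Dx; rewrite mulrCA ler_wpM2l ?f0//.
    by have [/andP[]] := H _ (tB x Dx).
  by rewrite ler_pM2l// HM.
have : c * (u a / 2 * @mass_cst R n 2) <= C * M.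
  exact: le_trans (le_trans step1 K1) (le_trans step2 step3).
move=> fin; have -> : 2 * C / (c * @mass_cst R n 2) * M = (C * M) / (c * @mass_cst R n 2 / 2).
  by field; rewrite !gt_eqF.
rewrite ler_pdivlMr ?divr_gt0 ?mulr_gt0//; apply: le_trans fin.
by rewrite le_eqVlt; apply/orP; left; apply/eqP; field.
Qed.

(** The exponent conjugate to the integrability of the kernel: for theta > [crit_exp] with conjugate
    theta', T^(-[kern_exp] theta') is integrable uniformly in e. For n >= 5 the condition [kern_exp]
    theta' < n/2 is precisely theta > n/4. *)
Definition crit_exp : R := if (n <= 4)%N then 2 else n%:R / 4.

(** At a maximum point of u, with value W = max w, split w^p = w^k w^s <= W^k w^s. Young's
    inequality separates w^s from the kernel, leaving w^(s theta), controlled by the moment of order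
    Q, and an integrable power of T. This gives W <= const W^k with k < 1. *)
Lemma sup_bound (p Q K L : R) : (0 < n)%N -> 1 < p -> (p - 1) * crit_exp < Q ->
  exists M : R, forall lam u du d2u v dv d2v, 0 < lam <= L ->
  navier_system D p lam u du d2u v dv d2v ->
  itg D (fun x => (u x + 1) `^ Q) <= K -> forall x, D x -> u x <= M.
Proof.
move=> n0 p1 pQ.
have r1 : 1 < crit_exp.
  rewrite /crit_exp; case: ifPn => [_|]; first by lra.
  rewrite -ltnNge => n5; have : (5 : R) <= n%:R by rewrite ler_nat.
  lra.
set r := crit_exp in pQ r1 *.
(* The midpoint of the open interval of admissible theta, from [crit_exp] to Q/(p-1). *)
pose th := (r + Q / (p - 1)) / 2.
have rQ : r < Q / (p - 1) by rewrite ltr_pdivlMr ?subr_gt0// mulrC.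
have rth : r < th by rewrite /th; lra.
have th1 : 1 < th by exact: lt_trans rth.
have th0 : 0 < th by lra.
have thQ : (p - 1) * th < Q.
  have : th < Q / (p - 1) by rewrite /th; lra.
  by rewrite ltr_pdivlMr ?subr_gt0// mulrC.
(* As much of the exponent [p] as the moment of order [Q] can pay for. The remainder [k] is below 1
   because (p - 1) theta < Q. *)
pose s := Num.min p (Q / th); pose k := p - s.
have s1 : s <= p by rewrite ge_min lexx.
have s2 : s * th <= Q.
  by rewrite -ler_pdivlMr// ge_min lexx orbT.
have s3 : p - 1 < s by rewrite lt_min; apply/andP; split; [lra|rewrite ltr_pdivlMr].
have s0 : 0 < s by lra.
have k01 : 0 <= k < 1 by rewrite /k; apply/andP; split; lra.
pose th' := th / (th - 1).
have th'0 : 0 < th' by rewrite divr_gt0; move: th1; lra_goal.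
have th'E : th^-1 + th'^-1 = 1.
  have hz (z : R) : 1 < z -> z^-1 + (z / (z - 1))^-1 = 1.
    by move=> z1; rewrite invf_div; field; rewrite gt_eqF//; move: z1; lra_goal.
  exact: hz.
have ke : kern_exp n * th' < n%:R / 2 :> R.
  rewrite /kern_exp /th' mulrA ltr_pdivrMr; last lra.
  move: rth; rewrite /r /crit_exp; case: ifPn => [_ rth|n5 rth].
    have : (1 : R) <= n%:R by rewrite ler1n.
    nra.
  by lra.
have ke0 : 0 <= kern_exp n * th'.
  rewrite mulr_ge0 ?(ltW th'0)// /kern_exp; case: ifPn => [_|]; first by lra_goal.
  by rewrite -ltnNge => n5; have : (5 : R) <= n%:R; [rewrite ler_nat|lra_goal].
have [CT CT0 HT] := itg_radial_powR oD bD ke0 ke.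
have [C C0 HC] := biharmonic_bound n0.
have [->|D0] := eqVneq D set0; first by exists 0.
have [M0 HM0] : exists M0 : R, 0 <= M0 /\ forall lam, 0 < lam <= L ->
    C * lam * (`|K| + CT) <= M0.
  exists (C * `|L| * (`|K| + CT)); split.
    by rewrite !mulr_ge0 ?addr_ge0// ltW.
  move=> lam /andP[l0 lL]; rewrite ler_wpM2r ?addr_ge0 ?(ltW CT0)//.
  by rewrite ler_wpM2l ?(ltW C0)// (le_trans lL) ?ler_norm.
have [M00 HM] := HM0.
exists ((1 + M0) `^ (1 - k)^-1) => lam u du d2u v dv d2v lL sys HK x Dx.
have [[[cu bu _ _] [cv bv _ _]] [vu vv] up eu ev] := sys.
have /andP[lam0 _] := lL.
have vp := system_v_pos oD bD lam0 sys.
have vbu := vanish_on_bd_vanb oD bD (C2_C0 cu) vu.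
have vbv := vanish_on_bd_vanb oD bD (C2_C0 cv) vv.
have [a [Da ua umax]] := vanb_max (C2_C0 cu) vbu Dx (up x Dx).
pose W := u a + 1.
have wp y : D y -> 1 <= u y + 1 by move=> Dy; rewrite lerDr ltW// up.
have wW y : D y -> 1 <= u y + 1 <= W by move=> Dy; rewrite wp// lerD2r umax.
have W1 : 1 <= W by rewrite /W; move: ua; lra_goal.
have bw (c : R) : BC D (fun x => (u x + 1) `^ c).
  apply: (@BC_comp R n D (fun x => u x + 1) (fun t => t `^ c) 1 W) => //.
    by apply: C0D; [exact: C2_C0 cu|exact: C0_cst].
  by move=> t /andP[t1 _]; apply: powR_continuous; move: t1; lra_goal.
have bf : BC D (fun x => lam * (u x + 1) `^ p) by exact: BCZ.
have main : u a <= C * (lam * W `^ k * (`|K| + CT)).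
  apply: (HC u du d2u v dv d2v (fun x => lam * (u x + 1) `^ p)) => //.
  - by move=> y Dy; exact: ltW (up y Dy).
  - by move=> y Dy; exact: ltW (vp y Dy).
  - by move=> y Dy; rewrite mulr_ge0 ?powR_ge0// ltW//; case/andP: lL.
  - by move=> y Dy; rewrite eu.
  - by move=> y Dy; rewrite ev.
  move=> e /andP[e0 e1].
  have tk := twice_derivable_powR (- kern_exp n : R).
  have tk' := twice_derivable_powR (- (kern_exp n * th') : R).
  have bk := BC_radial bD a e0 tk; have bk' := BC_radial bD a e0 tk'.
  apply: (@le_trans _ _ (lam * W `^ k * (itg D (fun x => (u x + 1) `^ Q) +
      itg D (fun x => (sqd a x + e) `^ (- (kern_exp n * th')))))).
    rewrite -itgD// -itgZ//; last exact: BCD.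
    apply: itg_le => //; [exact: BCM|by apply: BCZ; exact: BCD|].
    move=> y Dy; have /andP[w1 w2] := wW y Dy.
    have w0 : 0 < u y + 1 by move: w1; lra_goal.
    have t0 : 0 < sqd a y + e by rewrite ltr_wpDl// sqd_ge0.
    rewrite -!mulrA ler_wpM2l//; first by rewrite ltW//; case/andP: lL.
    have -> : (u y + 1) `^ p = (u y + 1) `^ k * (u y + 1) `^ s.
      by rewrite -powRD ?(gt_eqF w0) ?implybT// /k subrK.
    rewrite -mulrA; apply: ler_pM; rewrite ?powR_ge0 ?mulr_ge0 ?powR_ge0//.
      by case/andP: k01 => k0 _; rewrite ge0_ler_powR// nnegrE; move: w2 w1; lra_goal.
    have yg := conjugate_powR (powR_ge0 (u y + 1) s)
      (powR_ge0 (sqd a y + e) (- kern_exp n)) th0 th'0 th'E.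
    apply: le_trans yg _; rewrite -!powRrM mulNr.
    apply: lerD.
      apply: (@le_trans _ _ ((u y + 1) `^ (s * th))).
        by rewrite ler_pdivrMr// ler_peMr ?powR_ge0// ltW.
      by rewrite ler_powR.
    rewrite ler_pdivrMr// ler_peMr ?powR_ge0//.
    by rewrite /th' ler_pdivlMr; move: th1; lra_goal.
  rewrite ler_wpM2l ?mulr_ge0 ?powR_ge0//; first by rewrite ltW//; case/andP: lL.
  by apply: lerD; [rewrite (le_trans HK)// ler_norm|exact: HT].
have W0 : 0 < W by move: W1; lra_goal.
have /andP[k0 k1] := k01.
have Wk : 1 <= W `^ k.
  have h : 1 `^ k <= W `^ k by rewrite ge0_ler_powR// nnegrE; move: W1; lra_goal.
  by rewrite powR1 in h.
have W2 : W <= (1 + M0) * W `^ k.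
  have h := HM lam lL.
  have h2 : C * (lam * W `^ k * (`|K| + CT)) <= M0 * W `^ k.
    have -> : C * (lam * W `^ k * (`|K| + CT)) = C * lam * (`|K| + CT) * W `^ k by ring.
    by rewrite ler_wpM2r ?powR_ge0.
  by rewrite /W; have := le_trans main h2; rewrite /W in Wk *; move: Wk; lra_goal.
(* Dividing by W^k bounds W, because the exponent left over, 1 - k, is positive. *)
have W3 : W `^ (1 - k) <= 1 + M0.
  have Wkp : 0 < W `^ k by move: Wk; lra_goal.
  rewrite -(ler_pM2r Wkp) -powRD ?(gt_eqF W0) ?implybT// subrK powRr1//; move: W1; lra_goal.
have k1' : 0 < 1 - k by move: k1; lra_goal.
apply: (@le_trans _ _ W); first by rewrite /W; have := umax x Dx; lra_goal.
have -> : W = (W `^ (1 - k)) `^ (1 - k)^-1.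
  by rewrite -powRrM mulfV ?gt_eqF// powRr1//; move: W1; lra_goal.
by rewrite ge0_ler_powR ?invr_ge0 ?nnegrE ?powR_ge0//; move: M00 k1'; lra_goal.
Qed.

End potential_bounds.

(** * Smooth bumps built from exp (-1/t) *)

Section flat_functions.
Context {R : realType}.
Implicit Types (P : {poly R}) (t r : R).

(** The functions P(1/t) exp(-1/t), extended by zero, form a family closed under differentiation;
    [flat_next] gives the polynomial X^2 (P - P') of the derivative. *)
Definition flat P t : R := if 0 < t then P.[t^-1] * expR (- t^-1) else 0.

Definition flat_next P : {poly R} := 'X^2 * (P^`() - P) * (-1)%:P.

Lemma poly_expR_bound P (k : nat) :
  exists2 C, 0 < C & forall s : R, 0 <= s -> `|P.[s] * s ^+ k| <= C * expR s.
Proof.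
elim/poly_ind: P k => [|P c IH] k.
  by exists 1 => // s s0; rewrite horner0 mul0r normr0 mul1r expR_ge0.
have [C C0 HC] := IH k.+1.
exists (C + (`|c| + 1) * (k`!%:R)).
  by rewrite addr_gt0// mulr_gt0 ?ltr_wpDl// ltr0n fact_gt0.
move=> s s0; rewrite hornerMXaddC mulrDl -mulrA -exprS mulrDl.
apply: le_trans (ler_normD _ _) _; apply: lerD; first exact: HC.
rewrite normrM -mulrA ler_pM//; first by rewrite lerDl.
rewrite normrX ger0_norm//; case: k {IH HC} => [|k].
  by rewrite expr0 fact0 mul1r -expR0 ler_expR.
have := expR_ge1Dxn k s0; rewrite -lerBrDl => H.
have f0 : (0 : R) < k.+1`!%:R by rewrite ltr0n fact_gt0.
rewrite mulrC -ler_pdivrMr//; apply: le_trans H _; by rewrite gerBl.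
Qed.

Lemma is_derive0_quadratic (f : R -> R) C : (forall h, `|f h| <= C * h ^+ 2) ->
  is_derive (0 : R) 1 f 0.
Proof.
move=> fC; have f0 : f 0 = 0.
  by apply/eqP; rewrite -normr_le0 (le_trans (fC 0))// expr0n mulr0.
have L : h^-1 *: (f (h *: 1 + 0) - f 0) @[h --> (0 : R)^'] --> (0 : R).
  apply/cvgrPdist_le => e e0; near=> h.
  rewrite f0 subr0 addr0 [h *: 1]mulr1 sub0r normrN normrM normfV.
  have h0 : 0 < `|h| by rewrite normr_gt0; near: h; exact: nbhs_dnbhs_neq.
  rewrite ler_pdivrMl//; apply: le_trans (fC h) _.
  rewrite -(real_normK (num_real h)) expr2 mulrCA ler_wpM2l//.
  have : `|h| < e / (`|C| + 1).
    near: h; apply: nbhs_dnbhs; exists (e / (`|C| + 1)); first by rewrite /= divr_gt0// ltr_wpDl.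
    by move=> z; rewrite /ball /= sub0r normrN.
  rewrite ltr_pdivlMr ?ltr_wpDl// => H; apply: le_trans (ltW H).
  by rewrite mulrC ler_wpM2l// (le_trans (ler_norm C))// lerDl.
apply: DeriveDef; first by apply/cvg_ex; exists 0.
exact: cvg_lim L.
Unshelve. all: end_near. Qed.

Lemma flat_le0 P t : t <= 0 -> flat P t = 0.
Proof. by rewrite /flat ltNge => ->. Qed.

Lemma flat_gt0 P t : 0 < t -> flat P t = P.[t^-1] * expR (- t^-1).
Proof. by rewrite /flat => ->. Qed.

Lemma is_derive_flat P t : is_derive t 1 (flat P) (flat (flat_next P) t).
Proof.
have [t0|t0|->] := ltgtP t 0.
- rewrite flat_le0 1?ltW//.
  have E : \forall z \near t, (fun=> 0 : R) z = flat P z.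
    near=> z; rewrite flat_le0// ltW//; near: z.
    by apply: open_nbhs_nbhs; split; [exact: open_lt|].
  exact: near_eq_is_derive E (is_derive_cst (0 : R) t (1 : R)).
- rewrite flat_gt0//.
  have E : \forall z \near t, P.[z^-1] * expR (- z^-1) = flat P z.
    near=> z; rewrite flat_gt0//; near: z.
    by apply: open_nbhs_nbhs; split; [exact: open_gt|].
  apply: near_eq_is_derive E _.
  have dv : is_derive t 1 (fun z : R => z^-1) (- t ^- 2).
    have := is_deriveV (f := id) (lt0r_neq0 t0) (is_derive_id t (1 : R)).
    by move=> H; apply: (is_derive_eq H); rewrite [_ *: 1]mulr1.
  have d1 := is_derive_compR dv (is_derive_poly P t^-1).
  have d2 := is_derive_compR (is_deriveN dv) (is_derive_expR (- t^-1)).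
  apply: (is_derive_eq (is_deriveM d1 d2)).
  rewrite /flat_next !hornerE /= exprVn /GRing.scale /=; ring.
- rewrite flat_le0//.
  (* Taking two extra powers of 1/t bounds the function by C t^2 near 0, which gives derivative zero
     there. *)
  have [C C0 HC] := poly_expR_bound P 2.
  apply: (@is_derive0_quadratic _ C) => h.
  have [h0|h0] := leP h 0; first by rewrite flat_le0// normr0 mulr_ge0 ?sqr_ge0// ltW.
  rewrite flat_gt0// expRN normrM [X in _ * X]ger0_norm ?invr_ge0 ?expR_ge0//.
  rewrite ler_pdivrMr ?expR_gt0//.
  have hi : 0 <= h^-1 by rewrite invr_ge0 ltW.
  have := HC _ hi; rewrite normrM [X in _ * X]ger0_norm ?exprn_ge0// => H.
  have h2 : 0 < h ^+ 2 by rewrite exprn_gt0.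
  have := ler_wpM2r (ltW h2) H; rewrite -mulrA -exprMn mulVf ?gt_eqF// expr1n mulr1.
  by rewrite mulrAC.
Unshelve. all: end_near. Qed.

Definition flats (k : nat) t : R := flat (iter k flat_next 1) t.

(** Orders of differentiation of the two factors of a product. Repetitions in the list replace
    binomial coefficients, so one more derivative acts term by term. *)
Fixpoint leibniz_terms (k : nat) : seq (nat * nat) :=
  if k is k'.+1 then
    flatten [seq [:: (z.1.+1, z.2); (z.1, z.2.+1)] | z <- leibniz_terms k']
  else [:: (0%N, 0%N)].

Definition bump_term r (z : nat * nat) t : R :=
  flats z.1 (r + t) * ((-1) ^+ z.2 * flats z.2 (r - t)).

(* [bump r k] is the k-th derivative of exp (-1/(r+t)) exp (-1/(r-t)) on (-r, r). *)
Definition bump r (k : nat) t : R := \sum_(z <- leibniz_terms k) bump_term r z t.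

Lemma is_derive_bump_term r z t : is_derive t 1 (bump_term r z)
  (bump_term r (z.1.+1, z.2) t + bump_term r (z.1, z.2.+1) t).
Proof.
have da : is_derive t 1 (fun s : R => r + s) 1.
  by apply: (is_derive_eq (is_deriveD (is_derive_cst r t (1 : R)) (is_derive_id t (1 : R)))); rewrite add0r.
have db : is_derive t 1 (fun s : R => r - s) (-1).
  by apply: (is_derive_eq (is_deriveB (is_derive_cst r t (1 : R)) (is_derive_id t (1 : R)))); rewrite sub0r.
have d1 := is_derive_compR da (is_derive_flat (iter z.1 flat_next 1) (r + t)).
have d2 := is_derive_compR db (is_derive_flat (iter z.2 flat_next 1) (r - t)).
apply: (is_derive_eq (is_deriveM d1 (is_deriveZ ((-1) ^+ z.2) d2))).
rewrite /bump_term /flats /= exprS /GRing.scale /=; ring.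
Qed.

Lemma is_derive_bump r k t : is_derive t 1 (bump r k) (bump r k.+1 t).
Proof.
rewrite /bump /=; elim: (leibniz_terms k) => [|z L IH].
  rewrite big_nil; have := is_derive_cst (0 : R) t (1 : R).
  by rewrite (_ : (fun t => _) = cst 0)//; apply/funext => s; rewrite big_nil.
rewrite /= !big_cons addrA; have H := is_deriveD (is_derive_bump_term r z t) IH.
by rewrite (_ : (fun t => _) = bump_term r z \+ (fun t => \sum_(z0 <- L) bump_term r z0 t))//;
  apply/funext => s; rewrite big_cons.
Qed.

Lemma bump_out r k t : r <= `|t| -> bump r k t = 0.
Proof.
move=> rt; rewrite /bump big1_seq// => z _; rewrite /bump_term /flats.
have [t0|t0] := leP 0 t.
  by rewrite [flat _ (r - t)]flat_le0 ?mulr0// subr_le0 -[t]ger0_norm.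
by rewrite flat_le0 ?mul0r// -lerBrDr sub0r -ltr0_norm.
Qed.

Lemma bump_ge0 r t : 0 <= bump r 0 t.
Proof.
rewrite /bump big_seq1 /bump_term expr0 mul1r /flats /=.
by rewrite mulr_ge0// /flat; case: ifP => // _; rewrite hornerC mul1r expR_ge0.
Qed.

Lemma bump_gt0 r : 0 < r -> 0 < bump r 0 0.
Proof.
move=> r0; rewrite /bump big_seq1 /bump_term expr0 mul1r /flats /= addr0 subr0.
by rewrite /flat r0 hornerC mul1r mulr_gt0// expR_gt0.
Qed.

Lemma bump_continuous r k : continuous (bump r k).
Proof.
move=> t; apply: differentiable_continuous; apply/derivable1_diffP.
by case: (is_derive_bump r k t).
Qed.

End flat_functions.

(** * Uniformity on compact sets, and directional derivatives *)

Section uniformity.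
Context {R : realType} {n : nat}.
Local Notation V := 'rV[R]_n.
Implicit Types (D K : set V) (f g : V -> R) (x y v : V).

(** The Lebesgue number argument: a property that holds for all pairs of points in some cube about
    each point of [K] holds for all pairs closer than a common radius. *)
Lemma compact_uniform K (Q : V -> V -> Prop) : compact K ->
  (forall x, K x -> exists2 r : R, 0 < r &
     forall x' y, cube x r x' -> cube x r y -> Q x' y) ->
  exists2 r : R, 0 < r & forall x y, K x -> cube x r y -> Q x y.
Proof.
move=> /compact_near_coveringP cK H.
have := cK R ((0 : R)^'+) (fun r x' => forall y, cube x' r y -> Q x' y) _.
case=> [x Kx|].
  have [r r0 Hr] := H x Kx.
  exists (cube x (r / 2), [set s : R | s < r / 2]); first split => /=.
  - by apply/nbhs_cubeP; exists (r / 2) => //; rewrite divr_gt0.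
  - by apply: nbhs_right_lt; rewrite divr_gt0.
  move=> [x' s] /= [xx' sr] y yx'; apply: Hr => i.
    by apply: lt_le_trans (xx' i) _; rewrite ler_pdivrMr// ler_pMr// ler1n.
  rewrite -(subrK (x' ord0 i) (y ord0 i)) -addrA (le_lt_trans (ler_normD _ _))//.
  by rewrite [ltRHS]splitr ltrD// (lt_trans (yx' i)).
move=> e /= e0 He; exists (e / 2); first by rewrite divr_gt0.
move=> x y Kx yx; apply: (He (e / 2)) => //=.
  by rewrite sub0r normrN gtr0_norm ?divr_gt0// ltr_pdivrMr// ltr_pMr// ltr1n.
by rewrite divr_gt0.
Qed.

Lemma compact_cube_sub K D : compact K -> open D -> K `<=` D ->
  exists2 r : R, 0 < r & forall x y, K x -> cube x r y -> D y.
Proof.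
move=> cK /open_cubeP oD KD; apply: compact_uniform => // x Kx.
by have [r r0 H] := oD x (KD x Kx); exists r => // x' y _ /H.
Qed.

Lemma cs_uniform D K f (e : R) : compact K -> K `<=` D -> open D -> C0 D f ->
  (forall x, D x -> ~ K x -> f x = 0) -> 0 < e ->
  exists2 r : R, 0 < r & forall x y, D x -> D y -> cube x r y -> `|f y - f x| <= e.
Proof.
move=> cK KD oD cf f0 e0.
have [r r0 H] : exists2 r : R, 0 < r & forall x y, K x -> cube x r y -> D y -> `|f y - f x| <= e.
  apply: compact_uniform => // x Kx.
  have : \forall z \near x, `|f x - f z| < e / 2.
    have := cf x (KD x Kx); rewrite /prop_for /continuous_at => /cvgrPdist_lt.
    by apply; rewrite divr_gt0.
  move=> /nbhs_cubeP[r r0 Hr]; exists r => // x' y /Hr /= h1 /Hr /= h2 _.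
  by move: h1 h2; rewrite !ltr_norml ler_norml; lra.
exists r => // x y Dx Dy xy; have [Kx|Kx] := pselect (K x); first exact: H.
have [Ky|Ky] := pselect (K y); last by rewrite !f0// subrr normr0 ltW.
by rewrite distrC; apply: H => // i; rewrite distrC.
Qed.

Lemma mvt_bound (g g' : R -> R) (b c e : R) :
  (forall s : R, `|s| <= `|b| -> is_derive s (1 : R) g (g' s) /\ `|g' s - c| <= e) ->
  `|g b - g 0 - b * c| <= `|b| * e.
Proof.
move=> H; have gc s : `|s| <= `|b| -> {for s, continuous g}.
  move=> /H[[ds _] _]; apply: differentiable_continuous; exact/derivable1_diffP.
have [b0|b0|->] := ltgtP b 0; last by rewrite subrr mul0r subr0 normr0 mul0r.
- have ib (s : R) : s \in `[b, 0] -> `|s| <= `|b|.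
    by rewrite in_itv /= => /andP[s1 s2]; rewrite !ler0_norm//; lra.
  have cg : {within `[b, 0], continuous g}.
    by apply: continuous_in_subspaceT => s /set_mem sb; exact: gc (ib s sb).
  have dg (s : R) : s \in `]b, 0[ -> is_derive s (1 : R) g (g' s).
    by move=> /subset_itv_oo_cc /ib /H[].
  have [s /subset_itv_oo_cc /ib /H[_ gs] E] := MVT b0 dg cg.
  have -> : g b - g 0 - b * c = b * (g' s - c) by rewrite -[g b - g 0]opprB E; ring.
  by rewrite normrM ler_wpM2l.
have ib (s : R) : s \in `[0, b] -> `|s| <= `|b|.
  by rewrite in_itv /= => /andP[s1 s2]; rewrite !ger0_norm//; lra.
have cg : {within `[0, b], continuous g}.
  by apply: continuous_in_subspaceT => s /set_mem sb; exact: gc (ib s sb).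
have dg (s : R) : s \in `]0, b[ -> is_derive s (1 : R) g (g' s).
  by move=> /subset_itv_oo_cc /ib /H[].
have [s /subset_itv_oo_cc /ib /H[_ gs] E] := MVT b0 dg cg.
have -> : g b - g 0 - b * c = b * (g' s - c) by rewrite E; ring.
by rewrite normrM ler_wpM2l.
Qed.

Lemma is_derive_epsP f x v (d : R) : is_derive x v f d <->
  forall e : R, 0 < e -> exists2 r : R, 0 < r &
    forall t : R, `|t| < r -> `|f (t *: v + x) - f x - t * d| <= e * `|t|.
Proof.
split.
  move=> [/cvg_ex[l Hl] E] e e0.
  have ld : l = d by rewrite -E; apply/esym/cvg_lim.
  rewrite ld in Hl; move/cvgrPdist_lt : (Hl) => /(_ e e0).
  move=> /nbhs_ballP[r /= r0 Hr]; exists r => // t tr.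
  have [->|t0] := eqVneq t 0; first by rewrite scale0r add0r subrr mul0r subr0 normr0 mulr0.
  have := Hr t; rewrite /ball /= sub0r normrN => /(_ tr t0).
  have -> : f (t *: v + x) - f x - t * d = - (t * (d - t^-1 *: (f (t *: v + x) - f x))).
    by rewrite /GRing.scale /= mulrBr mulrA mulfV// mul1r opprB.
  by rewrite normrN normrM mulrC => /ltW h; rewrite ler_wpM2r.
move=> H; have L : h^-1 *: (f (h *: v + x) - f x) @[h --> (0 : R)^'] --> d.
  apply/cvgrPdist_le => e e0; have [r r0 Hr] := H e e0.
  apply/nbhs_ballP; exists r => // t; rewrite /ball /= sub0r normrN => tr t0.
  have := Hr t tr.
  have -> : f (t *: v + x) - f x - t * d = - (t * (d - t^-1 *: (f (t *: v + x) - f x))).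
    by rewrite /GRing.scale /= mulrBr mulrA mulfV// mul1r opprB.
  by rewrite normrN normrM mulrC ler_pM2r// normr_gt0.
apply: DeriveDef; first by apply/cvg_ex; exists d.
exact: cvg_lim L.
Qed.

(** Continuity of the partial derivatives yields all directional derivatives by adding one
    coordinate direction at a time: the mean value theorem along direction [i] compares with the
    partial derivative at [x] up to o(t). *)
Lemma C1_dir_step D f df x v (d al : R) i : open D -> C1 D f df -> D x ->
  is_derive x v f d -> is_derive x (v + al *: ebase i) f (d + al * df i x).
Proof.
move=> oD [cf cdf fd] Dx /is_derive_epsP H; apply/is_derive_epsP => e e0.
have e2 : 0 < e / 2 by rewrite divr_gt0.
have [r1 r10 H1] := H _ e2.
have e3 : 0 < e / 2 / (`|al| + 1) by rewrite divr_gt0// ltr_wpDl.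
have : nbhs x (D `&` [set z | `|df i x - df i z| < e / 2 / (`|al| + 1)]).
  apply: filterI; first exact: open_nbhs_nbhs.
  have := cdf i x Dx; rewrite /prop_for /continuous_at => /cvgrPdist_lt.
  by apply.
move=> /nbhs_cubeP[r2 r20 H2].
pose m := `|v| + `|al| + 1.
have m0 : 0 < m by rewrite /m; have := normr_ge0 v; have := normr_ge0 al; lra.
exists (Num.min r1 (r2 / m)); first by rewrite lt_min r10 divr_gt0.
move=> t; rewrite lt_min ltr_pdivlMr// => /andP[t1 t2].
pose g (s : R) := f (s *: ebase i + (t *: v + x)).
have gE : f (t *: (v + al *: ebase i) + x) = g (t * al).
  by rewrite /g scalerDr scalerA addrA [t *: v + _]addrC.
have inD s : `|s| <= `|t * al| -> cube x r2 (s *: ebase i + (t *: v + x)).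
  move=> sl j; apply: le_lt_trans t2.
  have -> : (s *: ebase i + (t *: v + x)) ord0 j - x ord0 j = s * (j == i)%:R + t * v ord0 j.
    by rewrite !mxE eqxx /= addrA addrK.
  apply: le_trans (ler_normD _ _) _; rewrite /m !normrM.
  have b1 : `|s| * `|(j == i)%:R : R| <= `|t| * `|al|.
    rewrite -[leRHS]normrM; apply: (le_trans _ sl); rewrite normr_nat.
    by case: (j == i); rewrite ?mulr1 ?mulr0.
  have b2 : `|t| * `|v ord0 j| <= `|t| * `|v| by rewrite ler_wpM2l ?norm_coord_le.
  have := normr_ge0 t; rewrite !mulrDr mulr1; lra.
have M := @mvt_bound g (fun s => df i (s *: ebase i + (t *: v + x))) (t * al) (df i x)
  (e / 2 / (`|al| + 1)) _.
have {}M : `|g (t * al) - g 0 - t * al * df i x| <= `|t * al| * (e / 2 / (`|al| + 1)).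
  apply: M => s /inD /H2[Ds /= /ltW]; rewrite distrC => h; split => //.
  by apply: is_derive_lineat; exact: fd.
have M1 := H1 t t1.
have E : f (t *: (v + al *: ebase i) + x) - f x - t * (d + al * df i x) =
   (g (t * al) - g 0 - t * al * df i x) + (f (t *: v + x) - f x - t * d).
  have g0 : g 0 = f (t *: v + x) by rewrite /g scale0r add0r.
  by rewrite gE g0; ring.
rewrite E (le_trans (ler_normD _ _))//.
apply: (@le_trans _ _ (`|t| * (e / 2) + e / 2 * `|t|)); last first.
  by rewrite le_eqVlt; apply/orP; left; apply/eqP; field.
apply: lerD; [apply: le_trans M _|exact: M1].
have q : `|al| * (e / 2 / (`|al| + 1)) <= e / 2.
  by rewrite mulrCA ler_piMr ?(ltW e2)// ler_pdivrMr ?ltr_wpDl// mul1r lerDl.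
by rewrite normrM -[leLHS]mulrA; exact: ler_wpM2l (normr_ge0 t) _ _ q.
Qed.

Lemma C1_dir D f df x v : open D -> C1 D f df -> D x ->
  is_derive x v f (\sum_i v ord0 i * df i x).
Proof.
move=> oD cf Dx; rewrite {1}(row_sum_delta v).
elim/big_rec2: _ => [|i d w _ IH].
  apply/is_derive_epsP => e e0; exists 1 => // t _.
  by rewrite scaler0 add0r subrr mulr0 subr0 normr0 mulr_ge0// ltW.
have := @C1_dir_step D f df x w d (v ord0 i) i oD cf Dx IH.
by rewrite [w + _]addrC [d + _]addrC.
Qed.

Lemma C1_segment D f df x y : open D -> C1 D f df ->
  (forall t : R, 0 <= t <= 1 -> D (t *: (y - x) + x)) ->
  exists2 t : R, 0 < t < 1 &
    f y - f x = \sum_i (y - x) ord0 i * df i (t *: (y - x) + x).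
Proof.
move=> oD cf seg.
pose g (t : R) := f (t *: (y - x) + x).
pose g' (t : R) := \sum_i (y - x) ord0 i * df i (t *: (y - x) + x).
have dg (t : R) : t \in `[0, 1] -> is_derive t (1 : R) g (g' t).
  rewrite in_itv /= => /seg Dt; apply: is_derive_lineat; exact: C1_dir cf Dt.
have cg : {within `[0, 1], continuous g}.
  apply: continuous_in_subspaceT => s /set_mem /dg [ds _].
  by apply: differentiable_continuous; exact/derivable1_diffP.
have dg' (t : R) : t \in `]0, 1[ -> is_derive t (1 : R) g (g' t).
  by move=> /subset_itv_oo_cc /dg.
have [t t01 E] := MVT ltr01 dg' cg; exists t; first by move: t01; rewrite in_itv.
by move: E; rewrite /g scale0r add0r scale1r subrK subr0 mulr1.
Qed.

End uniformity.

(** * Mollification and approximation by test functions *)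

Section mollification.
Context {R : realType} {n : nat}.
Local Notation V := 'rV[R]_n.
Implicit Types (D : set V) (f : V -> R) (x y z : V) (a : 'I_n -> nat) (r : R).

(** Indexing the product of one-dimensional bumps by orders of differentiation keeps all partial
    derivatives of the mollifier inside the family; the mollifier itself is the case of all orders
    zero. *)
Definition moll r a z : R := \prod_i bump r (a i) (z ord0 i).

Definition incr (i : 'I_n) a : 'I_n -> nat := fun j => (a j + (j == i))%N.

Lemma moll_line r a i z t : is_derive t (1 : R) (fun s => moll r a (s *: ebase i + z))
  (moll r (incr i a) (t *: ebase i + z)).
Proof.
have ee j s : (s *: ebase i + z) ord0 j = s * (j == i)%:R + z ord0 j.
  by rewrite !mxE eqxx /= eq_sym.
pose c := \prod_(j | j != i) bump r (a j) (z ord0 j).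
have E b s : (forall j, j != i -> b j = a j) ->
    moll r b (s *: ebase i + z) = bump r (b i) (s + z ord0 i) * c.
  move=> ba; rewrite /moll (bigD1 i)//= ee eqxx mulr1; congr (_ * _).
  by apply: eq_bigr => j ji; rewrite ba// ee (negPf ji) mulr0 add0r.
rewrite (_ : (fun s => _) = (fun s => bump r (a i) (s + z ord0 i) * c)); last first.
  by apply/funext => s; rewrite E.
rewrite E; last by move=> j ji; rewrite /incr (negPf ji) addn0.
rewrite /incr eqxx addn1.
have da : is_derive t (1 : R) (fun s : R => s + z ord0 i) 1.
  by apply: (is_derive_eq (is_deriveD (is_derive_id t (1 : R)) (is_derive_cst (z ord0 i) t (1 : R)))); rewrite addr0.
have d1 := is_derive_compR da (is_derive_bump r (a i) (t + z ord0 i)).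
apply: (is_derive_eq (is_deriveM d1 (is_derive_cst c t (1 : R)))).
by rewrite /GRing.scale /=; ring.
Qed.

Lemma C0_moll r a : C0 setT (moll r a).
Proof.
suff H (s : seq 'I_n) : C0 setT (fun z => \prod_(i <- s) bump r (a i) (z ord0 i)).
  exact: H.
elim: s => [|i s IH].
  rewrite (_ : (fun z => _) = fun=> 1); first exact: C0_cst.
  by apply/funext => z; rewrite big_nil.
rewrite (_ : (fun z => _) = fun z => bump r (a i) (z ord0 i) *
    \prod_(i <- s) bump r (a i) (z ord0 i)).
  apply: C0M => //; apply: (@C0_comp R n setT (fun z => z ord0 i)); first exact: C0_coord.
  by move=> x _; exact: bump_continuous.
by apply/funext => z; rewrite big_cons.
Qed.

Lemma moll_out r a z i : r <= `|z ord0 i| -> moll r a z = 0.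
Proof. by move=> h; rewrite /moll (bigD1 i)//= bump_out// mul0r. Qed.

Lemma moll_ge0 r z : 0 <= moll r (fun=> 0%N) z.
Proof. by apply: prodr_ge0 => i _; exact: bump_ge0. Qed.

Lemma moll_gt0 r : 0 < r -> 0 < moll r (fun=> 0%N) 0.
Proof. by move=> r0; apply: prodr_gt0 => i _; rewrite mxE bump_gt0. Qed.

Lemma moll_box r a z : ~ [set x : V | forall i, `|x ord0 i| <= r] z -> moll r a z = 0.
Proof.
move=> /existsNP[i /negP]; rewrite -ltNge => /ltW; exact: moll_out.
Qed.

Lemma moll_bounded r a : exists2 M : R, 0 < M & forall z, `|moll r a z| <= M.
Proof.
have [|M M0 HM] := continuous_bounded_on (@compact_closed_box R n r) (f := moll r a).
  by move=> x _; exact: C0_moll.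
exists M => // z; have [/HM//|/moll_box ->] := pselect ([set x : V | forall i, `|x ord0 i| <= r] z).
by rewrite normr0 ltW.
Qed.

Lemma C0_sub_comp D f x : C0 setT f -> C0 D (fun y => f (x - y)).
Proof.
move=> cf y _; apply: (@continuous_comp _ _ _ (fun y => x - y) f); last exact: cf.
apply: continuous_rV => i.
rewrite (_ : (fun z => _) = fun z => x ord0 i - z ord0 i); last by apply/funext => z; rewrite !mxE.
exact: ((C0B (@C0_cst R n setT (x ord0 i)) (@C0_coord R n setT i)) y I).
Qed.

Lemma BC_moll_sub D r a x : BC D (fun y => moll r a (x - y)).
Proof.
split; first exact: C0_sub_comp (@C0_moll r a).
by have [M M0 HM] := moll_bounded r a; exists M.
Qed.

Lemma C1_moll_sub D r a x : C1 D (fun y => moll r a (x - y))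
  (fun i y => - moll r (incr i a) (x - y)).
Proof.
split => [|i|i y _].
- by have [] := BC_moll_sub D r a x.
- by apply: C0N; have [] := BC_moll_sub D r (incr i a) x.
apply/is_derive_line.
rewrite (_ : (fun t : R => _) = (fun t : R => moll r a ((- t) *: ebase i + (x - y)))); last first.
  by apply/funext => t; congr moll; rewrite opprD scaleNr addrCA.
have dn : is_derive (0 : R) (1 : R) (fun t : R => - t) (-1).
  exact: (is_deriveN (is_derive_id (0 : R) (1 : R))).
have := is_derive_compR dn (moll_line r a i (x - y) (- 0)).
by move=> H; apply: (is_derive_eq H); rewrite mulrN1 oppr0 scale0r add0r.
Qed.

Section convolution.
Variables (D : set V).
Hypotheses (oD : open D) (bD : bounded_set D).

Definition conv f r a x : R := itg D (fun y => f y * moll r a (x - y)).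

Lemma is_derive_conv f r a i x : BC D f ->
  is_derive x (ebase i) (conv f r a) (conv f r (incr i a) x).
Proof.
move=> bf; apply/is_derive_line.
pose F (t : R) y := f y * moll r a (t *: ebase i + x - y).
pose F' (t : R) y := f y * moll r (incr i a) (t *: ebase i + x - y).
have dF t y : is_derive t (1 : R) (F^~ y) (F' t y).
  rewrite (_ : F^~ y = (fun t => f y * moll r a (t *: ebase i + (x - y)))); last first.
    by apply/funext => s; rewrite /F addrA.
  apply: (is_derive_eq (is_deriveZ (f y) (moll_line r a i (x - y) t))).
  by rewrite /F' addrA.
have bF b t : BC D (fun y => f y * moll r b (t *: ebase i + x - y)).
  by apply: BCM => //; exact: BC_moll_sub.
have [cf [M1 HM1]] := bf; have [M2 M20 HM2] := moll_bounded r (incr i a).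
pose G (y : V) : R := `|M1| * M2.
have G0 y : 0 <= G y by rewrite mulr_ge0// ltW.
have I0 : (0 : R) \in `](-1 : R), (1 : R)[ by rewrite in_itv /= ltrN10 ltr01.
have E t y : partial1of2 F t y = F' t y.
  by rewrite partial1of2E; have [_ ->] := dF t y.
have L := @cvg_differentiation_under_integral R _ V (lebesgue_rV n) F D
  (domain_measurable oD) 0 (-1) 1 I0
  (fun t _ => BC_integrable oD bD (bF a t))
  (fun t y _ _ => let: DeriveDef h _ := dF t y in h) G G0
  (BC_integrable oD bD (BC_cst D (`|M1| * M2))) _.
have {}L : h^-1 *: (conv f r a ((h + 0) *: ebase i + x) - conv f r a (0 *: ebase i + x))
    @[h --> (0 : R)^'] --> conv f r (incr i a) x.
  have -> : conv f r (incr i a) x = \int[lebesgue_rV n]_(y in D) partial1of2 F 0 y.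
    rewrite /conv; apply: eq_itg => y _.
    by rewrite E /F' scale0r add0r.
  apply: L => t y _ Dy; rewrite E /F' /G normrM ler_pM//.
  by rewrite (le_trans (HM1 y Dy))// ler_norm.
pose g (t : R) := conv f r a (t *: ebase i + x).
have EE : (fun h : R => h^-1 *: (g (h *: 1 + 0) - g 0)) = (fun h => h^-1 *: (g (h + 0) - g 0)).
  by apply/funext => h; rewrite [h *: 1]mulr1.
have L' : h^-1 *: (g (h *: 1 + 0) - g 0) @[h --> (0 : R)^'] --> conv f r (incr i a) x.
  by rewrite EE.
apply: DeriveDef; first by apply/cvg_ex; exists (conv f r (incr i a) x).
exact: cvg_lim L'.
Qed.

Lemma C0_conv f r a : BC D f -> C0 setT (conv f r a).
Proof.
move=> bf x _; suff L : conv f r a @ nbhs x --> conv f r a x by exact: L.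
apply/cvgrPdist_le => e e0.
have [cf [M1 HM1]] := bf.
pose m := `|M1| * fine (lebesgue_rV n D) + 1.
have L0 : 0 <= fine (lebesgue_rV n D) by rewrite fine_ge0.
have m0 : 0 < m by rewrite ltr_wpDl// mulr_ge0.
have [q q0 Hq] := cs_uniform (@compact_closed_box R n r) (@subsetT _ _) (@openT _)
  (@C0_moll r a) (fun x _ => @moll_box r a x) (divr_gt0 e0 m0).
apply/nbhs_cubeP; exists q => // x' xx' /=.
have b y : BC D (fun z => f z * moll r a (y - z)) by apply: BCM => //; exact: BC_moll_sub.
rewrite /conv -itgB//; apply: le_trans (itg_abs oD bD _) _; first exact: BCB.
apply: (@le_trans _ _ (itg D (fun=> `|M1| * (e / m)))).
  apply: itg_le => //; [by apply: BC_abs; exact: BCB|exact: BC_cst|move=> y Dy].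
  rewrite -mulrBr normrM ler_pM//; first by rewrite (le_trans (HM1 y Dy))// ler_norm.
  rewrite distrC; apply: Hq => // i; rewrite !mxE.
  have -> : x' ord0 i - y ord0 i - (x ord0 i - y ord0 i) = x' ord0 i - x ord0 i by ring.
  exact: xx'.
rewrite (itg_cst oD) mulrAC mulrCA ler_piMr ?(ltW e0)//.
by rewrite ler_pdivrMr// mul1r /m lerDl.
Qed.

Lemma smooth_conv f r a : BC D f -> smooth setT (conv f r a).
Proof.
move=> bf; have P (s : seq 'I_n) : partials s (conv f r a) = conv f r (foldr incr a s).
  elim: s => //= i s ->; apply/funext => x; rewrite /partial.
  by have [_ <-] := is_derive_conv r (foldr incr a s) i x bf.
move=> k s _ x _; rewrite P; split; first exact: C0_conv.
by move=> _ i; have [] := is_derive_conv r (foldr incr a s) i x bf.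
Qed.

End convolution.

(** Does the work of translation invariance of the measure: the derivative of the mass in [x] is the
    integral of a partial derivative of a function with compact support in the larger cube, hence
    zero, and the segment from 0 to [x] stays in the cube of half-side [B]. *)
Lemma moll_mass_cst B r x : 0 < B -> 0 < r -> (forall i, `|x ord0 i| < B) ->
  conv (cube 0 (B + r)) (fun=> 1) r (fun=> 0%N) x =
  conv (cube 0 (B + r)) (fun=> 1) r (fun=> 0%N) 0.
Proof.
move=> B0 r0 xB; set D := cube 0 (B + r); set z := fun=> 0%N.
have oD : open D := @open_cube R n 0 (B + r).
have bD : bounded_set D := @bounded_cube R n 0 (B + r).
have b1 : BC D (fun=> 1 : R) by exact: BC_cst.
pose dN (i : 'I_n) (x : V) : R := conv D (fun=> 1) r (incr i z) x.
have cN : C1 setT (conv D (fun=> 1) r z) dN.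
  split => [|i|i y _]; [exact: C0_conv|exact: C0_conv|exact: is_derive_conv].
have inB (t : R) : 0 <= t <= 1 -> forall i, `|(t *: (x - 0) + 0) ord0 i| < B.
  move=> /andP[t0 t1] i; rewrite !mxE subr0 addr0 normrM ger0_norm//.
  by apply: le_lt_trans (xB i); rewrite ler_piMl.
have [t /andP[t0 t1] E] := C1_segment (@openT _) cN (fun t _ => I) (x := 0) (y := x).
apply/eqP; rewrite -subr_eq0 E; apply/eqP; rewrite big1// => i _.
rewrite [dN i _](_ : _ = 0) ?mulr0// /dN /conv.
have t01 : 0 <= t <= 1 by rewrite !ltW.
set w := t *: (x - 0) + 0; have wB : forall i, `|w ord0 i| < B := inB t t01.
transitivity (- itg D (fun y => - moll r (incr i z) (w - y))).
  rewrite itgN ?opprK//; last exact: BC_moll_sub.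
  by apply: eq_itg => y _; rewrite mul1r.
apply/eqP; rewrite oppr_eq0; apply/eqP.
apply: (itg_grad_eq0 oD bD i (C1_moll_sub D r z w)).
exists [set y : V | forall j, `|(y - w) ord0 j| <= r].
  split.
    rewrite (_ : mkset _ = (fun y => y + w) @` [set y : V | forall j, `|y ord0 j| <= r]).
      apply: continuous_compact; last exact: compact_closed_box.
      apply: continuous_subspaceT => y; apply: continuous_rV => j.
      rewrite (_ : (fun z => _) = fun z => z ord0 j + w ord0 j); last by apply/funext => u; rewrite !mxE.
      exact: ((C0D (@C0_coord R n setT j) (@C0_cst R n setT (w ord0 j))) y I).
    apply/seteqP; split => [y yw|_ [y yr <-] j]; last by rewrite addrK.
    by exists (y - w); [exact: yw|rewrite subrK].
  move=> y yw j; rewrite mxE subr0 -(subrK (w ord0 j) (y ord0 j)).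
  rewrite (le_lt_trans (ler_normD _ _))// addrC ltr_leD//.
  by have := yw j; rewrite !mxE.
move=> y _ yw; apply: moll_box => h; apply: yw => j.
by have := h j; rewrite !mxE -normrN opprB.
Qed.

(** Mollification of the extension by zero, divided by the constant mass [N]. The commutation of
    mixed partials is evident from the formula for [psi]; it is recorded because symmetry of
    Hessians of C^2 functions will be deduced from it. *)
Lemma test_fun_approx D f df (e : R) : open D -> bounded_set D -> C1 D f df -> cs D f ->
  0 < e -> exists2 psi, test_fun D psi /\
    (forall i j, partial i (partial j psi) = partial j (partial i psi)) & forall x, D x ->
    `|f x - psi x| <= e /\ forall i, `|df i x - partial i psi x| <= e.
Proof.
move=> oD bD cf sf e0.
have [K [F [dF [cK KD cF FD F0]]]] := cs_extend oD cf sf.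
have [cF0 cdF _] := cF.
have [r1 r10 H1] := compact_cube_sub cK oD KD.
have [r2 r20 H2] := cs_uniform cK (@subsetT _ _) (@openT _) cF0 (fun x _ h => (F0 x h).1) e0.
have [r3 r30 H3] : exists2 r, 0 < r & forall i x y, cube x r y -> `|dF i y - dF i x| <= e.
  have H i := cs_uniform cK (@subsetT _ _) (@openT _) (cdF i) (fun x _ h => (F0 x h).2 i) e0.
  have {}H i : exists r, 0 < r /\ forall x y, cube x r y -> `|dF i y - dF i x| <= e.
    by have [r r0 h] := H i; exists r; split => // x y; exact: h.
  have [q Hq] := choice H.
  exists (\big[Num.min/1]_i q i); first by apply: lt_bigmin => // i _; exact: (Hq i).1.
  move=> i x y xy; apply: (Hq i).2 => j; apply: lt_le_trans (xy j) _.
  exact: bigmin_le_cond.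
(* The mollification radius keeps the support inside [D] ([r1]) and lets the function ([r2]) and all
   its first derivatives ([r3]) oscillate by at most [e]. *)
pose r := Num.min (r1 / 2) (Num.min r2 r3).
have r0 : 0 < r by rewrite !lt_min r20 r30 divr_gt0.
have rr1 : r < r1.
  by apply: (@le_lt_trans _ _ (r1 / 2)); [rewrite ge_min lexx|rewrite ltr_pdivrMr// ltr_pMr// ltr1n].
have rr2 : r <= r2 by rewrite !ge_min lexx orbT.
have rr3 : r <= r3 by rewrite !ge_min lexx !orbT.
have [B B0 HB] := bounded_set_cube bD.
pose E := cube (0 : V) (B + r).
have oE : open E := @open_cube R n 0 (B + r).
have bE : bounded_set E := @bounded_cube R n 0 (B + r).
pose z : 'I_n -> nat := fun=> 0%N.
pose N := conv E (fun=> 1) r z 0.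
have NE x : D x -> itg E (fun y => moll r z (x - y)) = N.
  move=> Dx; rewrite /N -(moll_mass_cst B0 r0 (HB x Dx)).
  by apply: eq_itg => y _; rewrite mul1r.
have N0 : 0 < N.
  have m0 := moll_gt0 r0.
  have : \forall y \near (0 : V), `|moll r z 0 - moll r z y| < moll r z 0 / 2.
    have := @C0_moll r z 0 I; rewrite /prop_for /continuous_at => /cvgrPdist_lt.
    by apply; rewrite divr_gt0.
  move=> /nbhs_cubeP[q q0 Hq]; pose q' := Num.min q r.
  have q'0 : 0 < q' by rewrite lt_min q0.
  apply: (@lt_le_trans _ _ (moll r z 0 / 2 * (2 * q') ^+ n)).
    by rewrite mulr_gt0 ?divr_gt0// exprn_gt0// mulr_gt0.
  rewrite /N /conv; apply: (@itg_ge_cube R n E _ 0) => //.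
  - by apply: BCM; [exact: BC_cst|exact: BC_moll_sub].
  - by move=> y _; rewrite mul1r moll_ge0.
  - exact: ltW.
  - move=> y yq i; apply: lt_le_trans (yq i) _.
    by apply: (@le_trans _ _ r); [rewrite /q' ge_min lexx orbT|rewrite lerDr ltW].
  move=> y yq; rewrite mul1r.
  have : cube 0 q (0 - y).
    move=> i; rewrite !mxE !subr0 sub0r normrN.
    by have := yq i; rewrite mxE subr0 => h; rewrite (lt_le_trans h)// ge_min lexx.
  by move=> /Hq /=; rewrite ltr_norml; lra.
have FE : BC E F.
  apply: cs_BC; first exact: C0S cF0.
  exists K; last by move=> x _ /F0[].
  split => // x /KD /HB h i; by rewrite mxE subr0 (lt_le_trans (h i))// lerDl ltW.
have dFE i : BC E (dF i).
  apply: cs_BC; first exact: C0S (cdF i).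
  exists K; last by move=> x _ /F0[].
  split => // x /KD /HB h j; by rewrite mxE subr0 (lt_le_trans (h j))// lerDl ltW.
have near_f (g : V -> R) x : BC E g -> D x -> (forall y, cube x r y -> `|g y - g x| <= e) ->
    `|g x - conv E (fun y => N^-1 * g y) r z x| <= e.
  move=> bg Dx gx; rewrite /conv.
  have bgm : BC E (fun y => g y * moll r z (x - y)) by apply: BCM => //; exact: BC_moll_sub.
  have bm := BC_moll_sub E r z x.
  have -> : itg E (fun y => N^-1 * g y * moll r z (x - y)) =
      N^-1 * itg E (fun y => g y * moll r z (x - y)).
    by rewrite -itgZ//; apply: eq_itg => y _; rewrite mulrA.
  have -> : g x = N^-1 * itg E (fun y => g x * moll r z (x - y)).
    by rewrite itgZ// NE// mulrCA mulVf ?mulr1// gt_eqF.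
  rewrite -mulrBr -itgB//; last exact: BCZ.
  rewrite normrM gtr0_norm ?invr_gt0// mulrC ler_pdivrMr//.
  apply: le_trans (itg_abs oE bE _) _; first by apply: BCB => //; exact: BCZ.
  have -> : e * N = itg E (fun y => e * moll r z (x - y)) by rewrite itgZ// NE.
  apply: itg_le => //.
  - by apply: BC_abs; apply: BCB => //; exact: BCZ.
  - exact: BCZ.
  move=> y _; rewrite -mulrBl normrM (ger0_norm (moll_ge0 _ _)).
  have [yx|yx] := pselect (cube x r y).
    by rewrite ler_wpM2r ?moll_ge0// distrC; exact: gx.
  have /existsNP[i /negP] := yx; rewrite -leNgt => h.
  by rewrite (@moll_out r z _ i) ?mulr0// !mxE distrC.
have bNF : BC E (fun y => N^-1 * F y) by exact: BCZ.
exists (conv E (fun y => N^-1 * F y) r z); first split; first split.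
- exact: smooth_conv.
- exists [set x + y | x in K & y in [set y : V | forall i, `|y ord0 i| <= r]].
  split.
  + rewrite (_ : [set _ | _ in _ & _ in _] =
      (fun p : V * V => p.1 + p.2) @` (K `*` [set y : V | forall i, `|y ord0 i| <= r])).
      apply: continuous_compact; first by apply: continuous_subspaceT; exact: add_continuous.
      by apply: compact_setX => //; exact: compact_closed_box.
    apply/seteqP; split => [_ [x Kx [y yr <-]]|_ [[x y] [/= Kx yr] <-]]; first by exists (x, y).
    by exists x => //; exists y.
  + move=> _ [x Kx [y yr <-]]; apply: (H1 x) => // i.
    by rewrite mxE addrAC subrr add0r (le_lt_trans (yr i)).
  + move=> x nK; rewrite /conv (_ : itg E _ = itg E (fun=> 0)); first by rewrite itg_cst// mul0r.
    apply: eq_itg => y _; have [Ky|/F0[-> _]] := pselect (K y); last by rewrite mulr0 mul0r.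
    rewrite moll_box ?mulr0// => h; apply: nK; exists y => //; exists (x - y) => //.
    by rewrite addrC subrK.
- have pE a i : partial i (conv E (fun y => N^-1 * F y) r a) = conv E (fun y => N^-1 * F y) r (incr i a).
    by apply/funext => x; rewrite /partial; have [_ <-] := is_derive_conv oE bE r a i x bNF.
  move=> i j; rewrite !pE; congr conv; apply/funext => k; rewrite /incr; exact: addnAC.
move=> x Dx; have [FDx dFDx] := FD x Dx; split.
  rewrite -FDx; apply: near_f => // y xy; apply: H2 => // i.
  exact: lt_le_trans (xy i) rr2.
move=> i; rewrite -dFDx.
(* The derivative of the convolution falls on the mollifier; integration by parts in [E] returns it
   to [F], so the gradient is approximated in the same way as the function. *)
have -> : partial i (conv E (fun y => N^-1 * F y) r z) x = conv E (fun y => N^-1 * dF i y) r z x.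
  rewrite /partial; have [_ ->] := is_derive_conv oE bE r z i x bNF; rewrite /conv.
  have csF : cs E (fun y => N^-1 * F y).
    apply: csMr; exists K; last by move=> y _ /F0[].
    by split => // y /KD /HB h j; rewrite mxE subr0 (lt_le_trans (h j))// lerDl ltW.
  have cNF : C1 E (fun y => N^-1 * F y) (fun i y => N^-1 * dF i y).
    by apply: C1Z; exact: C1S cF.
  have := ibp oE bE i cNF (C1_moll_sub E r z x) csF.
  move=> /(congr1 (fun t => - t)); rewrite opprK => <-.
  rewrite -itgN//; last first.
    by apply: BCM => //; apply: BCN; exact: BC_moll_sub.
  by apply: eq_itg => y _; rewrite mulrN opprK.
apply: near_f => // y xy; apply: H3 => j; exact: lt_le_trans (xy j) rr3.
Qed.

End mollification.

(** * Admissible test functions in the stability inequality *)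

Section stability_test_functions.
Context {R : realType} {n : nat} (D : set 'rV[R]_n).
Local Notation V := 'rV[R]_n.
Hypotheses (oD : open D) (bD : bounded_set D).
Implicit Types (f g : V -> R) (x y : V).

Lemma itg_dominated (F : nat -> V -> R) g M : (forall k, BC D (F k)) -> BC D g ->
  (forall k x, D x -> `|F k x| <= M) -> (forall x, D x -> F k x @[k --> \oo] --> g x) ->
  itg D (F k) @[k --> \oo] --> itg D g.
Proof.
move=> bF bg FM Fg.
have mF k : measurable_fun D (EFin \o F k).
  by have /integrableP[] := BC_integrable oD bD (bF k).
have iM := BC_integrable oD bD (BC_cst D M).
have L := @dominated_cvg _ V R (lebesgue_rV n) D (domain_measurable oD)
  (fun k x => (F k x)%:E) (fun x => (g x)%:E) (fun=> M%:E) mF _ _ iM.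
apply: fine_cvg; rewrite fineK; last first.
  by apply: integrable_fin_num; [exact: domain_measurable|exact: BC_integrable].
apply: L => //.
by move=> x Dx; apply: cvg_EFin; [exact: nearW|exact: Fg].
Qed.

(** Approximability in the H^1 norm up to each error, instead of by a sequence: this form can be
    chained through an intermediate function, and the sequence is chosen once, in [H2_H10_C2b]. *)
Definition H10 f (df : 'I_n -> V -> R) := forall e : R, 0 < e ->
  exists2 psi, test_fun D psi & itg D (fun x => (f x - psi x) ^+ 2) <= e /\
    forall i, itg D (fun x => (df i x - partial i psi x) ^+ 2) <= e.

Lemma test_fun_C1 psi : test_fun D psi ->
  [/\ C1 D psi (fun i => partial i psi), cs D psi, BC D psi & forall i, BC D (partial i psi)].
Proof.
move=> [sp [K [cK KD K0]]].
have c1 : C1 setT psi (fun i => partial i psi) by exact: (@Ck_C1 R n 1 setT psi [::] (sp 1%N)).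
have c1D := C1S (@subsetT _ D) c1.
have csp : cs D psi by exists K => // x _; exact: K0.
split=> //; first by apply: cs_BC => //; have [] := c1D.
by move=> i; apply: (@cs_BC R n D (partial i psi)); [have [_ h _] := c1D; exact: h|exact: cs_grad c1D csp].
Qed.

Lemma H2_H10_C2b f df d2f : C2b D f df d2f -> H10 f df -> H2_H10 D f df d2f.
Proof.
move=> [cf bf bdf bd2f] ap.
have L2_BC g : BC D g -> L2 D g.
  move=> bg; split; first by apply: C0_measurable => //; case: bg.
  by apply: BC_integrable => //; exact: BCX.
have wp i g dg : C1 D g dg -> weak_partial i D g (dg i).
  move=> cg psi /test_fun_C1[cp sp bp bdp].
  have := ibp oD bD i cp cg sp; rewrite /itg.
  under eq_Rintegral do rewrite mulrC.
  by move=> ->; rewrite opprK; under eq_Rintegral do rewrite mulrC.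
have [c1 c2] := cf.
split.
- exact: L2_BC.
- by move=> i; split; [exact: L2_BC|exact: wp].
- by move=> i j; split; [exact: L2_BC|exact: wp].
have ap' k : exists psi, test_fun D psi /\ itg D (fun x => (f x - psi x) ^+ 2) <= k.+1%:R^-1 /\
    forall i, itg D (fun x => (df i x - partial i psi x) ^+ 2) <= k.+1%:R^-1.
  have [|psi h1 h2] := ap (k.+1%:R^-1); first by rewrite invr_gt0 ltr0n.
  by exists psi.
have [psi Hpsi] := choice ap'; exists psi.
have L (g : nat -> V -> R) : (forall k, itg D (fun x => g k x ^+ 2) <= k.+1%:R^-1) ->
    itg D (fun x => g k x ^+ 2) @[k --> \oo] --> (0 : R).
  move=> gk; apply: (squeeze_cvgr _ (cvg_cst 0) cvg_harmonic).
  by apply: nearW => k; rewrite /= gk andbT itg_ge0// => x _; rewrite sqr_ge0.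
split.
- by move=> k; have [] := Hpsi k.
- by apply: L => k; have [_ []] := Hpsi k.
- by move=> i; apply: L => k; have [_ [_]] := Hpsi k.
Qed.

Lemma H10_cs f df : C1 D f df -> cs D f -> H10 f df.
Proof.
move=> cf sf e e0; set L := fine (lebesgue_rV n D).
have L0 : 0 <= L by rewrite fine_ge0.
pose d := Num.min 1 (e / (L + 1)).
have d0 : 0 < d by rewrite lt_min ltr01 divr_gt0// ltr_wpDl.
have d1 : d <= 1 by rewrite ge_min lexx.
have dL : d ^+ 2 * L <= e.
  apply: (@le_trans _ _ (d * L)); first by rewrite ler_wpM2r// expr2 ler_piMl// ltW.
  apply: (@le_trans _ _ (e / (L + 1) * L)); first by rewrite ler_wpM2r// ge_min lexx orbT.
  by rewrite mulrAC ler_pdivrMr ?ltr_wpDl// ler_wpM2l ?(ltW e0)// lerDl.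
have [psi [tp _] H] := test_fun_approx oD bD cf sf d0.
have [cp sp bp bdp] := test_fun_C1 tp.
have bf : BC D f by apply: cs_BC => //; have [] := cf.
have bdf i : BC D (df i).
  by apply: cs_BC; [have [_ h _] := cf; exact: h|exact: cs_grad sf].
have main g h : BC D g -> BC D h -> (forall x, D x -> `|g x - h x| <= d) ->
    itg D (fun x => (g x - h x) ^+ 2) <= e.
  move=> bg bh gh; apply: (le_trans _ dL); rewrite -(itg_cst oD).
  apply: itg_le => //; [by apply: BCX; exact: BCB|exact: BC_cst|move=> x Dx].
  by rewrite -(real_normK (num_real _)) ler_pXn2r ?nnegrE ?(ltW d0)// gh.
exists psi => //; split; first by apply: main => // x /H[].
by move=> i; apply: main => // x /H[_]; apply.
Qed.

(** The truncations hst (1/(k+1)) of [f] have compact support and converge to [f] in H^1 by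
    dominated convergence: their gradients are [hst1] grad f with [hst1] between 0 and 1. Hence v
    itself is admissible in the stability inequality. *)
Lemma H10_vanish f df d2f : C2b D f df d2f -> vanish_on_bd D f ->
  (forall x, D x -> 0 < f x) -> H10 f df.
Proof.
move=> [cf bf bdf bd2f] vf fp e e0.
have vb := vanish_on_bd_vanb oD bD (C2_C0 cf) vf.
pose d (k : nat) : R := k.+1%:R^-1.
have d0 k : 0 < d k by rewrite invr_gt0 ltr0n.
have dc : d k @[k --> \oo] --> (0 : R) by exact: cvg_harmonic.
pose F k x := (f x - hst (d k) (f x)) ^+ 2 +
  \sum_i (df i x - hst1 (d k) (f x) * df i x) ^+ 2.
have ch k := C2_hst (d0 k) cf.
have sh k := cs_hst (d0 k) vb.
have bh k : BC D (fun x => hst (d k) (f x)).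
  by apply: cs_BC => //; exact: C2_C0 (ch k).
have bh1 k i : BC D (fun x => hst1 (d k) (f x) * df i x).
  have [[_ h _] _] := ch k; apply: cs_BC; first exact: h.
  exact: cs_grad (C2_C1 (ch k)) (sh k).
have bF k : BC D (F k).
  apply: BCD; first by apply: BCX; exact: BCB.
  by apply: BC_sum => i; apply: BCX; exact: BCB.
have [M HM] : exists M, forall k x, D x -> `|F k x| <= M.
  have [_ [M0 HM0]] : BC D (fun x => 4 + \sum_i df i x ^+ 2).
    by apply: BCD; [exact: BC_cst|apply: BC_sum => i; exact: BCX].
  exists M0 => k x Dx; apply: le_trans (HM0 x Dx).
  have p1 : 0 <= F k x by rewrite addr_ge0 ?sqr_ge0// sumr_ge0// => i _; rewrite sqr_ge0.
  have p2 : 0 <= 4 + \sum_i df i x ^+ 2.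
    by rewrite addr_ge0// sumr_ge0// => i _; rewrite sqr_ge0.
  rewrite !ger0_norm// lerD//.
    have [_ _ _ _] := hst_facts (f x) (d0 k); rewrite tpos_pos ?(ltW (fp x Dx))// => /andP[h1 h2].
    have dk1 : d k <= 1 by rewrite /d invf_le1 ?ltr0n// ler1n.
    have := ltW (d0 k); nra.
  apply: ler_sum => i _.
  have [_ _ /andP[h1 h2] _ _] := hst_facts (f x) (d0 k).
  have -> : df i x - hst1 (d k) (f x) * df i x = (1 - hst1 (d k) (f x)) * df i x by ring.
  rewrite exprMn ler_piMl ?sqr_ge0// expr_le1//; lra.
have L := itg_dominated bF (BC_cst D 0) HM _.
have {}L : itg D (F k) @[k --> \oo] --> (0 : R).
  rewrite [X in _ --> X](_ : _ = itg D (fun=> 0)); last by rewrite (itg_cst oD) mul0r.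
  apply: L => x Dx; apply/cvgrPdist_le => e1 e10.
  have fx0 := fp x Dx.
  (* Once 3 d_k <= f(x) the factor [hst1] equals 1 and the gradient difference at [x] is exactly
     zero; the remaining difference of values is at most 2 d_k. *)
  have q0 : 0 < Num.min (f x / 3) (Num.min 1 (e1 / 4)).
    by rewrite !lt_min ltr01 !divr_gt0.
  move/cvgrPdist_lt : (dc) => /(_ _ q0); apply: filterS => k.
  rewrite sub0r normrN gtr0_norm// !lt_min => /and3P[k1 k2 k3].
  rewrite sub0r normrN /F.
  have [_ h1 _ _] := hst_facts (f x) (d0 k).
  rewrite tpos_pos ?(ltW fx0)// => /andP[h2 h3].
  rewrite h1; last by lra.
  rewrite big1 ?addr0; last by move=> i _; rewrite mul1r subrr expr0n.
  rewrite ger0_norm ?sqr_ge0//; have := d0 k => dk; nra.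
move/cvgrPdist_le : L => /(_ _ (divr_gt0 e0 (ltr0Sn R 3))) H.
have [k _ /(_ k (leqnn k)) /=] := H; rewrite sub0r normrN => Hk.
have {}Hk : itg D (F k) <= e / 4 by apply: le_trans Hk; exact: ler_norm.
have [psi tp [p1 p2]] := H10_cs (C2_C1 (ch k)) (sh k) (divr_gt0 e0 (ltr0Sn R 3)).
have [cp sp bp bdp] := test_fun_C1 tp.
have main (a b c : V -> R) : BC D a -> BC D b -> BC D c ->
    (forall x, D x -> (a x - b x) ^+ 2 <= F k x) ->
    itg D (fun x => (b x - c x) ^+ 2) <= e / 4 ->
    itg D (fun x => (a x - c x) ^+ 2) <= e.
  move=> ba bb bc aF bcle.
  have b1 : BC D (fun x => (b x - c x) ^+ 2) by apply: BCX; exact: BCB.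
  apply: (@le_trans _ _ (itg D (fun x => 2 * F k x + 2 * (b x - c x) ^+ 2))).
    apply: itg_le => //; [by apply: BCX; exact: BCB|by apply: BCD; exact: BCZ|].
    move=> x Dx; have := aF x Dx; have := sqr_ge0 (a x - b x - (b x - c x)); nra.
  rewrite itgD ?itgZ//; [lra|exact: BCZ|exact: BCZ].
have s0 x i0 : 0 <= \sum_(i | i != i0) (df i x - hst1 (d k) (f x) * df i x) ^+ 2.
  by rewrite sumr_ge0// => i _; rewrite sqr_ge0.
exists psi => //; split.
  apply: (main f (fun x => hst (d k) (f x)) psi) => // x Dx.
  by rewrite /F lerDl sumr_ge0// => i _; rewrite sqr_ge0.
move=> i; apply: (main (df i) (fun x => hst1 (d k) (f x) * df i x) (partial i psi)) => // x Dx.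
by rewrite /F (bigD1 i)//= addrCA lerDl addr_ge0 ?sqr_ge0.
Qed.

Lemma stable_test p lam u f df d2f : stable p D lam u -> C2b D f df d2f -> H10 f df ->
  lam * p * itg D (fun x => (u x + 1) `^ (p - 1) * f x ^+ 2) <=
  itg D (fun x => lap d2f x ^+ 2).
Proof. by move=> st cf hf; exact: st (H2_H10_C2b cf hf). Qed.

End stability_test_functions.

Lemma powR_absorb {R : realType} (a b e : R) : a < b -> 0 < e ->
  exists2 C, 0 <= C & forall w, 1 <= w -> w `^ a <= e * w `^ b + C.
Proof.
move=> ab e0; have d0 : 0 < b - a by lra.
exists ((e^-1) `^ (`|a| / (b - a))); first exact: powR_ge0.
move=> w w1; have w0 : 0 < w by lra.
have [h|h] := leP (e^-1) (w `^ (b - a)).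
  apply: (@le_trans _ _ (e * w `^ b)); last by rewrite lerDl powR_ge0.
  have -> : w `^ b = w `^ (b - a) * w `^ a.
    by rewrite -powRD ?subrK// (gt_eqF w0) implybT.
  rewrite mulrA ler_peMl ?powR_ge0//.
  by rewrite mulrC -ler_pdivrMr// div1r.
apply: (@le_trans _ _ (w `^ `|a|)); first by apply: ler_powR => //; exact: ler_norm.
apply: (@le_trans _ _ (e^-1 `^ (`|a| / (b - a)))); last first.
  by rewrite lerDr mulr_ge0 ?(ltW e0)// powR_ge0.
have -> : w `^ `|a| = (w `^ (b - a)) `^ (`|a| / (b - a)).
  by rewrite -powRrM mulrCA mulfV ?mulr1// gt_eqF.
rewrite ge0_ler_powR ?nnegrE ?powR_ge0 ?divr_ge0 ?(ltW d0)//; last exact: ltW.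
by rewrite invr_ge0 ltW.
Qed.

(** * The moment of order 2p and the subcritical case *)

Section moment_bounds.
Context {R : realType} {n : nat} (D : set 'rV[R]_n).
Local Notation V := 'rV[R]_n.
Hypotheses (oD : open D) (bD : bounded_set D).

Lemma system_w_BC (p lam : R) u du d2u v dv d2v (a : R) :
  navier_system D p lam u du d2u v dv d2v -> BC D (fun x => (u x + 1) `^ a).
Proof.
move=> [[[cu [_ [M HM]] _ _] _] _ up _ _].
apply: (@BC_comp R n D (fun x => u x + 1) (fun t => t `^ a) 1 (M + 1)).
- by apply: C0D; [exact: C2_C0 cu|exact: C0_cst].
- move=> x Dx; rewrite lerDr ltW ?up//= lerD2r.
  by apply: le_trans (HM x Dx); exact: ler_norm.
- by move=> t /andP[t1 _]; apply: powR_continuous; lra.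
Qed.

(* Stability tested with [phi = - Delta u], combined with Souplet's inequality. *)
Lemma moment_2p (p : R) : 1 < p -> exists K : R, forall lam u du d2u v dv d2v, 0 < lam ->
  navier_system D p lam u du d2u v dv d2v -> stable p D lam u ->
  itg D (fun x => (u x + 1) `^ (2 * p)) <= K.
Proof.
(* Stability and Souplet's inequality lead to 2 p (I - 2 J) <= (p + 1) I, that is (p - 1) I <= 4 p
   J. With this coefficient the absorption of [J] consumes exactly half of the left hand side. *)
move=> p1; have e0 : 0 < (p - 1) / (8 * p) by rewrite divr_gt0; lra.
have ab : (3 * p - 1) / 2 < 2 * p by lra.
have [C C0 HC] := powR_absorb ab e0.
set L := fine (lebesgue_rV n D).
exists (8 * p / (p - 1) * (C * L)) => lam u du d2u v dv d2v lam0 sys st.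
have [[cu cv] [vu vv] up eu ev] := sys.
have vp := system_v_pos oD bD lam0 sys.
have T := stable_test oD bD st cv (H10_vanish oD bD cv vv vp).
have bw a := system_w_BC a sys.
pose I := itg D (fun x => (u x + 1) `^ (2 * p)).
pose J := itg D (fun x => (u x + 1) `^ ((3 * p - 1) / 2)).
have w1 x : D x -> 1 <= u x + 1 by move=> Dx; rewrite lerDr ltW// up.
have E1 : itg D (fun x => lap d2v x ^+ 2) = lam ^+ 2 * I.
  rewrite /I -itgZ//; apply: eq_itg => x Dx.
  have w0 : 0 < u x + 1 by have := w1 x Dx; lra.
  rewrite -sqrrN ev// exprMn; congr (_ * _).
  by rewrite -powR_mulrn ?powR_ge0// -powRrM mulrC.
have E2 : 2 * lam / (p + 1) * (I - 2 * J) <= itg D (fun x => (u x + 1) `^ (p - 1) * v x ^+ 2).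
  have [_ bv _ _] := cv.
  rewrite /I /J -itgZ// -itgB//; last exact: BCZ.
  rewrite -itgZ//; last by apply: BCB => //; exact: BCZ.
  apply: itg_le => //.
  - by apply: BCZ; apply: BCB => //; exact: BCZ.
  - by apply: BCM => //; exact: BCX.
  move=> x Dx; have w0 : 0 < u x + 1 by have := w1 x Dx; lra.
  have Sv := system_v_ge oD bD p1 lam0 sys Dx.
  set w := u x + 1 in Sv w0 *.
  set c := Num.sqrt (2 * lam / (p + 1)) in Sv.
  have c2 : c ^+ 2 = 2 * lam / (p + 1).
    by rewrite sqr_sqrtr// divr_ge0 ?mulr_ge0//; move: lam0 ab; lra_goal.
  have c0 : 0 <= c by exact: sqrtr_ge0.
  have wb1 : 1 <= w `^ ((p + 1) / 2).
    have h : 1 `^ ((p + 1) / 2) <= w `^ ((p + 1) / 2).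
      by rewrite ge0_ler_powR ?nnegrE//; [move: ab; lra_goal|lra|exact: w1].
    by rewrite powR1 in h.
  have s1 : 0 <= c * (w `^ ((p + 1) / 2) - 1) by rewrite mulr_ge0//; lra.
  have s2 : (c * (w `^ ((p + 1) / 2) - 1)) ^+ 2 <= v x ^+ 2.
    by rewrite ler_pXn2r ?nnegrE// ltW// vp.
  have W a b : w `^ a * w `^ b = w `^ (a + b) by rewrite -powRD// (gt_eqF w0) implybT.
  apply: le_trans (ler_wpM2l (powR_ge0 w (p - 1)) s2).
  rewrite exprMn c2 mulrCA ler_wpM2l//; first by rewrite divr_ge0 ?mulr_ge0//; move: lam0 ab; lra_goal.
  rewrite (_ : (w `^ ((p + 1) / 2) - 1) ^+ 2 =
     w `^ ((p + 1) / 2) * w `^ ((p + 1) / 2) - 2 * w `^ ((p + 1) / 2) + 1); last by ring.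
  rewrite W mulrDr mulr1 mulrBr W (mulrCA _ 2) W.
  have -> : p - 1 + ((p + 1) / 2 + (p + 1) / 2) = 2 * p by field.
  have -> : p - 1 + (p + 1) / 2 = (3 * p - 1) / 2 by field.
  by rewrite lerDl powR_ge0.
have E3 : J <= (p - 1) / (8 * p) * I + C * L.
  rewrite /I /J -(itg_cst oD C) -itgZ// -itgD//; [|exact: BCZ|exact: BC_cst].
  apply: itg_le => //; [by apply: BCD; [exact: BCZ|exact: BC_cst]|].
  by move=> x Dx; exact: HC (w1 x Dx).
rewrite E1 in T.
have lp : 0 < lam * p by rewrite mulr_gt0//; lra.
have T2 := le_trans (ler_wpM2l (ltW lp) E2) T.
have T3 : 2 * p * (I - 2 * J) <= (p + 1) * I.
  have l2 : 0 < lam ^+ 2 by rewrite exprn_gt0.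
  rewrite -(ler_pM2l l2); have pp : 0 < p + 1 by move: ab; lra_goal.
  have := ler_wpM2l (ltW pp) T2.
  have -> : (p + 1) * (lam * p * (2 * lam / (p + 1) * (I - 2 * J))) = lam ^+ 2 * (2 * p * (I - 2 * J)).
    by field; rewrite gt_eqF.
  by move=> h; apply: le_trans h _; rewrite le_eqVlt; apply/orP; left; apply/eqP; ring.
have T4 : 4 * p * J <= (p - 1) / 2 * I + 4 * p * (C * L).
  have := ler_wpM2l (_ : 0 <= 4 * p) E3; move=> /(_ ltac:(move: p1; lra_goal)) h.
  apply: le_trans h _; rewrite le_eqVlt; apply/orP; left; apply/eqP; field.
  by rewrite gt_eqF//; move: p1; lra_goal.
have T5 : (p - 1) / 2 * I <= 4 * p * (C * L) by move: T4 T3; lra_goal.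
have -> : 8 * p / (p - 1) * (C * L) = (4 * p * (C * L)) / ((p - 1) / 2).
  by field; rewrite gt_eqF//; move: p1; lra_goal.
by rewrite ler_pdivlMr ?divr_gt0 ?subr_gt0// mulrC.
Qed.

(** A bound valid for all parameters in [L/2, L) passes to the pointwise limit from the left.
    Restricting to the upper half keeps lam away from zero, which the finer moment estimates need
    when they divide by it. *)
Lemma extremal_bounded_of_moment (p Q : R) : (0 < n)%N -> 1 < p -> (p - 1) * @crit_exp R n < Q ->
  (forall L : R, 0 < L -> exists K : R, forall lam u du d2u v dv d2v, L / 2 <= lam < L ->
     navier_system D p lam u du d2u v dv d2v -> stable p D lam u ->
     itg D (fun x => (u x + 1) `^ Q) <= K) ->
  extremal_solution_bounded p D.
Proof.
move=> n0 p1 pQ HK L us [L0 [U [HU ae]] _ _ _].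
have [K HKL] := HK L L0.
have [M HM] := @sup_bound R n D oD bD p Q K L n0 p1 pQ.
have UM lam x : L / 2 <= lam < L -> D x -> `|U lam x| <= M.
  move=> /andP[l1 l2] Dx; have l0 : 0 < lam by apply: lt_le_trans l1; rewrite divr_gt0.
  have [|[cs _] st] := HU lam; first by rewrite l0.
  have [du [d2u [v [dv [d2v sys]]]]] := classical_navier_system oD bD cs.
  have [_ _ up _ _] := sys; rewrite gtr0_norm ?up//.
  apply: (HM lam _ _ _ _ _ _ _ sys) => //; first by rewrite l0 ltW.
  by apply: (HKL lam _ _ _ _ _ _ _ sys st); rewrite l1.
exists M; apply: filterS ae => x Hx Dx; have {}Hx := Hx Dx.
have near1 : \forall lam \near L^'-, `|U lam x| <= M.
  have h1 : \forall lam \near L^'-, L / 2 <= lam.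
    by apply: nbhs_left_ge; rewrite ltr_pdivrMr// ltr_pMr// ltr1n.
  have h2 : \forall lam \near L^'-, lam < L by exact: nbhs_left_lt.
  by apply: filterS2 h1 h2 => lam a b; apply: UM => //; rewrite a b.
rewrite leNgt; apply/negP => Mx.
have near2 : \forall lam \near L^'-, M < `|U lam x|.
  by apply: (cvgr_gt `|us x|) => //; exact: cvg_norm.
apply: (@filter_not_empty _ (L^'-)).
by apply: filterS2 near1 near2 => lam a b; move: a; rewrite leNgt b.
Qed.

(** The moment of order 2p exceeds (p - 1) n/4 exactly when p (n - 8) < n. The product form covers n
    <= 8, where it holds for every p, and p < n/(n-8) for larger n. *)
Lemma extremal_bounded_subcritical (p : R) : (0 < n)%N -> 1 < p -> p * (n%:R - 8) < n%:R ->
  extremal_solution_bounded p D.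
Proof.
move=> n0 p1 pn; apply: (@extremal_bounded_of_moment p (2 * p)) => //.
  rewrite /crit_exp; case: ifPn => _; first by lra.
  by rewrite mulrA ltr_pdivrMr//; lra.
move=> L L0; have [K HK] := moment_2p p1; exists K.
move=> lam u du d2u v dv d2v /andP[l1 _]; apply: HK.
by apply: lt_le_trans l1; rewrite divr_gt0.
Qed.

End moment_bounds.

(** * The Euclidean inner product and the unit sphere *)

Section euclidean_geometry.
Context {R : realType} {n : nat}.
Local Notation V := 'rV[R]_n.
Implicit Types (D K : set V) (x y z t : V).

Definition dotp x y : R := \sum_i x ord0 i * y ord0 i.

Lemma dotpC x y : dotp x y = dotp y x.
Proof. by apply: eq_bigr => i _; rewrite mulrC. Qed.

Lemma dotpDl x y z : dotp (x + y) z = dotp x z + dotp y z.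
Proof. by rewrite -big_split/=; apply: eq_bigr => i _; rewrite mxE mulrDl. Qed.

Lemma dotpZl c x z : dotp (c *: x) z = c * dotp x z.
Proof. by rewrite mulr_sumr; apply: eq_bigr => i _; rewrite mxE mulrA. Qed.

Lemma dotpNl x z : dotp (- x) z = - dotp x z.
Proof. by rewrite -scaleN1r dotpZl mulN1r. Qed.

Lemma dotpBl x y z : dotp (x - y) z = dotp x z - dotp y z.
Proof. by rewrite dotpDl dotpNl. Qed.

Lemma dotpZr c x z : dotp x (c *: z) = c * dotp x z.
Proof. by rewrite dotpC dotpZl dotpC. Qed.

Lemma dotpBr x y z : dotp x (y - z) = dotp x y - dotp x z.
Proof. by rewrite dotpC dotpBl !(dotpC x). Qed.

Lemma dotp_ge0 x : 0 <= dotp x x.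
Proof. by apply: sumr_ge0 => i _; rewrite -expr2 sqr_ge0. Qed.

Lemma dotp_le x y a b : 0 <= a -> (forall i, `|x ord0 i| <= a) -> (forall i, `|y ord0 i| <= b) ->
  `|dotp x y| <= n%:R * (a * b).
Proof.
move=> a0 xa yb; apply: le_trans (ler_norm_sum _ _ _) _.
rewrite -[n in n%:R]card_ord -sum1_card natr_sum mulr_suml; apply: ler_sum => i _.
by rewrite mul1r normrM ler_pM.
Qed.

Lemma dotp_coord_le x i : x ord0 i ^+ 2 <= dotp x x.
Proof.
rewrite /dotp (bigD1 i)//= -expr2 lerDl sumr_ge0// => j _.
by rewrite -expr2 sqr_ge0.
Qed.

Lemma unit_coord t i : dotp t t = 1 -> `|t ord0 i| <= 1.
Proof.
move=> t1; have := dotp_coord_le t i; rewrite t1 -[`|_| <= 1](@ler_pXn2r _ 2)// ?nnegrE//.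
by rewrite expr1n real_normK ?num_real.
Qed.

Lemma C0_dotp D (a : V) : C0 D (fun x => dotp x a).
Proof.
rewrite /dotp; apply: C0_sum => i; apply: C0M; first exact: C0_coord.
exact: (@C0_cst R n D (a ord0 i)).
Qed.

Lemma C2_dotp D (a : V) (c : R) : C2 D (fun x => dotp x a + c)
  (fun i _ => a ord0 i) (fun _ _ _ => 0).
Proof.
have H := C2D (C2_sum (index_enum 'I_n) (fun i => C2Z (a ord0 i) (@C2_coord R n setT i)))
  (C2_cst setT c).
apply: (C2S (@subsetT _ D)); apply: (C2_ext (@openT _) H).
- by move=> x _; congr (_ + _); apply: eq_bigr => i _; rewrite mulrC.
- move=> i x _; rewrite addr0 (bigD1 i)//= eqxx mulr1 big1 ?addr0// => j ji.
  by rewrite eq_sym (negPf ji) mulr0.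
- by move=> i j x _; rewrite addr0 big1// => k _; rewrite mulr0.
Qed.

Lemma closed_halfspace (a : V) c : closed [set x | dotp x a <= c].
Proof.
apply: (@closed_comp _ _ (fun x : V => dotp x a) [set u | u <= c]); last exact: closed_le.
by move=> x _; exact: (@C0_dotp setT a x I).
Qed.

Lemma compact_sphere : compact [set t : V | dotp t t = 1].
Proof.
apply: (@subclosed_compact _ _ [set t : V | forall i, `|t ord0 i| <= 1]).
- apply: (@closed_comp _ _ (fun x : V => dotp x x) [set u | u = 1]); last exact: closed_eq.
  move=> x _; have H : C0 setT (fun x : V => dotp x x).
    by rewrite /dotp; apply: C0_sum => i; apply: C0M; exact: C0_coord.
  exact: H x I.
- exact: compact_closed_box.
- by move=> t t1 i; exact: unit_coord.
Qed.

Lemma compact_uniform2 K1 K2 (P : R -> V -> V -> Prop) : compact K1 -> compact K2 ->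
  (forall x t, K1 x -> K2 t -> exists2 r : R, 0 < r &
     forall x' t' d, K1 x' -> K2 t' -> cube x r x' -> cube t r t' -> 0 < d < r -> P d x' t') ->
  exists2 d : R, 0 < d & forall x t, K1 x -> K2 t -> P d x t.
Proof.
move=> c1 c2 H; have := compact_setX c1 c2; move=> /compact_near_coveringP cK.
have := cK R ((0 : R)^'+) (fun d p => K1 p.1 -> K2 p.2 -> P d p.1 p.2) _.
case=> [[x t] [/= Kx Kt]|].
  have [r r0 Hr] := H x t Kx Kt.
  exists ([set p : V * V | cube x r p.1 /\ cube t r p.2], [set d : R | 0 < d < r]); first split => /=.
  - exists (cube x r, cube t r); first by split; apply/nbhs_cubeP; exists r.
    by move=> [x' t'].
  - have h1 := nbhs_right_lt r0; have h2 := nbhs_right_gt (0 : R).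
    by apply: filterS2 h1 h2 => d a b; apply/andP.
  by move=> [[x' t'] d] /= [[h1 h2] h3] k1 k2; exact: Hr.
move=> e /= e0 He; exists (e / 2); first by rewrite divr_gt0.
move=> x t Kx Kt; apply: (He (e / 2) _ _ (x, t)) => //=.
  by rewrite sub0r normrN gtr0_norm ?divr_gt0// ltr_pdivrMr// ltr_pMr// ltr1n.
by rewrite divr_gt0.
Qed.

End euclidean_geometry.

(** * Supporting hyperplanes and reflection of small caps *)

Section convex_domains.
Context {R : realType} {n : nat} (D : set 'rV[R]_n).
Local Notation V := 'rV[R]_n.
Hypotheses (oD : open D) (bD : bounded_set D).
Hypothesis vD : convex_set (D : set (convex_lmodType V)).
Hypothesis sD : smooth_boundary D.
Implicit Types (x y z t : V).

Lemma convex_comb x y (s : R) : D x -> D y -> 0 <= s <= 1 -> D (s *: x + (1 - s) *: y).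
Proof.
move=> Dx Dy /andP[s0 s1].
by have := vD (Itv01 s0 s1) (mem_set Dx) (mem_set Dy); move=> /set_mem.
Qed.

Lemma convex_segment x y (s : R) : D x -> D y -> 0 <= s <= 1 -> D (s *: (y - x) + x).
Proof.
move=> Dx Dy s01; have := convex_comb Dy Dx s01.
by rewrite scalerBl scale1r scalerBr [x - _]addrC addrA.
Qed.

Lemma convex_closure x y (s : R) : closure D x -> D y -> 0 < s <= 1 -> D (s *: (y - x) + x).
Proof.
move=> clx Dy /andP[s0 s1]; have /open_cubeP H := oD.
have [r r0 Hr] := H y Dy.
have sr : 0 < s * r by rewrite mulr_gt0.
have : nbhs x (cube x (s * r)) by apply/nbhs_cubeP; exists (s * r).
move=> /clx[x' [Dx' xx']].
(* [x] is replaced by a nearby [x'] in [D], and [y] is shifted so that the point at parameter [s] is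
   unchanged; for [x'] close enough the shifted [y'] is still in [D]. *)
pose y' := y + s^-1 *: ((1 - s) *: (x - x')).
have Dy' : D y'.
  apply: Hr => i; rewrite !mxE addrAC subrr add0r normrM gtr0_norm ?invr_gt0//.
  rewrite ltr_pdivrMl// normrM ger0_norm ?subr_ge0//.
  apply: le_lt_trans (xx' i); rewrite -normrN opprB ler_piMl// gerBl ltW//.
have -> : s *: (y - x) + x = s *: (y' - x') + x'; last first.
  by apply: convex_segment => //; rewrite ltW.
apply/rowP => i; rewrite !mxE; field; exact: lt0r_neq0.
Qed.

Lemma closure_box : exists2 B, 0 < B & forall x, closure D x -> forall i, `|x ord0 i| <= B.
Proof.
have [B B0 HB] := bounded_set_cube bD; exists B => // x clx.
have cb := compact_closed (@norm_hausdorff _ _) (@compact_closed_box R n B).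
have : closure [set x : V | forall i, `|x ord0 i| <= B] x.
  by apply: closureS clx => z /HB h i; rewrite ltW.
by have /closure_id <- := cb.
Qed.

Lemma compact_closure : compact (closure D).
Proof.
have [B B0 HB] := closure_box.
apply: (subclosed_compact (@closed_closure _ _) (@compact_closed_box R n B)).
by move=> x /HB.
Qed.

Lemma bdE x : bd D x <-> closure D x /\ ~ D x.
Proof. by rewrite /bd (interior_id D).1//. Qed.

Lemma boundary_chart b : bd D b -> exists (W : set V) (rho : V -> R) (g : 'I_n -> V -> R),
  [/\ open W, W b, C1 W rho g & [/\ rho b = 0, 0 < dotp (\row_i g i b) (\row_i g i b),
     forall x, W x -> rho x < 0 -> D x, forall x, W x -> D x -> rho x < 0 &
     forall x, W x -> closure D x -> rho x <= 0]].
Proof.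
move=> bb; have [W [rho [oW Wb sW [i gi] Wrho]]] := sD bb.
have [clb nDb] := (bdE b).1 bb.
have c1 : C1 W rho (fun i => partial i rho) by exact: (@Ck_C1 R n 1 W rho [::] (sW 1%N)).
have cl x : W x -> closure D x -> rho x <= 0.
  move=> Wx clx; rewrite leNgt; apply/negP => px.
  have : nbhs x (W `&` [set z | 0 < rho z]).
    apply: filterI; first exact: open_nbhs_nbhs.
    have [c0 _ _] := c1.
    have H : nbhs (rho x) [set u | 0 < u].
      by apply: open_nbhs_nbhs; split; [exact: open_gt|].
    exact: (c0 x Wx _ H).
  move=> /clx[z [Dz [Wz /=]]]; rewrite ltNge => /negP; apply.
  by rewrite ltW//; exact: (Wrho z Wz).1.
exists W, rho, (fun i => partial i rho); split => //; split => //.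
- apply/eqP; rewrite eq_le cl//= leNgt; apply/negP => h.
  by apply: nDb; apply/Wrho.
- apply: lt_le_trans (dotp_coord_le _ i).
  by rewrite mxE lt_neqAle sqr_ge0 andbT eq_sym sqrf_eq0.
- by move=> x Wx /(Wrho x Wx).2.
- by move=> x Wx /(Wrho x Wx).1.
Qed.

Lemma rho_along (W : set V) (rho : V -> R) g b v : open W -> C1 W rho g -> W b -> rho b = 0 ->
  0 < dotp v (\row_i g i b) ->
  exists2 r : R, 0 < r & forall s, 0 < s < r -> W (s *: v + b) /\ 0 < rho (s *: v + b).
Proof.
move=> oW cW Wb r0 dv; have H := C1_dir v oW cW Wb.
have H' : is_derive b v rho (dotp v (\row_i g i b)).
  by apply: (is_derive_eq H); apply: eq_bigr => i _; rewrite mxE.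
have /is_derive_line H2 := H'.
have [|r1 r10 Hr1] := derive_pos_right H2 dv; first by rewrite scale0r add0r.
have [r2 r20 Hr2] := line_near v oW Wb.
exists (Num.min r1 r2); first by rewrite lt_min r10.
move=> s /andP[s0]; rewrite lt_min => /andP[s1 s2]; split.
  by apply: Hr2; rewrite gtr0_norm.
by apply: Hr1; rewrite s0.
Qed.

(** The normal is the normalized gradient of the defining function. If some [y] in [D] were higher
    than [b], moving from [b] towards [y] would make the defining function positive, although
    convexity keeps the path in [D]. *)
Lemma supporting_normal b : bd D b -> exists2 t, dotp t t = 1 &
  forall y, D y -> dotp y t <= dotp b t.
Proof.
move=> bb; have [W [rho [g [oW Wb cW [rb gg W1 W2 W3]]]]] := boundary_chart bb.
have [clb nDb] := (bdE b).1 bb.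
set gb := \row_i g i b in gg; pose s := Num.sqrt (dotp gb gb).
have s0 : 0 < s by rewrite sqrtr_gt0.
exists (s^-1 *: gb).
  rewrite dotpZl dotpZr mulrA -invfM -expr2 sqr_sqrtr ?(ltW gg)//.
  by rewrite mulVf// gt_eqF.
move=> y Dy; rewrite !dotpZr ler_pM2l ?invr_gt0// -subr_le0 -dotpBl leNgt; apply/negP => h.
have [r r0 Hr] := rho_along oW cW Wb rb h.
pose q := Num.min (r / 2) 1.
have q0 : 0 < q by rewrite lt_min ltr01 divr_gt0.
have qr : q < r.
  by apply: (@le_lt_trans _ _ (r / 2)); [rewrite ge_min lexx|rewrite ltr_pdivrMr// ltr_pMr// ltr1n].
have [Wq] := Hr q ltac:(by rewrite q0).
have Dq : D (q *: (y - b) + b) by apply: convex_closure => //; rewrite q0 ge_min lexx orbT.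
by move=> /lt_trans /(_ (W2 _ Wq Dq)); rewrite ltxx.
Qed.

(* If the half-line from a boundary point in an extremal direction did not leave the
   domain transversally, moving along [t - e grad rho] would stay in the domain and
   increase the height. *)
Lemma extremal_transversal b t (W : set V) (rho : V -> R) g :
  open W -> W b -> C1 W rho g -> rho b = 0 -> (forall x, W x -> rho x < 0 -> D x) ->
  0 < dotp (\row_i g i b) (\row_i g i b) -> dotp t t = 1 ->
  (forall y, D y -> dotp y t <= dotp b t) -> 0 < dotp t (\row_i g i b).
Proof.
move=> oW Wb cW rb W1 gg tt bt; set gb := \row_i g i b in gg *.
rewrite ltNge; apply/negP => tg.
pose e := (`|dotp gb t| + 1)^-1 : R.
have e0 : 0 < e by rewrite invr_gt0 ltr_wpDl.
have et : e * dotp gb t < 1.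
  rewrite /e mulrC ltr_pdivrMr ?ltr_wpDl// mul1r (le_lt_trans (ler_norm _))//.
  by rewrite ltrDl.
pose v := t - e *: gb.
have vg : 0 < dotp (- v) gb.
  rewrite dotpNl oppr_gt0 dotpBl dotpZl; have : 0 < e * dotp gb gb by rewrite mulr_gt0.
  lra.
have cN := C1N cW.
have gE : \row_i - g i b = - gb by apply/rowP => i; rewrite !mxE.
have vg' : 0 < dotp v (\row_i - g i b) by rewrite gE dotpC dotpNl -dotpC -dotpNl.
have rb' : - rho b = 0 by rewrite rb oppr0.
have [r r0 Hr] := @rho_along W (fun x => - rho x) (fun i x => - g i x) b v oW cN Wb rb' vg'.
have [Wq] := Hr (r / 2) ltac:(by rewrite divr_gt0//= ltr_pdivrMr// ltr_pMr// ltr1n).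
rewrite oppr_gt0 => rq; have := bt _ (W1 _ Wq rq).
rewrite dotpDl dotpZl gerDr leNgt => /negP; apply.
by rewrite mulr_gt0 ?divr_gt0// dotpBl dotpZl tt subr_gt0.
Qed.

(* Reflections in planes close to the supporting plane in direction [t] map the cap
   they cut off back into the domain. *)
Lemma cap_reflection : exists2 d0 : R, 0 < d0 & forall x t, closure D x -> dotp t t = 1 ->
  forall s : R, 0 < s -> (forall y, D y -> dotp y t <= dotp x t - s + d0) ->
  D (x - (2 * s) *: t).
Proof.
pose P (d : R) x t := forall s : R, 0 < s ->
  (forall y, D y -> dotp y t <= dotp x t - s + d) -> D (x - (2 * s) *: t).
suff [d d0 Hd] : exists2 d : R, 0 < d &
    forall x t, closure D x -> [set t : V | dotp t t = 1] t -> P d x t.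
  by exists d => // x t clx tt; exact: Hd.
have [B B0 HB] := closure_box.
apply: (compact_uniform2 compact_closure compact_sphere) => x t clx tt.
(* By compactness it suffices to argue near one pair (x, t). If some point [y0] is higher than [x],
   the cap condition fails for all nearby pairs when [d] is small. Otherwise [x] is a boundary point
   of maximal height and the boundary is transversal to [t] there. *)
have [[y0 Dy0 hy0]|hmax] := pselect (exists2 y, D y & dotp x t < dotp y t).
  pose m := dotp y0 t - dotp x t.
  have m0 : 0 < m by rewrite subr_gt0.
  have n10 : (0 : R) < n%:R * (2 * B + 1) + n%:R + 1.
    by rewrite ltr_wpDl// addr_ge0 ?mulr_ge0 ?addr_ge0 ?mulr_ge0// ltW.
  pose r := m / (2 * (n%:R * (2 * B + 1) + n%:R + 1)).
  have r0 : 0 < r by rewrite divr_gt0// mulr_gt0.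
  exists r => // x' t' d clx' tt' xx' tt2 /andP[d0 dr] s s0 Hs.
  exfalso; have := Hs y0 Dy0.
  have E : dotp y0 t' - dotp x' t' = m + dotp (y0 - x) (t' - t) - dotp (x' - x) t'.
    by rewrite /m dotpBr !dotpBl; ring.
  have b1 : `|dotp (y0 - x) (t' - t)| <= n%:R * (2 * B * r).
    apply: dotp_le; first by rewrite mulr_ge0// ltW.
      move=> i; rewrite !mxE (le_trans (ler_normB _ _))//.
      rewrite mulr2n mulrDl !mul1r; apply: lerD; [|exact: HB].
      by apply: HB; exact: subset_closure.
    by move=> i; rewrite !mxE ltW//; exact: tt2.
  have b2 : `|dotp (x' - x) t'| <= n%:R * (r * 1).
    apply: dotp_le; first exact: ltW.
      by move=> i; rewrite !mxE ltW//; exact: xx'.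
    by move=> i; exact: unit_coord.
  have : n%:R * (2 * B * r) + n%:R * (r * 1) + r < m.
    have -> : n%:R * (2 * B * r) + n%:R * (r * 1) + r = (n%:R * (2 * B) + n%:R + 1) * r by ring.
    rewrite /r [ltLHS]mulrA ltr_pdivrMr ?mulr_gt0//.
    rewrite [ltRHS]mulrC ltr_pM2r//.
    have : (0 : R) <= n%:R by [].
    have : 0 <= n%:R * (2 * B + 1) :> R by rewrite mulr_ge0// addr_ge0 ?mulr_ge0// ltW.
    move: B0 => ? ? ?; nra.
  move: b1 b2; rewrite !ler_norml => /andP[b1 b1'] /andP[b2 b2']; move: b2' b1 s0 dr E; lra_goal.
have {}hmax y : D y -> dotp y t <= dotp x t.
  by move=> Dy; rewrite leNgt; apply/negP => h; apply: hmax; exists y.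
have bx : bd D x.
  apply/bdE; split => // Dx; have [r r0 Hr] := line_near t oD Dx.
  have := hmax _ (Hr (r / 2) ltac:(by rewrite gtr0_norm ?divr_gt0// ltr_pdivrMr// ltr_pMr// ltr1n)).
  by rewrite dotpDl dotpZl tt mulr1 gerDr leNgt divr_gt0.
have [W [rho [g [oW Wx cW [rx gg W1 W2 W3]]]]] := boundary_chart bx.
have tg := extremal_transversal oW Wx cW rx W1 gg tt hmax.
pose a := dotp t (\row_i g i x).
have [M M1 HM] : exists2 M, 1 <= M & forall i, `|g i x| <= M.
  exists (1 + \sum_i `|g i x|); first by rewrite lerDl sumr_ge0.
  by move=> i; rewrite (bigD1 i)//= addrCA lerDl addr_ge0// sumr_ge0.
pose q := Num.min 1 (a / (2 * n%:R * (M + 2) + 1)).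
have den : (0 : R) < 2 * n%:R * (M + 2) + 1 by rewrite ltr_wpDl// mulr_ge0 ?mulr_ge0//; lra.
have q0 : 0 < q by rewrite lt_min ltr01 divr_gt0.
have : nbhs x (W `&` [set z | forall i, `|g i x - g i z| < q]).
  apply: filterI; first exact: open_nbhs_nbhs.
  have Hi i : \forall z \near x, `|g i x - g i z| < q.
    have [_ c _] := cW; have := c i x Wx; rewrite /prop_for /continuous_at => /cvgrPdist_lt.
    by apply.
  exact: (@filter_forall _ _ (fun i z => `|g i x - g i z| < q) (nbhs x) _ Hi).
move=> /nbhs_cubeP[r1 r10 Hr1].
pose r := Num.min (r1 / 4) q.
have r0 : 0 < r by rewrite lt_min q0 divr_gt0.
exists r => // x' t' d clx' tt' xx' tt2 /andP[d0 dr] s s0 Hs.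
(* The cap condition extends to the closure, in particular to [x'] itself. Hence the reflection
   moves [x'] by at most 2 d, and the segment stays in the chart. *)
have sd : s <= d.
  have : closure [set y | dotp y t' <= dotp x' t' - s + d] x' by apply: closureS clx'.
  have /closure_id <- := @closed_halfspace R n t' (dotp x' t' - s + d).
  by rewrite /= -subr_ge0 => ?; lra.
have rr1 : r <= r1 / 4 by rewrite ge_min lexx.
have rq : r <= q by rewrite ge_min lexx orbT.
have seg (w : R) : 0 <= w <= 1 -> cube x r1 (w *: (x' - (2 * s) *: t' - x') + x').
  move=> /andP[w0 w1] i.
  have -> : (w *: (x' - (2 * s) *: t' - x') + x') ord0 i - x ord0 i =
      (x' ord0 i - x ord0 i) - w * (2 * s) * t' ord0 i by rewrite !mxE; ring.
  apply: le_lt_trans (ler_normB _ _) _.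
  have h1 := xx' i; have h2 : `|w * (2 * s) * t' ord0 i| <= 2 * s.
    rewrite !normrM (ger0_norm w0) (gtr0_norm s0) ger0_norm//.
    rewrite -[leRHS]mulr1; apply: ler_pM => //; [by rewrite !mulr_ge0// ltW| |exact: unit_coord].
    by rewrite ler_piMl// mulr_ge0// ltW.
  move: h2 rr1 sd h1 s0 dr; lra_goal.
have segW (w : R) : 0 <= w <= 1 -> W (w *: (x' - (2 * s) *: t' - x') + x').
  by move=> /seg /Hr1[].
have [w /andP[w0 w1] E] := C1_segment oW cW segW.
have w01 : 0 <= w <= 1 by rewrite !ltW.
have [Wz gz] := Hr1 _ (seg w w01); set z := w *: _ + x' in E Wz gz.
have Wx' : W x'.
  by have := segW 0; rewrite scale0r add0r; apply; rewrite lexx ler01.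
have Wy : W (x' - (2 * s) *: t').
  by have := segW 1; rewrite scale1r subrK; apply; rewrite lexx ler01.
apply: W1 => //.
(* On the short segment [t'] is close to [t] and the gradient close to that at [x], so the
   transversality constant [a] survives: the defining function strictly decreases from its
   nonpositive value at [x'], which puts the image in [D]. *)
have pos : 0 < \sum_i t' ord0 i * g i z.
  have -> : \sum_i t' ord0 i * g i z = a + dotp (t' - t) (\row_i g i x) + dotp t' (\row_i (g i z - g i x)).
    rewrite /a dotpBl addrCA subrr addr0 /dotp -big_split/=.
    by apply: eq_bigr => i _; rewrite !mxE; ring.
  have b1 : `|dotp (t' - t) (\row_i g i x)| <= n%:R * (r * M).
    apply: dotp_le; first exact: ltW.
      by move=> i; rewrite !mxE ltW//; exact: tt2.
    by move=> i; rewrite mxE.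
  have b2 : `|dotp t' (\row_i (g i z - g i x))| <= n%:R * (1 * q).
    apply: dotp_le => //; first by move=> i; exact: unit_coord.
    by move=> i; rewrite mxE distrC ltW//; exact: gz.
  have qa : q * (2 * n%:R * (M + 2) + 1) <= a by rewrite -ler_pdivlMr// ge_min lexx orbT.
  have n0 : (0 : R) <= n%:R by [].
  have rM : n%:R * (r * M) <= n%:R * (q * M) by rewrite ler_wpM2l// ler_wpM2r//; move: M1; lra_goal.
  have : 0 <= n%:R * (q * M) by rewrite !mulr_ge0 ?(ltW q0)//; move: M1; lra_goal.
  have : 0 <= n%:R * q by rewrite mulr_ge0// ltW.
  move: b1 b2; rewrite !ler_norml => /andP[b1 _] /andP[b2 _]; nra.
have E2 : rho (x' - (2 * s) *: t') - rho x' = - (2 * s) * \sum_i t' ord0 i * g i z.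
  rewrite E mulr_sumr; apply: eq_bigr => i _; rewrite !mxE; ring.
have r3 := W3 _ Wx' clx'.
have : 0 < (2 * s) * \sum_i t' ord0 i * g i z by rewrite mulr_gt0// mulr_gt0.
move: r3 E2; lra_goal.
Qed.

(** A point close to a boundary point inherits its supporting direction up to an error [d]; by
    compactness of the boundary one radius serves for all, and [K] is what remains of the
    closure. *)
Lemma supporting_collar (d : R) : 0 < d -> exists K : set V, [/\ compact K, K `<=` D &
  forall x, D x -> ~ K x -> exists2 t, dotp t t = 1 & forall y, D y -> dotp y t <= dotp x t + d].
Proof.
move=> d0; have cbd : compact (bd D).
  have -> : bd D = closure D `&` ~` D.
    by apply/seteqP; split => x /bdE.
  apply: compact_closedI; [exact: compact_closure|exact: open_closedC].
have [r r0 Hr] : exists2 r : R, 0 < r & forall b x, bd D b -> cube b r x ->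
    bd D b -> exists2 t, dotp t t = 1 & forall y, D y -> dotp y t <= dotp x t + d.
  apply: (compact_uniform cbd) => b bb.
  pose r := d / (n%:R + 1).
  have r0 : 0 < r by rewrite divr_gt0// ltr_wpDl.
  have [t tt ht] := supporting_normal bb.
  exists r => // _ x _ bx _; exists t => // y Dy; apply: le_trans (ht y Dy) _.
  rewrite -lerBlDl -dotpBl; apply: le_trans (ler_norm _) _.
  apply: (@le_trans _ _ (n%:R * (r * 1))).
    apply: dotp_le; [exact: ltW| |by move=> i; exact: unit_coord].
    by move=> i; rewrite !mxE distrC ltW//; exact: bx.
  by rewrite mulr1 /r mulrA ler_pdivrMr ?ltr_wpDl// mulrC ler_pM2l// lerDl.
pose K := closure D `&` ~` (\bigcup_(b in bd D) cube b r).
exists K; split.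
- apply: compact_closedI; first exact: compact_closure.
  by apply: open_closedC; apply: bigcup_open => b _; exact: open_cube.
- move=> x [clx nx]; apply: contrapT => nDx; apply: nx; exists x; first exact/bdE.
  by move=> i; rewrite subrr normr0.
move=> x Dx nK; have : (\bigcup_(b in bd D) cube b r) x.
  apply: contrapT => h; apply: nK; split => //; exact: subset_closure.
by move=> [b hb xb]; exact: (Hr b x hb xb hb).
Qed.

End convex_domains.

(** * Composition with affine maps and reflections *)

Section affine_composition.
Context {R : realType} {n : nat}.
Local Notation V := 'rV[R]_n.
Implicit Types (D : set V) (f : V -> R) (x t : V) (A : 'M[R]_n) (b : V).

Lemma continuous_affine A b x : {for x, continuous (fun x : V => x *m A + b)}.
Proof.
apply: continuous_rV => j.
rewrite (_ : (fun y : V => _) = (fun y : V => \sum_k y ord0 k * A k j + b ord0 j)); last first.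
  by apply/funext => y; rewrite !mxE.
have H : C0 setT (fun y : V => \sum_k y ord0 k * A k j + b ord0 j).
  apply: C0D; last exact: C0_cst.
  apply: C0_sum => k; apply: C0M; first exact: C0_coord.
  exact: (@C0_cst R n setT (A k j)).
exact: (H x I).
Qed.

Lemma C0_affine D D' f A b : C0 D f -> (forall x, D' x -> D (x *m A + b)) ->
  C0 D' (fun x => f (x *m A + b)).
Proof.
move=> cf DD x Dx; apply: (@continuous_comp _ _ _ (fun y : V => y *m A + b) f).
  exact: continuous_affine.
exact: cf (DD x Dx).
Qed.

Lemma C1_affine_mx D D' f df A b : open D -> C1 D f df -> (forall x, D' x -> D (x *m A + b)) ->
  C1 D' (fun x => f (x *m A + b)) (fun i x => \sum_j A i j * df j (x *m A + b)).
Proof.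
move=> oD cf DD; have [c0 c1 _] := cf; split.
- exact: C0_affine c0 DD.
- move=> i; apply: C0_sum => j; apply: C0M; first exact: (@C0_cst R n D' (A i j)).
  exact: C0_affine (c1 j) DD.
move=> i x Dx; apply/is_derive_line.
rewrite (_ : (fun s : R => _) = (fun s : R => f (s *: (ebase i *m A) + (x *m A + b)))); last first.
  by apply/funext => s; rewrite mulmxDl -scalemxAl addrA.
have := (is_derive_line _ _ _ _).1 (C1_dir (ebase i *m A) oD cf (DD x Dx)).
by move=> H; apply: (is_derive_eq H); apply: eq_bigr => j _; rewrite -rowE mxE.
Qed.

Lemma C2_affine_mx D D' f df d2f A b : open D -> C2 D f df d2f ->
  (forall x, D' x -> D (x *m A + b)) ->
  C2 D' (fun x => f (x *m A + b)) (fun i x => \sum_j A i j * df j (x *m A + b))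
    (fun i k x => \sum_j A i j * \sum_l A k l * d2f j l (x *m A + b)).
Proof.
move=> oD [cf cdf] DD; split; first exact: C1_affine_mx cf DD.
by move=> i; apply: C1_sum => j; apply: C1Z; exact: C1_affine_mx (cdf j) DD.
Qed.

Definition refl t (m : R) x : V := x - (2 * (dotp x t - m)) *: t.

Definition refl_mx t : 'M[R]_n := \matrix_(i, j) ((i == j)%:R - 2 * t ord0 i * t ord0 j).

Lemma reflE t m x : refl t m x = x *m refl_mx t + (2 * m) *: t.
Proof.
apply/rowP => j; rewrite !mxE.
under eq_bigr do rewrite mxE mulrBr.
rewrite sumrB (bigD1 j)//= eqxx mulr1 big1 ?addr0; last first.
  by move=> i ij; rewrite (negPf ij) mulr0.
have -> : \sum_i x ord0 i * (2 * t ord0 i * t ord0 j) = 2 * dotp x t * t ord0 j.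
  rewrite /dotp mulr_sumr mulr_suml; apply: eq_bigr => i _; ring.
ring.
Qed.

Lemma refl_mx_orth t j l : dotp t t = 1 ->
  \sum_i refl_mx t i j * refl_mx t i l = (j == l)%:R.
Proof.
move=> tt; under eq_bigr do rewrite !mxE.
have -> : \sum_i ((i == j)%:R - 2 * t ord0 i * t ord0 j) * ((i == l)%:R - 2 * t ord0 i * t ord0 l) =
   \sum_i (i == j)%:R * ((i == l)%:R - 2 * t ord0 i * t ord0 l)
   - 2 * t ord0 j * (\sum_i (i == l)%:R * t ord0 i)
   + 4 * t ord0 j * t ord0 l * dotp t t.
  rewrite /dotp !mulr_sumr -sumrB -big_split/=; apply: eq_bigr => i _; ring.
have D1 (k : 'I_n) (F : 'I_n -> R) : \sum_i (i == k)%:R * F i = F k.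
  by rewrite (bigD1 k)//= eqxx mul1r big1 ?addr0// => i ik; rewrite (negPf ik) mul0r.
rewrite !D1 tt; ring.
Qed.

(** The Laplacian commutes with the reflection because the matrix [refl_mx] is orthogonal: summing
    the second derivatives over [i] contracts two of its columns. *)
Lemma refl_C2 D D' f df d2f t m : open D -> C2 D f df d2f -> dotp t t = 1 ->
  (forall x, D' x -> D (refl t m x)) -> exists dg d2g,
  C2 D' (fun x => f (refl t m x)) dg d2g /\
  forall x, lap d2g x = lap d2f (refl t m x).
Proof.
move=> oD cf tt DD.
have DD' x : D' x -> D (x *m refl_mx t + (2 * m) *: t) by rewrite -reflE; exact: DD.
have H := C2_affine_mx oD cf DD'.
have E : (fun x => f (refl t m x)) = (fun x => f (x *m refl_mx t + (2 * m) *: t)).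
  by apply/funext => x; rewrite reflE.
rewrite E; do 2 eexists; split; first exact: H.
move=> x; rewrite /lap reflE; set z := x *m _ + _.
have -> : \sum_i \sum_j refl_mx t i j * \sum_l refl_mx t i l * d2f j l z =
   \sum_j \sum_l (\sum_i refl_mx t i j * refl_mx t i l) * d2f j l z.
  rewrite exchange_big /=; apply: eq_bigr => j _.
  under eq_bigr do rewrite mulr_sumr.
  rewrite exchange_big /=; apply: eq_bigr => l _.
  by rewrite mulr_suml; apply: eq_bigr => i _; rewrite mulrA.
apply: eq_bigr => j _; under eq_bigr do rewrite refl_mx_orth//.
rewrite (bigD1 j)//= eqxx mul1r big1 ?addr0// => l lj.
by rewrite eq_sym (negPf lj) mul0r.
Qed.

Lemma continuous_refl t m x : {for x, continuous (refl t m)}.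
Proof.
rewrite (_ : refl t m = fun x => x *m refl_mx t + (2 * m) *: t); last first.
  by apply/funext => y; rewrite reflE.
exact: continuous_affine.
Qed.

Lemma compact_superlevel (Q : set V) f (e : R) : compact Q ->
  (forall x, Q x -> {for x, continuous f}) -> compact [set x | Q x /\ e <= f x].
Proof.
move=> cQ cf; have clQ : closed Q := compact_closed (@norm_hausdorff _ _) cQ.
apply: (subclosed_compact _ cQ); last by move=> x [].
move=> x clx; have Qx : Q x.
  by rewrite (closure_id Q).1//; apply: closureS clx => y [].
split => //; rewrite leNgt; apply/negP => fe.
have H : nbhs (f x) [set s | s < e].
  by apply: open_nbhs_nbhs; split; [exact: open_lt|].
by have [y [[_ /= h1] /= h2]] := clx _ (cf x Qx _ H); move: h2; rewrite ltNge h1.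
Qed.

End affine_composition.

(** * The strong maximum principle on convex open sets *)

Section strong_maximum_principle.
Context {R : realType} {n : nat}.
Local Notation V := 'rV[R]_n.
Implicit Types (S : set V) (W : V -> R) (x y : V).

Lemma sqd_triangle x y z : sqd x z <= 2 * sqd x y + 2 * sqd y z.
Proof.
rewrite /sqd !mulr_sumr -big_split/=; apply: ler_sum => i _.
have := sqr_ge0 ((z ord0 i - y ord0 i) - (y ord0 i - x ord0 i)); nra.
Qed.

Lemma compact_ball y (r : R) : compact [set x : V | sqd y x <= r].
Proof.
have c : C0 setT (fun x => sqd y x).
  apply: C0_sum => i; apply: C0X; apply: C0B; first exact: C0_coord.
  exact: (@C0_cst R n setT (y ord0 i)).
have cl : closed [set x : V | sqd y x <= r].
  apply: (@closed_comp _ _ (fun x : V => sqd y x) [set u | u <= r]); last exact: closed_le.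
  by move=> x _; exact: (c x I).
apply: (subclosed_compact cl (@compact_closed_box R n (`|r| + 1 + `|y|))).
move=> x /= xr i; have h := sqd_coord y x i.
rewrite -(subrK (y ord0 i) (x ord0 i)); apply: le_trans (ler_normD _ _) _.
apply: lerD; last exact: norm_coord_le.
rewrite -[`|_| <= _](@ler_pXn2r _ 2)// ?nnegrE ?addr_ge0// real_normK ?num_real//.
apply: (le_trans h); apply: (le_trans xr); have := ler_norm r; have := normr_ge0 r; nra.
Qed.

(* Comparison in the annulus r^2 < |x - y|^2 < 4 r^2 with a multiple of
   exp(-a |x - y|^2) - exp(-4 a r^2). *)
Lemma positivity_ball S W dW d2W y r : (0 < n)%N -> open S -> C2 S W dW d2W -> 0 < r ->
  (forall x, S x -> 0 <= W x /\ lap d2W x <= 0) ->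
  (forall x, sqd y x <= 4 * r ^+ 2 -> S x) -> (forall x, sqd y x <= r ^+ 2 -> 0 < W x) ->
  forall x, sqd y x < 4 * r ^+ 2 -> 0 < W x.
Proof.
move=> n0 oS cW r0 WS BS Wr.
have r20 : 0 < r ^+ 2 by rewrite exprn_gt0.
have BS' x : sqd y x <= r ^+ 2 -> S x by move=> h; apply: BS; lra.
have [m m0 Hm] : exists2 m : R, 0 < m & forall x, sqd y x <= r ^+ 2 -> m <= W x.
  have c : forall x, [set x | sqd y x <= r ^+ 2] x -> {for x, continuous (fun x => (W x)^-1)}.
    move=> x /= xr; have Sx := BS' x xr; apply: (@continuous_comp _ _ _ W (fun s : R => s^-1)).
      exact: ((C2_C0 cW) x Sx).
    by apply: inv_continuous; rewrite gt_eqF// Wr.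
  have [M M0 HM] := continuous_bounded_on (@compact_ball y (r ^+ 2)) c.
  exists M^-1 => [|x xr]; first by rewrite invr_gt0.
  have w0 := Wr x xr; have := HM x xr; rewrite ger0_norm; last by rewrite invr_ge0 ltW.
  by move=> h; rewrite -[W x]invrK lef_pV2 ?posrE ?invr_gt0.
(* For s = |x - y|^2 the Laplacian of exp(-a s) is (4 a^2 s - 2 a n) exp(-a s); with this [a] it is
   positive as soon as s > r^2, that is, in the whole annulus. *)
pose a : R := n%:R / r ^+ 2; have nR : (0 : R) < n%:R by rewrite ltr0n.
have a0 : 0 < a by rewrite divr_gt0.
pose c0 := expR (- (a * (4 * r ^+ 2))).
pose h (s : R) := m * (expR (- (a * s)) - c0).
pose h1 (s : R) := m * (- a * expR (- (a * s))).
pose h2 (s : R) := m * (a ^+ 2 * expR (- (a * s))).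
have da s : is_derive s (1 : R) (fun s : R => - (a * s)) (- a).
  apply: (is_derive_eq (is_deriveN (is_deriveZ a (is_derive_id s (1 : R))))).
  by rewrite [_ *: 1]mulr1.
have de s : is_derive s (1 : R) (fun s : R => expR (- (a * s))) (- a * expR (- (a * s))).
  by apply: (is_derive_eq (is_derive_compR (da s) (is_derive_expR _))); rewrite mulrC.
have dh s : is_derive s (1 : R) h (h1 s).
  apply: (is_derive_eq (is_deriveZ m (is_deriveB (de s) (is_derive_cst c0 s (1 : R))))).
  by rewrite subr0.
have dh1 s : is_derive s (1 : R) h1 (h2 s).
  apply: (is_derive_eq (is_deriveZ m (is_deriveZ (- a) (de s)))).
  by rewrite /h2 /GRing.scale /=; ring.
have ce s : {for s, continuous (fun s : R => expR (- (a * s)))}.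
  by have [d _] := de s; apply: differentiable_continuous; exact/derivable1_diffP.
have ch2 : continuous h2.
  move=> s; apply: cvgM; first exact: cvg_cst.
  by apply: cvgM; [exact: cvg_cst|exact: ce].
have cb := C2_comp (C2_sqd y 0) (fun x _ => dh _) (fun x _ => dh1 _) (fun x _ => ch2 _).
pose A := [set x : V | r ^+ 2 < sqd y x < 4 * r ^+ 2].
have csq : C0 setT (fun x => sqd y x + 0) := C2_C0 (C2_sqd y 0).
have oA : open A.
  have -> : A = (fun x => sqd y x + 0) @^-1` [set s | r ^+ 2 < s < 4 * r ^+ 2].
    by apply/seteqP; split => x /=; rewrite /A /= addr0.
  apply: open_comp; first by move=> x _; exact: csq x I.
  have -> : [set s : R | r ^+ 2 < s < 4 * r ^+ 2] = [set s | r ^+ 2 < s] `&` [set s | s < 4 * r ^+ 2].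
    by apply/seteqP; split => s /=; [move=> /andP[]|move=> [-> ->]].
  by apply: openI; [exact: open_gt|exact: open_lt].
have AS : A `<=` S by move=> x /andP[_ /ltW]; exact: BS.
have cf := C2B (C2S (@subsetT _ S) cb) cW.
have fle x : sqd y x <= r ^+ 2 \/ sqd y x = 4 * r ^+ 2 -> h (sqd y x + 0) - W x <= 0.
  rewrite addr0 => -[hx|hx].
    rewrite subr_le0; apply: le_trans (Hm x hx); rewrite /h ler_piMr ?(ltW m0)//.
    rewrite lerBlDr; apply: (@le_trans _ _ 1); last by rewrite lerDl expR_ge0.
    by rewrite expR_le1 oppr_le0 mulr_ge0 ?(ltW a0)// sqd_ge0.
  rewrite /h hx subrr mulr0 sub0r oppr_le0.
  by have [] := WS x (BS x ltac:(by rewrite hx)).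
have vA : vanb A (fun x => h (sqd y x + 0) - W x).
  move=> e e0.
  have cQ := @compact_superlevel R n _ (fun x => h (sqd y x + 0) - W x) e (@compact_ball y (4 * r ^+ 2)).
  rewrite (_ : mkset _ = [set x | [set x | sqd y x <= 4 * r ^+ 2] x /\ e <= h (sqd y x + 0) - W x]).
    by apply: cQ => x /BS Sx; exact: (C2_C0 cf).
  apply/seteqP; split => x /= [hx ex]; split => //; first by case/andP: hx => _ /ltW.
  have ne := fle x; apply/andP; split.
    by rewrite ltNge; apply/negP => h'; have := ne (or_introl h'); lra.
  by rewrite lt_neqAle hx andbT; apply/eqP => h'; have := ne (or_intror h'); lra.
have MP := weak_max_principle oA (C2S AS cf) vA _.
have {}MP x : A x -> h (sqd y x + 0) - W x <= 0.
  apply: MP => z Az _; have [_ lW] := WS z (AS z Az).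
  have -> : lap (fun i j x => (h1 (sqd y x + 0) * (2 * (i == j)%:R) +
      (2 * (x ord0 i - y ord0 i)) * (h2 (sqd y x + 0) * (2 * (x ord0 j - y ord0 j)))) - d2W i j x) z =
      radial_lap n 0 h1 h2 (sqd y z + 0) - lap d2W z.
    by rewrite -lap_radial /lap sumrB.
  rewrite subr_gt0; apply: le_lt_trans lW _; rewrite /radial_lap /h1 /h2 !addr0 !subr0.
  have E0 := expR_gt0 (- (a * sqd y z)); set E := expR _ in E0 *.
  have as_ : n%:R < a * sqd y z.
    rewrite /a mulrAC ltr_pdivlMr// ltr_pM2l//; by case/andP: Az.
  have : 0 < m * E * a * (4 * (a * sqd y z) - 2 * n%:R).
    have q : 0 < 4 * (a * sqd y z) - 2 * n%:R.
      by move: as_ nR; move: (a * sqd y z) (n%:R : R) => w N; lra.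
    by apply: mulr_gt0 => //; apply: mulr_gt0 => //; exact: mulr_gt0.
  move=> h'; apply: lt_le_trans h' _; rewrite le_eqVlt; apply/orP; left; apply/eqP; ring.
move=> x x4; have [xr|xr] := leP (sqd y x) (r ^+ 2); first exact: Wr.
have := MP x ltac:(by rewrite /A /= xr x4); rewrite subr_le0 addr0; apply: lt_le_trans.
by rewrite /h mulr_gt0// subr_gt0 ltr_expR ltrN2 ltr_pM2l.
Qed.

(** Positivity spreads from a ball of radius r to the concentric ball of radius 2 r, so it travels
    along a chain of balls centred on the segment from [y] to [x], with r fixed by the distance of
    the segment to the complement of [S] and by the first ball. *)
Lemma strong_max_principle S W dW d2W : (0 < n)%N -> open S -> C2 S W dW d2W ->
  (forall x y (s : R), S x -> S y -> 0 <= s <= 1 -> S (s *: (y - x) + x)) ->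
  (forall x, S x -> 0 <= W x /\ lap d2W x <= 0) ->
  forall y x, S y -> 0 < W y -> S x -> 0 < W x.
Proof.
move=> n0 oS cW cvS WS y x Sy Wy Sx.
pose K := (fun s : R => s *: (x - y) + y) @` `[0, 1].
have cK : compact K.
  apply: continuous_compact; last exact: segment_compact.
  apply: continuous_subspaceT => s; apply: continuous_rV => j.
  rewrite (_ : (fun s : R => _) = (fun s : R => s * (x ord0 j - y ord0 j) + y ord0 j)); last first.
    by apply/funext => q; rewrite !mxE.
  by apply: cvgD; [apply: cvgM; [exact: cvg_id|exact: cvg_cst]|exact: cvg_cst].
have KS : K `<=` S by move=> _ [s /= s01 <-]; apply: cvS => //; move: s01; rewrite in_itv.
have [q q0 Hq] := compact_cube_sub cK oS KS.
have : nbhs y (S `&` [set z | 0 < W z]).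
  apply: filterI; first exact: open_nbhs_nbhs.
  have H : nbhs (W y) [set s | 0 < s] by apply: open_nbhs_nbhs; split; [exact: open_gt|].
  exact: ((C2_C0 cW) y Sy _ H).
move=> /nbhs_cubeP[q' q'0 Hq'].
pose r := Num.min q q' / 4.
have m0 : 0 < Num.min q q' by rewrite lt_min q0.
have r0 : 0 < r by rewrite divr_gt0.
have rq : 2 * r < q.
  have : Num.min q q' <= q by rewrite ge_min lexx.
  rewrite /r; lra.
have rq' : r < q'.
  have : Num.min q q' <= q' by rewrite ge_min lexx orbT.
  rewrite /r; lra.
have ballc z w (c : R) : 0 <= c -> sqd z w <= c ^+ 2 -> forall i, `|w ord0 i - z ord0 i| <= c.
  move=> c0 h i; rewrite -[`|_| <= _](@ler_pXn2r _ 2)// ?nnegrE// real_normK ?num_real//.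
  exact: le_trans (sqd_coord z w i) h.
(* So many steps that consecutive centres are closer than r; the next ball of radius r then lies
   inside the doubled previous one. *)
have [N HN] : exists N : nat, sqd y x < (N.+1%:R * r) ^+ 2.
  have e0 : 0 < r / (sqd y x + 1) by rewrite divr_gt0// ltr_wpDl// sqd_ge0.
  have [N hN] := natSinv_lt_ex e0.
    exists N; have N1 : (1 : R) <= N.+1%:R by rewrite ler1n.
    have s0 := sqd_ge0 y x.
    move: hN; rewrite invf_plt ?posrE ?ltr0n ?divr_gt0 ?ltr_wpDl// invf_div ltr_pdivrMr// => hN.
    have h1 : sqd y x + 1 < N.+1%:R * r by [].
    nra.
pose p (k : nat) := (k%:R / N.+1%:R) *: (x - y) + y.
have N0 : (0 : R) < N.+1%:R by rewrite ltr0n.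
have Kp k : (k <= N.+1)%N -> K (p k).
  move=> kN; exists (k%:R / N.+1%:R) => //; rewrite /= in_itv /= divr_ge0//=.
  by rewrite ler_pdivrMr// mul1r ler_nat.
have pS k : sqd (p k) (p k.+1) < r ^+ 2.
  have -> : sqd (p k) (p k.+1) = N.+1%:R ^- 2 * sqd y x.
    rewrite /sqd mulr_sumr; apply: eq_bigr => i _; rewrite !mxE -natr1.
    by field; rewrite ?gt_eqF.
  by rewrite ltr_pdivrMl ?exprn_gt0// -exprMn.
have main k : (k <= N.+1)%N -> forall z, sqd (p k) z <= r ^+ 2 -> 0 < W z.
  elim: k => [|k IH] kN z zr.
    have zc : cube y q' z.
      move=> i; apply: le_lt_trans rq'; apply: ballc; [exact: ltW|].
      by move: zr; rewrite /p mul0r scale0r add0r.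
    by have [] := Hq' z zc.
  apply: (positivity_ball n0 oS cW r0 WS (y := p k)).
  - move=> w hw; apply: (Hq (p k) w); first by apply: Kp; exact: ltnW.
    move=> i; apply: le_lt_trans rq; apply: ballc; first by rewrite mulr_ge0// ltW.
    by rewrite exprMn -natrX.
  - by apply: IH; exact: ltnW.
  - have := sqd_triangle (p k) (p k.+1) z; have := pS k; lra.
apply: (main N.+1) => //; rewrite /p mulfV ?gt_eqF// scale1r subrK.
by rewrite /sqd big1 ?exprn_ge0 ?ltW// => i _; rewrite subrr expr0n.
Qed.

End strong_maximum_principle.

(** * Maximum principle for systems on sets of small measure *)

Section small_domains.
Context {R : realType} {n : nat} (D : set 'rV[R]_n).
Local Notation V := 'rV[R]_n.
Hypotheses (oD : open D) (bD : bounded_set D).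
Implicit Types (E : set V) (f g : V -> R) (x y : V).

Lemma sub_bounded E : E `<=` D -> bounded_set E.
Proof. by move=> ED; have [M [Mr HM]] := bD; exists M; split => // N MN x /ED; exact: HM. Qed.

Lemma BC_sub E f : E `<=` D -> BC D f -> BC E f.
Proof. by move=> ED [cf [M HM]]; split; [exact: C0S cf|exists M => x /ED; exact: HM]. Qed.

(** With k = n/2 - 1/2, still integrable, the kernel is at most e1 T^(-k) where T <= e1^2 and at
    most a constant elsewhere. The first part is small by the choice of [e1], the second by the
    smallness of the measure. *)
Lemma small_kernel (eps : R) : (2 < n)%N -> 0 < eps -> exists2 eta : R, 0 < eta &
  forall E, open E -> E `<=` D -> fine (lebesgue_rV n E) <= eta -> forall a, D a ->
  forall e : R, 0 < e <= 1 -> itg E (fun x => (sqd a x + e) `^ (- (n%:R / 2 - 1))) <= eps.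
Proof.
move=> n2 eps0; have n3 : (3 : R) <= n%:R by rewrite ler_nat.
pose k : R := n%:R / 2 - 1 / 2.
have k0 : 0 <= k by rewrite /k; lra.
have kn : k < n%:R / 2 by rewrite /k; lra.
have [CT CT0 HT] := itg_radial_powR oD bD k0 kn.
pose e1 := eps / (2 * CT); have e10 : 0 < e1 by rewrite divr_gt0// mulr_gt0.
pose C := (e1 ^+ 2) `^ (- (n%:R / 2 - 1)).
have C0 : 0 < C by rewrite powR_gt0// exprn_gt0.
exists (eps / (2 * C)); first by rewrite divr_gt0// mulr_gt0.
move=> E oE ED mE a Da e /andP[e0 _].
have bE := sub_bounded ED.
have tk := twice_derivable_powR (- k : R).
have tb := twice_derivable_powR (- (n%:R / 2 - 1) : R).
have bk := BC_radial bD a e0 tk; have bb := BC_radial bD a e0 tb.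
have bkE := BC_sub ED bk; have bbE := BC_sub ED bb.
apply: (@le_trans _ _ (itg E (fun x => e1 * (sqd a x + e) `^ (- k) + C))).
  apply: itg_le => //; first by apply: BCD; [exact: BCZ|exact: BC_cst].
  move=> x Ex; have t0 : 0 < sqd a x + e by rewrite ltr_wpDl// sqd_ge0.
  set t := sqd a x + e in t0 *.
  have [h|h] := leP t (e1 ^+ 2).
    apply: (@le_trans _ _ (e1 * t `^ (- k))); last by rewrite lerDl ltW.
    have -> : - (n%:R / 2 - 1) = 2^-1 + - k :> R by rewrite /k; field.
    rewrite powRD ?(gt_eqF t0) ?implybT// ler_wpM2r ?powR_ge0//.
    rewrite powR12_sqrt ?(ltW t0)// -[e1]gtr0_norm// -sqrtr_sqr.
    by rewrite ler_sqrt// sqr_ge0.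
  apply: (@le_trans _ _ C); last by rewrite lerDr mulr_ge0 ?(ltW e10)// powR_ge0.
  rewrite /C !powRN lef_pV2 ?posrE ?powR_gt0// ?exprn_gt0//.
  by rewrite ge0_ler_powR ?nnegrE ?(ltW t0) ?(ltW h) ?exprn_ge0 ?(ltW e10)//; lra.
rewrite itgD ?itgZ//; [|exact: BCZ|exact: BC_cst].
rewrite (itg_cst oE).
have h1 : itg E (fun x => (sqd a x + e) `^ (- k)) <= CT.
  apply: le_trans (HT a e Da e0); apply: itg_subset => // x _; exact: powR_ge0.
have h2 : e1 * itg E (fun x => (sqd a x + e) `^ (- k)) <= eps / 2.
  apply: le_trans (ler_wpM2l (ltW e10) h1) _.
  by rewrite /e1 le_eqVlt; apply/orP; left; apply/eqP; field; rewrite gt_eqF.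
have h3 : C * fine (lebesgue_rV n E) <= eps / 2.
  apply: le_trans (ler_wpM2l (ltW C0) mE) _.
  by rewrite le_eqVlt; apply/orP; left; apply/eqP; field; rewrite gt_eqF.
lra.
Qed.

Lemma vanb_sup E f : C0 E f -> vanb E f -> exists2 A : R, 0 <= A &
  (forall x, E x -> f x <= A) /\ (0 < A -> exists2 a, E a & f a = A).
Proof.
move=> cf vf; have [[x1 Ex1 fx1]|h] := pselect (exists2 x, E x & 0 < f x).
  have [a [Ea fa amax]] := vanb_max cf vf Ex1 fx1.
  by exists (f a); [exact: ltW|split => // _; exists a].
exists 0 => //; split; last by rewrite ltxx.
by move=> x Ex; rewrite leNgt; apply/negP => fx; apply: h; exists x.
Qed.

(** Let A and B be the suprema of the positive parts of [f] and [g]. On a set of small measure the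
    potential bound gives A <= B/2 and B <= A/2, so both vanish; no condition on the shape of the
    set enters. *)
Lemma small_maximum_principle (Lip : R) : (2 < n)%N -> 0 <= Lip -> exists2 eta : R, 0 < eta &
  forall E, open E -> E `<=` D -> fine (lebesgue_rV n E) <= eta ->
  forall f df d2f g dg d2g, C2 E f df d2f -> C2 E g dg d2g -> vanb E f -> vanb E g ->
  BC E f -> BC E g -> (forall x, E x -> 0 < f x -> - lap d2f x <= tpos (g x)) ->
  (forall x, E x -> 0 < g x -> - lap d2g x <= Lip * tpos (f x)) ->
  forall x, E x -> f x <= 0 /\ g x <= 0.
Proof.
move=> n2 L0; have n3 : (3 : R) <= n%:R by rewrite ler_nat.
pose c : R := n%:R * (n%:R - 2) * @mass_cst R n 1 / 2.
have c0 : 0 < c by rewrite divr_gt0// !mulr_gt0 ?mass_cst_gt0//; lra.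
pose eps := c / (2 * (1 + Lip)).
have eps0 : 0 < eps by rewrite divr_gt0// mulr_gt0//; lra.
have [eta eta0 H] := small_kernel n2 eps0.
exists eta => // E oE ED mE f df d2f g dg d2g cf cg vf vg bf bg ef eg.
have bE := sub_bounded ED.
have [A A0 [fA hA]] := vanb_sup (C2_C0 cf) vf.
have [B B0 [gB hB]] := vanb_sup (C2_C0 cg) vg.
have tposA (h : V -> R) (M x : R) : 0 <= M -> x <= M -> tpos x <= M.
  by move=> M0 xM; have [x0|x0] := leP 0 x; [rewrite tpos_pos|rewrite tpos_neg// ltW].
have main h dh d2h q M q1 : C2 E h dh d2h -> vanb E h -> BC E h -> BC E q -> 0 <= M ->
    (forall x, E x -> 0 <= q x <= M) -> (forall x, E x -> 0 < h x -> - lap d2h x <= q x) ->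
    E q1 -> c * h q1 <= M * eps.
  move=> ch vh bh bq M0 qM eh Ea.
  have -> : c * h q1 = n%:R * (n%:R - 2) * @mass_cst R n 1 * (h q1 / 2) by rewrite /c; field.
  apply: (second_order_bound oE bE n2 ch vh (BC_tpos bh) bq _ eh Ea).
    by move=> x /qM /andP[].
  move=> e e01; have /andP[e0 _] := e01.
  have tb := twice_derivable_powR (- (n%:R / 2 - 1) : R).
  have bb := BC_radial bE q1 e0 tb.
  apply: (@le_trans _ _ (M * itg E (fun x => (sqd q1 x + e) `^ (- (n%:R / 2 - 1))))).
    rewrite -itgZ//; apply: itg_le => //; [exact: BCM|exact: BCZ|move=> x Ex].
    by rewrite ler_wpM2r ?powR_ge0//; case/andP: (qM x Ex).
  by rewrite ler_wpM2l//; apply: H => //; exact: ED.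
have cA : c * A <= B * eps.
  have [A0'|A0'] := ltP 0 A; last first.
    have -> : A = 0 by apply/eqP; rewrite eq_le A0' A0.
    by rewrite mulr0 mulr_ge0// ltW.
  have [a Ea <-] := hA A0'.
  apply: (main f df d2f (fun x => tpos (g x)) B a) => //; first exact: BC_tpos.
  by move=> x Ex; rewrite tpos_ge0 (tposA g)// gB.
have cB : c * B <= Lip * A * eps.
  have [B0'|B0'] := ltP 0 B; last first.
    have -> : B = 0 by apply/eqP; rewrite eq_le B0' B0.
    by rewrite mulr0; apply: mulr_ge0; [exact: mulr_ge0|exact: ltW].
  have [a Ea <-] := hB B0'.
  apply: (main g dg d2g (fun x => Lip * tpos (f x)) (Lip * A) a) => //.
  - by apply: BCZ; exact: BC_tpos.
  - exact: mulr_ge0.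
  - by move=> x Ex; rewrite mulr_ge0 ?tpos_ge0//= ler_wpM2l// (tposA f)// fA.
have l1 : 0 < 1 + Lip by lra.
have hz (a b d : R) : 0 < b -> a / (2 * b) * d * 2 = a * d / b by move=> b0; field; rewrite gt_eqF.
have e3 : eps * Lip * 2 <= c.
  by rewrite /eps hz// ler_pdivrMr// ler_wpM2l ?(ltW c0)//; lra_goal.
have e2 : eps * 2 <= c.
  by rewrite -[eps]mulr1 /eps hz// ler_pdivrMr// ler_wpM2l ?(ltW c0)//; move: L0; lra_goal.
have A1 : A <= B / 2.
  rewrite -(ler_pM2l c0); apply: le_trans cA _.
  by have := ler_wpM2l B0 e2; lra_goal.
have B1 : B <= A / 2.
  rewrite -(ler_pM2l c0); apply: le_trans cB _.
  by have := ler_wpM2l A0 e3; lra_goal.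
by move=> x Ex; have := fA x Ex; have := gB x Ex; split; move: H1 H0 B1 A1; lra_goal.
Qed.

Lemma small_level f (eta : R) : C0 D f -> (forall x, D x -> 0 < f x) -> 0 < eta ->
  exists2 d : R, 0 < d & fine (lebesgue_rV n [set x | D x /\ f x < d]) <= eta.
Proof.
move=> cf fp eta0; pose F (k : nat) := [set x | D x /\ f x < k.+1%:R^-1].
have oF (c : R) : open [set x | D x /\ f x < c].
  rewrite openE => x [Dx fx]; apply: filterI; first exact: open_nbhs_nbhs.
  have H : nbhs (f x) [set s | s < c] by apply: open_nbhs_nbhs; split; [exact: open_lt|].
  exact: (cf x Dx _ H).
have mF k : measurable (F k) by rewrite /F; apply: open_measurable_rV; exact: oF.
have F0 : \bigcap_k F k = set0.
  apply/seteqP; split => // x Fx; have [Dx _] := Fx 0%N I.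
  have [k hk] := natSinv_lt_ex (fp x Dx).
  by have [_] := Fx k I; rewrite ltNge (ltW hk).
have Flty k : (lebesgue_rV n (F k) < +oo)%E.
  apply: le_lt_trans (domain_lty oD bD).
  by apply: le_measure; rewrite ?inE//; [exact: domain_measurable|move=> x []].
have L := @nonincreasing_cvg_mu _ V R (lebesgue_rV n) F (Flty 0%N) mF.
have {}L : lebesgue_rV n (F k) @[k --> \oo] --> (0 : \bar R)%E.
  rewrite -(measure0 (lebesgue_rV n)) -F0; apply: L.
    by apply: bigcap_measurable => // _; exact: mF.
  move=> i j ij; apply/subsetPset => x [Dx fx]; split => //; apply: lt_le_trans fx _.
  by rewrite lef_pV2 ?posrE ?ltr0n// ler_nat.
have {}L : fine (lebesgue_rV n (F k)) @[k --> \oo] --> (0 : R) by exact: fine_cvg.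
move/cvgrPdist_lt : L => /(_ _ eta0)[k _ /(_ k (leqnn k)) /=].
rewrite sub0r normrN => hk; exists k.+1%:R^-1; first by rewrite invr_gt0 ltr0n.
by apply: ltW; apply: le_lt_trans hk; exact: ler_norm.
Qed.

(** Avoids rotating coordinates. The function d atan((x.t - m)/d) is bounded by 2 d, while its
    derivative along [t] is at least 1/2 in the slab; integrating this derivative by parts against a
    cutoff [chi] bounded below on [D] bounds the measure of the slab by a multiple of d. *)
Lemma small_slab (t : V) (m eta : R) : dotp t t = 1 -> 0 < eta ->
  exists2 d : R, 0 < d & fine (lebesgue_rV n [set x | D x /\ `|dotp x t - m| < d]) <= eta.
Proof.
move=> tt eta0; have [B B0 HB] := bounded_set_cube bD.
pose r := B + 1; have r0 : 0 < r by rewrite /r; lra.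
pose E := cube (0 : V) (r + 1).
have oE : open E := @open_cube R n 0 (r + 1).
have bE : bounded_set E := @bounded_cube R n 0 (r + 1).
have DE : D `<=` E by move=> x /HB h i; rewrite mxE subr0 (lt_trans (h i))// /r; lra.
pose z : 'I_n -> nat := fun=> 0%N.
pose chi (y : V) := moll r z (0 - y); pose dchi i (y : V) := - moll r (incr i z) (0 - y).
have cchi : C1 E chi dchi by exact: C1_moll_sub.
have schi : cs E chi.
  exists [set y : V | forall i, `|y ord0 i| <= r].
    split; first exact: compact_closed_box.
    by move=> y yr i; rewrite mxE subr0 (le_lt_trans (yr i))// ltrDl.
  move=> y _ ny; apply: moll_box => h; apply: ny => i.
  by have := h i; rewrite !mxE sub0r normrN.
have [c c0 Hc] : exists2 c : R, 0 < c & forall x, D x -> c <= chi x.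
  have cc : forall x, [set x : V | forall i, `|x ord0 i| <= B] x -> {for x, continuous (fun x => (chi x)^-1)}.
    move=> x xB; apply: (@continuous_comp _ _ _ chi (fun s : R => s^-1)).
      have [c0 _ _] := cchi; apply: c0 => i; rewrite mxE subr0 (le_lt_trans (xB i))// /r; lra.
    apply: inv_continuous; rewrite gt_eqF//; apply: prodr_gt0 => i _.
    rewrite /bump big_seq1 /bump_term expr0 mul1r /flats /= !mxE sub0r.
    have := xB i; rewrite ler_norml => /andP[h1 h2].
    by rewrite mulr_gt0// flat_gt0 ?hornerC ?mul1r ?expR_gt0// /r; lra.
  have [M M0 HM] := continuous_bounded_on (@compact_closed_box R n B) cc.
  exists M^-1 => [|x Dx]; first by rewrite invr_gt0.
  have := HM x (fun i => ltW (HB x Dx i)) => h.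
  have ch0 : 0 <= chi x by exact: moll_ge0.
  have [e0|ne] := eqVneq (chi x) 0; last first.
    have cp : 0 < chi x by rewrite lt_neqAle eq_sym ne.
    by move: h; rewrite ger0_norm ?invr_ge0// => h; rewrite -[chi x]invrK lef_pV2 ?posrE ?invr_gt0.
  exfalso; move: e0; apply/eqP; rewrite gt_eqF//; apply: prodr_gt0 => i _.
  rewrite /bump big_seq1 /bump_term expr0 mul1r /flats /= !mxE sub0r.
  have := ltW (HB x Dx i); rewrite ler_norml => /andP[h1 h2].
  by rewrite mulr_gt0// flat_gt0 ?hornerC ?mul1r ?expR_gt0// /r; move: h2 h1; lra_goal.
have bdchi i : BC E (dchi i) by apply: BCN; exact: BC_moll_sub.
have bchi : BC E chi by exact: BC_moll_sub.
have [_ [M HM]] : BC E (fun y => \sum_i t ord0 i * dchi i y).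
  by apply: BC_sum => i; exact: BCZ.
pose mE := fine (lebesgue_rV n E); have mE0 : 0 <= mE by rewrite fine_ge0.
pose d := eta * c / (4 * (`|M| * mE + 1)).
have den0 : 0 < `|M| * mE + 1 by rewrite ltr_wpDl// mulr_ge0.
have d0 : 0 < d by rewrite divr_gt0 ?mulr_gt0.
exists d => //; set S := [set x | D x /\ `|dotp x t - m| < d].
have cd : C2 setT (fun x => dotp x t + - m) _ _ := C2_dotp setT t (- m).
have oS : open S.
  have -> : S = D `&` ((fun x => dotp x t + - m) @^-1` [set s | `|s| < d]) by apply/seteqP; split.
  apply: openI => //; apply: open_comp; first by move=> x _; exact: ((C2_C0 cd) x I).
  rewrite (_ : mkset _ = [set s : R | - d < s] `&` [set s | s < d]).
    by apply: openI; [exact: open_gt|exact: open_lt].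
  by apply/seteqP; split => s /=; rewrite ltr_norml; [move=> /andP[]|move=> [? ?]; apply/andP].
pose Phi (s : R) := d * atan (s / d).
pose Phi1 (s : R) := (1 + (s / d) ^+ 2)^-1.
have dPhi s : is_derive s (1 : R) Phi (Phi1 s).
  have ds : is_derive s (1 : R) (fun s : R => s / d) d^-1.
    have := is_deriveZ d^-1 (is_derive_id s (1 : R)).
    rewrite (_ : _ \*: _ = fun s => s / d); last by apply/funext => w; rewrite /= mulrC.
    by move=> H; apply: (is_derive_eq H); rewrite [_ *: 1]mulr1.
  have H := is_deriveZ d (is_derive_compR ds (is_derive1_atan (s / d))).
  apply: (is_derive_eq H); rewrite /Phi1 /GRing.scale /=.
  by rewrite mulrCA mulfV ?mulr1// gt_eqF.
have cPhi1 : continuous Phi1.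
  move=> s; apply: (@continuous_comp _ _ _ (fun s : R => 1 + (s / d) ^+ 2) (fun s : R => s^-1)).
    apply: cvgD; first exact: cvg_cst.
    by rewrite expr2; apply: cvgM; apply: cvgM; (exact: cvg_id || exact: cvg_cst).
  by apply: inv_continuous; rewrite gt_eqF// ltr_pwDl// sqr_ge0.
have cP := C1_comp (C2_C1 cd) (fun x _ => dPhi _) (fun x _ => cPhi1 _).
have cG := C1M cchi (C1S (@subsetT _ E) cP).
have sG : cs E (fun x => chi x * Phi (dotp x t + - m)) by exact: csMl.
have G0 i := itg_grad_eq0 oE bE i cG sG.
have bPhi : BC E (fun x => Phi (dotp x t + - m)).
  have [cP0 _ _] := cP; split; first exact: C0S cP0.
  exists (2 * d) => x _; rewrite /Phi normrM gtr0_norm// mulrC ler_pM2r//.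
  have := atan_gtNpi2 ((dotp x t + - m) / d); have := atan_ltpi2 ((dotp x t + - m) / d).
  have := @pihalf_lt2 R; rewrite ler_norml; lra_goal.
have bPhi1 : BC E (fun x => Phi1 (dotp x t + - m)).
  have [_ _ _] := cP; split.
    move=> x _; apply: (@continuous_comp _ _ _ (fun x : V => dotp x t + - m) Phi1); last exact: cPhi1.
    exact: ((C2_C0 cd) x I).
  exists 1 => x _; rewrite /Phi1 ger0_norm ?invr_ge0 ?addr_ge0 ?sqr_ge0//.
  by rewrite invf_le1 ?ltr_pwDl ?sqr_ge0// lerDl sqr_ge0.
have key : itg E (fun x => chi x * Phi1 (dotp x t + - m)) <= 2 * d * (`|M| * mE).
  have bgi i : BC E (fun x => t ord0 i * (chi x * (Phi1 (dotp x t + - m) * t ord0 i) +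
      Phi (dotp x t + - m) * dchi i x)).
    apply: BCZ; apply: BCD; apply: BCM => //.
    by under eq_fun do rewrite mulrC; exact: BCZ.
  have E1 : itg E (fun x => \sum_i t ord0 i * (chi x * (Phi1 (dotp x t + - m) * t ord0 i) +
      Phi (dotp x t + - m) * dchi i x)) = 0.
    rewrite itg_sum// big1// => i _.
    rewrite itgZ//; last first.
      apply: BCD; apply: BCM => //.
      by under eq_fun do rewrite mulrC; exact: BCZ.
    by rewrite G0 mulr0.
  have E2 : itg E (fun x => chi x * Phi1 (dotp x t + - m)) =
     itg E (fun x => - (Phi (dotp x t + - m) * \sum_i t ord0 i * dchi i x)).
    apply/eqP; rewrite -subr_eq0 -itgB//.
    - rewrite -[X in _ == X]E1; apply/eqP; apply: eq_itg => x _.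
      rewrite opprK -[chi x * _]mulr1 -{1}tt /dotp mulr_sumr mulr_sumr -big_split/=.
      by apply: eq_bigr => i _; ring.
    - exact: BCM.
    - by apply: BCN; apply: BCM => //; apply: BC_sum => i; exact: BCZ.
  rewrite E2; apply: (@le_trans _ _ (itg E (fun=> 2 * d * `|M|))).
    apply: itg_le => //; [|exact: BC_cst|].
      by apply: BCN; apply: BCM => //; apply: BC_sum => i; exact: BCZ.
    move=> x Ex; apply: le_trans (ler_norm _) _; rewrite normrN normrM ler_pM//.
      rewrite /Phi normrM gtr0_norm// mulrC ler_pM2r//.
      have := atan_gtNpi2 ((dotp x t + - m) / d); have := atan_ltpi2 ((dotp x t + - m) / d).
      have := @pihalf_lt2 R; rewrite ler_norml; lra_goal.
    by rewrite (le_trans (HM x Ex))// ler_norm.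
  by rewrite (itg_cst oE) -/mE le_eqVlt; apply/orP; left; apply/eqP; ring.
have SE : S `<=` E by move=> x [/DE].
have bp : BC E (fun x => chi x * Phi1 (dotp x t + - m)) by exact: BCM.
have p0 x : E x -> 0 <= chi x * Phi1 (dotp x t + - m).
  by move=> _; rewrite mulr_ge0 ?moll_ge0// invr_ge0 addr_ge0// sqr_ge0.
have := itg_subset oE bE oS SE bp p0 => h1.
have h2 : c / 2 * fine (lebesgue_rV n S) <= itg S (fun x => chi x * Phi1 (dotp x t + - m)).
  rewrite -(itg_cst oS); apply: itg_le => //.
  - by apply: sub_bounded => x [].
  - exact: BC_cst.
  - by have [cb [M' HM']] := bp; split; [exact: C0S cb|exists M' => x /SE; exact: HM'].
  move=> x [Dx xd]; apply: ler_pM; [exact: ltW|by rewrite invr_ge0|exact: Hc|].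
  rewrite /Phi1 lef_pV2 ?posrE ?ltr_pwDl ?sqr_ge0//.
  have : ((dotp x t - m) / d) ^+ 2 <= 1.
    rewrite -real_normK ?num_real// expr_le1// normrM [`|d^-1|]gtr0_norm ?invr_gt0//.
    by rewrite ler_pdivrMr// mul1r ltW.
  lra_goal.
have h3 : 2 * d * (`|M| * mE) <= c / 2 * eta.
  have -> : c / 2 * eta = 2 * d * (`|M| * mE + 1) by rewrite /d; field; rewrite gt_eqF.
  by apply: ler_wpM2l; [rewrite mulr_ge0 ?(ltW d0)|rewrite lerDl].
have c2 : 0 < c / 2 by rewrite divr_gt0.
by rewrite -(ler_pM2l c2); apply: le_trans h2 (le_trans h1 (le_trans key h3)).
Qed.

End small_domains.

(** * Moving planes for the system in a fixed direction *)

Section moving_planes.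
Context {R : realType} {n : nat} (D : set 'rV[R]_n) (t : 'rV[R]_n) (d0 : R).
Local Notation V := 'rV[R]_n.
Hypotheses (oD : open D) (bD : bounded_set D) (n2 : (2 < n)%N).
Hypothesis vD : convex_set (D : set (convex_lmodType V)).
Hypothesis tt : dotp t t = 1.
Hypothesis cap_refl : forall x, closure D x ->
  forall s : R, 0 < s -> (forall y, D y -> dotp y t <= dotp x t - s + d0) ->
  D (x - (2 * s) *: t).
Implicit Types (f : V -> R) (x y : V) (m : R).

Definition cap m : set V := [set x | D x /\ m < dotp x t].

(** The part of [D] above height [m] has height at most [d0]: this is the range of planes for which
    reflecting the cap stays in [D]. *)
Definition room m := forall y, D y -> dotp y t <= m + d0.

Lemma open_cap m : open (cap m).
Proof.
have -> : cap m = D `&` ~` [set x | dotp x t <= m].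
  by apply/seteqP; split => x [Dx h]; split => //=; [apply/negP; rewrite -ltNge|rewrite ltNge; apply/negP].
by apply: openI => //; apply: closed_openC; exact: closed_halfspace.
Qed.

Lemma cap_segment m x y (s : R) : cap m x -> cap m y -> 0 <= s <= 1 -> cap m (s *: (y - x) + x).
Proof.
move=> [Dx hx] [Dy hy] s01; split; first exact: convex_segment.
rewrite dotpDl dotpZl dotpBl; case/andP: s01 => s0 s1.
have [->|s1'] := eqVneq s 1; first by lra.
have p1 : 0 < (1 - s) * (dotp x t - m) by rewrite mulr_gt0 ?subr_gt0// lt_neqAle s1'.
have p2 : 0 <= s * (dotp y t - m) by rewrite mulr_ge0// subr_ge0 ltW.
lra.
Qed.

Lemma refl_in m x : room m -> closure D x -> m < dotp x t -> D (refl t m x).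
Proof.
move=> rm clx mx; apply: cap_refl => //; first by rewrite subr_gt0.
by move=> y Dy; rewrite opprB addrCA subrr addr0; exact: rm.
Qed.

Lemma cap_in m x : room m -> cap m x -> D (refl t m x).
Proof. by move=> rm [Dx hx]; apply: refl_in => //; exact: subset_closure. Qed.

(* If f agreed with its reflection, following the half-line from [x] in direction [t]
   to its exit point would make f vanish at an interior point. *)
Lemma reflection_neq m f x : room m -> C0 D f -> vanb D f -> (forall x, D x -> 0 < f x) ->
  cap m x -> exists2 y, cap m y & f y != f (refl t m y).
Proof.
move=> rm cf vf fp [Dx hx]; apply: contrapT => H.
have {}H y : cap m y -> f y = f (refl t m y).
  by move=> cy; apply/eqP; apply: contrapT => h; apply: H; exists y => //; apply/negP.
pose A := [set s : R | 0 <= s /\ D (s *: t + x)].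
have [B B0 HB] := bounded_set_cube bD.
have A0 : A 0 by split => //; rewrite scale0r add0r.
have Dd s : A s -> s <= n%:R * (B * 1) - dotp x t.
  move=> [s0 Ds]; rewrite lerBrDr.
  have -> : s + dotp x t = dotp (s *: t + x) t by rewrite dotpDl dotpZl tt mulr1.
  apply: le_trans (ler_norm _) _; apply: dotp_le; [exact: ltW| |by move=> i; exact: unit_coord].
  by move=> i; apply: ltW; exact: HB.
have hA : has_sup A by split; [exists 0|exists (n%:R * (B * 1) - dotp x t) => s /Dd].
pose s1 := sup A; pose y1 := s1 *: t + x.
have s10 : 0 <= s1 by apply: sup_upper_bound.
have adh (e : R) : 0 < e -> exists2 s, A s & s1 - e < s by move=> e0; exact: sup_adherent.
have cl1 : closure D y1.
  move=> U /nbhs_cubeP[r r0 HU]; have [s [s0 Ds] hs] := adh r r0.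
  exists (s *: t + x); split => //; apply: HU => i.
  have ss1 : s <= s1 by apply: sup_upper_bound.
  rewrite !mxE opprD addrACA subrr addr0 -mulrBl normrM.
  apply: (@le_lt_trans _ _ (`|s - s1| * 1)); first by rewrite ler_wpM2l// unit_coord.
  by rewrite mulr1 ler0_norm; lra.
have nD1 : ~ D y1.
  move=> Dy; have [r r0 Hr] := line_near t oD Dy.
  have : A (r / 2 + s1).
    split; first by rewrite addr_ge0// divr_ge0// ltW.
    rewrite scalerDl -addrA; apply: Hr.
    by rewrite gtr0_norm ?divr_gt0// ltr_pdivrMr// ltr_pMr// ltr1n.
  move=> /(sup_upper_bound hA); rewrite gerDr leNgt => /negP; apply.
  by rewrite divr_gt0.
have h1 : m < dotp y1 t by rewrite dotpDl dotpZl tt; lra.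
have Dz := refl_in rm cl1 h1; set z := refl t m y1 in Dz.
have fz := fp z Dz; pose c := f z / 2; have c0 : 0 < c by rewrite divr_gt0.
have clQ : closed [set x | D x /\ c <= f x].
  exact: compact_closed (@norm_hausdorff _ _) (vf c c0).
have N1 : nbhs y1 (~` [set x | D x /\ c <= f x]).
  by apply: open_nbhs_nbhs; split; [exact: closed_openC|move=> []].
have N2 : nbhs z (D `&` [set y | c < f y]).
  apply: filterI; first exact: open_nbhs_nbhs.
  have h : nbhs (f z) [set s | c < s].
    by apply: open_nbhs_nbhs; split; [exact: open_gt|rewrite /= /c; lra].
  exact: (cf z Dz _ h).
have N3 := @continuous_refl R n t m y1 _ N2.
have N4 : nbhs y1 (~` [set x | D x /\ c <= f x] `&` (refl t m @^-1` (D `&` [set y | c < f y]))).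
  exact: filterI N1 N3.
have [r r0 Hr] := (nbhs_cubeP _ _).1 N4.
have [s [s0 Ds] hs] := adh r r0.
have ss1 : s <= s1 by apply: sup_upper_bound.
have := Hr (s *: t + x); case.
  move=> i; rewrite !mxE opprD addrACA subrr addr0 -mulrBl normrM.
  apply: (@le_lt_trans _ _ (`|s - s1| * 1)); first by rewrite ler_wpM2l// unit_coord.
  by rewrite mulr1 ler0_norm; move: ss1 hs; lra_goal.
move=> h3 [_ /= h4]; apply: h3; split => //.
rewrite H ?ltW//; split => //; rewrite dotpDl dotpZl tt; move: s0 hx; lra_goal.
Qed.

(** The difference between the reflected function and [f] is nonnegative and superharmonic on the
    convex cap and positive somewhere by [reflection_neq]; the strong maximum principle makes it
    positive everywhere. *)
Lemma strict_reflection m f df d2f : room m -> C2 D f df d2f -> vanb D f ->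
  (forall x, D x -> 0 < f x) ->
  (forall x, cap m x -> f x <= f (refl t m x) /\ lap d2f (refl t m x) <= lap d2f x) ->
  forall x, cap m x -> f x < f (refl t m x).
Proof.
move=> rm cf vf fp H x cx.
have [y cy fy] := reflection_neq rm (C2_C0 cf) vf fp cx.
have [dg [d2g [cg lg]]] := refl_C2 oD cf tt (fun x => @cap_in m x rm).
have cW := C2B cg (C2S (fun x (h : cap m x) => h.1) cf).
have WS z : cap m z -> 0 <= f (refl t m z) - f z /\ lap (fun i j x => d2g i j x - d2f i j x) z <= 0.
  move=> cz; have [h1 h2] := H z cz; split; first by rewrite subr_ge0.
  by rewrite /lap sumrB -/(lap d2g z) lg subr_le0.
have Wy : 0 < f (refl t m y) - f y.
  by rewrite subr_gt0 lt_neqAle fy; exact: (H y cy).1.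
have n0 : (0 < n)%N by exact: ltn_trans n2.
have := strong_max_principle n0 (@open_cap m) cW (fun x y s => @cap_segment m x y s) WS cy Wy cx.
by rewrite subr_gt0.
Qed.

Section system.
Variables (u v : V -> R) (du dv : 'I_n -> V -> R) (d2u d2v : 'I_n -> 'I_n -> V -> R).
Variables (F : R -> R) (Lip : R).
Hypotheses (cu : C2 D u du d2u) (cv : C2 D v dv d2v) (vu : vanb D u) (vv : vanb D v).
Hypotheses (bu : BC D u) (bv : BC D v).
Hypotheses (up : forall x, D x -> 0 < u x) (vp : forall x, D x -> 0 < v x).
Hypotheses (eu : forall x, D x -> - lap d2u x = v x) (ev : forall x, D x -> - lap d2v x = F (u x)).
Hypotheses (Lip0 : 0 <= Lip)
  (FL : forall x y, D x -> D y -> F (u x) - F (u y) <= Lip * tpos (u x - u y)).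

Definition reflects m :=
  forall x, cap m x -> u x <= u (refl t m x) /\ v x <= v (refl t m x).

Lemma reflects_strict m : room m -> reflects m ->
  forall x, cap m x -> u x < u (refl t m x) /\ v x < v (refl t m x).
Proof.
move=> rm P x cx; split.
  apply: (strict_reflection rm cu vu up _ cx) => y cy; have [h1 h2] := P y cy; split => //.
  have := eu (cap_in rm cy); have := eu cy.1; lra.
apply: (strict_reflection rm cv vv vp _ cx) => y cy; have [h1 h2] := P y cy; split => //.
have := FL cy.1 (cap_in rm cy); rewrite tpos_neg ?subr_le0// mulr0.
have := ev (cap_in rm cy); have := ev cy.1; lra.
Qed.

Lemma BC_refl m E f : room m -> BC D f -> E `<=` cap m -> BC E (fun x => f (refl t m x)).
Proof.
move=> rm [cf [M HM]] Em; split; last by exists M => x /Em cx; apply: HM; exact: cap_in.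
move=> x /Em cx; apply: (@continuous_comp _ _ _ (refl t m) f); first exact: continuous_refl.
by apply: cf; exact: cap_in.
Qed.

(** The difference vanishes on the plane, has nonpositive limits at the outer boundary because [f]
    tends to zero there and its reflection is positive, and is negative on [K]. Thus sets where it
    is at least e > 0 stay compact inside the cap without [K]. *)
Lemma vanb_reflect m (K : set V) f : room m -> C0 D f -> vanb D f -> (forall x, D x -> 0 < f x) ->
  (forall x, K x -> cap m x -> f x < f (refl t m x)) ->
  vanb [set x | cap m x /\ ~ K x] (fun x => f x - f (refl t m x)).
Proof.
move=> rm cf vf fp HK e e0.
pose Q := [set x | D x /\ e <= f x] `&` ~` [set x | dotp x t < m].
have oh : open [set x : V | dotp x t < m].
  have -> : [set x : V | dotp x t < m] = (fun x : V => dotp x t) @^-1` [set s | s < m] by [].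
  by apply: open_comp; [move=> x _; exact: (@C0_dotp R n setT t x I)|exact: open_lt].
have cQ : compact Q by apply: compact_closedI; [exact: vf|exact: open_closedC].
have Qm x : Q x -> m <= dotp x t by move=> [_ /= /negP]; rewrite -leNgt.
have fixp x : dotp x t = m -> refl t m x = x by move=> h; rewrite /refl h subrr mulr0 scale0r subr0.
have RQ x : Q x -> D (refl t m x).
  move=> Qx; have [[Dx _] _] := Qx; have := Qm x Qx; rewrite le_eqVlt => /orP[/eqP h|h].
    by rewrite fixp.
  exact: cap_in.
have cc x : Q x -> {for x, continuous (fun x => f x - f (refl t m x))}.
  move=> Qx; have h1 : {for x, continuous f} by apply: cf; case: Qx => -[].
  have h2 : {for x, continuous (fun x => f (refl t m x))}.
    apply: (@continuous_comp _ _ _ (refl t m) f); first exact: continuous_refl.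
    by apply: cf; exact: RQ.
  exact: cvgB h1 h2.
have := @compact_superlevel R n Q _ e cQ cc.
rewrite (_ : mkset _ = [set x | [set x | cap m x /\ ~ K x] x /\ e <= f x - f (refl t m x)])//.
apply/seteqP; split => x /= [].
  move=> Qx ex; have [[Dx _] _] := Qx; split => //.
  have cx : cap m x.
    split => //; have := Qm x Qx; rewrite le_eqVlt => /orP[/eqP h|//].
    by move: ex; rewrite fixp// subrr leNgt e0.
  by split => // Kx; have := HK x Kx cx; lra.
move=> [[Dx hx] nK] ex; split => //; split; last by apply/negP; rewrite -leNgt ltW.
by split => //; have := fp _ (cap_in rm (conj Dx hx)); lra.
Qed.

Lemma compact_gap m (K : set V) f : room m -> C0 D f -> compact K -> K `<=` cap m ->
  (forall x, K x -> f x < f (refl t m x)) -> exists2 r : R, 0 < r &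
  forall m' x, m - r < m' -> m' <= m -> K x -> room m' -> f x < f (refl t m' x).
Proof.
move=> rm cf cK Km HK.
have cW x : K x -> {for x, continuous (fun x => f (refl t m x) - f x)}.
  move=> Kx; have h1 : {for x, continuous f} by apply: cf; exact: (Km x Kx).1.
  have h2 : {for x, continuous (fun x => f (refl t m x))}.
    apply: (@continuous_comp _ _ _ (refl t m) f); first exact: continuous_refl.
    by apply: cf; apply: cap_in => //; exact: Km.
  exact: cvgB h2 h1.
have cWV x : K x -> {for x, continuous (fun x => (f (refl t m x) - f x)^-1)}.
  move=> Kx; apply: (@continuous_comp _ _ _ (fun x => f (refl t m x) - f x) (fun s : R => s^-1)).
    exact: cW.
  by apply: inv_continuous; rewrite gt_eqF// subr_gt0 HK.
have [M M0 HM] := continuous_bounded_on cK cWV.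
pose e := M^-1 / 2; have e0 : 0 < e by rewrite divr_gt0// invr_gt0.
have gap x : K x -> M^-1 <= f (refl t m x) - f x.
  move=> Kx; have w0 : 0 < f (refl t m x) - f x by rewrite subr_gt0 HK.
  have := HM x Kx; rewrite ger0_norm; last by rewrite invr_ge0 ltW.
  by move=> h; rewrite -[leRHS]invrK lef_pV2 ?posrE ?invr_gt0.
have cK' : compact (refl t m @` K).
  apply: continuous_compact => //; apply: continuous_subspaceT => x; exact: continuous_refl.
have KD' : (refl t m @` K) `<=` D by move=> _ [x Kx <-]; apply: cap_in => //; exact: Km.
have [r r0 Hr] : exists2 r : R, 0 < r & forall x y, (refl t m @` K) x -> cube x r y -> `|f x - f y| < e.
  apply: compact_uniform => // x /KD' Dx.
  have : \forall y \near x, `|f x - f y| < e / 2.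
    have h := cf x Dx; rewrite /prop_for /continuous_at in h; move/cvgrPdist_lt : h.
    by apply; rewrite divr_gt0.
  move=> /nbhs_cubeP[r r0 Hr]; exists r => // x' y /Hr /= h1 /Hr /= h2.
  by move: h1 h2; rewrite !ltr_norml; lra.
exists (r / 3); first by rewrite divr_gt0.
move=> m' x h1 h2 Kx rm'; have := gap x Kx.
have := Hr (refl t m x) (refl t m' x) (ex_intro2 _ _ x Kx erefl).
have h : cube (refl t m x) r (refl t m' x).
  move=> i; rewrite !mxE.
  have -> : x ord0 i - 2 * (dotp x t - m') * t ord0 i - (x ord0 i - 2 * (dotp x t - m) * t ord0 i) =
     2 * (m' - m) * t ord0 i by ring.
  rewrite normrM; apply: (@le_lt_trans _ _ (`|2 * (m' - m)| * 1)).
    by rewrite ler_wpM2l// unit_coord.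
  by rewrite mulr1 ler0_norm; lra.
move=> /(_ h); rewrite ltr_norml /e; have : 0 < M^-1 by rewrite invr_gt0.
lra.
Qed.

(** Strict inequality at height [m] persists on a compact part of the cap for slightly lower planes.
    The rest of the lower cap has small measure, and the two differences satisfy a cooperative
    system there, to which the maximum principle for small measure applies. *)
Lemma reflects_step m : room m -> reflects m -> exists2 r : R, 0 < r &
  forall m', m - r < m' -> m' <= m -> room m' -> reflects m'.
Proof.
move=> rm P; have [eta eta0 SMP] := small_maximum_principle oD bD n2 Lip0.
have eta2 : 0 < eta / 2 by rewrite divr_gt0.
have [d1 d10 H1] := small_level oD bD (C2_C0 cu) up eta2.
have [d2 d20 H2] := small_slab oD bD m tt eta2.
(* [K] avoids the boundary (u >= d1) and the plane (height at least m + d2/2). What it misses of a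
   cap slightly lower than [m] lies in the level set u < d1 or in a slab about the old plane, each
   of measure at most eta/2. *)
pose K := [set x | D x /\ d1 <= u x] `&` ~` [set x | dotp x t < m + d2 / 2].
have oh c : open [set x : V | dotp x t < c].
  have -> : [set x : V | dotp x t < c] = (fun x : V => dotp x t) @^-1` [set s | s < c] by [].
  by apply: open_comp; [move=> x _; exact: (@C0_dotp R n setT t x I)|exact: open_lt].
have cK : compact K by apply: compact_closedI; [exact: vu|exact: open_closedC].
have Km : K `<=` cap m.
  move=> x [[Dx _] /= /negP]; rewrite -leNgt => h; split => //.
  by apply: lt_le_trans h; rewrite ltrDl divr_gt0.
have st := reflects_strict rm P.
have [r1 r10 G1] := compact_gap rm (C2_C0 cu) cK Km (fun x h => (st x (Km x h)).1).
have [r2 r20 G2] := compact_gap rm (C2_C0 cv) cK Km (fun x h => (st x (Km x h)).2).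
exists (Num.min (d2 / 2) (Num.min r1 r2)); first by rewrite !lt_min r10 r20 divr_gt0.
move=> m' hm m'm rm'.
have [hm0 [hm1 hm2]] : m - d2 / 2 < m' /\ m - r1 < m' /\ m - r2 < m'.
  have q : Num.min (d2 / 2) (Num.min r1 r2) <= d2 / 2 by rewrite ge_min lexx.
  have q1 : Num.min (d2 / 2) (Num.min r1 r2) <= r1 by rewrite !ge_min lexx orbT.
  have q2 : Num.min (d2 / 2) (Num.min r1 r2) <= r2 by rewrite !ge_min lexx !orbT.
  by split; [move: q hm; lra_goal|split; lra].
pose E := [set x | cap m' x /\ ~ K x].
have oE : open E.
  have -> : E = cap m' `&` ~` K by [].
  apply: openI; first exact: open_cap.
  by apply: closed_openC; exact: compact_closed (@norm_hausdorff _ _) cK.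
have Ec : E `<=` cap m' by move=> x [].
have ED : E `<=` D by move=> x [[]].
have oA : open [set x | D x /\ u x < d1].
  rewrite openE => x [Dx fx]; apply: filterI; first exact: open_nbhs_nbhs.
  have H : nbhs (u x) [set s | s < d1] by apply: open_nbhs_nbhs; split; [exact: open_lt|].
  exact: ((C2_C0 cu) x Dx _ H).
have oS : open [set x | D x /\ `|dotp x t - m| < d2].
  have -> : [set x | D x /\ `|dotp x t - m| < d2] = D `&` ([set x : V | dotp x t < m + d2] `&` ~` [set x | dotp x t <= m - d2]).
    apply/seteqP; split => x /= [Dx]; rewrite ltr_norml.
      by move=> /andP[h1 h2]; split => //; split; [move: h2; lra_goal|apply/negP; rewrite -ltNge; lra].
    by move=> [h1 /negP]; rewrite -ltNge => h2; split => //; apply/andP; split; move: h2 h1; lra_goal.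
  by apply: openI => //; apply: openI => //; apply: closed_openC; exact: closed_halfspace.
have lty (A : set V) : open A -> A `<=` D -> lebesgue_rV n A \is a fin_num.
  move=> oA' AD; rewrite ge0_fin_numE//; apply: le_lt_trans (domain_lty oD bD).
  by apply: le_measure; rewrite ?inE//; [exact: open_measurable_rV|exact: domain_measurable].
have mE : fine (lebesgue_rV n E) <= eta.
  rewrite (splitr eta); apply: le_trans (lerD H1 H2).
  rewrite -fineD; [|by apply: lty => // x []|by apply: lty => // x []].
  apply: fine_le; [exact: lty|by rewrite fin_numD !lty// => x []|].
  apply: le_trans (measureU2 _ _ _); [|exact: open_measurable_rV|exact: open_measurable_rV].
  apply: le_measure; rewrite ?inE; [exact: open_measurable_rV| |].
    by apply: measurableU; exact: open_measurable_rV.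
  move=> x [[Dx hx] nK]; have [h|h] := ltP (u x) d1; first by left.
  right; split => //; have h3 : dotp x t < m + d2 / 2.
    by rewrite ltNge; apply/negP => h4; apply: nK; split => //=; apply/negP; rewrite -leNgt.
  rewrite ltr_norml; move: h3 hx hm0; lra_goal.
have [dg [d2g [cg lg]]] := refl_C2 oD cu tt (fun x (h : E x) => cap_in rm' (Ec x h)).
have [dh [d2h [ch lh]]] := refl_C2 oD cv tt (fun x (h : E x) => cap_in rm' (Ec x h)).
have cf1 := C2B (C2S ED cu) cg; have cf2 := C2B (C2S ED cv) ch.
have v1 := vanb_reflect rm' (C2_C0 cu) vu up (fun x h _ => G1 m' x hm1 m'm h rm').
have v2 := vanb_reflect rm' (C2_C0 cv) vv vp (fun x h _ => G2 m' x hm2 m'm h rm').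
have b1 : BC E (fun x => u x - u (refl t m' x)) by apply: BCB; [exact: BC_sub bu|exact: BC_refl].
have b2 : BC E (fun x => v x - v (refl t m' x)) by apply: BCB; [exact: BC_sub bv|exact: BC_refl].
have S := SMP E oE ED mE _ _ _ _ _ _ cf1 cf2 v1 v2 b1 b2 _ _.
move=> x cx; have [Kx|nK] := pselect (K x).
  by split; apply: ltW; [exact: G1|exact: G2].
have [] := S _ _ x (conj cx nK); last by rewrite !subr_le0.
- move=> y Ey _; rewrite /lap sumrB -/(lap d2u y) -/(lap d2g y) lg.
  have := eu (ED y Ey); have := eu (cap_in rm' (Ec y Ey)).
  have := tpos_le (v y - v (refl t m' y)); lra_goal.
- move=> y Ey _; rewrite /lap sumrB -/(lap d2v y) -/(lap d2h y) lh.
  have := ev (ED y Ey); have := ev (cap_in rm' (Ec y Ey)).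
  have := FL (ED y Ey) (cap_in rm' (Ec y Ey)); lra_goal.
Qed.

Lemma room_le m m' : m <= m' -> room m -> room m'.
Proof. by move=> mm rm y Dy; apply: le_trans (rm y Dy) _; rewrite lerD2r. Qed.

Lemma reflects_closed m : room m -> (forall m', m < m' -> reflects m') -> reflects m.
Proof.
move=> rm H x cx.
have rc f : C0 D f -> (forall m', m < m' < dotp x t -> f x <= f (refl t m' x)) ->
    f x <= f (refl t m x).
  move=> cf Hf; rewrite leNgt; apply/negP => h.
  have N : nbhs (f (refl t m x)) [set s | s < f x].
    by apply: open_nbhs_nbhs; split; [exact: open_lt|].
  have := cf _ (cap_in rm cx) _ N; move=> /nbhs_cubeP[r r0 Hr].
  have [_ hx] := cx; pose e := Num.min (r / 3) ((dotp x t - m) / 2).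
  have e0 : 0 < e by rewrite lt_min !divr_gt0// subr_gt0.
  have er : e <= r / 3 by rewrite ge_min lexx.
  have ex : e <= (dotp x t - m) / 2 by rewrite ge_min lexx orbT.
  have := Hf (m + e) ltac:(by apply/andP; split; lra); apply/negP; rewrite -ltNge.
  apply: (Hr (refl t (m + e) x)) => i; rewrite !mxE.
  have -> : x ord0 i - 2 * (dotp x t - (m + e)) * t ord0 i - (x ord0 i - 2 * (dotp x t - m) * t ord0 i) =
     2 * e * t ord0 i by ring.
  rewrite normrM; apply: (@le_lt_trans _ _ (`|2 * e| * 1)).
    by rewrite ler_wpM2l// unit_coord.
  by rewrite mulr1 ger0_norm; lra.
have Hc m' : m < m' < dotp x t -> cap m' x by move=> /andP[_ h]; split => //; exact: cx.1.
split; apply: rc; [exact: C2_C0 cu| |exact: C2_C0 cv|] => m' hm'.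
  by have [] := H m' (andP hm').1 x (Hc m' hm').
by have [] := H m' (andP hm').1 x (Hc m' hm').
Qed.

(** High planes cut off empty caps. At the supremum of the heights where the property fails it still
    holds, being closed under limits from above, and the step below that supremum contradicts its
    definition. *)
Lemma moving_plane m : room m -> reflects m.
Proof.
move=> rm; apply: contrapT => nP.
pose B := [set m' : R | m <= m' /\ ~ reflects m'].
have [b b0 Hb] := bounded_set_cube bD.
have ub m' : B m' -> m' <= n%:R * (b * 1).
  move=> [_ h]; rewrite leNgt; apply/negP => h2; apply: h => x [Dx hx]; exfalso.
  have : dotp x t <= n%:R * (b * 1).
    apply: le_trans (ler_norm _) _; apply: dotp_le; [exact: ltW| |by move=> i; exact: unit_coord].
    by move=> i; apply: ltW; exact: Hb.
  lra.
have hB : has_sup B by split; [exists m|exists (n%:R * (b * 1)) => m' /ub].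
pose m1 := sup B; have mm1 : m <= m1 by apply: sup_upper_bound.
have rm1 := room_le mm1 rm.
have P1 : reflects m1.
  apply: reflects_closed => // m' h; apply: contrapT => h2.
  have : B m' by split => //; lra.
  by move=> /(sup_upper_bound hB); rewrite leNgt h.
have [r r0 Hr] := reflects_step rm1 P1.
have [m2 Bm2 h3] := sup_adherent r0 hB; have [h1 h2] := Bm2.
apply: h2; apply: Hr => //; last exact: room_le h1 rm.
exact: sup_upper_bound.
Qed.

End system.

End moving_planes.

(** * Uniform bounds near the boundary *)

Section boundary_collar.
Context {R : realType} {n : nat} (D : set 'rV[R]_n).
Local Notation V := 'rV[R]_n.
Hypotheses (n2 : (2 < n)%N) (sD : smooth_bounded_convex_domain D).

(* Moving planes in all directions close to that of a supporting plane compare the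
   value at a point near the boundary with those on an interior cube of fixed size. *)
Lemma collar_bound : exists K : set V, [/\ compact K, K `<=` D & exists2 C : R, 0 < C &
  forall p lam u du d2u v dv d2v, 1 < p -> 0 < lam ->
  navier_system D p lam u du d2u v dv d2v -> forall x, D x -> ~ K x ->
  u x <= C * itg D u /\ v x <= C * itg D v].
Proof.
have [_ oD bD vD sbD] := sD.
have [d0 d00 Hcap] := cap_reflection oD bD sbD.
have d80 : 0 < d0 / 8 by rewrite divr_gt0.
have [K [cK KD HK]] := supporting_collar oD bD vD sbD d80.
have [B B0 HB] := bounded_set_cube bD.
have n0 : (0 : R) <= n%:R by [].
(* Small compared with d0 and with the size [B] of the domain, so that replacing the centre of the
   cube by any of its points changes the inner products below by small fractions of d0^2. *)
pose r := Num.min (d0 / 8) (d0 ^+ 2 / (16 * (n%:R * (2 * B) + n%:R * d0 + 1))).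
have den : 0 < n%:R * (2 * B) + n%:R * d0 + 1.
  by rewrite ltr_wpDl// addr_ge0// mulr_ge0// ?mulr_ge0// ltW.
have r0 : 0 < r by rewrite lt_min d80 divr_gt0 ?exprn_gt0 ?mulr_gt0.
exists K; split => //; exists ((2 * r) ^+ n)^-1.
  by rewrite invr_gt0 exprn_gt0// mulr_gt0.
move=> p lam u du d2u v dv d2v p1 lam0 sys x Dx nK.
have [[[cu bu _ _] [cv bv _ _]] [vu vv] up eu ev] := sys.
have vp := system_v_pos oD bD lam0 sys.
have vbu := vanish_on_bd_vanb oD bD (C2_C0 cu) vu.
have vbv := vanish_on_bd_vanb oD bD (C2_C0 cv) vv.
have [t tt ht] := HK x Dx nK.
have [_ [M HM]] := bu.
pose F (s : R) := lam * (s + 1) `^ p.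
(* This Lipschitz constant depends on the supremum of the solution. It only serves to start the
   moving planes; the constant of the conclusion is the inverse volume of a cube fixed
   beforehand. *)
pose Lip := lam * (p * (`|M| + 1) `^ (p - 1)).
have Lip0 : 0 <= Lip by rewrite mulr_ge0 ?(ltW lam0)// mulr_ge0 ?powR_ge0//; move: p1; lra_goal.
have FL y z : D y -> D z -> F (u y) - F (u z) <= Lip * tpos (u y - u z).
  move=> Dy Dz; have uy := up y Dy; have uz := up z Dz.
  have [h|h] := leP (u y) (u z).
    rewrite tpos_neg ?subr_le0// mulr0 subr_le0 /F ler_wpM2l ?(ltW lam0)//.
    by rewrite ge0_ler_powR ?nnegrE//; move: h uy p1; lra_goal.
  rewrite tpos_pos ?subr_ge0 ?(ltW h)// /F -mulrBr /Lip -mulrA ler_wpM2l ?(ltW lam0)//.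
  have dP (s : R) : s \in `]u z, u y[ -> is_derive s (1 : R) (fun s : R => (s + 1) `^ p) (p * (s + 1) `^ (p - 1)).
    rewrite in_itv /= => /andP[s1 s2]; have s0 : 0 < s + 1 by move: s1 uz; lra_goal.
    have ds : is_derive s (1 : R) (fun s : R => s + 1) 1.
      by apply: (is_derive_eq (is_deriveD (is_derive_id s (1 : R)) (is_derive_cst (1 : R) s (1 : R)))); rewrite addr0.
    by apply: (is_derive_eq (is_derive_compR ds (is_derive1_powR p s0))); rewrite mulr1.
  have cP : {within `[u z, u y], continuous (fun s : R => (s + 1) `^ p)}.
    apply: continuous_in_subspaceT => s /set_mem; rewrite /= in_itv /= => /andP[s1 s2].
    apply: (@continuous_comp _ _ _ (fun s : R => s + 1) (fun s : R => s `^ p)).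
      by apply: cvgD; [exact: cvg_id|exact: cvg_cst].
    by apply: powR_continuous; move: s1 uz; lra_goal.
  have [s] := MVT h dP cP; rewrite in_itv /= => /andP[s1 s2] ->.
  rewrite ler_wpM2r ?subr_ge0 ?(ltW h)// ler_wpM2l//; first by move: p1; lra_goal.
  have := HM y Dy; rewrite gtr0_norm// => uM; have MM := ler_norm M.
  by rewrite ge0_ler_powR ?nnegrE//; move: MM uM s2 s1 uz p1; lra_goal.
have ev' y : D y -> - lap d2v y = F (u y) by exact: ev.
have eu' y : D y -> - lap d2u y = v y by move=> Dy; rewrite eu.
(* The centre lies at depth 3/4 d0 below [x] in the supporting direction, so mirror images of [x] in
   the cube are at distance between d0/2 and d0 from it. *)
pose c := x - (3 / 4 * d0) *: t.
have main z : cube c r z -> D z /\ u x <= u z /\ v x <= v z.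
  move=> zc; pose e := z - c; have eE i : `|e ord0 i| <= r by have := zc i; rewrite /e !mxE => /ltW.
  (* [z] is the mirror image of [x] in the plane through their midpoint orthogonal to w = x - z. The
     estimates below check that d0/2 <= |w| <= d0 and that the cap cut off by this plane has height
     at most d0. *)
  pose w := (3 / 4 * d0) *: t - e.
  have zE : z = x - w by apply/rowP => i; rewrite !mxE; ring.
  have rd : r <= d0 / 8 by rewrite ge_min lexx.
  have rden : r * (16 * (n%:R * (2 * B) + n%:R * d0 + 1)) <= d0 ^+ 2.
    by rewrite -ler_pdivlMr ?mulr_gt0// ge_min lexx orbT.
  have te : `|dotp t e| <= n%:R * (1 * r) by apply: dotp_le => // i; exact: unit_coord.
  have ee : `|dotp e e| <= n%:R * (r * r) by apply: dotp_le => //; exact: ltW.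
  have ww : dotp w w = 9 / 16 * d0 ^+ 2 - 3 / 2 * d0 * dotp t e + dotp e e.
    have H (k : R) (e' : V) : dotp (k *: t - e') (k *: t - e') = k ^+ 2 - 2 * k * dotp t e' + dotp e' e'.
      by rewrite dotpBl !dotpBr !dotpZl !dotpZr tt (dotpC e' t); ring.
    by rewrite /w H; field.
  have nB : 0 <= n%:R * (2 * B) by rewrite mulr_ge0// mulr_ge0// ltW.
  have nd : 0 <= n%:R * d0 by rewrite mulr_ge0// ltW.
  have nr : n%:R * r * d0 <= d0 ^+ 2 / 16.
    have : r * (n%:R * d0) <= r * (n%:R * (2 * B) + n%:R * d0 + 1).
      by rewrite ler_wpM2l ?(ltW r0)//; move: nB; lra_goal.
    move: rden; lra_goal.
  have nrB : n%:R * (2 * B) * r <= d0 ^+ 2 / 16.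
    have : r * (n%:R * (2 * B)) <= r * (n%:R * (2 * B) + n%:R * d0 + 1).
      by rewrite ler_wpM2l ?(ltW r0)//; move: nd; lra_goal.
    move: rden; lra_goal.
  have nrr : n%:R * r * r <= d0 ^+ 2 / 128.
    have : n%:R * r * r <= n%:R * r * (d0 / 8) by rewrite ler_wpM2l// mulr_ge0// ltW.
    move: nr; lra_goal.
  have d2 : 0 < d0 ^+ 2 by rewrite exprn_gt0.
  have wlo : (d0 / 2) ^+ 2 <= dotp w w.
    rewrite ww; move: te ee; rewrite !ler_norml => /andP[te1 te2] /andP[ee1 ee2].
    have : d0 * dotp t e <= d0 * (n%:R * (1 * r)) by rewrite ler_wpM2l// ltW.
    have : 0 <= dotp e e by exact: dotp_ge0.
    have -> : (d0 / 2) ^+ 2 = d0 ^+ 2 / 4 by field.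
    move: ee2 nrr nr; lra_goal.
  have whi : dotp w w <= d0 ^+ 2.
    rewrite ww; move: te ee; rewrite !ler_norml => /andP[te1 te2] /andP[ee1 ee2].
    have : d0 * - dotp t e <= d0 * (n%:R * (1 * r)) by rewrite ler_wpM2l; [|exact: ltW|move: te1; lra_goal].
    move: ee2 ee1 nrr nr; lra_goal.
  pose l := Num.sqrt (dotp w w).
  have w0 : 0 < dotp w w by apply: lt_le_trans wlo; rewrite exprn_gt0// divr_gt0.
  have l2 : l ^+ 2 = dotp w w by rewrite sqr_sqrtr// ltW.
  have l0 : 0 < l by rewrite sqrtr_gt0.
  have llo : d0 / 2 <= l.
    by rewrite -(@ler_pXn2r _ 2)// ?nnegrE ?l2// ?(ltW l0)// divr_ge0// ltW.
  have lhi : l <= d0 by rewrite -(@ler_pXn2r _ 2)// ?nnegrE ?l2// ?(ltW l0)// ltW.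
  pose th := l^-1 *: w.
  have thth : dotp th th = 1.
    have H (a : R) : 0 < a -> a^-1 * (a^-1 * a ^+ 2) = 1 by move=> a0; field; rewrite gt_eqF.
    by rewrite dotpZl dotpZr -l2 H.
  have wth : w = l *: th by rewrite scalerA mulfV ?gt_eqF// scale1r.
  pose m := dotp x th - l / 2.
  have rm : room D th d0 m.
    move=> y Dy; rewrite -lerBlDl /m.
    have : l * dotp (y - x) th <= l * (d0 / 2).
      rewrite -dotpZr -wth /w dotpBr dotpZr.
      have h1 : dotp (y - x) t <= d0 / 8 by have := ht y Dy; rewrite dotpBl; lra_goal.
      have h2 : `|dotp (y - x) e| <= n%:R * (2 * B * r).
        apply: dotp_le => //; first by rewrite mulr_ge0// ltW.
        move=> i; rewrite !mxE; have := HB y Dy i; have := HB x Dx i.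
        by rewrite !ltr_norml ler_norml; lra_goal.
      have h3 : 3 / 4 * d0 * dotp (y - x) t <= 3 / 4 * d0 * (d0 / 8).
        by rewrite ler_wpM2l//; move: lhi llo; lra_goal.
      have h4 : d0 / 2 * (d0 / 2) <= l * (d0 / 2) by rewrite ler_wpM2r// divr_ge0// ltW.
      move: h2; rewrite ler_norml => /andP[h2 _]; move: h2 h4 h3 whi wlo nrB; lra_goal.
    by rewrite ler_pM2l// dotpBl; move: lhi; lra_goal.
  have cx : cap D th m x by split => //; rewrite /m gtrBl divr_gt0.
  have rz : refl th m x = z.
    rewrite /refl /m zE wth; congr (_ - _ *: _).
    by rewrite opprB addrCA subrr addr0 mulrCA mulfV ?mulr1.
  have capr := fun x clx => @Hcap x th clx thth.
  have [h1 h2] := moving_plane oD bD n2 vD thth capr cu cv vbu vbv bu bv up vp eu' ev' Lip0 FL rm cx.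
  rewrite rz in h1 h2; split => //; rewrite -rz.
  exact: (@cap_in R n D th d0 capr m x rm cx).
have cD : cube c r `<=` D by move=> z /main[].
have q0 : 0 < (2 * r) ^+ n by rewrite exprn_gt0// mulr_gt0.
rewrite !(mulrC _^-1) !ler_pdivlMr//; split.
  apply: (@itg_ge_cube R n D u c r (u x)) => //; [by move=> y /up /ltW|exact: ltW|].
  by move=> z /main[_ []].
apply: (@itg_ge_cube R n D v c r (v x)) => //; [by move=> y /vp /ltW|exact: ltW|].
by move=> z /main[_ []].
Qed.

End boundary_collar.

(** * Cutoffs, and symmetry of second derivatives *)

Section cutoff_functions.
Context {R : realType} {n : nat} (D : set 'rV[R]_n).
Local Notation V := 'rV[R]_n.
Hypotheses (oD : open D) (bD : bounded_set D).
Implicit Types (f F b : V -> R) (x y : V) (K : set V).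

Lemma moll_integral_gt0 (U : set V) x (q r : R) : open U -> bounded_set U -> 0 < q -> 0 < r ->
  cube x q `<=` U -> 0 < itg U (fun y => moll r (fun=> 0%N) (x - y)).
Proof.
move=> oU bU q0 r0 xU; set z := fun=> 0%N.
have m0 := @moll_gt0 R n r r0.
have : \forall y \near (0 : V), `|moll r z 0 - moll r z y| < moll r z 0 / 2.
  have := @C0_moll R n r z 0 I; rewrite /prop_for /continuous_at => /cvgrPdist_lt.
  by apply; rewrite divr_gt0.
move=> /nbhs_cubeP[q1 q10 Hq]; pose q' := Num.min q q1.
have q'0 : 0 < q' by rewrite lt_min q0.
apply: (@lt_le_trans _ _ (moll r z 0 / 2 * (2 * q') ^+ n)).
  by rewrite mulr_gt0 ?divr_gt0// exprn_gt0// mulr_gt0.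
apply: (@itg_ge_cube R n U _ x) => //; [exact: BC_moll_sub|by move=> y _; exact: moll_ge0| | |].
- exact: ltW.
- by move=> y yq; apply: xU => i; rewrite (lt_le_trans (yq i))// ge_min lexx.
move=> y yq; have : cube 0 q1 (x - y).
  move=> i; rewrite !mxE subr0 distrC; apply: lt_le_trans (yq i) _.
  by rewrite ge_min lexx orbT.
by move=> /Hq /=; rewrite ltr_norml; lra.
Qed.

(** A mollified indicator [chi] of a neighbourhood is merely positive on [K]. Composition with 1 -
    ((1 - m s)^+)^4, constant where m s >= 1, makes the value 1 and kills the first and second
    derivatives at every point of [K], even if [K] has no interior. *)
Lemma cutoff_exists K : compact K -> K `<=` D -> exists z dz d2z,
  [/\ C2 D z dz d2z, cs D z, forall x, 0 <= z x <= 1 &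
      forall x, K x -> [/\ z x = 1, forall i, dz i x = 0 & forall i j, d2z i j x = 0]].
Proof.
move=> cK KD; have [r r0 Hr] := compact_cube_sub cK oD KD.
pose O := \bigcup_(k in K) cube k (r / 3); have r3 : 0 < r / 3 by rewrite divr_gt0.
have rr : r / 3 < r by rewrite ltr_pdivrMr// ltr_pMr// ltr1n.
have oO : open O by apply: bigcup_open => k _; exact: open_cube.
have OD : O `<=` D by move=> y [k Kk ky]; apply: (Hr k) => // i; exact: lt_trans (ky i) rr.
have bO := sub_bounded bD OD.
have b1 : BC O (fun=> 1 : R) by exact: BC_cst.
pose chi := conv O (fun=> 1) (r / 3) (fun=> 0%N).
have schi : smooth setT chi by exact: smooth_conv.
have cchi : C2 setT chi (fun i => partial i chi) (fun i j => partials [:: j; i] chi) :=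
  @Ck_C2 R n 2 setT chi [::] (schi 2%N) isT.
have chi0 x : 0 <= chi x by apply: itg_ge0 => // y _; rewrite mul1r moll_ge0.
have chip x : K x -> 0 < chi x.
  move=> Kx; have H : cube x (r / 3) `<=` O by move=> y xy; exists x.
  have := moll_integral_gt0 oO bO r3 r3 H; rewrite /chi /conv.
  by under [X in _ -> _ < X]eq_Rintegral do rewrite mul1r.
have [m m0 Hm] : exists2 m : R, 0 < m & forall x, K x -> 1 <= m * chi x.
  have cc : forall x, K x -> {for x, continuous (fun x => (chi x)^-1)}.
    move=> x Kx; apply: (@continuous_comp _ _ _ chi (fun s : R => s^-1)).
      exact: ((C2_C0 cchi) x I).
    by apply: inv_continuous; rewrite gt_eqF// chip.
  have [M M0 HM] := continuous_bounded_on cK cc.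
  exists M => // x Kx; have c0 := chip x Kx; have := HM x Kx.
  rewrite ger0_norm ?invr_ge0// => h; have := ler_wpM2r (ltW c0) h.
  by rewrite mulVf// gt_eqF.
pose h (s : R) := 1 - tpow 4 (1 - m * s).
pose h1 (s : R) := 4 * m * tpow 3 (1 - m * s).
pose h2 (s : R) := - (12 * m ^+ 2) * tpow 2 (1 - m * s).
have dl s : is_derive s (1 : R) (fun s : R => 1 - m * s) (- m).
  apply: (is_derive_eq (is_deriveB (is_derive_cst (1 : R) s (1 : R)) (is_deriveZ m (is_derive_id s (1 : R))))).
  by rewrite sub0r [_ *: 1]mulr1.
have dh s : is_derive s (1 : R) h (h1 s).
  have H := is_derive_compR (dl s) (@is_derive_tpow R 3 (1 - m * s) isT).
  apply: (is_derive_eq (is_deriveB (is_derive_cst (1 : R) s (1 : R)) H)).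
  by rewrite /h1; ring.
have dh1 s : is_derive s (1 : R) h1 (h2 s).
  have H := is_derive_compR (dl s) (@is_derive_tpow R 2 (1 - m * s) isT).
  apply: (is_derive_eq (is_deriveZ (4 * m) H)).
  by rewrite /h2 /GRing.scale /=; ring.
have ch2 : continuous h2.
  move=> s; apply: cvgM; first exact: cvg_cst.
  apply: (@continuous_comp _ _ _ (fun s : R => 1 - m * s) (tpow 2)); last exact: tpow_continuous.
  by apply: cvgB; [exact: cvg_cst|apply: cvgM; [exact: cvg_cst|exact: cvg_id]].
have cz := C2_comp (C2S (@subsetT _ D) cchi) (fun x _ => dh _) (fun x _ => dh1 _) (fun x _ => ch2 _).
do 3 eexists; split; first exact: cz.
- exists [set x + y | x in K & y in [set y : V | forall i, `|y ord0 i| <= 2 * (r / 3)]].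
    split.
      rewrite (_ : [set _ | _ in _ & _ in _] =
        (fun p : V * V => p.1 + p.2) @` (K `*` [set y : V | forall i, `|y ord0 i| <= 2 * (r / 3)])).
        apply: continuous_compact; first by apply: continuous_subspaceT; exact: add_continuous.
        by apply: compact_setX => //; exact: compact_closed_box.
      apply/seteqP; split => [_ [x Kx [y yr <-]]|_ [[x y] [/= Kx yr] <-]]; first by exists (x, y).
      by exists x => //; exists y.
    move=> _ [x Kx [y yr <-]]; apply: (Hr x) => // i.
    by rewrite mxE addrAC subrr add0r (le_lt_trans (yr i))//; lra.
  move=> x Dx nK; rewrite (_ : chi x = 0).
    by rewrite /h mulr0 subr0 /tpow tpos_pos// expr1n subrr.
  rewrite /chi /conv (_ : itg O _ = itg O (fun=> 0)); first by rewrite itg_cst// mul0r.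
  apply: eq_itg => y [k Kk ky]; rewrite moll_box ?mulr0// => hb; apply: nK.
  exists k => //; exists (x - k); last by rewrite addrC subrK.
  move=> i; rewrite !mxE -(subrK (y ord0 i) (x ord0 i)) -addrA.
  apply: le_trans (ler_normD _ _) _; rewrite mulr2n mulrDl !mul1r; apply: lerD.
    by have := hb i; rewrite !mxE.
  exact: ltW (ky i).
- move=> x; have t0 : 0 <= tpos (1 - m * chi x) <= 1.
    rewrite tpos_ge0/=; have [s0|s0] := leP 0 (1 - m * chi x).
      by rewrite tpos_pos// gerBl mulr_ge0// ltW.
    by rewrite tpos_neg// ltW.
  rewrite /h /tpow; have /andP[a1 a2] := t0.
  have := exprn_ge0 4 a1; have : tpos (1 - m * chi x) ^+ 4 <= 1 by rewrite exprn_ile1.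
  move: (tpos _ ^+ 4) => w; lra.
move=> x Kx; have t0 : tpos (1 - m * chi x) = 0 by rewrite tpos_neg// subr_le0 Hm.
split.
- by rewrite /h /tpow t0 expr0n subr0.
- by move=> i; rewrite /h1 /tpow t0 expr0n mulr0 mul0r.
- by move=> i j; rewrite /h1 /h2 /tpow t0 !expr0n !mulr0 !mul0r mulr0 addr0.
Qed.

Let close_to_third (a b c A B e : R) : 0 < e -> 0 < A + B + 1 ->
  `|a - c| <= e / (A + B + 1) * A -> `|b - c| <= e / (A + B + 1) * B -> `|a - b| <= e.
Proof.
move=> e0 J0; set k := e / (A + B + 1) => h1 h2.
have k0 : 0 < k by rewrite divr_gt0.
have kE : k * (A + B + 1) = e by rewrite /k divfK// gt_eqF.
have -> : e = k * A + k * B + k by rewrite -kE; ring.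
move: h1 h2; rewrite !ler_norml; lra.
Qed.

(** For smooth [b] this is two integrations by parts and commutation of mixed partials. For [b] only
    of class C^1, it is first multiplied by a cutoff equal to 1 on the support of [F] and then
    approximated, with its gradient, by test functions. *)
Lemma itg_curl F dF b db i j : C1 D F dF -> cs D F -> C1 D b db ->
  itg D (fun x => dF j x * db i x) = itg D (fun x => dF i x * db j x).
Proof.
move=> cF sF cb; have [K [F' [dF' [cK KD _ FD F0]]]] := cs_extend oD cF sF.
have [z [dz [d2z [cz sz z01 zK]]]] := cutoff_exists cK KD.
have cg := C1M (C2_C1 cz) cb.
have sg : cs D (fun x => z x * b x) by exact: csMl.
have [cF0 cF1 _] := cF; have [cb0 cb1 _] := cb.
have bdF k : BC D (dF k) by apply: cs_BC => //; exact: cs_grad cF sF.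
have dFE k l x : D x -> dF k x * db l x = dF k x * (z x * db l x + b x * dz l x).
  move=> Dx; have [Kx|Kx] := pselect (K x).
    by have [-> -> _] := zK x Kx; rewrite mul1r mulr0 addr0.
  by rewrite -(proj2 (FD x Dx)) (proj2 (F0 x Kx)) !mul0r.
have bF k l : BC D (fun x => dF k x * db l x).
  apply: BC_csMl => //; exact: cs_grad cF sF.
apply/eqP; rewrite -subr_eq0 -normr_le0; apply/ler_addgt0Pr => e e0; rewrite add0r.
pose J := itg D (fun x => `|dF j x|) + itg D (fun x => `|dF i x|) + 1.
have J0 : 0 < J by rewrite ltr_wpDl// addr_ge0// itg_ge0.
have [psi [tp sym] H] := test_fun_approx oD bD cg sg (divr_gt0 e0 J0).
have [cp sp bp bdp] := test_fun_C1 oD tp.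
have cdp k : C1 D (partial k psi) (fun l => partial l (partial k psi)).
  apply: (C1S (@subsetT _ D)); have [sm _] := tp.
  exact: (@Ck_C1 R n 2 setT psi [:: k] (sm 2%N) isT).
have E : itg D (fun x => dF j x * partial i psi x) = itg D (fun x => dF i x * partial j psi x).
  have e1 := ibp oD bD j cF (cdp i) sF; have e2 := ibp oD bD i cF (cdp j) sF.
  rewrite (sym i j) e1 in e2; exact: oppr_inj e2.
have close k l : `|itg D (fun x => dF k x * db l x) - itg D (fun x => dF k x * partial l psi x)| <=
    e / J * itg D (fun x => `|dF k x|).
  have bF2 : BC D (fun x => dF k x * partial l psi x) by exact: BCM.
  have bB := BCB (bF k l) bF2.
  rewrite -(itgB oD bD (bF k l) bF2); apply: le_trans (itg_abs oD bD bB) _.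
  have bA := BC_abs (bdF k).
  rewrite -(itgZ oD bD (e / J) bA); apply: (itg_le oD bD (BC_abs bB) (BCZ (e / J) bA)).
  move=> x Dx; have [_ h] := H x Dx; rewrite (dFE k l x Dx) -mulrBr normrM mulrC.
  exact: ler_wpM2r (normr_ge0 (dF k x)) _ _ (h l).
have := close j i; have := close i j; rewrite E => c1 c2.
exact: close_to_third e0 J0 c2 c1.
Qed.

(** Schwarz's theorem in weak form: tested against any bump, the antisymmetric part of the Hessian
    integrates to zero by [itg_curl]; being continuous, it cannot be positive at a point. *)
Lemma hessian_sym f df d2f i j x : C2 D f df d2f -> D x -> d2f i j x = d2f j i x.
Proof.
move=> cf; suff H k l y : D y -> d2f k l y <= d2f l k y.
  by move=> Dx; apply/eqP; rewrite eq_le !H.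
move=> Dy; rewrite leNgt; apply/negP => h.
have [_ c2] := cf; have ch p q : C0 D (d2f p q) by have [_ c _] := c2 p; exact: c.
pose g x := d2f k l x - d2f l k x.
have cg : C0 D g by exact: C0B.
have gy : 0 < g y by rewrite subr_gt0.
have : nbhs y (D `&` [set z | 0 < g z]).
  apply: filterI; first exact: open_nbhs_nbhs.
  have N : nbhs (g y) [set s | 0 < s] by apply: open_nbhs_nbhs; split; [exact: open_gt|].
  exact: (cg y Dy _ N).
move=> /nbhs_cubeP[r r0 Hr].
pose F (w : V) := moll (r / 2) (fun=> 0%N) (y - w).
have r2 : 0 < r / 2 by rewrite divr_gt0.
have cF := C1_moll_sub D (r / 2) (fun=> 0%N) y.
have outF w : ~ cube y r w -> F w = 0.
  move=> /existsNP[p /negP]; rewrite -leNgt => hp; apply: (@moll_out _ _ _ _ _ p).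
  by rewrite !mxE distrC (le_trans _ hp)// ler_pdivrMr// ler_pMr// ler1n.
have sF : cs D F.
  exists [set w : V | forall p, `|w ord0 p - y ord0 p| <= r / 2].
    split.
      rewrite (_ : mkset _ = (fun w => w + y) @` [set w : V | forall p, `|w ord0 p| <= r / 2]).
        apply: continuous_compact; last exact: compact_closed_box.
        apply: continuous_subspaceT => w; apply: continuous_rV => p.
        rewrite (_ : (fun u => _) = fun u : V => u ord0 p + y ord0 p); last by apply/funext => u; rewrite !mxE.
        exact: ((C0D (@C0_coord R n setT p) (@C0_cst R n setT (y ord0 p))) w I).
      apply/seteqP; split => [w wr|_ [w wr <-] p]; last by rewrite mxE addrK.
      by exists (w - y); [move=> p; rewrite !mxE|rewrite subrK].
    move=> w wr; apply: (Hr w _).1 => p; apply: le_lt_trans (wr p) _.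
    by rewrite ltr_pdivrMr// ltr_pMr// ltr1n.
  move=> w _ nw; apply: moll_box => hw; apply: nw => p.
  by have := hw p; rewrite !mxE distrC.
have E1 := ibp oD bD l cF (c2 k) sF; have E2 := ibp oD bD k cF (c2 l) sF.
have E3 := itg_curl k l cF sF (C2_C1 cf).
have cF0 : C0 D F by have [] := cF.
have bF p q : BC D (fun w => F w * d2f p q w) by exact: BC_csMl.
have Z : itg D (fun w => F w * g w) = 0.
  have -> : itg D (fun w => F w * g w) = itg D (fun w => F w * d2f k l w) - itg D (fun w => F w * d2f l k w).
    by rewrite -itgB//; apply: eq_itg => w _; rewrite mulrBr.
  by rewrite E1 E2 E3 subrr.
have bFg : BC D (fun w => F w * g w) by exact: BC_csMl.
have Fg0 w : D w -> 0 <= F w * g w.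
  move=> Dw; have [/Hr[_ /= gw]|/outF ->] := pselect (cube y r w); last by rewrite mul0r.
  by rewrite mulr_ge0 ?moll_ge0// ltW.
have : nbhs y (cube y r `&` [set w | F y * g y / 2 < F w * g w]).
  apply: filterI; first by apply/nbhs_cubeP; exists r.
  have Fp : 0 < F y * g y by rewrite mulr_gt0// /F subrr moll_gt0.
  have N : nbhs (F y * g y) [set s | F y * g y / 2 < s].
    by apply: open_nbhs_nbhs; split; [exact: open_gt|rewrite /=; lra].
  exact: ((C0M cF0 cg) y Dy _ N).
move=> /nbhs_cubeP[q q0 Hq].
have := @itg_ge_cube R n D (fun w => F w * g w) y q (F y * g y / 2) oD bD bFg Fg0 (ltW q0).
rewrite Z leNgt => /(_ _ _)/negP; apply.
- by move=> w /Hq[/Hr[]].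
- by move=> w /Hq[_ /= /ltW].
apply: mulr_gt0; last by rewrite exprn_gt0// mulr_gt0.
by rewrite divr_gt0//; apply: mulr_gt0 => //; rewrite /F subrr moll_gt0.
Qed.

End cutoff_functions.

(** * Pointwise algebra of Bochner's formula *)

Section bochner_algebra.
Context {R : realType} {n : nat}.

Definition dsum (F : 'I_n -> 'I_n -> R) : R := \sum_i \sum_j F i j.

Lemma eq_dsum F G : (forall i j, F i j = G i j) -> dsum F = dsum G.
Proof. by move=> FG; apply: eq_bigr => i _; apply: eq_bigr => j _. Qed.

Lemma dsumD F G : dsum (fun i j => F i j + G i j) = dsum F + dsum G.
Proof. by rewrite /dsum -big_split; apply: eq_bigr => i _; rewrite big_split. Qed.

Lemma dsumZ c F : dsum (fun i j => c * F i j) = c * dsum F.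
Proof. by rewrite /dsum mulr_sumr; apply: eq_bigr => i _; rewrite mulr_sumr. Qed.

Lemma dsum_mul (a b : 'I_n -> R) : dsum (fun i j => a i * b j) = (\sum_i a i) * \sum_j b j.
Proof. by rewrite big_distrlr. Qed.

Variables (xi r : 'I_n -> R) (H : 'I_n -> 'I_n -> R) (Lam : 'I_n -> R) (rho e q : R).
Hypothesis symH : forall i j, H i j = H j i.

Let s := \sum_i xi i ^+ 2.
Let L := \sum_i H i i.
Let T := dsum (fun i j => H i j ^+ 2).
Let Q := dsum (fun i j => xi i * xi j * H i j).
Let Z := dsum (fun i j => xi i * r j * H i j).
Let rx := \sum_i r i * xi i.

Lemma hessian_square (a : R) :
  dsum (fun i j => (H i j + a * (xi i * xi j)) ^+ 2) = T + 2 * a * Q + a ^+ 2 * s ^+ 2.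
Proof.
have E2 : s ^+ 2 = dsum (fun i j => xi i ^+ 2 * xi j ^+ 2) by rewrite dsum_mul expr2.
rewrite E2 /T /Q -!dsumZ -!dsumD; apply: eq_dsum => i j; ring.
Qed.

Lemma curl_sum :
  dsum (fun i j => (rho * e * H i j + xi i * (rho * (2 * q * e * xi j) + e * r j)) * H j i
      - (rho * e * H i i + xi i * (rho * (2 * q * e * xi i) + e * r i)) * H j j)
  = rho * e * T + 2 * q * rho * e * Q + e * Z - rho * e * L ^+ 2 - 2 * q * rho * e * s * L - e * rx * L.
Proof.
have E1 : L ^+ 2 = dsum (fun i j => H i i * H j j) by rewrite dsum_mul expr2.
have E2 : s * L = dsum (fun i j => xi i ^+ 2 * H j j) by rewrite dsum_mul.
have E3 : rx * L = dsum (fun i j => r i * xi i * H j j) by rewrite dsum_mul.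
rewrite -!(mulrA _ s L) -!(mulrA _ rx L) E1 E2 E3 /T /Q /Z -!mulNr -!dsumZ -!dsumD.
apply: eq_dsum => i j; rewrite (symH j i); ring.
Qed.

Lemma divergence_sum1 :
  \sum_j (rho * e * xi j * (\sum_i (xi i * H i j + xi i * H i j)) +
     s * (rho * e * H j j + xi j * (rho * (2 * q * e * xi j) + e * r j)))
  = 2 * (rho * e) * Q + s * (rho * e * L + 2 * q * rho * e * s + e * rx).
Proof.
rewrite big_split /=; congr (_ + _).
  rewrite /Q /dsum exchange_big /= mulr_sumr; apply: eq_bigr => j _.
  by rewrite !mulr_sumr; apply: eq_bigr => i _; ring.
rewrite -mulr_sumr; congr (_ * _); rewrite big_split /= -mulr_sumr -addrA; congr (_ + _).
by rewrite /s /rx !mulr_sumr -big_split; apply: eq_bigr => j _ /=; ring.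
Qed.

Lemma divergence_sum2 :
  \sum_j (s * e * Lam j + r j * (s * (2 * q * e * xi j) + e * \sum_i (xi i * H i j + xi i * H i j)))
  = s * e * (\sum_j Lam j) + 2 * q * s * e * rx + 2 * e * Z.
Proof.
rewrite big_split /= -mulr_sumr -addrA; congr (_ + _).
rewrite (eq_bigr (fun j => 2 * q * s * e * (r j * xi j) + 2 * e * \sum_i xi i * r j * H i j)).
  by rewrite big_split /= -!mulr_sumr /Z /dsum exchange_big.
move=> j _.
have -> : \sum_i (xi i * H i j + xi i * H i j) = 2 * \sum_i xi i * H i j.
  by rewrite mulr_sumr; apply: eq_bigr => i _; ring.
have -> : \sum_i xi i * r j * H i j = r j * \sum_i xi i * H i j.
  by rewrite mulr_sumr; apply: eq_bigr => i _; ring.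
by move: (\sum_i xi i * H i j) s => a s'; ring.
Qed.

(** Here [xi] and [H] stand for the gradient and Hessian of ln U, [r] and [Lam] for the gradient and
    pure second derivatives of the weight rho, [e] for U^(2q). The right side is a square, a curl
    term and two divergences. Its factor q - 1/2 is forced: the terms [Q] enter with coefficient 2 a
    - 2 q + 1, and [T] and [Z] cancel by themselves. *)
Lemma bochner_pointwise (G : R) : L = - (G + s) ->
  rho * e * (G ^+ 2 + (3 / 2 - 2 * q) * (G * s) - (q - 1 / 2) * (3 / 2 - q) * s ^+ 2)
    + e * (- (rx * G) + (q - 1 / 2) * (rx * s) + 1 / 2 * (s * \sum_j Lam j)) =
  rho * e * dsum (fun i j => (H i j + (q - 1 / 2) * (xi i * xi j)) ^+ 2)
  - dsum (fun i j => (rho * e * H i j + xi i * (rho * (2 * q * e * xi j) + e * r j)) * H j i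
      - (rho * e * H i i + xi i * (rho * (2 * q * e * xi i) + e * r i)) * H j j)
  + 1 / 2 * (\sum_j (rho * e * xi j * (\sum_i (xi i * H i j + xi i * H i j)) +
     s * (rho * e * H j j + xi j * (rho * (2 * q * e * xi j) + e * r j))))
  + 1 / 2 * (\sum_j (s * e * Lam j +
     r j * (s * (2 * q * e * xi j) + e * \sum_i (xi i * H i j + xi i * H i j)))).
Proof.
move=> LE; rewrite hessian_square curl_sum divergence_sum1 divergence_sum2 LE.
move: s T Q Z rx (\sum_j Lam j) => s' T' Q' Z' rx' Lm; by field.
Qed.

End bochner_algebra.

(** * The weighted Bochner inequality for ln U *)

Section bochner_inequality.
Context {R : realType} {n : nat} (D : set 'rV[R]_n).
Local Notation V := 'rV[R]_n.
Hypotheses (oD : open D) (bD : bounded_set D).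
Variables (U : V -> R) (dU : 'I_n -> V -> R) (d2U : 'I_n -> 'I_n -> V -> R) (g : V -> R).
Hypotheses (cU : C2 D U dU d2U) (Up : forall x, D x -> 0 < U x).
Hypothesis eU : forall x, D x -> - lap d2U x = g x.

Definition lgrad (i : 'I_n) x := dU i x / U x.
Definition lhess (i j : 'I_n) x := d2U i j x / U x - lgrad i x * lgrad j x.
Definition lgrad2 x : R := \sum_i lgrad i x ^+ 2.

Lemma C2_ln_gradient : C2 D (fun x => ln (U x)) lgrad lhess.
Proof.
have tl := @twice_derivable_ln R.
have H := C2_comp cU (fun x Dx => let: And3 a _ _ := tl _ (Up Dx) in a)
  (fun x Dx => let: And3 _ b _ := tl _ (Up Dx) in b)
  (fun x Dx => let: And3 _ _ c := tl _ (Up Dx) in c).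
apply: (C2_ext oD H) => //.
- by move=> i x Dx; rewrite /lgrad mulrC powR_inv1// ltW// Up.
- move=> i j x Dx; have U0 := Up Dx; rewrite /lhess /lgrad.
  have -> : U x `^ (-1 - 1) = (U x)^-1 * (U x)^-1.
    by rewrite powRD ?(gt_eqF U0) ?implybT// !powR_inv1// ltW.
  by rewrite powR_inv1 ?(ltW U0)//; field; rewrite gt_eqF.
Qed.

Lemma C1_U_powR (a : R) : C1 D (fun x => U x `^ a) (fun i x => a * U x `^ a * lgrad i x).
Proof.
apply: (C1_ext oD (C2_C1 (C2_powR a cU Up))) => // i x Dx.
have U0 := Up Dx; have -> : U x `^ a = U x `^ (a - 1) * U x.
  by rewrite -{3}[U x]powRr1 ?(ltW U0)// -powRD ?subrK// (gt_eqF U0) implybT.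
by rewrite /lgrad; field; rewrite gt_eqF.
Qed.

Lemma lap_ln x : D x -> \sum_i lhess i i x = - (g x / U x + lgrad2 x).
Proof.
move=> Dx; rewrite /lhess sumrB -mulr_suml -/(lap d2U x).
have -> : lap d2U x = - g x by rewrite -eU// opprK.
by rewrite mulNr opprD; congr (_ - _); apply: eq_bigr => i _; rewrite expr2.
Qed.

Variables (rho : V -> R) (drho : 'I_n -> V -> R) (d2rho : 'I_n -> 'I_n -> V -> R) (q : R).
Hypotheses (cr : C2 D rho drho d2rho) (sr : cs D rho) (r0 : forall x, D x -> 0 <= rho x).

(** The usual derivation differentiates the Laplacian of ln U. To stay within C^2 the squared
    Hessian is compared with the squared Laplacian through [itg_curl], applied to each component of
    the weighted gradient; what remains after integration is the nonnegative square. *)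
Lemma bochner_integral : 0 <= itg D (fun x =>
  rho x * U x `^ (2 * q) * ((g x / U x) ^+ 2 + (3 / 2 - 2 * q) * (g x / U x * lgrad2 x)
    - (q - 1 / 2) * (3 / 2 - q) * lgrad2 x ^+ 2)
  + U x `^ (2 * q) * (- ((\sum_i drho i x * lgrad i x) * (g x / U x))
    + (q - 1 / 2) * ((\sum_i drho i x * lgrad i x) * lgrad2 x)
    + 1 / 2 * (lgrad2 x * lap d2rho x))).
Proof.
have [_ cx] := C2_ln_gradient; have symH i j x : D x -> lhess i j x = lhess j i x.
  by move=> Dx; exact: (hessian_sym oD bD i j C2_ln_gradient Dx).
have cE := C1_U_powR (2 * q); pose E x := U x `^ (2 * q).
have cW := C1M (C2_C1 cr) cE; have sW : cs D (fun x => rho x * E x) by exact: csMl.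
have cs2 := C1_sum (index_enum 'I_n) (fun i => C1M (cx i) (cx i)).
have c0x i : C0 D (lgrad i) by have [] := cx i.
have c0H i j : C0 D (lhess i j) by have [_ c _] := cx i; exact: c.
have c0E : C0 D E by have [] := cE.
have c0W : C0 D (fun x => rho x * E x) by have [] := cW.
(* [X1] is the curl expression of the components rho E d_i ln U; [X2] and [X3] are the divergences
   of rho E |grad ln U|^2 grad ln U and of |grad ln U|^2 E grad rho. All three integrate to zero
   since rho has compact support. *)
pose X1 i j x :=
  (rho x * E x * lhess i j x + lgrad i x * (rho x * (2 * q * E x * lgrad j x) + E x * drho j x)) * lhess j i x
  - (rho x * E x * lhess i i x + lgrad i x * (rho x * (2 * q * E x * lgrad i x) + E x * drho i x)) * lhess j j x.
pose X2 j x := rho x * E x * lgrad j x * (\sum_i (lgrad i x * lhess i j x + lgrad i x * lhess i j x)) +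
  (\sum_i lgrad i x * lgrad i x) * (rho x * E x * lhess j j x + lgrad j x * (rho x * (2 * q * E x * lgrad j x) + E x * drho j x)).
pose X3 j x := (\sum_i lgrad i x * lgrad i x) * E x * d2rho j j x +
  drho j x * ((\sum_i lgrad i x * lgrad i x) * (2 * q * E x * lgrad j x) +
   E x * (\sum_i (lgrad i x * lhess i j x + lgrad i x * lhess i j x))).
have cF i := C1M cW (cx i).
have sF i : cs D (fun x => rho x * E x * lgrad i x) by exact: csMl.
have bdF i k : BC D (fun x => rho x * E x * lhess i k x + lgrad i x * (rho x * (2 * q * E x * lgrad k x) + E x * drho k x)).
  apply: cs_BC; last exact: cs_grad (cF i) (sF i).
  by have [_ c _] := cF i; exact: c.
have bX1t i j k l : BC D (fun x => (rho x * E x * lhess i k x + lgrad i x * (rho x * (2 * q * E x * lgrad k x) + E x * drho k x)) * lhess j l x).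
  apply: BC_csMl; [by case: (bdF i k)|exact: c0H|exact: cs_grad (cF i) (sF i)].
have bX1 i j : BC D (X1 i j) by apply: BCB; exact: bX1t.
have I1 i j : itg D (X1 i j) = 0.
  rewrite (itgB oD bD (bX1t i j j i) (bX1t i j i j)).
  by rewrite (itg_curl oD bD i j (cF i) (sF i) (cx j)) subrr.
have cG2 j := C1M (cF j) cs2.
have sG2 j : cs D (fun x => rho x * E x * lgrad j x * \sum_i lgrad i x * lgrad i x) by exact: csMl.
have bX2 j : BC D (X2 j).
  apply: cs_BC; last exact: cs_grad (cG2 j) (sG2 j).
  by have [_ c _] := cG2 j; exact: c.
have I2 j : itg D (X2 j) = 0 by exact: (itg_grad_eq0 oD bD j (cG2 j) (sG2 j)).
have [cr1 cr2] := cr.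
have cG3 j := C1M (C1M cs2 cE) (cr2 j).
have sdr j : cs D (drho j) by exact: cs_grad cr1 sr.
have sG3 j : cs D (fun x => (\sum_i lgrad i x * lgrad i x) * E x * drho j x) by exact: csMr.
have bX3 j : BC D (X3 j).
  apply: cs_BC; last exact: cs_grad (cG3 j) (sG3 j).
  by have [_ c _] := cG3 j; exact: c.
have I3 j : itg D (X3 j) = 0 by exact: (itg_grad_eq0 oD bD j (cG3 j) (sG3 j)).
pose N x := rho x * E x * dsum (fun i j => (lhess i j x + (q - 1 / 2) * (lgrad i x * lgrad j x)) ^+ 2).
have bN : BC D N.
  apply: BC_csMl => //; apply: C0_sum => i; apply: C0_sum => j; apply: C0X.
  apply: C0D => //; apply: C0M; first exact: (@C0_cst R n D (q - 1 / 2)).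
  exact: C0M.
have bS1 : BC D (fun x => dsum (fun i j => X1 i j x)).
  by apply: BC_sum => i; apply: BC_sum.
have bS2 : BC D (fun x => 1 / 2 * \sum_j X2 j x) by apply: BCZ; exact: BC_sum.
have bS3 : BC D (fun x => 1 / 2 * \sum_j X3 j x) by apply: BCZ; exact: BC_sum.
rewrite (_ : itg D _ = itg D (fun x => N x - dsum (fun i j => X1 i j x) + 1 / 2 * \sum_j X2 j x
   + 1 / 2 * \sum_j X3 j x)); last first.
  apply: eq_itg => x Dx; rewrite /N /X1 /X2 /X3.
  have -> : \sum_i lgrad i x * lgrad i x = lgrad2 x by apply: eq_bigr => i _; rewrite expr2.
  rewrite -(bochner_pointwise (fun i => drho i x) (fun i => d2rho i i x) (rho x) (E x) q
    (fun i j => symH i j x Dx) (lap_ln Dx)) //.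
rewrite itgD//; last by apply: BCD => //; exact: BCB.
rewrite itgD//; last exact: BCB.
rewrite itgB// !itgZ//; [|exact: BC_sum|exact: BC_sum].
rewrite !itg_sum//; last by move=> i; exact: BC_sum.
rewrite (eq_bigr (fun=> 0)) => [|i _]; last by rewrite itg_sum// big1.
rewrite !big1// !mulr0 !addr0 subr0; apply: itg_ge0 => // x Dx.
rewrite mulr_ge0 ?mulr_ge0 ?powR_ge0 ?r0//.
by apply: sumr_ge0 => i _; apply: sumr_ge0 => j _; rewrite sqr_ge0.
Qed.

End bochner_inequality.

Lemma powR_pred {R : realType} (t a : R) : 0 < t -> t `^ (a - 1) = t `^ a / t.
Proof.
move=> t0; have -> : t `^ a = t `^ (a - 1) * t.
  by rewrite -{3}[t]powRr1 ?(ltW t0)// -powRD ?subrK// (gt_eqF t0) implybT.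
by rewrite mulfK// gt_eqF.
Qed.

(** * Bochner and stability estimates with a cutoff *)

Section weighted_estimates.
Context {R : realType} {n : nat} (D K : set 'rV[R]_n).
Local Notation V := 'rV[R]_n.
Hypotheses (oD : open D) (bD : bounded_set D) (cK : compact K) (KD : K `<=` D).
Variables (z : V -> R) (dz : 'I_n -> V -> R) (d2z : 'I_n -> 'I_n -> V -> R).
Hypotheses (cz : C2 D z dz d2z) (sz : cs D z) (z01 : forall x, 0 <= z x <= 1).
Hypothesis zK : forall x, K x -> [/\ z x = 1, forall i, dz i x = 0 & forall i j, d2z i j x = 0].

Lemma young_powers (N d : R) : 0 <= N -> 0 < d -> exists2 C : R, 0 <= C &
  forall y : R, 0 <= y -> N * (1 + y + y ^+ 2 + y ^+ 3) <= d * y ^+ 4 + C.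
Proof.
move=> N0 d0; pose Y := 1 + 4 * N / d.
have Y1 : 1 <= Y by rewrite lerDl divr_ge0 ?(ltW d0)// mulr_ge0.
exists (N * (4 * Y ^+ 3)); first by rewrite mulr_ge0// mulr_ge0// exprn_ge0//; lra.
move=> y y0; have [h|h] := leP y Y.
  have h3 : 1 + y + y ^+ 2 + y ^+ 3 <= 4 * Y ^+ 3.
    have a1 : 1 <= Y ^+ 3 by rewrite exprn_ege1.
    have a2 : y <= Y ^+ 3 by apply: le_trans h _; rewrite -[leLHS]expr1 ler_weXn2l.
    have a3 : y ^+ 2 <= Y ^+ 3.
      apply: (@le_trans _ _ (Y ^+ 2)); first by rewrite ler_pXn2r ?nnegrE//; lra.
      by rewrite ler_weXn2l.
    have a4 : y ^+ 3 <= Y ^+ 3 by rewrite ler_pXn2r ?nnegrE//; lra.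
    lra.
  have := ler_wpM2l N0 h3; have : 0 <= d * y ^+ 4 by rewrite mulr_ge0 ?exprn_ge0// ltW.
  lra.
have y1 : 1 <= y by lra.
have h3 : 1 + y + y ^+ 2 + y ^+ 3 <= 4 * y ^+ 3.
  have a1 : 1 <= y ^+ 3 by rewrite exprn_ege1.
  have a2 : y <= y ^+ 3 by rewrite -[leLHS]expr1 ler_weXn2l.
  have a3 : y ^+ 2 <= y ^+ 3 by rewrite ler_weXn2l.
  lra.
have y30 : 0 <= y ^+ 3 by rewrite exprn_ge0.
have yN : 4 * N <= d * y.
  have : d * Y <= d * y by rewrite ler_wpM2l ?ltW.
  rewrite /Y mulrDr mulr1 mulrCA mulfV ?gt_eqF// mulr1; lra.
have := ler_wpM2l N0 h3; have := ler_wpM2r y30 yN.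
have : 0 <= N * (4 * Y ^+ 3) by rewrite mulr_ge0// mulr_ge0// exprn_ge0//; lra.
rewrite (_ : d * y * y ^+ 3 = d * y ^+ 4); last by ring.
lra.
Qed.

Lemma cutoff_bounds : exists2 N : R, 0 <= N & forall x, D x ->
  (forall i, `|dz i x| <= N) /\ `|lap d2z x| <= N.
Proof.
have sd i : cs D (dz i) by exact: cs_grad (C2_C1 cz) sz.
have cd i : C0 D (dz i) by have [[_ c _] _] := cz; exact: c.
have [_ [M HM]] : BC D (fun x => \sum_i `|dz i x| + `|lap d2z x|).
  apply: BCD; first by apply: BC_sum => i; apply: BC_abs; exact: cs_BC.
  by apply: BC_abs; apply: cs_BC; [exact: C0_lap cz|exact: cs_lap cz sz].
exists `|M| => // x Dx; have s0 : 0 <= \sum_i `|dz i x| by exact: sumr_ge0.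
have h : \sum_i `|dz i x| + `|lap d2z x| <= `|M|.
  by apply: le_trans (le_trans (ler_norm _) (HM x Dx)) (ler_norm _).
split; last by lra.
move=> i; apply: le_trans h; rewrite (bigD1 i)//= -addrA lerDl addr_ge0//.
by apply: sumr_ge0.
Qed.

Definition zpow (k : nat) x := z x ^+ k.
Definition dzpow (k : nat) (i : 'I_n) x := k%:R * z x ^+ k.-1 * dz i x.
Definition d2zpow (k : nat) (i j : 'I_n) x :=
  k%:R * z x ^+ k.-1 * d2z i j x + dz i x * (k%:R * (k.-1%:R * z x ^+ k.-2) * dz j x).

Lemma C2_zpow k : C2 D (zpow k) (dzpow k) (d2zpow k).
Proof.
have dX (m : nat) (s : R) : is_derive s (1 : R) (fun s : R => s ^+ m) (m%:R * s ^+ m.-1).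
  elim: m => [|m IH].
    by apply: (is_derive_eq (is_derive_cst (1 : R) s (1 : R))); rewrite mul0r.
  rewrite (_ : (fun s : R => _) = (fun s => s * s ^+ m)); last by apply/funext => w; rewrite exprS.
  apply: (is_derive_eq (is_deriveM (is_derive_id s (1 : R)) IH)); rewrite /GRing.scale /= mulr1 -natr1.
  case: m {IH} => [|m]; last by rewrite /= exprS; ring.
  by rewrite mulr0n mul0r mulr0 !add0r mul1r.
have d1 s : is_derive s (1 : R) (fun s : R => k%:R * s ^+ k.-1) (k%:R * (k.-1%:R * s ^+ k.-2)).
  exact: (is_deriveZ k%:R (dX k.-1 s)).
have c2 (s : R) : {for s, continuous (fun s : R => k%:R * (k.-1%:R * s ^+ k.-2))}.
  apply: cvgM; first exact: cvg_cst.
  apply: cvgM; first exact: cvg_cst.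
  exact: exprn_continuous.
exact: (C2_comp cz (fun x _ => dX k _) (fun x _ => d1 _) (fun x _ => c2 _)).
Qed.

Lemma norm_zpow (k a : R) m x : 0 <= k -> `|k * z x ^+ m * a| = k * z x ^+ m * `|a|.
Proof.
move=> k0; rewrite normrM ger0_norm// mulr_ge0// exprn_ge0//.
by case/andP: (z01 x).
Qed.

Variables (q M0 : R).
Hypotheses (q1 : 1 <= q) (M00 : 0 <= M0).

Section solution.
Variables (U : V -> R) (dU : 'I_n -> V -> R) (d2U : 'I_n -> 'I_n -> V -> R) (g : V -> R).

(** The three moments of degree two in the pair (- Delta U / U, |grad ln U|^2). Up to cutoff terms
    the integral of (Delta (z^4 U^q))^2 is q^2 (A - 2 (q-1) B + (q-1)^2 C). *)
Definition momA := itg D (fun x => z x ^+ 8 * U x `^ (2 * q) * (g x / U x) ^+ 2).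
Definition momB := itg D (fun x => z x ^+ 8 * U x `^ (2 * q) * (g x / U x * lgrad2 U dU x)).
Definition momC := itg D (fun x => z x ^+ 8 * U x `^ (2 * q) * lgrad2 U dU x ^+ 2).

Hypotheses (cU : C2 D U dU d2U) (Up : forall x, D x -> 0 < U x).
Hypothesis eU : forall x, D x -> - lap d2U x = g x.

Lemma lgrad2_ge0 x : 0 <= lgrad2 U dU x.
Proof. by apply: sumr_ge0 => i _; rewrite sqr_ge0. Qed.

Lemma C0_weight (f : V -> R) : C0 D f -> BC D (fun x => z x ^+ 8 * U x `^ (2 * q) * f x).
Proof.
move=> cf; apply: BC_csMl => //.
  apply: C0M; first by apply: C0X; exact: C2_C0 cz.
  by have [] := C1_U_powR oD cU Up (2 * q).
by apply: csMl; apply: csX => //.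
Qed.

Lemma C0_lgrad i : C0 D (lgrad U dU i).
Proof. by have [_ c] := C2_ln_gradient oD cU Up; have [] := c i. Qed.

Lemma C0_lgrad2 : C0 D (lgrad2 U dU).
Proof. by apply: C0_sum => i; apply: C0X; exact: C0_lgrad. Qed.

Lemma C0_quot : C0 D (fun x => g x / U x).
Proof.
have cg : C0 D g.
  by apply: (near_C0 oD _ (C0N (C0_lap cU))) => x Dx; rewrite eU.
apply: C0M => // x Dx.
apply: (@continuous_comp _ _ _ U (fun s : R => s^-1)); first exact: ((C2_C0 cU) x Dx).
by apply: inv_continuous; rewrite gt_eqF// Up.
Qed.

Lemma momA_ge0 : 0 <= momA.
Proof.
apply: itg_ge0 => // x _; rewrite mulr_ge0 ?sqr_ge0// mulr_ge0 ?powR_ge0// exprn_ge0//.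
by case/andP: (z01 x).
Qed.

Lemma momC_ge0 : 0 <= momC.
Proof.
apply: itg_ge0 => // x _; rewrite mulr_ge0 ?sqr_ge0// mulr_ge0 ?powR_ge0// exprn_ge0//.
by case/andP: (z01 x).
Qed.

(* In the collar U and g are bounded, and Y = U^(q/2) z^2 |grad ln U| is the quantity
   whose fourth power is the density of [momC]. *)
Lemma collar_density (N : R) x : D x -> U x <= M0 -> `|g x| <= M0 ->
  (forall i, `|dz i x| <= N) -> 0 <= N -> exists Y : R, [/\ 0 <= Y,
    Y ^+ 4 = z x ^+ 8 * U x `^ (2 * q) * lgrad2 U dU x ^+ 2,
    U x `^ (2 * q) * (z x ^+ 6 * lgrad2 U dU x) <= (M0 + 1) `^ q * Y ^+ 2 /\
    U x `^ (2 * q) <= (M0 + 1) `^ (2 * q) &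
    z x ^+ 3 * `|\sum_i dz i x * lgrad U dU i x| * U x `^ (2 * q) * (z x ^+ 3 * lgrad2 U dU x)
      * z x <= n%:R * N * (M0 + 1) `^ (q / 2) * Y ^+ 3 /\
    z x ^+ 7 * `|\sum_i dz i x * lgrad U dU i x| * U x `^ (2 * q) * `|g x / U x| <=
      n%:R * N * ((M0 + 1) `^ (3 * q / 2 - 1) * M0) * Y /\
    U x `^ (2 * q) * (z x ^+ 3 * `|\sum_i dz i x * lgrad U dU i x|) ^+ 2 <=
      (n%:R * N) ^+ 2 * (M0 + 1) `^ q * Y ^+ 2].
Proof.
move=> Dx UM gM dzN N0; have U0 := Up Dx; have /andP[z0 z1] := z01 x.
pose s := lgrad2 U dU x; have s0 : 0 <= s := lgrad2_ge0 x.
pose w := Num.sqrt s; have w0 : 0 <= w by exact: sqrtr_ge0.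
have w2 : w ^+ 2 = s by rewrite sqr_sqrtr.
have lw i : `|lgrad U dU i x| <= w.
  rewrite -(@ler_pXn2r _ 2)// ?nnegrE// w2 real_normK ?num_real// /s /lgrad2 (bigD1 i)//=.
  by rewrite lerDl sumr_ge0// => j _; rewrite sqr_ge0.
set r := `|\sum_i dz i x * lgrad U dU i x|.
have r0 : 0 <= r by exact: normr_ge0.
have rw : r <= n%:R * N * w.
  apply: le_trans (ler_norm_sum _ _ _) _.
  apply: (@le_trans _ _ (\sum_(i < n) N * w)).
    by apply: ler_sum => i _; rewrite normrM ler_pM.
  rewrite -[n in n%:R]card_ord -sum1_card natr_sum !mulr_suml; apply: ler_sum => i _.
  by rewrite mul1r.
pose P a := U x `^ a; have P0 a : 0 <= P a by exact: powR_ge0.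
have PD a b : P a * P b = P (a + b) by rewrite /P -powRD// (gt_eqF U0) implybT.
pose Q a := (M0 + 1) `^ a; have Q0 a : 0 <= Q a by exact: powR_ge0.
have PQ a : 0 <= a -> P a <= Q a.
  by move=> a0; rewrite /P /Q ge0_ler_powR ?nnegrE//; move: UM U0; lra_goal.
pose h := P (q / 2).
have h4 : P (2 * q) = h ^+ 4.
  by rewrite /h !exprS expr0 mulr1 !PD; congr P; field.
have h2 : P q = h ^+ 2 by rewrite /h expr2 PD; congr P; field.
have q1' := q1; have M00' := M00.
have h0 : 0 <= h by exact: P0.
have zk (k l : nat) : (l <= k)%N -> z x ^+ k <= z x ^+ l by move=> kl; rewrite ler_wiXn2l.
have zp k : 0 <= z x ^+ k by exact: exprn_ge0.
have Y0 : 0 <= h * z x ^+ 2 * w by rewrite !mulr_ge0.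
exists (h * z x ^+ 2 * w); split => //.
- rewrite -/s -w2 -/(P (2 * q)) h4; ring.
- split; last by apply: PQ; move: q1'; lra_goal.
  rewrite -/s -w2 -/(P (2 * q)) -/(Q q) h4.
  have := PQ q ltac:(move: q1'; lra_goal); rewrite h2 => hq.
  apply: (@le_trans _ _ (h ^+ 2 * (h * z x ^+ 2 * w) ^+ 2)); last first.
    by rewrite ler_wpM2r ?exprn_ge0.
  rewrite (_ : h ^+ 4 * (z x ^+ 6 * w ^+ 2) = (h ^+ 4 * w ^+ 2) * z x ^+ 6); last by ring.
  rewrite (_ : h ^+ 2 * _ = (h ^+ 4 * w ^+ 2) * z x ^+ 4); last by ring.
  by rewrite ler_wpM2l ?mulr_ge0 ?exprn_ge0// zk.
have nN : 0 <= n%:R * N by rewrite mulr_ge0.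
split; last split.
- rewrite -/s -w2 -/(P (2 * q)) -/(Q (q / 2)) h4.
  have := PQ (q / 2) ltac:(move: q1'; lra_goal); rewrite -/h => hq.
  apply: (@le_trans _ _ (n%:R * N * h * (h * z x ^+ 2 * w) ^+ 3)); last first.
    by rewrite ler_wpM2r ?exprn_ge0// ler_wpM2l.
  rewrite (_ : z x ^+ 3 * r * _ * _ * z x = (h ^+ 4 * w ^+ 2 * z x ^+ 7) * r); last by ring.
  apply: (@le_trans _ _ ((h ^+ 4 * w ^+ 2 * z x ^+ 7) * (n%:R * N * w))).
    by rewrite ler_wpM2l// !mulr_ge0// exprn_ge0.
  rewrite (_ : _ * (n%:R * N * w) = (n%:R * N * h ^+ 4 * w ^+ 3) * z x ^+ 7); last by ring.
  rewrite (_ : n%:R * N * h * _ = (n%:R * N * h ^+ 4 * w ^+ 3) * z x ^+ 6); last by ring.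
  by rewrite ler_wpM2l ?zk// !mulr_ge0// exprn_ge0.
- rewrite normrM [`|(U x)^-1|]gtr0_norm ?invr_gt0// -/(P (2 * q)) -/(Q (3 * q / 2 - 1)).
  have e1 : P (2 * q) / U x = h * P (3 * q / 2 - 1).
    have -> : (U x)^-1 = P (-1) by rewrite /P powR_inv1 ?ltW.
    by rewrite PD /h PD; congr P; field.
  rewrite (_ : z x ^+ 7 * r * P (2 * q) * _ = (P (2 * q) / U x) * `|g x| * (z x ^+ 7 * r)); last by ring.
  rewrite e1.
  have e2 : P (3 * q / 2 - 1) * `|g x| <= Q (3 * q / 2 - 1) * M0.
    by apply: ler_pM => //; apply: PQ; move: q1'; lra_goal.
  rewrite (_ : h * _ * `|g x| * _ = (P (3 * q / 2 - 1) * `|g x|) * (h * z x ^+ 7 * r)); last by ring.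
  rewrite (_ : n%:R * N * _ * _ = (Q (3 * q / 2 - 1) * M0) * (h * z x ^+ 2 * (n%:R * N * w))); last by ring.
  apply: ler_pM => //; [by rewrite mulr_ge0|by rewrite !mulr_ge0|].
  apply: ler_pM => //; first by rewrite mulr_ge0.
  by rewrite ler_wpM2l// zk.
rewrite -/(P (2 * q)) -/(Q q) h4.
have := PQ q ltac:(move: q1'; lra_goal); rewrite h2 => hq.
have r2 : r ^+ 2 <= (n%:R * N) ^+ 2 * w ^+ 2.
  by rewrite -exprMn ler_pXn2r ?nnegrE// mulr_ge0.
apply: (@le_trans _ _ ((n%:R * N) ^+ 2 * h ^+ 2 * (h * z x ^+ 2 * w) ^+ 2)); last first.
  by rewrite ler_wpM2r ?exprn_ge0// ler_wpM2l ?exprn_ge0.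
rewrite (_ : h ^+ 4 * _ = (h ^+ 4 * z x ^+ 6) * r ^+ 2); last by ring.
apply: (@le_trans _ _ ((h ^+ 4 * z x ^+ 6) * ((n%:R * N) ^+ 2 * w ^+ 2))).
  by rewrite ler_wpM2l// mulr_ge0// exprn_ge0.
rewrite (_ : h ^+ 4 * z x ^+ 6 * _ = (h ^+ 4 * (n%:R * N) ^+ 2 * w ^+ 2) * z x ^+ 6); last by ring.
rewrite (_ : (n%:R * N) ^+ 2 * _ * _ = (h ^+ 4 * (n%:R * N) ^+ 2 * w ^+ 2) * z x ^+ 4); last by ring.
by rewrite ler_wpM2l ?zk// !mulr_ge0 ?exprn_ge0.
Qed.

End solution.

Lemma lap_zpow k x : lap (d2zpow k) x = k%:R * z x ^+ k.-1 * lap d2z x +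
  k%:R * (k.-1%:R * z x ^+ k.-2) * \sum_i dz i x ^+ 2.
Proof.
rewrite /lap /d2zpow big_split /= -mulr_sumr; congr (_ + _).
by rewrite mulr_sumr; apply: eq_bigr => i _; ring.
Qed.

Lemma sum_dzpow k (f : 'I_n -> R) x :
  \sum_i dzpow k i x * f i = k%:R * z x ^+ k.-1 * \sum_i dz i x * f i.
Proof. by rewrite mulr_sumr; apply: eq_bigr => i _; rewrite /dzpow mulrA. Qed.

Lemma sum_sqr_le (N : R) x : 0 <= N -> (forall i, `|dz i x| <= N) ->
  0 <= \sum_i dz i x ^+ 2 <= n%:R * N ^+ 2.
Proof.
move=> N0 h; rewrite sumr_ge0 => [|i _]; last exact: sqr_ge0.
rewrite -[n in n%:R]card_ord -sum1_card natr_sum mulr_suml /=; apply: ler_sum => i _.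
by rewrite mul1r -real_normK ?num_real// ler_pXn2r ?nnegrE.
Qed.

(** The terms with derivatives of the cutoff live off [K], where U and g are bounded. Each is at
    most a constant times Y, Y^2 or Y^3, where Y^4 is the density of [momC]; eight powers of z leave
    enough of them after two derivatives. Young's inequality absorbs them into d [momC] and a
    constant independent of the solution. *)
Lemma weighted_bochner (d : R) : 0 < d -> exists2 K0 : R, 0 <= K0 &
  forall U dU d2U g, C2 D U dU d2U -> (forall x, D x -> 0 < U x) ->
  (forall x, D x -> - lap d2U x = g x) ->
  (forall x, D x -> ~ K x -> U x <= M0 /\ `|g x| <= M0) ->
  (q - 1 / 2) * (3 / 2 - q) * momC U dU <=
    momA U g + (3 / 2 - 2 * q) * momB U dU g + d * momC U dU + K0.
Proof.
move=> d0; have [N N0 HN] := cutoff_bounds.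
pose Q a := (M0 + 1) `^ a; have Q0 a : 0 <= Q a by exact: powR_ge0.
have nN : 0 <= n%:R * N by rewrite mulr_ge0.
pose c1 := n%:R * N * (Q (3 * q / 2 - 1) * M0).
pose c2 := n%:R * N * Q (q / 2).
pose c3 := 8 * N + 56 * (n%:R * N ^+ 2).
have c10 : 0 <= c1 by rewrite !mulr_ge0.
have c20 : 0 <= c2 by rewrite !mulr_ge0.
have c30 : 0 <= c3 by rewrite addr_ge0 ?mulr_ge0 ?sqr_ge0.
pose N4 := 8 * c1 + 8 * q * c2 + c3 * Q q.
have q1' := q1; have q0' : 0 <= q by lra.
have N40 : 0 <= N4 by rewrite !addr_ge0// !mulr_ge0.
have [K1 K10 HK1] := young_powers N40 d0.
exists (K1 * fine (lebesgue_rV n D)); first by rewrite mulr_ge0 ?fine_ge0.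
move=> U dU d2U g cU Up eU UM.
have r0 x : D x -> 0 <= zpow 8 x by move=> _; rewrite exprn_ge0//; case/andP: (z01 x).
have sr : cs D (zpow 8) by exact: csX.
have cr := C2_zpow 8.
have BI := bochner_integral oD bD cU Up eU q cr sr r0.
have cG := C0_quot cU Up eU; have cS := C0_lgrad2 cU Up.
pose E x := U x `^ (2 * q).
have cE : C0 D E by have [] := C1_U_powR oD cU Up (2 * q).
pose r x := \sum_i dzpow 8 i x * lgrad U dU i x.
have cdr i : C0 D (dzpow 8 i) by have [[_ c _] _] := cr; exact: c.
have sdr i : cs D (dzpow 8 i) by exact: cs_grad (C2_C1 cr) sr.
have c_r : C0 D r by apply: C0_sum => i; apply: C0M => //; exact: C0_lgrad cU Up i.
have s_r : cs D r by apply: cs_sum => i; exact: csMl.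
have cl : C0 D (lap (d2zpow 8)) := C0_lap cr.
have sl : cs D (lap (d2zpow 8)) := cs_lap oD cr sr.
have bW := C0_weight cU Up.
pose P1 x := zpow 8 x * E x * ((g x / U x) ^+ 2 + (3 / 2 - 2 * q) * (g x / U x * lgrad2 U dU x)
    - (q - 1 / 2) * (3 / 2 - q) * lgrad2 U dU x ^+ 2).
pose P2 x := E x * (- (r x * (g x / U x)) + (q - 1 / 2) * (r x * lgrad2 U dU x)
    + 1 / 2 * (lgrad2 U dU x * lap (d2zpow 8) x)).
have cc (a : R) f : C0 D f -> C0 D (fun x => a * f x).
  by move=> cf; apply: C0M => //; exact: (@C0_cst R n D a).
have bP1 : BC D P1.
  apply: bW; apply: C0B; first apply: C0D; [exact: C0X|by apply: (cc); exact: C0M|].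
  by apply: (cc); exact: C0X.
have bP2 : BC D P2.
  apply: cs_BC.
    apply: C0M => //; apply: C0D; first apply: C0D.
    - by apply: C0N; exact: C0M.
    - by apply: (cc); exact: C0M.
    - by apply: (cc); exact: C0M.
  apply: csMr; apply: csD; first apply: csD.
  - by apply: csN; exact: csMl.
  - by apply: csMr; exact: csMl.
  - by apply: csMr; exact: csMr.
have bA : BC D (fun x => z x ^+ 8 * U x `^ (2 * q) * (g x / U x) ^+ 2) by apply: bW; exact: C0X.
have bB : BC D (fun x => z x ^+ 8 * U x `^ (2 * q) * (g x / U x * lgrad2 U dU x)).
  by apply: bW; exact: C0M.
have bC : BC D (fun x => z x ^+ 8 * U x `^ (2 * q) * lgrad2 U dU x ^+ 2) by apply: bW; exact: C0X.
pose kap := (q - 1 / 2) * (3 / 2 - q).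
have E1 : itg D P1 = momA U g + (3 / 2 - 2 * q) * momB U dU g - kap * momC U dU.
  rewrite -!itgZ// -itgD//; last exact: BCZ.
  rewrite -itgB//; [|by apply: BCD => //; exact: BCZ|exact: BCZ].
  by apply: eq_itg => x Dx; rewrite /P1 /zpow /E /kap; ring.
have E2 : itg D P2 <= d * momC U dU + K1 * fine (lebesgue_rV n D).
  rewrite -itgZ// -(itg_cst oD) -itgD//; [|exact: BCZ|exact: BC_cst].
  apply: itg_le => //; first by apply: BCD; [exact: BCZ|exact: BC_cst].
  move=> x Dx; have /andP[z0 z1] := z01 x.
  have W0 : 0 <= z x ^+ 8 * U x `^ (2 * q) * lgrad2 U dU x ^+ 2.
    by rewrite mulr_ge0 ?sqr_ge0// mulr_ge0 ?powR_ge0// exprn_ge0.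
  have [Kx|nK] := pselect (K x).
    have [_ d1 d2] := zK Kx.
    have rK : r x = 0.
      by rewrite /r sum_dzpow big1 ?mulr0// => i _; rewrite d1 mul0r.
    have lK : lap (d2zpow 8) x = 0.
      rewrite lap_zpow [lap d2z x]big1; last by move=> i _; rewrite d2.
      by rewrite big1 ?mulr0 ?addr0// => i _; rewrite d1 expr0n.
    have -> : P2 x = 0 by rewrite /P2 rK lK !mul0r !mulr0 oppr0 !addr0 mulr0.
    by rewrite addr_ge0// mulr_ge0// ltW.
  (* The three cutoff terms contain the gradient of z against g/U, the gradient of z against |grad
     ln U|^2, and the Laplacian of z^8; they are of order 1, 3 and 2 in [Y]. *)
  have [UM1 gM] := UM x Dx nK; have [dzN lzN] := HN x Dx.
  have [Y [Y0 Y4 [Y2 _] [Y3 [Y1 _]]]] := collar_density dU Up Dx UM1 gM dzN N0.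
  rewrite -Y4; apply: le_trans (HK1 Y Y0).
  have rE : r x = 8 * z x ^+ 7 * \sum_i dz i x * lgrad U dU i x by rewrite /r sum_dzpow.
  move: Y1 Y3 Y2; rewrite -/(E x) -/(Q q) -/(Q (q / 2)) -/(Q (3 * q / 2 - 1)) -/c1 -/c2.
  move: rE; set sg := \sum_i dz i x * lgrad U dU i x; set s := lgrad2 U dU x.
  set G := g x / U x => rE Y1 Y3 Y2.
  have E0 : 0 <= E x by exact: powR_ge0.
  have s0 : 0 <= s by exact: lgrad2_ge0.
  have t1 : E x * - (r x * G) <= 8 * c1 * Y.
    rewrite rE (_ : E x * - _ = 8 * z x ^+ 7 * - (sg * E x * G)); last by ring.
    apply: le_trans (ler_norm _) _; rewrite norm_zpow// normrN normrM.
    rewrite [`|sg * E x|]normrM (ger0_norm E0); move: Y1; move: (`|G|) (c1) => G' c1'; lra_goal.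
  have t2 : E x * ((q - 1 / 2) * (r x * s)) <= 8 * q * c2 * Y ^+ 3.
    rewrite rE; apply: (@le_trans _ _ (8 * q * (z x ^+ 3 * `|sg| * E x * (z x ^+ 3 * s) * z x))); last first.
      rewrite -(mulrA (8 * q) c2); apply: ler_wpM2l => //; move: q0'; lra_goal.
    rewrite (_ : 8 * q * _ = q * (8 * z x ^+ 7 * s * E x) * `|sg|); last by ring.
    rewrite (_ : E x * _ = (q - 1 / 2) * (8 * z x ^+ 7 * s * E x) * sg); last by ring.
    have m0 : 0 <= 8 * z x ^+ 7 * s * E x by rewrite !mulr_ge0 ?exprn_ge0.
    apply: (@le_trans _ _ ((q - 1 / 2) * (8 * z x ^+ 7 * s * E x) * `|sg|)).
      by rewrite ler_wpM2l ?ler_norm// mulr_ge0//; move: q1'; lra_goal.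
    by apply: ler_wpM2r => //; apply: ler_wpM2r => //; lra_goal.
  have t3 : E x * (1 / 2 * (s * lap (d2zpow 8) x)) <= c3 * Q q * Y ^+ 2.
    have h : `|lap (d2zpow 8) x| <= z x ^+ 6 * c3.
      rewrite lap_zpow /=; apply: le_trans (ler_normD _ _) _.
      have /andP[q0 qN] := sum_sqr_le N0 dzN.
      rewrite /c3 mulrDr; apply: lerD.
        rewrite norm_zpow//; rewrite (_ : z x ^+ 6 * (8 * N) = 8 * z x ^+ 6 * N); last by ring.
        apply: ler_pM => //; first by rewrite mulr_ge0// exprn_ge0.
        by rewrite ler_wpM2l// ler_wiXn2l.
      rewrite mulrA norm_zpow// (ger0_norm q0).
      rewrite (_ : z x ^+ 6 * (56 * (n%:R * N ^+ 2)) = 8 * 7 * z x ^+ 6 * (n%:R * N ^+ 2)); last by ring.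
      by rewrite ler_wpM2l// !mulr_ge0// exprn_ge0.
    have m0 : 0 <= E x * s by rewrite mulr_ge0.
    apply: (@le_trans _ _ (E x * s * (z x ^+ 6 * c3))).
      rewrite (_ : E x * (1 / 2 * _) = E x * s * (1 / 2 * lap (d2zpow 8) x)); last by ring.
      rewrite ler_wpM2l//; apply: le_trans h; apply: le_trans (ler_norm _) _.
      by rewrite normrM ger0_norm// ler_piMl//; lra_goal.
    rewrite (_ : E x * s * _ = c3 * (E x * (z x ^+ 6 * s))); last by ring.
    by rewrite -mulrA ler_wpM2l.
  have -> : P2 x = E x * - (r x * G) + E x * ((q - 1 / 2) * (r x * s)) +
     E x * (1 / 2 * (s * lap (d2zpow 8) x)) by rewrite /P2 -/G -/s; ring.
  apply: le_trans (lerD (lerD t1 t2) t3) _; rewrite /N4.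
  have Y2' : 0 <= Y ^+ 2 by exact: exprn_ge0.
  have Y3' : 0 <= Y ^+ 3 by exact: exprn_ge0.
  have a1 : 0 <= 8 * c1 by rewrite mulr_ge0.
  have a2 : 0 <= 8 * q * c2 by rewrite mulr_ge0//; move: q0'; lra_goal.
  have a3 : 0 <= c3 * Q q by rewrite mulr_ge0.
  move: a1 a2 a3 Y2' Y3' Y0; move: (8 * c1) (8 * q * c2) (c3 * Q q) (Y ^+ 2) (Y ^+ 3) => A1 A2 A3 y2 y3 h1 h2 h3 h4 h5 h6.
  have : 0 <= A1 * (1 + y2 + y3) by rewrite mulr_ge0//; move: h5 h4; lra_goal.
  have : 0 <= A2 * (1 + Y + y2) by rewrite mulr_ge0//; move: h6 h4; lra_goal.
  have : 0 <= A3 * (1 + Y + y3) by rewrite mulr_ge0//; move: h6 h5; lra_goal.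
  lra_goal.
have BI2 : 0 <= itg D P1 + itg D P2 by rewrite -itgD.
rewrite -/kap; move: BI2 E2 E1; lra_goal.
Qed.

Lemma C2_zpow_powR k (a : R) U dU d2U g : C2 D U dU d2U -> (forall x, D x -> 0 < U x) ->
  (forall x, D x -> - lap d2U x = g x) -> exists dphi d2phi,
  C2 D (fun x => z x ^+ k * U x `^ a) dphi d2phi /\ forall x, D x ->
  lap d2phi x = - (a * U x `^ a * z x ^+ k * (g x / U x - (a - 1) * lgrad2 U dU x)) +
    U x `^ a * (2 * a * (k%:R * z x ^+ k.-1) * (\sum_i dz i x * lgrad U dU i x) +
      lap (d2zpow k) x).
Proof.
move=> cU Up eU; have cphi := C2M (C2_zpow k) (C2_powR a cU Up).
do 2 eexists; split; [exact: cphi|move=> x Dx]; have U0 := Up x Dx.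
set s := lgrad2 U dU x; set e := U x `^ a.
set sg := \sum_i dz i x * lgrad U dU i x.
have e1 : U x `^ (a - 1) = e / U x by exact: powR_pred.
have e2 : U x `^ (a - 1 - 1) = e / U x / U x by rewrite powR_pred// e1.
rewrite {1}/lap.
transitivity (\sum_i (z x ^+ k * (a * (e / U x) * d2U i i x + a * (a - 1) * e * lgrad U dU i x ^+ 2)
   + 2 * (k%:R * z x ^+ k.-1 * a * e) * (dz i x * lgrad U dU i x) + e * d2zpow k i i x)).
  apply: eq_bigr => i _; rewrite /zpow /dzpow /lgrad e1 e2 -/e /=.
  by field; rewrite gt_eqF.
rewrite !big_split /= -!mulr_sumr -/(lap (d2zpow k) x) -/sg.
rewrite !big_split /= -!mulr_sumr -/(lgrad2 U dU x) -/s -/(lap d2U x).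
have -> : lap d2U x = - g x by rewrite -eU// opprK.
move: (lap (d2zpow k) x) sg s => l sg' s'.
by field; rewrite gt_eqF.
Qed.

(** The leading part of Delta (z^4 U^q) is - q z^4 U^q (g/U - (q-1) |grad ln U|^2), whose square
    expands into the three moments; the rest involves derivatives of z and is absorbed as in the
    Bochner estimate. *)
Lemma weighted_stability_test (d : R) : 0 < d -> exists2 K0 : R, 0 <= K0 &
  forall U dU d2U g, C2 D U dU d2U -> (forall x, D x -> 0 < U x) ->
  (forall x, D x -> - lap d2U x = g x) ->
  (forall x, D x -> ~ K x -> U x <= M0 /\ `|g x| <= M0) ->
  exists dphi d2phi, [/\ C2 D (fun x => z x ^+ 4 * U x `^ q) dphi d2phi,
    cs D (fun x => z x ^+ 4 * U x `^ q) &
    itg D (fun x => lap d2phi x ^+ 2) <= (1 + d) * q ^+ 2 *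
      (momA U g - 2 * (q - 1) * momB U dU g + (q - 1) ^+ 2 * momC U dU) + d * momC U dU + K0].
Proof.
move=> d0; have [N N0 HN] := cutoff_bounds.
pose Q a := (M0 + 1) `^ a; have Q0 a : 0 <= Q a by exact: powR_ge0.
pose c4 := (n%:R * N) ^+ 2 * Q q; pose c5 := 4 * N + 12 * (n%:R * N ^+ 2).
have c40 : 0 <= c4 by rewrite mulr_ge0 ?sqr_ge0.
have c50 : 0 <= c5 by rewrite addr_ge0 ?mulr_ge0 ?sqr_ge0.
pose di := 1 + d^-1; have di0 : 0 <= di by rewrite addr_ge0// invr_ge0 ltW.
pose N6 := di * (128 * q ^+ 2 * c4 + 2 * c5 ^+ 2 * Q (2 * q)).
have q1' := q1.
have N60 : 0 <= N6 by rewrite mulr_ge0// addr_ge0// mulr_ge0// mulr_ge0// sqr_ge0.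
have [K1 K10 HK1] := young_powers N60 d0.
exists (K1 * fine (lebesgue_rV n D)); first by rewrite mulr_ge0 ?fine_ge0.
move=> U dU d2U g cU Up eU UM.
have [dphi [d2phi [cphi lapE0]]] := C2_zpow_powR 4 q cU Up eU.
have sphi : cs D (fun x => z x ^+ 4 * U x `^ q) by apply: csMl; exact: csX.
exists dphi, d2phi; split => //.
have cG := C0_quot cU Up eU; have cS := C0_lgrad2 cU Up; have bW := C0_weight cU Up.
have bL := BCX 2 (cs_BC (C0_lap cphi) (cs_lap oD cphi sphi)).
have bA : BC D (fun x => z x ^+ 8 * U x `^ (2 * q) * (g x / U x) ^+ 2) by apply: bW; exact: C0X.
have bB : BC D (fun x => z x ^+ 8 * U x `^ (2 * q) * (g x / U x * lgrad2 U dU x)).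
  by apply: bW; exact: C0M.
have bC : BC D (fun x => z x ^+ 8 * U x `^ (2 * q) * lgrad2 U dU x ^+ 2) by apply: bW; exact: C0X.
rewrite /momA /momB /momC -!itgZ// -(itg_cst oD).
rewrite -itgB//; last exact: BCZ.
rewrite -itgD//; [|by apply: BCB => //; exact: BCZ|exact: BCZ].
have bM : BC D (fun x => z x ^+ 8 * U x `^ (2 * q) * (g x / U x) ^+ 2 -
   2 * (q - 1) * (z x ^+ 8 * U x `^ (2 * q) * (g x / U x * lgrad2 U dU x)) +
   (q - 1) ^+ 2 * (z x ^+ 8 * U x `^ (2 * q) * lgrad2 U dU x ^+ 2)).
  by apply: BCD; [apply: BCB => //; exact: BCZ|exact: BCZ].
rewrite -itgZ// -itgD//; [|exact: BCZ|exact: BCZ].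
rewrite -itgD//; [|by apply: BCD; exact: BCZ|exact: BC_cst].
apply: itg_le => //; first by apply: BCD; [apply: BCD; exact: BCZ|exact: BC_cst].
move=> x Dx; have U0 := Up x Dx; have /andP[z0 z1] := z01 x.
set s := lgrad2 U dU x; set G := g x / U x; set e := U x `^ q.
set sg := \sum_i dz i x * lgrad U dU i x; set S2 := \sum_i dz i x ^+ 2.
have ee : U x `^ (2 * q) = e ^+ 2.
  by rewrite /e expr2 -powRD ?(gt_eqF U0) ?implybT//; congr (_ `^ _); ring.
set lp := lap d2phi x.
have lpE : lp = - (q * e * z x ^+ 4 * (G - (q - 1) * s)) + e * (8 * q * z x ^+ 3 * sg +
    4 * z x ^+ 3 * lap d2z x + 12 * z x ^+ 2 * S2).
  by rewrite /lp lapE0// lap_zpow /= -/G -/s -/e -/sg -/S2; ring.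
have W0 : 0 <= z x ^+ 8 * e ^+ 2 * s ^+ 2.
  by apply: mulr_ge0; [apply: mulr_ge0; [exact: exprn_ge0|exact: sqr_ge0]|exact: sqr_ge0].
rewrite ee -/G -/s.
set a := q * e * z x ^+ 4 * (G - (q - 1) * s).
set b := e * (8 * q * z x ^+ 3 * sg + 4 * z x ^+ 3 * lap d2z x + 12 * z x ^+ 2 * S2).
have -> : (1 + d) * q ^+ 2 * (z x ^+ 8 * e ^+ 2 * G ^+ 2 - 2 * (q - 1) * (z x ^+ 8 * e ^+ 2 * (G * s)) +
   (q - 1) ^+ 2 * (z x ^+ 8 * e ^+ 2 * s ^+ 2)) = (1 + d) * a ^+ 2 by rewrite /a; ring.
(* (b - a)^2 <= (1 + d) a^2 + (1 + 1/d) b^2, so the leading part keeps its constant up to the factor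
   1 + d. *)
have ab : lp ^+ 2 <= (1 + d) * a ^+ 2 + di * b ^+ 2.
  rewrite lpE -/a -/b /di.
  have h : 0 <= d^-1 * (d * a + b) ^+ 2 by rewrite mulr_ge0 ?sqr_ge0// invr_ge0 ltW.
  have h2 : d^-1 * (d * a + b) ^+ 2 = d * a ^+ 2 + 2 * a * b + d^-1 * b ^+ 2.
    by field; rewrite gt_eqF.
  rewrite h2 in h; move: (d^-1) h => d' h; nra.
apply: (le_trans ab); rewrite -addrA lerD2l.
have [Kx|nK] := pselect (K x).
  have [_ d1 d2] := zK Kx.
  have sg0 : sg = 0 by rewrite /sg big1// => i _; rewrite d1 mul0r.
  have S20 : S2 = 0 by rewrite /S2 big1// => i _; rewrite d1 expr0n.
  have l0 : lap d2z x = 0 by rewrite /lap big1// => i _; rewrite d2.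
  have -> : b = 0 by rewrite /b sg0 S20 l0 !mulr0 !addr0 mulr0.
  by rewrite expr0n /= mulr0 addr_ge0// mulr_ge0// ltW.
have [UM1 gM] := UM x Dx nK; have [dzN lzN] := HN x Dx.
have [Y [Y0 Y4 [_ YE] [_ [_ Y2]]]] := collar_density dU Up Dx UM1 gM dzN N0.
rewrite ee -/s in Y4; rewrite -Y4; apply: le_trans (HK1 Y Y0).
move: YE Y2; rewrite ee -/(Q q) -/(Q (2 * q)) -/c4 -/sg => YE Y2.
have /andP[q0 qN] := sum_sqr_le N0 dzN.
have cb : `|4 * z x ^+ 3 * lap d2z x + 12 * z x ^+ 2 * S2| <= c5.
  apply: le_trans (ler_normD _ _) _; rewrite /c5; apply: lerD.
    rewrite norm_zpow//.
    rewrite -mulrA ler_wpM2l// -[leRHS]mul1r ler_pM// ?exprn_ge0//.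
    by rewrite exprn_ile1.
  rewrite norm_zpow// (ger0_norm q0).
  rewrite -mulrA ler_wpM2l// -[leRHS]mul1r ler_pM// ?exprn_ge0//.
  by rewrite exprn_ile1.
have b2 : b ^+ 2 <= 128 * q ^+ 2 * (e ^+ 2 * (z x ^+ 3 * `|sg|) ^+ 2) + 2 * c5 ^+ 2 * e ^+ 2.
  set c := 4 * z x ^+ 3 * lap d2z x + 12 * z x ^+ 2 * S2 in cb.
  have cc : c ^+ 2 <= c5 ^+ 2.
    by rewrite -(real_normK (num_real c)) ler_pXn2r ?nnegrE.
  rewrite [(z x ^+ 3 * `|sg|) ^+ 2]exprMn (real_normK (num_real sg)).
  have -> : b ^+ 2 = e ^+ 2 * (8 * q * z x ^+ 3 * sg + c) ^+ 2 by rewrite /b /c; ring.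
  have h := sqr_ge0 (8 * q * z x ^+ 3 * sg - c).
  have h1 : (8 * q * z x ^+ 3 * sg + c) ^+ 2 <= 128 * q ^+ 2 * ((z x ^+ 3) ^+ 2 * sg ^+ 2) + 2 * c5 ^+ 2.
    move: h cc; move: (z x ^+ 3) => z3; nra.
  have := ler_wpM2l (sqr_ge0 e) h1; lra_goal.
apply: (@le_trans _ _ (di * (128 * q ^+ 2 * (c4 * Y ^+ 2) + 2 * c5 ^+ 2 * Q (2 * q)))).
  rewrite ler_wpM2l//; apply: (le_trans b2); apply: lerD.
    by rewrite ler_wpM2l// mulr_ge0 ?sqr_ge0.
  by rewrite ler_wpM2l// mulr_ge0 ?sqr_ge0.
rewrite /N6 -(mulrA di); apply: ler_wpM2l => //.
have a1 : 0 <= 128 * q ^+ 2 * c4 by rewrite mulr_ge0// mulr_ge0 ?sqr_ge0.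
have a2 : 0 <= 2 * c5 ^+ 2 * Q (2 * q) by rewrite mulr_ge0// mulr_ge0 ?sqr_ge0.
have y2 : 0 <= Y ^+ 2 by exact: exprn_ge0.
have y3 : 0 <= Y ^+ 3 by exact: exprn_ge0.
rewrite (mulrA _ c4); move: a1 a2 y2 y3 Y0.
move: (128 * q ^+ 2 * c4) (2 * c5 ^+ 2 * Q (2 * q)) (Y ^+ 2) (Y ^+ 3) => A1 A2 w2 w3 h1 h2 h3 h4 h5.
have : 0 <= A1 * (1 + Y + w3) by rewrite mulr_ge0//; move: h5 h4; lra_goal.
have : 0 <= A2 * (Y + w2 + w3) by rewrite mulr_ge0//; move: h5 h4 h3; lra_goal.
lra_goal.
Qed.

End weighted_estimates.

(** Fixes the small parameters: a strict condition at d = 0, whose perturbed version is a cubic in d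
    with explicit coefficients, remains true for some positive d below [m]. *)
Lemma small_cubic {R : realType} (a b c e m : R) : 0 < a -> 0 < m ->
  exists2 d : R, 0 < d < m & 0 < a + b * d + c * d ^+ 2 + e * d ^+ 3.
Proof.
move=> a0 m0; pose k := `|b| + `|c| + `|e|.
have k0 : 0 <= k by rewrite !addr_ge0.
pose d := Num.min (m / 2) (Num.min 1 (a / (2 * (k + 1)))).
have d0 : 0 < d by rewrite !lt_min !divr_gt0 ?ltr01// mulr_gt0//; lra.
have [d1 d2 d3] : [/\ d <= m / 2, d <= 1 & d <= a / (2 * (k + 1))].
  by rewrite !ge_min !lexx ?orbT.
exists d; first by apply/andP; split=> //; lra.
have dk : d * (2 * (k + 1)) <= a by rewrite -ler_pdivlMr// mulr_gt0//; lra.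
have ds (x : R) j : - (`|x| * d) <= x * d ^+ j.+1.
  have h : d ^+ j.+1 <= d by rewrite exprS ler_piMr ?(ltW d0)// exprn_ile1// ltW.
  have h2 : `|x * d ^+ j.+1| <= `|x| * d.
    by rewrite normrM (ger0_norm (exprn_ge0 _ (ltW d0))) ler_wpM2l.
  by rewrite lerNl; apply: le_trans h2; rewrite -normrN ler_norm.
have h1 := ds b 0; have h2 := ds c 1; have h3 := ds e 2; rewrite expr1 in h1.
by move: h1 h2 h3 dk k0; rewrite /k; move: (`|b|) (`|c|) (`|e|) => b' c' e'; lra.
Qed.

(** * Bounds in the collar uniform in the solution *)

Section uniform_bounds.
Context {R : realType} {n : nat} (D : set 'rV[R]_n).
Local Notation V := 'rV[R]_n.

Lemma stability_density_ge (p lam : R) u du d2u v dv d2v x : open D -> bounded_set D ->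
  1 < p -> 0 < lam -> navier_system D p lam u du d2u v dv d2v -> D x ->
  2 * lam / (p + 1) * ((u x + 1) `^ (2 * p) - 2 * (u x + 1) `^ ((3 * p - 1) / 2)) <=
  (u x + 1) `^ (p - 1) * v x ^+ 2.
Proof.
move=> oD bD p1 lam0 sys Dx; have [_ _ up _ _] := sys.
have w1 : 1 <= u x + 1 by rewrite lerDr ltW// up.
have w0 : 0 < u x + 1 by lra.
have Sv := system_v_ge oD bD p1 lam0 sys Dx.
have vp := system_v_pos oD bD lam0 sys Dx.
set w := u x + 1 in Sv w0 w1 *.
set c := Num.sqrt (2 * lam / (p + 1)) in Sv.
have c2 : c ^+ 2 = 2 * lam / (p + 1).
  by rewrite sqr_sqrtr// divr_ge0 ?mulr_ge0//; lra.
have c0 : 0 <= c by exact: sqrtr_ge0.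
have wb1 : 1 <= w `^ ((p + 1) / 2).
  have h : 1 `^ ((p + 1) / 2) <= w `^ ((p + 1) / 2).
    by rewrite ge0_ler_powR ?nnegrE//; move: w1 p1; lra_goal.
  by rewrite powR1 in h.
have s1 : 0 <= c * (w `^ ((p + 1) / 2) - 1) by rewrite mulr_ge0//; lra.
have s2 : (c * (w `^ ((p + 1) / 2) - 1)) ^+ 2 <= v x ^+ 2.
  by rewrite ler_pXn2r ?nnegrE// ltW.
have W a b : w `^ a * w `^ b = w `^ (a + b) by rewrite -powRD// (gt_eqF w0) implybT.
apply: le_trans (ler_wpM2l (powR_ge0 w (p - 1)) s2).
rewrite exprMn c2 mulrCA ler_wpM2l//; first by rewrite divr_ge0 ?mulr_ge0//; move: lam0 p1; lra_goal.
rewrite (_ : (w `^ ((p + 1) / 2) - 1) ^+ 2 =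
   w `^ ((p + 1) / 2) * w `^ ((p + 1) / 2) - 2 * w `^ ((p + 1) / 2) + 1); last by ring.
rewrite W mulrDr mulr1 mulrBr W (mulrCA _ 2) W.
have -> : p - 1 + ((p + 1) / 2 + (p + 1) / 2) = 2 * p by field.
have -> : p - 1 + (p + 1) / 2 = (3 * p - 1) / 2 by field.
by rewrite lerDl powR_ge0.
Qed.

(* Integrating [- Delta v = lam w^p] against a paraboloid bounds the mass of v. *)
Lemma system_v_mass : (0 < n)%N -> open D -> bounded_set D -> exists2 B : R, 0 <= B &
  forall p lam u du d2u v dv d2v, 0 < lam -> navier_system D p lam u du d2u v dv d2v ->
  itg D v <= B * (lam * itg D (fun x => (u x + 1) `^ p)).
Proof.
move=> n0 oD bD; have [B B1 HB] := domain_sqd_le bD.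
exists B; first by lra.
move=> p lam u du d2u v dv d2v lam0 sys.
have [[_ [cv bv _ _]] [_ vv] up _ ev] := sys.
have vp := system_v_pos oD bD lam0 sys.
have bw := system_w_BC p sys.
have bq : BC D (fun x => lam * (u x + 1) `^ p) by exact: BCZ.
have [D0|[a Da]] : (forall x, ~ D x) \/ D !=set0.
  have [->|/set0P] := eqVneq D set0; last by right.
  by left => x.
  rewrite (@eq_itg R n D v (fun=> 0)); last by move=> x /D0.
  rewrite (@eq_itg R n D (fun x => (u x + 1) `^ p) (fun=> 0)); last by move=> x /D0.
  by rewrite (itg_cst oD) mul0r !mulr0.
have cG := C2B (C2_cst setT B) (C2_sqd a (0 : R)).
have G0 x : D x -> 0 <= B - (sqd a x + 0) <= B.
  by move=> Dx; have := HB a x Da Dx; have := sqd_ge0 a x; lra.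
have bG : BC D (fun x => B - (sqd a x + 0)) by apply: (C0T_BC bD); exact: C2_C0 cG.
have lG x : lap (fun i j (_ : V) => 0 - 2 * (i == j)%:R) x = - (2 * n%:R) :> R.
  rewrite /lap (eq_bigr (fun=> - 2)); last by move=> i _; rewrite eqxx mulr1 sub0r.
  by rewrite sumr_const card_ord mulNrn mulr_natr.
have bl : BC D (lap (fun i j (_ : V) => 0 - 2 * (i == j)%:R)).
  by apply: (near_BC oD _ (BC_cst D (- (2 * n%:R)))) => x _; rewrite lG.
have q0 x : D x -> 0 <= lam * (u x + 1) `^ p by move=> _; rewrite mulr_ge0 ?powR_ge0// ltW.
have vb : vanb D v by apply: vanish_on_bd_vanb => //; exact: C2_C0 cv.
have ev' x : D x -> 0 < v x -> - lap d2v x <= lam * (u x + 1) `^ p by move=> Dx _; rewrite ev.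
have H := kato_integral oD bD cv vb (BC_tpos bv) bq q0 ev' (C2S (@subsetT _ D) cG)
  bG bl (fun x Dx => proj1 (andP (G0 x Dx))).
have h1 : itg D v <= itg D (fun x => tpos (v x) * - lap (fun i j (_ : V) => 0 - 2 * (i == j)%:R) x).
  apply: itg_le => //; first by apply: BCM; [exact: BC_tpos|exact: BCN].
  move=> x Dx; rewrite tpos_pos ?(ltW (vp x Dx))// lG opprK ler_peMr ?(ltW (vp x Dx))//.
  have : (1 : R) <= n%:R by rewrite ler1n.
  lra.
apply: (le_trans h1); apply: (le_trans H); rewrite -itgZ// -itgZ//.
apply: itg_le => //; [exact: BCM|exact: BCZ|] => x Dx; rewrite mulrC ler_wpM2r ?q0//.
by case/andP: (G0 x Dx).
Qed.

(** The collar bound is in terms of the masses of u and v. The first is controlled by the moment of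
    order 2p since w >= 1, the second by the mass of the source, so [K] and [M] depend only on p, L
    and the domain. *)
Lemma uniform_collar_bounds (p L : R) : (2 < n)%N -> smooth_bounded_convex_domain D ->
  1 < p -> 0 < L -> exists (K : set V) (M : R), [/\ compact K, K `<=` D, 0 <= M &
  forall lam u du d2u v dv d2v, 0 < lam < L -> navier_system D p lam u du d2u v dv d2v ->
  stable p D lam u -> itg D v <= M /\ forall x, D x -> ~ K x ->
  [/\ u x + 1 <= M, v x <= M & lam * (u x + 1) `^ p <= M]].
Proof.
move=> n2 sD p1 L0; have [_ oD bD _ _] := sD.
have [K [cK KD [C C0 HC]]] := collar_bound n2 sD.
have [K1 HK1] := moment_2p oD bD p1.
have [B B0 HB] := system_v_mass (ltn_trans (isT : (0 < 2)%N) n2) oD bD.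
pose M1 := C * `|K1| + 1; pose M2 := B * (L * `|K1|).
have M10 : 1 <= M1 by rewrite lerDr mulr_ge0// ltW.
have M20 : 0 <= M2 by rewrite !mulr_ge0// ltW.
have P0 : 0 <= L * M1 `^ p by rewrite mulr_ge0 ?powR_ge0// ltW.
have CM : 0 <= C * M2 by rewrite mulr_ge0// ltW.
exists K, (M1 + M2 + C * M2 + L * M1 `^ p); split => //; first by lra.
move=> lam u du d2u v dv d2v /andP[lam0 lamL] sys st.
have [[[cu bu _ _] _] _ up _ _] := sys.
have w1 x : D x -> 1 <= u x + 1 by move=> Dx; rewrite lerDr ltW// up.
have bw (a : R) := system_w_BC a sys.
have HK := HK1 lam u du d2u v dv d2v lam0 sys st.
have wle (f : V -> R) : BC D f -> (forall x, D x -> f x <= (u x + 1) `^ (2 * p)) ->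
    itg D f <= `|K1|.
  move=> bf h; apply: le_trans (le_trans HK (ler_norm _)).
  by apply: itg_le.
have i1 : itg D u <= `|K1|.
  apply: wle => // x Dx; apply: (@le_trans _ _ ((u x + 1) `^ 1)).
    by rewrite powRr1; have := w1 x Dx; lra_goal.
  by apply: ler_powR; [exact: w1|move: p1; lra_goal].
have i2 : itg D (fun x => (u x + 1) `^ p) <= `|K1|.
  by apply: wle => // x Dx; apply: ler_powR; [exact: w1|move: p1; lra_goal].
have i3 : itg D v <= M2.
  apply: (le_trans (HB p lam u du d2u v dv d2v lam0 sys)); rewrite ler_wpM2l//.
  apply: ler_pM => //; [exact: ltW| |exact: ltW].
  by apply: itg_ge0 => x _; exact: powR_ge0.
split; first by move: i3 CM P0 M10; lra_goal.
move=> x Dx nK; have [h1 h2] := HC p lam u du d2u v dv d2v p1 lam0 sys x Dx nK.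
have w2 : u x + 1 <= M1 by rewrite lerD2r; apply: (le_trans h1); rewrite ler_pM2l.
have v2 : v x <= C * M2 by apply: (le_trans h2); rewrite ler_pM2l.
have f2 : lam * (u x + 1) `^ p <= L * M1 `^ p.
  have w1x := w1 x Dx; apply: ler_pM; [exact: ltW|exact: powR_ge0|exact: ltW|].
  by rewrite ge0_ler_powR ?nnegrE//; move: w1x w2 p1; lra_goal.
by split; move: f2 v2 w2 CM P0 M20 M10; lra_goal.
Qed.

End uniform_bounds.

(** Lets the weight v^(2y) in the lower order terms be dominated by 1 + v, whose integral is already
    bounded. *)
Lemma powR_le1D {R : realType} (t y : R) : 0 < t -> 0 < y -> y < 1 / 2 -> t `^ (2 * y) <= 1 + t.
Proof.
move=> t0 y0 y1; have [h|h] := leP 1 t.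
  have h2 : t `^ (2 * y) <= t `^ 1 by apply: ler_powR => //; lra.
  by rewrite powRr1 in h2; lra.
have h2 : t `^ (2 * y) <= 1 `^ (2 * y) by rewrite ge0_ler_powR ?nnegrE//; lra.
by rewrite powR1 in h2; lra.
Qed.

Lemma density_algebra {R : realType} (p lam L C d W W' W'' t w : R) : 1 < p -> 0 < lam -> lam <= L ->
  0 <= C -> 0 <= t -> t <= 1 + w -> 0 < w ->
  2 * lam / (p + 1) * (W - 2 * W') <= W'' * w ^+ 2 -> W' <= d * W + C ->
  2 * p / (p + 1) * (1 - 2 * d) * (t * (lam ^+ 2 * W)) -
    2 * p / (p + 1) * (2 * C * L ^+ 2) * (1 + w) <= lam * p * (W'' * (t * w ^+ 2)).
Proof.
move=> p1 lam0 lL C0 t0 t1 w0 D1 D2.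
have th0 : 0 < 2 * p / (p + 1) by rewrite divr_gt0; lra.
have e1 : lam ^+ 2 * ((1 - 2 * d) * W - 2 * C) * (2 * p / (p + 1)) <= lam * p * (W'' * w ^+ 2).
  have lp : 0 <= lam * p by rewrite mulr_ge0//; lra.
  apply: le_trans (ler_wpM2l lp D1).
  have -> : lam * p * (2 * lam / (p + 1) * (W - 2 * W')) =
      lam ^+ 2 * (W - 2 * W') * (2 * p / (p + 1)).
    by field; rewrite gt_eqF//; lra.
  by rewrite ler_pM2r// ler_wpM2l ?sqr_ge0//; lra.
have e2 := ler_wpM2l t0 e1.
have e3 : lam ^+ 2 * t <= L ^+ 2 * (1 + w).
  by apply: ler_pM; rewrite ?sqr_ge0// ler_pXn2r ?nnegrE//; move: lL (lam0); lra_goal.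
have e4 : 2 * p / (p + 1) * (2 * C) * (lam ^+ 2 * t) <= 2 * p / (p + 1) * (2 * C) * (L ^+ 2 * (1 + w)).
  by apply: ler_wpM2l => //; apply: mulr_ge0; [exact: ltW|exact: mulr_ge0].
move: (2 * p / (p + 1)) e2 e4 => th e2 e4; clear -e2 e4; lra.
Qed.

(** With t = v, Souplet's bound makes v^(2y) at least comparable to w^(y(p+1)), which raises the
    moment order from 2p to 2p + y (p+1). The lower bound L/2 of lam makes the constants uniform. *)
Lemma power_le_of_souplet {R : realType} (p lam L y t w : R) : 1 < p -> 0 < lam -> 0 < y ->
  y < 1 / 2 -> 0 < L -> L / 2 <= lam -> 0 < t -> 0 < w ->
  Num.sqrt (2 * lam / (p + 1)) * (w `^ ((p + 1) / 2) - 1) <= t ->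
  w `^ (2 * p + y * (p + 1)) <=
  ((Num.sqrt (L / (p + 1)) / 2) `^ (2 * y) * (L / 2) ^+ 2)^-1 *
    (t `^ (2 * y) * (lam * w `^ p) ^+ 2) + 2 `^ ((2 * p + y * (p + 1)) / ((p + 1) / 2)).
Proof.
move=> p1 lam0 y0 y1 L0 l1 t0 w0 Sv.
set Q := 2 * p + y * (p + 1); set c0 := Num.sqrt (L / (p + 1)) / 2.
set b := (p + 1) / 2 in Sv *.
have b1 : 1 < b by rewrite /b; lra.
have Q0 : 0 <= Q by rewrite /Q addr_ge0// mulr_ge0//; move: (y0) (p1); lra_goal.
have c00 : 0 < c0 by rewrite divr_gt0// sqrtr_gt0 divr_gt0//; lra.
have C1p : 0 < c0 `^ (2 * y) * (L / 2) ^+ 2.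
  by rewrite mulr_gt0 ?powR_gt0// exprn_gt0// divr_gt0.
(* For w^b <= 2 the left side is bounded by the additive constant; for w^b > 2 the subtracted 1 in
   Souplet's bound costs at most half of w^b. *)
have [h|h] := leP (w `^ b) 2.
  have h' : (w `^ b) `^ (Q / b) <= 2 `^ (Q / b).
    by rewrite ge0_ler_powR ?nnegrE ?powR_ge0// divr_ge0//; lra.
  rewrite -powRrM mulrCA mulfV ?mulr1 in h'; last by rewrite gt_eqF//; lra.
  apply: (le_trans h'); rewrite lerDr mulr_ge0 ?invr_ge0 ?(ltW C1p)//.
  by rewrite mulr_ge0 ?powR_ge0 ?sqr_ge0.
suff h' : w `^ Q <= (c0 `^ (2 * y) * (L / 2) ^+ 2)^-1 * (t `^ (2 * y) * (lam * w `^ p) ^+ 2).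
  by apply: (le_trans h'); rewrite lerDl powR_ge0.
rewrite mulrC ler_pdivlMr//.
have cc : c0 * w `^ b <= t.
  apply: le_trans Sv.
  have hc : 2 * c0 <= Num.sqrt (2 * lam / (p + 1)).
    rewrite /c0 mulrCA mulfV ?mulr1//; apply: ler_wsqrtr.
    by rewrite ler_pM2r ?invr_gt0; move: l1 (p1); lra_goal.
  apply: (@le_trans _ _ (2 * c0 * (w `^ b - 1))).
    by move: h c00; clear; move: (w `^ b) c0 => W c h c00; nra.
  by rewrite ler_wpM2r//; lra.
have e1 : c0 `^ (2 * y) * w `^ (y * (p + 1)) <= t `^ (2 * y).
  have -> : y * (p + 1) = b * (2 * y) by rewrite /b; field.
  rewrite [w `^ (b * _)]powRrM -powRM ?powR_ge0 ?(ltW c00)//.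
  by rewrite ge0_ler_powR ?nnegrE ?mulr_ge0 ?powR_ge0 ?(ltW c00) ?(ltW t0)//; move: (y0); lra_goal.
have e2 : (L / 2) ^+ 2 * w `^ (2 * p) <= (lam * w `^ p) ^+ 2.
  rewrite [(lam * _) ^+ 2]exprMn -[(w `^ p) ^+ 2]powR_mulrn ?powR_ge0// -powRrM [p * _]mulrC.
  by rewrite ler_wpM2r ?powR_ge0// ler_pXn2r ?nnegrE//; move: l1 L0; lra_goal.
have -> : w `^ Q = w `^ (y * (p + 1)) * w `^ (2 * p).
  by rewrite -powRD ?(gt_eqF w0) ?implybT// /Q addrC.
have g1 : 0 <= c0 `^ (2 * y) * w `^ (y * (p + 1)) by rewrite mulr_ge0 ?powR_ge0.
have g2 : 0 <= (L / 2) ^+ 2 * w `^ (2 * p) by apply: mulr_ge0; [exact: sqr_ge0|exact: powR_ge0].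
rewrite mulrACA; apply: le_trans (ler_pM g1 g2 e1 e2).
by rewrite le_eqVlt; apply/orP; left; apply/eqP; ring.
Qed.

Lemma moment_v_closing {R : realType} (th q y d A G S K1 K2 kap : R) :
  0 <= kap - d -> 0 <= (1 + d) * q ^+ 2 * y ^+ 2 + d ->
  th * (1 - 2 * d) * A - S <= (1 + d) * q ^+ 2 * (A + y ^+ 2 * G) + d * G + K1 ->
  (kap - d) * G <= A + K2 ->
  A * ((kap - d) * (th * (1 - 2 * d)) - (1 + d) * q ^+ 2 * (kap - d + y ^+ 2) - d) <=
  (kap - d) * (S + K1) + ((1 + d) * q ^+ 2 * y ^+ 2 + d) * K2.
Proof.
move=> kd c10 T4 T5; have h1 := ler_wpM2l kd T4; have h2 := ler_wpM2l c10 T5.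
move: h1 h2; clear; move: (kap - d) (q ^+ 2) (y ^+ 2) => k' q' y' h1 h2; lra.
Qed.

(** * Stability tested with a power of v *)

Section first_moment.
Context {R : realType} {n : nat} (D : set 'rV[R]_n).
Local Notation V := 'rV[R]_n.

Section cutoff.
Hypotheses (oD : open D) (bD : bounded_set D).
Variables (K : set V) (z : V -> R) (dz : 'I_n -> V -> R) (d2z : 'I_n -> 'I_n -> V -> R).
Hypotheses (cz : C2 D z dz d2z) (sz : cs D z) (z01 : forall x, 0 <= z x <= 1).
Hypothesis zK : forall x, K x -> [/\ z x = 1, forall i, dz i x = 0 & forall i j, d2z i j x = 0].

Lemma weighted_stability (q M0 d : R) : 1 <= q -> 0 <= M0 -> 0 < d -> exists2 K0 : R, 0 <= K0 &
  forall p lam u U dU d2U g, stable p D lam u -> C2 D U dU d2U -> (forall x, D x -> 0 < U x) ->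
  (forall x, D x -> - lap d2U x = g x) ->
  (forall x, D x -> ~ K x -> U x <= M0 /\ `|g x| <= M0) ->
  lam * p * itg D (fun x => (u x + 1) `^ (p - 1) * (z x ^+ 4 * U x `^ q) ^+ 2) <=
  (1 + d) * q ^+ 2 * (momA D z q U g - 2 * (q - 1) * momB D z q U dU g +
    (q - 1) ^+ 2 * momC D z q U dU) + d * momC D z q U dU + K0.
Proof.
move=> q1 M00 d0; have [K0 K00 HK] := weighted_stability_test oD bD cz sz z01 zK q1 M00 d0.
exists K0 => // p lam u U dU d2U g st cU Up eU UM.
have [dphi [d2phi [cphi sphi H]]] := HK U dU d2U g cU Up eU UM.
apply: le_trans H; apply: (stable_test oD bD st _ (H10_cs oD bD (C2_C1 cphi) sphi)).
have s1 i : cs D (dphi i) by exact: cs_grad (C2_C1 cphi) sphi.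
have [[c0 c1 _] c2] := cphi.
split => //; first exact: cs_BC.
  by move=> i; apply: cs_BC => //; exact: c1.
move=> i j; have [_ c2' _] := c2 i; apply: cs_BC; first exact: c2'.
exact: cs_grad (c2 i) (s1 i).
Qed.

Lemma momB_ge0 q U (dU : 'I_n -> V -> R) g : (forall x, D x -> 0 < U x) ->
  (forall x, D x -> 0 <= g x) -> 0 <= momB D z q U dU g.
Proof.
move=> Up g0; apply: itg_ge0 => x Dx.
have /andP[z0 _] := z01 x.
apply: mulr_ge0; first by rewrite mulr_ge0 ?powR_ge0// exprn_ge0.
by rewrite mulr_ge0 ?lgrad2_ge0// divr_ge0 ?g0// ltW// Up.
Qed.

End cutoff.

Section density.
Variables (p lam L y : R) (u v : V -> R) (du dv : 'I_n -> V -> R) (d2u d2v : 'I_n -> 'I_n -> V -> R).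
Hypotheses (oD : open D) (bD : bounded_set D) (p1 : 1 < p) (lam0 : 0 < lam).
Hypothesis sys : navier_system D p lam u du d2u v dv d2v.
Hypotheses (y0 : 0 < y) (y1 : y < 1 / 2).

Lemma v_density_lower (C d s : R) x : D x -> 0 <= s <= 1 -> 0 <= C -> lam <= L ->
  (u x + 1) `^ ((3 * p - 1) / 2) <= d * (u x + 1) `^ (2 * p) + C ->
  2 * p / (p + 1) * (1 - 2 * d) * (s * v x `^ (2 * y) * (lam * (u x + 1) `^ p) ^+ 2) -
    2 * p / (p + 1) * (2 * C * L ^+ 2) * (1 + v x) <=
  lam * p * ((u x + 1) `^ (p - 1) * (s * v x `^ (2 * y) * v x ^+ 2)).
Proof.
move=> Dx /andP[s0 s1] C0 lL D2.
have vx := system_v_pos oD bD lam0 sys Dx.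
have D1 := stability_density_ge oD bD p1 lam0 sys Dx.
have t0 : 0 <= s * v x `^ (2 * y) by rewrite mulr_ge0 ?powR_ge0.
have t1 : s * v x `^ (2 * y) <= 1 + v x.
  apply: le_trans (powR_le1D vx y0 y1).
  by rewrite ler_piMl ?powR_ge0.
rewrite exprMn.
have -> : ((u x + 1) `^ p) ^+ 2 = (u x + 1) `^ (2 * p).
  by rewrite -powR_mulrn ?powR_ge0// -powRrM mulrC.
exact: density_algebra D1 D2.
Qed.

Lemma v_density_upper (x : V) : D x -> 0 < L -> L / 2 <= lam ->
  (u x + 1) `^ (2 * p + y * (p + 1)) <=
  ((Num.sqrt (L / (p + 1)) / 2) `^ (2 * y) * (L / 2) ^+ 2)^-1 *
    (v x `^ (2 * y) * (lam * (u x + 1) `^ p) ^+ 2) +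
  2 `^ ((2 * p + y * (p + 1)) / ((p + 1) / 2)).
Proof.
move=> Dx L0 l1; have vx := system_v_pos oD bD lam0 sys Dx.
have w0 : 0 < u x + 1 by have [_ _ up _ _] := sys; rewrite addr_gt0 ?up.
exact: (power_le_of_souplet p1 lam0 y0 y1 L0 l1 vx w0 (system_v_ge oD bD p1 lam0 sys Dx)).
Qed.

End density.

(* Stability tested with [z^4 v^(1+y)]; the gradient term of the test is absorbed by the
   Bochner estimate. *)
Lemma moment_v (p y L : R) : (2 < n)%N -> smooth_bounded_convex_domain D -> 1 < p ->
  0 < y -> y < 1 / 2 -> (1 + y) ^+ 2 * (p + 1) < 2 * p * (1 - 4 * y ^+ 2) -> 0 < L ->
  exists K : R, forall lam u du d2u v dv d2v, L / 2 <= lam < L ->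
     navier_system D p lam u du d2u v dv d2v -> stable p D lam u ->
     itg D (fun x => (u x + 1) `^ (2 * p + y * (p + 1))) <= K.
Proof.
move=> n2 sD p1 y0 y1 py L0; have [_ oD bD _ _] := sD.
pose q := 1 + y; have q1 : 1 <= q by rewrite /q; lra.
pose kap := 1 / 4 - y ^+ 2; have kap0 : 0 < kap by rewrite /kap; nra.
pose th := 2 * p / (p + 1); have th0 : 0 < th by rewrite divr_gt0; lra.
(* For d = 0 the estimates read th A <= q^2 (A + y^2 G) and kap G <= A up to constants. They bound A
   if th kap > q^2 (kap + y^2), and kap + y^2 = 1/4; this is the hypothesis relating y and p. *)
have F0 : 0 < th * kap - q ^+ 2 / 4.
  have h : (1 + y) ^+ 2 < th * (1 - 4 * y ^+ 2).
    by rewrite /th mulrAC ltr_pdivlMr//; lra.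
  by rewrite /kap /q; lra.
have [d /andP[d0 dk] Fd] := small_cubic (- (th * (1 + 2 * kap) + q ^+ 2 * (1 / 4 - 1) + 1))
  (2 * th + q ^+ 2) 0 F0 kap0.
set P := _ + _ in Fd.
have PE : P = (kap - d) * (th * (1 - 2 * d)) - (1 + d) * q ^+ 2 * (kap - d + y ^+ 2) - d.
  by rewrite /P /kap; field.
have ab : (3 * p - 1) / 2 < 2 * p by lra.
have kd : 0 <= kap - d by move: dk; lra_goal.
have c10 : 0 <= (1 + d) * q ^+ 2 * y ^+ 2 + d.
  by rewrite addr_ge0 ?(ltW d0)// mulr_ge0 ?sqr_ge0// mulr_ge0 ?sqr_ge0//; move: d0; lra_goal.
pose Q := 2 * p + y * (p + 1).
have Q0 : 0 <= Q by rewrite /Q addr_ge0// mulr_ge0//; move: (y0) (p1); lra_goal.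
have p0 : 0 < p + 1 by move: ab; lra_goal.
have lamP lam : L / 2 <= lam -> 0 < lam by move: L0; lra_goal.
have [K [M [cK KD M0 HM]]] := uniform_collar_bounds n2 sD p1 L0.
have [z [dz [d2z [cz sz z01 zK]]]] := cutoff_exists oD bD cK KD.
have [C C0 HC] := powR_absorb ab d0.
have [K1 K10 HK1] := weighted_stability oD bD cz sz z01 zK q1 M0 d0.
have [K2 K20 HK2] := weighted_bochner oD bD cz sz z01 zK q1 M0 d0.
set mu := fine (lebesgue_rV n D); have mu0 : 0 <= mu by exact: fine_ge0.
have tC0 : 0 <= th * (2 * C * L ^+ 2).
  apply: mulr_ge0; first exact: ltW.
  by apply: mulr_ge0; [exact: mulr_ge0|exact: sqr_ge0].
pose S := th * (2 * C * L ^+ 2) * (mu + M).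
have S0 : 0 <= S by apply: mulr_ge0 => //; exact: addr_ge0.
pose KA := ((kap - d) * (S + K1) + ((1 + d) * q ^+ 2 * y ^+ 2 + d) * K2) / P.
pose C1 := ((Num.sqrt (L / (p + 1)) / 2) `^ (2 * y) * (L / 2) ^+ 2)^-1.
have C1n : 0 <= C1 by rewrite invr_ge0 mulr_ge0 ?powR_ge0 ?sqr_ge0.
pose C2' := 2 `^ (Q / ((p + 1) / 2)).
have C2n : 0 <= C2' by exact: powR_ge0.
exists (C1 * KA + (C2' + M `^ Q) * mu) => lam u du d2u v dv d2v /andP[l1 l2] sys st.
have lam0 : 0 < lam by exact: lamP.
have lamL : 0 < lam < L by rewrite lam0.
have [[cu [cv bv _ _]] [vu vv] up eu ev] := sys.
have vp := system_v_pos oD bD lam0 sys.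
have [vM HMc] := HM lam u du d2u v dv d2v lamL sys st.
have w1 x : D x -> 1 <= u x + 1 by move=> Dx; rewrite lerDr ltW// up.
pose f x := lam * (u x + 1) `^ p.
have f0 x : 0 <= f x by rewrite mulr_ge0 ?powR_ge0// ltW.
have gM x : D x -> ~ K x -> v x <= M /\ `|f x| <= M.
  by move=> Dx nK; have [_ h1 h2] := HMc x Dx nK; rewrite ger0_norm.
have T1 := HK1 p lam u v dv d2v f st cv vp ev gM.
have T2 := HK2 v dv d2v f cv vp ev gM.
have A0 := momA_ge0 D z01 q v f.
have B0 : 0 <= momB D z q v dv f by exact: (momB_ge0 z01 q dv vp (fun x _ => f0 x)).
have Cn0 := momC_ge0 D z01 q v dv.
set A := momA D z q v f in T1 T2 A0 *; set B := momB D z q v dv f in T1 T2 B0.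
set G := momC D z q v dv in T1 T2 Cn0.
have bw a := system_w_BC a sys.
have cphi : BC D (fun x => z x ^+ 4 * v x `^ q).
  apply: BC_csMl; first by apply: C0X; exact: C2_C0 cz.
    by have [] := C1_U_powR oD cv vp q.
  exact: csX.
pose dens x := z x ^+ 8 * v x `^ (2 * q) * (f x / v x) ^+ 2.
have bdens : BC D dens.
  by apply: (C0_weight oD cz sz q cv vp); apply: C0X; exact: (C0_quot oD cv vp ev).
have v2q x : D x -> v x `^ (2 * q) = v x `^ (2 * y) * v x ^+ 2.
  move=> Dx; have vx := vp x Dx.
  rewrite -[v x ^+ 2]powR_mulrn ?(ltW vx)// -powRD ?(gt_eqF vx) ?implybT//.
  by congr (_ `^ _); rewrite /q; ring.
(* Since q = 1 + y, the factor v^2 in v^(2q) cancels the denominator of (f/v)^2: the density of A is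
   that of the equation's source squared, weighted by v^(2y). *)
have densE x : D x -> dens x = z x ^+ 8 * v x `^ (2 * y) * f x ^+ 2.
  move=> Dx; have vx := vp x Dx; rewrite /dens exprMn v2q//.
  by field; rewrite gt_eqF.
have T3 : th * (1 - 2 * d) * A - S <=
    lam * p * itg D (fun x => (u x + 1) `^ (p - 1) * (z x ^+ 4 * v x `^ q) ^+ 2).
  rewrite /A /momA -/dens.
  have bv1 : BC D (fun x => 1 + v x) by apply: BCD => //; exact: BC_cst.
  have -> : th * (1 - 2 * d) * itg D dens = itg D (fun x => th * (1 - 2 * d) * dens x).
    by rewrite itgZ.
  have hS : itg D (fun x => th * (2 * C * L ^+ 2) * (1 + v x)) <= S.
    rewrite itgZ// /S; apply: ler_wpM2l => //.
    rewrite itgD//; last exact: BC_cst.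
    by rewrite (itg_cst oD) mul1r lerD2l.
  apply: (@le_trans _ _ (itg D (fun x => th * (1 - 2 * d) * dens x) -
     itg D (fun x => th * (2 * C * L ^+ 2) * (1 + v x)))); first by rewrite lerD2l lerN2.
  have bphi : BC D (fun x => (u x + 1) `^ (p - 1) * (z x ^+ 4 * v x `^ q) ^+ 2).
    by apply: BCM => //; exact: BCX.
  rewrite -itgB//; [|exact: BCZ|exact: BCZ].
  rewrite -itgZ//; apply: itg_le => //; [by apply: BCB; exact: BCZ|exact: BCZ|].
  move=> x Dx; have vx := vp x Dx.
  have -> : (z x ^+ 4 * v x `^ q) ^+ 2 = z x ^+ 8 * v x `^ (2 * y) * v x ^+ 2.
    rewrite -mulrA -v2q// exprMn -exprM; congr (_ * _).
    rewrite expr2 -powRD ?(gt_eqF vx) ?implybT//.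
    by congr (_ `^ _); ring.
  rewrite densE//; apply: (v_density_lower oD bD p1 lam0 sys y0 y1) => //; last exact: HC (w1 x Dx).
    have /andP[z0 z1] := z01 x; by rewrite exprn_ge0// exprn_ile1.
  exact: ltW.
(* The mixed moment B enters with the coefficient - 2 (q - 1) <= 0 and is dropped; in [T5] it is
   dropped for the same reason. *)
have T4 : th * (1 - 2 * d) * A - S <= (1 + d) * q ^+ 2 * (A + y ^+ 2 * G) + d * G + K1.
  apply: (le_trans T3); apply: (le_trans T1); rewrite !lerD2r ler_wpM2l//.
    by rewrite mulr_ge0 ?sqr_ge0// addr_ge0// ltW.
  have -> : q - 1 = y by rewrite /q addrC addKr.
  by rewrite lerD2r gerBl// mulr_ge0// mulr_ge0// ltW.
have T5 : (kap - d) * G <= A + K2.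
  have h : 0 <= (1 / 2 + 2 * y) * B by rewrite mulr_ge0// addr_ge0 ?mulr_ge0 ?divr_ge0// ltW.
  have h2 : (q - 1 / 2) * (3 / 2 - q) = kap by rewrite /q /kap; field.
  have h3 : 3 / 2 - 2 * q = - (1 / 2 + 2 * y) by rewrite /q; field.
  rewrite h2 h3 mulNr in T2; move: T2 h; clear; move: ((1 / 2 + 2 * y) * B) kap => b k; lra.
have T6 : A <= KA.
  by rewrite /KA ler_pdivlMr// PE; exact: (moment_v_closing kd c10 T4 T5).
(* On [K] the cutoff is 1 and the density of A controls w^Q; off [K], w is at most M. *)
have T7 : itg D (fun x => (u x + 1) `^ Q) <= C1 * A + (C2' + M `^ Q) * mu.
  rewrite /A /momA -/dens -(itg_cst oD) -itgZ// -itgD//; [|exact: BCZ|exact: BC_cst].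
  apply: itg_le => //; first by apply: BCD; [exact: BCZ|exact: BC_cst].
  move=> x Dx; have P2 : 0 <= M `^ Q by exact: powR_ge0.
  rewrite densE//; have [Kx|nK] := pselect (K x); last first.
    have [wM _ _] := HMc x Dx nK; have w0 := le_trans ler01 (w1 x Dx).
    have h : (u x + 1) `^ Q <= M `^ Q by rewrite ge0_ler_powR ?nnegrE.
    apply: (le_trans h); rewrite addrA lerDr addr_ge0// mulr_ge0// mulr_ge0 ?sqr_ge0//.
    by rewrite mulr_ge0 ?powR_ge0// exprn_ge0//; case/andP: (z01 x).
  have [zx _ _] := zK x Kx; rewrite zx expr1n mul1r.
  apply: (le_trans (v_density_upper oD bD p1 lam0 sys y0 y1 Dx L0 l1)).
  by rewrite lerD2l lerDl.
by apply: (le_trans T7); rewrite lerD2r ler_wpM2l.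
Qed.

End first_moment.

(* Elimination in the closing inequalities of [moment_w]: E, C, X stand for the moments
   [lam \int z^8 w^(p+2q-1)], [momC] and [momA - 2(q-1)momB]. *)
Lemma moment_w_closing {R : realType} (p q a b y k d E X B C K : R) : 1 <= a -> 0 <= C -> 0 <= K ->
  0 < d -> 0 <= k - 3 * d ->
  p * E <= (1 + d) * q ^+ 2 * (X + y ^+ 2 * C) + d * C + K ->
  a * X <= E + d * C + K -> k * C <= X - B / 2 + d * C + K ->
  b * (1 - 2 * d) * E - d * C - K <= B ->
  E * ((k - 3 * d) * (p - (1 + d) * q ^+ 2 / a) -
    ((1 + d) * q ^+ 2 * (d + y ^+ 2) + d) * (a^-1 - b * (1 - 2 * d) / 2)) <=
  ((1 + d) * q ^+ 2 * (d + y ^+ 2) + d) * (3 * K) + (k - 3 * d) * (K * ((1 + d) * q ^+ 2 + 1)).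
Proof.
move=> a1 C0 K0 d0 kd h1 h2 h3 h4.
have a0 : 0 < a by lra.
have dCK : 0 <= d * C + K by rewrite addr_ge0// mulr_ge0// ltW.
have h2' : X <= E / a + (d * C + K).
  have hh : (d * C + K) / a <= d * C + K by rewrite ler_pdivrMr// ler_peMr.
  (* [X] is bounded by the Green inequality, then [B] is replaced by its lower bound and [C] is
     eliminated between [s1] and [s2]; what remains is an inequality for [E] alone. *)
  have : X <= (E + d * C + K) / a by rewrite ler_pdivlMr// mulrC.
  by rewrite -addrA mulrDl; lra.
set Q := (1 + d) * q ^+ 2 in h1 *; have Q0 : 0 <= Q by rewrite mulr_ge0 ?sqr_ge0//; lra.
set T := Q * (d + y ^+ 2) + d.
have T0 : 0 <= T.
  by rewrite addr_ge0 ?(ltW d0)// mulr_ge0// addr_ge0 ?sqr_ge0// ltW.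
have s1 : (k - 3 * d) * C <= (a^-1 - b * (1 - 2 * d) / 2) * E + 3 * K.
  move: h2' h3 h4; move: (b * (1 - 2 * d)) => b' h2' h3 h4.
  have hC : 0 <= d * C by rewrite mulr_ge0// ltW.
  lra.
have s2 : p * E <= Q * (E / a) + T * C + (Q + 1) * K.
  have := ler_wpM2l Q0 h2'; rewrite /T; move: h1; clear; move: (E / a) (y ^+ 2) => e w; lra.
have s3 := ler_wpM2l kd s2; have s4 := ler_wpM2l T0 s1.
move: s3 s4; clear; rewrite -[Q / a]/(Q * a^-1) -[E / a]/(E * a^-1).
move: (a^-1) (b * (1 - 2 * d)) (k - 3 * d) (T) (Q) => a' b' k' T' Q'; lra.
Qed.

(** Here P, Wb, Wm, W stand for w^(2q-1), w^b, w^m, w^(2q), s for |grad ln w|^2 and z for the eighth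
    power of the cutoff. The 1 in Souplet's bound leaves a term in w^(2q-1) s: a small multiple of
    w^m s absorbs it up to a term linear in s, which Young's inequality moves into the density of
    [momC]. *)
Lemma momB_density {R : realType} (c cL C d P Wb Wm W s z v : R) : 0 <= c -> c <= cL -> 0 <= C ->
  0 < d -> Wm = P * Wb -> 1 <= W -> 0 <= P -> 0 <= s -> 0 <= z -> z <= 1 ->
  P <= d * Wm + C -> c * (Wb - 1) <= v ->
  c * (1 - d) * (z * (Wm * s)) - d * (z * W * s ^+ 2) - (cL * C) ^+ 2 / (4 * d) <=
  z * ((P * v) * s).
Proof.
move=> c0 ccL C0 d0 e1 W1 P0 s0 z0 z1 ab sv.
have zs : 0 <= z * s by rewrite mulr_ge0.
have h1 : z * s * (c * (1 - d) * Wm - c * C) <= z * s * (P * v).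
  apply: ler_wpM2l => //; apply: le_trans (ler_wpM2l P0 sv).
  have := ler_wpM2l c0 ab; rewrite e1; lra.
have h2 : z * s * (c * C) <= d * (z * W * s ^+ 2) + (cL * C) ^+ 2 / (4 * d).
  have h3 : s * (cL * C) <= d * s ^+ 2 + (cL * C) ^+ 2 / (4 * d).
    have : 0 <= (2 * d * s - cL * C) ^+ 2 / (4 * d) by rewrite divr_ge0 ?sqr_ge0//; lra.
    rewrite (_ : (2 * d * s - cL * C) ^+ 2 / (4 * d) =
       d * s ^+ 2 - s * (cL * C) + (cL * C) ^+ 2 / (4 * d)); last by field; rewrite gt_eqF.
    lra.
  have h4 : z * s * (c * C) <= z * (d * s ^+ 2 + (cL * C) ^+ 2 / (4 * d)).
    rewrite -mulrA ler_wpM2l//; apply: le_trans h3; rewrite ler_wpM2l//.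
    by rewrite ler_wpM2r.
  apply: (le_trans h4); rewrite mulrDr; apply: lerD; last first.
    by rewrite ler_piMl// divr_ge0 ?sqr_ge0//; lra.
  rewrite mulrCA ler_wpM2l ?(ltW d0)// -mulrA ler_wpM2l// ler_peMl// sqr_ge0//.
lra.
Qed.

Lemma souplet_density {R : realType} (c cL C d P Wb Wm z v : R) : 0 <= c -> c <= cL -> 0 <= C ->
  Wm = P * Wb -> 0 <= P -> 0 <= z -> z <= 1 -> P <= d * Wm + C -> c * (Wb - 1) <= v ->
  c * (1 - d) * (z * Wm) - cL * C <= z * (P * v).
Proof.
move=> c0 ccL C0 e1 P0 z0 z1 ab sv.
have h1 : z * (c * (1 - d) * Wm - c * C) <= z * (P * v).
  apply: ler_wpM2l => //; apply: le_trans (ler_wpM2l P0 sv).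
  have := ler_wpM2l c0 ab; rewrite e1; lra.
have h2 : z * (c * C) <= cL * C.
  apply: (@le_trans _ _ (c * C)); first by rewrite ler_piMl// mulr_ge0.
  by rewrite ler_wpM2r.
lra.
Qed.

(** * Green's identity and the lower bound of the mixed moment *)

Section second_moment.
Context {R : realType} {n : nat} (D : set 'rV[R]_n).
Local Notation V := 'rV[R]_n.

Section cutoff.
Hypotheses (oD : open D) (bD : bounded_set D).
Variables (K : set V) (z : V -> R) (dz : 'I_n -> V -> R) (d2z : 'I_n -> 'I_n -> V -> R).
Hypotheses (cz : C2 D z dz d2z) (sz : cs D z) (z01 : forall x, 0 <= z x <= 1).
Hypothesis zK : forall x, K x -> [/\ z x = 1, forall i, dz i x = 0 & forall i j, d2z i j x = 0].

Lemma zpow8_lap : exists2 N : R, 0 <= N &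
  (forall x, D x -> `|lap (d2zpow z dz d2z 8) x| <= N) /\
  (forall x, K x -> lap (d2zpow z dz d2z 8) x = 0).
Proof.
have c8 := C2_zpow cz 8.
have s8 : cs D (zpow z 8) by exact: csX.
have [_ [N HN]] := cs_BC (C0_lap c8) (cs_lap oD c8 s8).
exists `|N| => //; split=> x; first by move=> Dx; apply: le_trans (HN x Dx) (ler_norm _).
move=> Kx; have [_ d1 d2] := zK Kx.
rewrite lap_zpow [lap d2z x]big1; last by move=> i _; rewrite d2.
by rewrite big1 ?mulr0 ?addr0// => i _; rewrite d1 expr0n.
Qed.

(** Moving the Laplacian from g to z^8 U^(2q-1) produces (2q-1) (A - 2 (q-1) B) plus cutoff terms.
    For U = w and g = v, minus the Laplacian of g is lam w^p, so this combination is compared with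
    the moment of order p + 2q - 1. *)
Lemma weighted_green (q M0 d : R) : 1 <= q -> 0 <= M0 -> 0 < d -> exists2 K0 : R, 0 <= K0 &
  forall U dU d2U g dg d2g, C2 D U dU d2U -> (forall x, D x -> 0 < U x) ->
  (forall x, D x -> - lap d2U x = g x) -> C2 D g dg d2g ->
  (forall x, D x -> ~ K x -> U x <= M0 /\ `|g x| <= M0) ->
  (2 * q - 1) * (momA D z q U g - 2 * (q - 1) * momB D z q U dU g) <=
  itg D (fun x => z x ^+ 8 * U x `^ (2 * q - 1) * - lap d2g x) + d * momC D z q U dU + K0.
Proof.
move=> q1 M00 d0; have [N N0 HN] := cutoff_bounds oD cz sz.
have [N8 N80 [HN8 HK8]] := zpow8_lap.
pose Q a := (M0 + 1) `^ a; have Q0 a : 0 <= Q a by exact: powR_ge0.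
pose c1 := n%:R * N * (Q (3 * q / 2 - 1) * M0).
have c10 : 0 <= c1 by rewrite /c1 !mulr_ge0.
pose a := 2 * q - 1; have a1 : 1 <= a by rewrite /a; lra.
pose N4 := 16 * a * c1 + Q a * M0 * N8.
have a0 : 0 <= 16 * a * c1 by rewrite mulr_ge0// mulr_ge0//; lra.
have a2 : 0 <= Q a * M0 * N8 by rewrite !mulr_ge0.
have N40 : 0 <= N4 by rewrite addr_ge0.
have [K1 K10 HK1] := young_powers N40 d0.
exists (K1 * fine (lebesgue_rV n D)); first by rewrite mulr_ge0 ?fine_ge0.
move=> U dU d2U g dg d2g cU Up eU cg UM.
have [dphi [d2phi [cphi lapE]]] := C2_zpow_powR cz 8 a cU Up eU.
have sphi : cs D (fun x => z x ^+ 8 * U x `^ a) by apply: csMl; exact: csX.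
have G2 := green2 oD bD cphi cg sphi.
have cG := C0_quot oD cU Up eU; have cS := C0_lgrad2 oD cU Up.
have bW := C0_weight oD cz sz q cU Up.
have bA : BC D (fun x => z x ^+ 8 * U x `^ (2 * q) * (g x / U x) ^+ 2) by apply: bW; exact: C0X.
have bB : BC D (fun x => z x ^+ 8 * U x `^ (2 * q) * (g x / U x * lgrad2 U dU x)).
  by apply: bW; exact: C0M.
have bC : BC D (fun x => z x ^+ 8 * U x `^ (2 * q) * lgrad2 U dU x ^+ 2) by apply: bW; exact: C0X.
have bL : BC D (fun x => lap d2phi x * g x).
  by apply: BC_csMl; [exact: C0_lap cphi|exact: C2_C0 cg|exact: cs_lap cphi sphi].
have -> : itg D (fun x => z x ^+ 8 * U x `^ a * - lap d2g x) =
    itg D (fun x => - (lap d2phi x * g x)).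
  have bz : BC D (fun x => z x ^+ 8 * U x `^ a * lap d2g x).
    by apply: BC_csMl; [exact: C2_C0 cphi|exact: C0_lap cg|].
  rewrite (itgN oD bD bL) -G2 -(itgN oD bD bz).
  by apply: eq_itg => x _; rewrite mulrN.
rewrite /momA /momB /momC -/a -!itgZ// -(itg_cst oD).
rewrite -itgB//; last exact: BCZ.
rewrite -itgZ//; last by apply: BCB => //; exact: BCZ.
have bN : BC D (fun x => - (lap d2phi x * g x)) by exact: BCN.
rewrite -itgD//; last exact: BCZ.
rewrite -itgD//; [|by apply: BCD => //; exact: BCZ|exact: BC_cst].
apply: itg_le => //.
- by apply: BCZ; apply: BCB => //; exact: BCZ.
- by apply: BCD; [apply: BCD => //; exact: BCZ|exact: BC_cst].
move=> x Dx; have U0 := Up x Dx; have /andP[z0 z1] := z01 x.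
have W0 : 0 <= z x ^+ 8 * U x `^ (2 * q) * lgrad2 U dU x ^+ 2.
  by rewrite mulr_ge0 ?sqr_ge0// mulr_ge0 ?powR_ge0// exprn_ge0.
have Ua : U x `^ a = U x `^ (2 * q) / U x by rewrite /a powR_pred.
set sg := \sum_i dz i x * lgrad U dU i x.
set l := lap (d2zpow z dz d2z 8) x.
have -> : - (lap d2phi x * g x) =
    a * (z x ^+ 8 * U x `^ (2 * q) * (g x / U x) ^+ 2 -
      2 * (q - 1) * (z x ^+ 8 * U x `^ (2 * q) * (g x / U x * lgrad2 U dU x))) -
    (16 * a * (z x ^+ 7 * sg * U x `^ (2 * q) * (g x / U x)) + U x `^ a * g x * l).
  rewrite lapE// -/sg -/l Ua /a /=; move: (lgrad2 U dU x) => s.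
  by field; rewrite gt_eqF.
rewrite -addrA -addrA lerDl.
suff : 16 * a * (z x ^+ 7 * sg * U x `^ (2 * q) * (g x / U x)) + U x `^ a * g x * l <=
   d * (z x ^+ 8 * U x `^ (2 * q) * lgrad2 U dU x ^+ 2) + K1.
  by rewrite addrC -subr_ge0.
have [Kx|nK] := pselect (K x).
  have [_ d1 _] := zK Kx.
  have -> : sg = 0 by rewrite /sg big1// => i _; rewrite d1 mul0r.
  rewrite /l HK8// !(mulr0, mul0r) addr0.
  by rewrite addr_ge0// mulr_ge0// ltW.
have [UM1 gM] := UM x Dx nK; have [dzN lzN] := HN x Dx.
have [Y [Y0 Y4 _ [_ [Y1 _]]]] := collar_density z01 q1 M00 dU Up Dx UM1 gM dzN N0.
rewrite -Y4; apply: le_trans (HK1 Y Y0).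
have t1 : 16 * a * (z x ^+ 7 * sg * U x `^ (2 * q) * (g x / U x)) <= 16 * a * c1 * Y.
  rewrite -[16 * a * c1 * Y]mulrA; apply: ler_wpM2l; first by rewrite mulr_ge0//; move: a1; lra_goal.
  apply: le_trans Y1; apply: le_trans (ler_norm _) _.
  rewrite normrM [`|z x ^+ 7 * sg * _|]normrM [`|z x ^+ 7 * sg|]normrM.
  by rewrite (ger0_norm (exprn_ge0 7 z0)) (ger0_norm (powR_ge0 _ _)).
have t2 : U x `^ a * g x * l <= Q a * M0 * N8.
  apply: le_trans (ler_norm _) _; rewrite normrM [`|_ * g x|]normrM (ger0_norm (powR_ge0 _ _)).
  apply: ler_pM => //; [by rewrite mulr_ge0 ?powR_ge0| |exact: HN8].
  by apply: ler_pM => //; [exact: powR_ge0|rewrite ge0_ler_powR ?nnegrE//; move: UM1 a1 U0; lra_goal].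
apply: le_trans (lerD t1 t2) _; rewrite /N4.
have Y2 : 0 <= Y ^+ 2 by exact: exprn_ge0.
have Y3 : 0 <= Y ^+ 3 by exact: exprn_ge0.
move: a0 a2 Y2 Y3 Y0; clear; move: (16 * a * c1) (Q a * M0 * N8) (Y ^+ 2) (Y ^+ 3).
move=> A1 A2 y2 y3 h1 h2 h3 h4 h5.
have : 0 <= A1 * (1 + y2 + y3) by rewrite mulr_ge0//; lra.
have : 0 <= A2 * (Y + y2 + y3) by rewrite mulr_ge0//; lra.
lra.
Qed.

(* Souplet's comparison gives [momB >= c \int z^8 w^m |grad ln w|^2] up to absorbable terms,
   with m = 2q - 1 + (p+1)/2; integrating [Delta w^m] against z^8 turns the right hand side
   into an integral of [w^(m-1) v], to which the comparison applies once more. *)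
Lemma momB_lower (p L q M d : R) : 1 < p -> 0 <= L -> 1 <= q -> 0 <= M -> 0 < d -> d < 1 ->
  exists2 K0 : R, 0 <= K0 & forall lam u du d2u v dv d2v, 0 < lam -> lam <= L ->
  navier_system D p lam u du d2u v dv d2v -> (forall x, D x -> ~ K x -> u x + 1 <= M) ->
  4 / ((p + 1) * (p + 4 * q - 3)) * (1 - 2 * d) *
    (lam * itg D (fun x => z x ^+ 8 * (u x + 1) `^ (p + 2 * q - 1))) -
    d * momC D z q (fun x => u x + 1) du - K0 <=
  momB D z q (fun x => u x + 1) du v.
Proof.
move=> p1 L0 q1 M0 d0 d1; pose b := (p + 1) / 2; pose m := 2 * q - 1 + b.
have m1 : 1 < m by rewrite /m /b; lra.
have h1 : 2 * q - 1 < m by rewrite /m /b; lra.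
have h2 : m - 1 < p + 2 * q - 1 by rewrite /m /b; lra.
have [A1 A10 HC1] := powR_absorb h1 d0; have [A2 A20 HC2] := powR_absorb h2 d0.
have [N8 N80 [HN8 HK8]] := zpow8_lap.
set mu := fine (lebesgue_rV n D); have mu0 : 0 <= mu by exact: fine_ge0.
pose cL := Num.sqrt (2 * L / (p + 1)); have cL0 : 0 <= cL by exact: sqrtr_ge0.
pose K1 := (cL * A1) ^+ 2 / (4 * d) * mu.
pose K2 := cL * A2 * mu + M `^ m * N8 * mu.
have K10 : 0 <= K1 by rewrite mulr_ge0// divr_ge0 ?sqr_ge0// mulr_ge0// ltW.
have K20 : 0 <= K2 by rewrite addr_ge0// mulr_ge0// mulr_ge0// powR_ge0.
exists (cL / (m - 1) * K2 + K1).
  by rewrite addr_ge0// mulr_ge0// divr_ge0// subr_ge0 ltW.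
move=> lam u du d2u v dv d2v lam0 lamL sys uM.
have [[[cu bu _ _] [cv bv _ _]] _ up eu _] := sys.
have vp := system_v_pos oD bD lam0 sys.
have w1 x : D x -> 1 <= u x + 1 by move=> Dx; rewrite lerDr ltW// up.
have wp x : D x -> 0 < u x + 1 by move=> Dx; exact: lt_le_trans ltr01 (w1 x Dx).
have cw : C2 D (fun x => u x + 1) du d2u := system_w_C2 oD sys.
have eu' x : D x -> - lap d2u x = v x by move=> Dx; rewrite eu.
pose c := Num.sqrt (2 * lam / (p + 1)); have c0 : 0 <= c by exact: sqrtr_ge0.
have ccL : c <= cL.
  by apply: ler_wsqrtr; rewrite ler_pM2r ?invr_gt0; move: lamL h2 h1; lra_goal.
have c2 : c ^+ 2 = 2 * lam / (p + 1) by rewrite sqr_sqrtr// divr_ge0 ?mulr_ge0//; move: lam0 h2 h1; lra_goal.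
have Sv x : D x -> c * ((u x + 1) `^ b - 1) <= v x by exact: (system_v_ge oD bD p1 lam0 sys).
have bw a : BC D (fun x => (u x + 1) `^ a) by exact: (system_w_BC a sys).
have c_w a : C0 D (fun x => (u x + 1) `^ a) by have [] := bw a.
have cS := C0_lgrad2 oD cw wp; have cG := C0_quot oD cw wp eu'.
have c_z8 : C0 D (fun x => z x ^+ 8) by apply: C0X; exact: C2_C0 cz.
have s_z8 : cs D (fun x => z x ^+ 8) by exact: csX.
pose s := lgrad2 (fun x => u x + 1) du.
have s0 x : 0 <= s x by exact: lgrad2_ge0.
have z80 x : 0 <= z x ^+ 8 by rewrite exprn_ge0//; case/andP: (z01 x).
have z81 x : z x ^+ 8 <= 1 by case/andP: (z01 x) => z0 z1; rewrite exprn_ile1.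
have bz (f : V -> R) : C0 D f -> BC D (fun x => z x ^+ 8 * f x) by move=> cf; exact: BC_csMl.
pose I := itg D (fun x => z x ^+ 8 * ((u x + 1) `^ m * s x)).
pose F := itg D (fun x => z x ^+ 8 * (u x + 1) `^ (p + 2 * q - 1)).
have bI : BC D (fun x => z x ^+ 8 * ((u x + 1) `^ m * s x)) by apply: bz; exact: C0M.
have bF : BC D (fun x => z x ^+ 8 * (u x + 1) `^ (p + 2 * q - 1)) by exact: bz.
have WD x (a e : R) : D x -> (u x + 1) `^ a * (u x + 1) `^ e = (u x + 1) `^ (a + e).
  by move=> Dx; rewrite -powRD// (gt_eqF (wp x Dx)) implybT.
have bB : BC D (fun x => z x ^+ 8 * (u x + 1) `^ (2 * q) * (v x / (u x + 1) * s x)).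
  by apply: (C0_weight oD cz sz q cw wp); exact: C0M.
have bC : BC D (fun x => z x ^+ 8 * (u x + 1) `^ (2 * q) * s x ^+ 2).
  by apply: (C0_weight oD cz sz q cw wp); exact: C0X.
have step1 : c * (1 - d) * I - d * momC D z q (fun x => u x + 1) du - K1 <=
    momB D z q (fun x => u x + 1) du v.
  rewrite /I /momB /momC -/s /K1 -(itg_cst oD).
  rewrite -!itgZ// -itgB//; [|exact: BCZ|exact: BCZ].
  rewrite -itgB//; [|by apply: BCB; exact: BCZ|exact: BC_cst].
  apply: itg_le => //; first by apply: BCB; [apply: BCB; exact: BCZ|exact: BC_cst].
  move=> x Dx; have w1x := w1 x Dx; have w0 := wp x Dx; have := Sv x Dx.
  have := HC1 _ w1x; have e1 : (u x + 1) `^ m = (u x + 1) `^ (2 * q - 1) * (u x + 1) `^ b.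
    by rewrite WD.
  have e2 : (u x + 1) `^ (2 * q) = (u x + 1) `^ (2 * q - 1) * (u x + 1).
    by rewrite powR_pred// divfK// gt_eqF.
  have g1 : 1 <= (u x + 1) `^ (2 * q).
    by apply: (@le_trans _ _ ((u x + 1) `^ 0)); [rewrite powRr0|apply: ler_powR => //; move: q1; lra_goal].
  rewrite (_ : z x ^+ 8 * (u x + 1) `^ (2 * q) * (v x / (u x + 1) * s x) =
    z x ^+ 8 * (((u x + 1) `^ (2 * q - 1) * v x) * s x)); last first.
    by rewrite e2; field; rewrite gt_eqF.
  have g0 : 0 <= (u x + 1) `^ (2 * q - 1) by exact: powR_ge0.
  move: e1 g1 g0 (s0 x) (z80 x) (z81 x).
  move: ((u x + 1) `^ (2 * q - 1)) ((u x + 1) `^ b) ((u x + 1) `^ m) ((u x + 1) `^ (2 * q)) (s x) (z x ^+ 8) (v x).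
  move=> P Wb Wm W sx z8 vx e1 g1 g0 sx0 z80' z81' ab sv.
  exact: (momB_density c0 ccL A10 d0 e1 g1 g0 sx0 z80' z81' ab sv).
have step2 : c * (1 - d) * F - K2 <= (m - 1) * I.
  (* The cutoff exponent 0 leaves w^m alone to be differentiated; the cutoff z^8 is the compactly
     supported factor in Green's identity. *)
  have [dphi [d2phi [cphi lapE]]] := C2_zpow_powR cz 0 m cw wp eu'.
  have c8 := C2_zpow cz 8.
  have G2 := green2 oD bD c8 cphi s_z8.
  have m0 : 0 < m by move: q1 h1; lra_goal.
  rewrite -(ler_pM2l m0) mulrA.
  have bl8 : BC D (fun x => lap (d2zpow z dz d2z 8) x * (z x ^+ 0 * (u x + 1) `^ m)).
    apply: BC_csMl; [exact: C0_lap c8|exact: C2_C0 cphi|exact: cs_lap c8 s_z8].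
  have bv' : BC D (fun x => z x ^+ 8 * ((u x + 1) `^ m * (v x / (u x + 1)))).
    by apply: bz; exact: C0M.
  have E1 : m * (m - 1) * I = m * itg D (fun x => z x ^+ 8 * ((u x + 1) `^ m * (v x / (u x + 1)))) +
      itg D (fun x => lap (d2zpow z dz d2z 8) x * (z x ^+ 0 * (u x + 1) `^ m)).
    rewrite -G2 /I -!itgZ// -itgD//; [|exact: BCZ|exact: BC_csMl c_z8 (C0_lap cphi) s_z8].
    apply: eq_itg => x Dx; rewrite lapE// lap_zpow /zpow /s /=; ring.
  have E2 : itg D (fun x => - (lap (d2zpow z dz d2z 8) x * (z x ^+ 0 * (u x + 1) `^ m))) <= M `^ m * N8 * mu.
    rewrite -(itg_cst oD); apply: itg_le => //; [exact: BCN|exact: BC_cst|] => x Dx.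
    have [Kx|nK] := pselect (K x).
      by rewrite HK8// mul0r oppr0 mulr_ge0 ?powR_ge0.
    apply: le_trans (ler_norm _) _; rewrite normrN normrM mulrC expr0 mul1r.
    apply: ler_pM => //; last exact: HN8.
    rewrite ger0_norm ?powR_ge0// ge0_ler_powR ?nnegrE ?(ltW m0)//; last exact: uM.
    exact: ltW (wp x Dx).
  have E3 : c * (1 - d) * F - cL * A2 * mu <=
      itg D (fun x => z x ^+ 8 * ((u x + 1) `^ m * (v x / (u x + 1)))).
    rewrite /F -(itg_cst oD) -itgZ// -itgB//; [|exact: BCZ|exact: BC_cst].
    apply: itg_le => //; first by apply: BCB; [exact: BCZ|exact: BC_cst].
    move=> x Dx; have w1x := w1 x Dx; have w0 := wp x Dx; have := Sv x Dx.
    have := HC2 _ w1x.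
    have e1 : (u x + 1) `^ (p + 2 * q - 1) = (u x + 1) `^ (m - 1) * (u x + 1) `^ b.
      by rewrite WD//; congr (_ `^ _); rewrite /m /b; field.
    rewrite (_ : (u x + 1) `^ m * (v x / (u x + 1)) = (u x + 1) `^ (m - 1) * v x); last first.
      by rewrite powR_pred//; ring.
    have g0 : 0 <= (u x + 1) `^ (m - 1) by exact: powR_ge0.
    move: e1 g0 (z80 x) (z81 x).
    move: ((u x + 1) `^ (m - 1)) ((u x + 1) `^ b) ((u x + 1) `^ (p + 2 * q - 1)) (z x ^+ 8) (v x).
    move=> P Wb Wm z8 vx e1 g0 z80' z81' ab sv.
    exact: (souplet_density c0 ccL A20 e1 g0 z80' z81' ab sv).
  rewrite E1; have E4 := ler_wpM2l (ltW m0) E3.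
  rewrite itgN// in E2; apply: (@le_trans _ _ (m * (c * (1 - d) * F - cL * A2 * mu) - M `^ m * N8 * mu)).
    rewrite /K2; have h : 0 <= M `^ m * N8 * mu by rewrite !mulr_ge0 ?powR_ge0.
    have := ler_wpM2r h (ltW m1); rewrite mul1r; move: (M `^ m * N8 * mu) (cL * A2 * mu) (c * (1 - d) * F) => X Y Z.
    lra_goal.
  by apply: lerD => //; rewrite lerNl.
have mm : 0 < m - 1 by move: q1 h1; lra_goal.
have F0 : 0 <= F by apply: itg_ge0 => x _; rewrite mulr_ge0 ?powR_ge0.
have step3 : I >= (c * (1 - d) * F - K2) / (m - 1) by rewrite ler_pdivrMr// [I * _]mulrC.
have cd : 0 <= c * (1 - d) by rewrite mulr_ge0//; move: d1; lra_goal.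
have step4 := ler_wpM2l cd step3.
apply: le_trans step1; rewrite -/F.
(* Souplet's constant enters twice, once for each use of the comparison, and m - 1 comes from Delta
   w^m; hence the coefficient c^2/(m - 1). *)
have e1 : 4 / ((p + 1) * (p + 4 * q - 3)) * lam = c ^+ 2 / (m - 1).
  by rewrite c2 /m /b; field; rewrite !gt_eqF//; move: q1 h2 h1; lra_goal.
rewrite (_ : _ * (1 - 2 * d) * (lam * F) = 4 / ((p + 1) * (p + 4 * q - 3)) * lam * F * (1 - 2 * d)); last by ring.
have cF : 0 <= c ^+ 2 / (m - 1) * F by rewrite mulr_ge0// divr_ge0 ?sqr_ge0// ltW.
have k1 : c ^+ 2 / (m - 1) * F * (1 - 2 * d) <= c ^+ 2 / (m - 1) * F * (1 - d) ^+ 2.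
  by apply: ler_wpM2l => //; have := sqr_ge0 d; lra_goal.
have k2 : c * (1 - d) * (K2 / (m - 1)) <= cL * (K2 / (m - 1)).
  apply: ler_wpM2r; first by rewrite divr_ge0// ltW.
  by apply: le_trans ccL; rewrite ler_piMr//; move: d0; lra_goal.
have k3 : c * (1 - d) * ((c * (1 - d) * F - K2) / (m - 1)) =
    c ^+ 2 / (m - 1) * F * (1 - d) ^+ 2 - c * (1 - d) * (K2 / (m - 1)) by ring.
rewrite k3 in step4; rewrite e1 -[cL / (m - 1) * K2]mulrA [_^-1 * K2]mulrC.
move: step4 k1 k2; clear.
move: (c ^+ 2 / (m - 1) * F) (c * (1 - d) * (K2 / (m - 1))) (cL * (K2 / (m - 1))) (c * (1 - d) * I)
  (d * momC D z q (fun x => u x + 1) du) (K1) ((1 - d) ^+ 2) => t1 t2 t3 t4 t5 t6 t7; lra.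
Qed.

End cutoff.
End second_moment.

(** With U = w and g = v, stability, Bochner, Green and the lower bound of B give four linear
    inequalities between the moments, up to errors d C and constants. Here q < 3/2 keeps the Bochner
    coefficient [k] positive. *)
Lemma moment_w {R : realType} {n : nat} (D : set 'rV[R]_n) (p q L : R) : (2 < n)%N ->
  smooth_bounded_convex_domain D -> 1 < p -> 1 <= q -> q < 3 / 2 ->
  0 < p * (p + 1) * (p + 4 * q - 3) * (2 * q - 1) ^+ 2 * (3 - 2 * q) -
    q ^+ 2 * (p + 1) * (p + 4 * q - 3) + 8 * q ^+ 2 * (q - 1) ^+ 2 * (2 * q - 1) -> 0 < L ->
  exists K : R, forall lam u du d2u v dv d2v, L / 2 <= lam < L ->
     navier_system D p lam u du d2u v dv d2v -> stable p D lam u ->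
     itg D (fun x => (u x + 1) `^ (p + 2 * q - 1)) <= K.
Proof.
move=> n2 sD p1 q1 q3 pq L0; have [_ oD bD _ _] := sD.
pose a := 2 * q - 1; have a1 : 1 <= a by rewrite /a; lra.
have a0 : 0 < a by lra.
pose X := (p + 1) * (p + 4 * q - 3); have X0 : 0 < X by rewrite mulr_gt0; lra.
pose b := 4 / X; pose y := q - 1.
pose k := (q - 1 / 2) * (3 / 2 - q); have k0 : 0 < k by rewrite mulr_gt0; move: q1 q3; lra_goal.
have k1 : k <= 1 by rewrite /k; have := sqr_ge0 (q - 1); lra.
(* The coefficient of E in [moment_w_closing] at d = 0; multiplied by 4 a X it is the polynomial
   hypothesis. *)
have F0 : 0 < k * (p - q ^+ 2 / a) - q ^+ 2 * y ^+ 2 * (a^-1 - b / 2).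
  have -> : k * (p - q ^+ 2 / a) - q ^+ 2 * y ^+ 2 * (a^-1 - b / 2) =
    (p * (p + 1) * (p + 4 * q - 3) * (2 * q - 1) ^+ 2 * (3 - 2 * q) -
    q ^+ 2 * (p + 1) * (p + 4 * q - 3) + 8 * q ^+ 2 * (q - 1) ^+ 2 * (2 * q - 1)) / (4 * a * X).
    rewrite /k /y /a /b /X; field; move: a0 X0; rewrite /a /X => a0 X0.
    by rewrite !gt_eqF//; move: q1 p1; lra_goal.
  by apply: divr_gt0 => //; apply: mulr_gt0 => //; exact: mulr_gt0.
have k30 : 0 < k / 3 by rewrite divr_gt0.
have [d /andP[d0 dk] Fd] := small_cubic
  (- 3 * (p - q ^+ 2 / a) - k * (q ^+ 2 / a) - (q ^+ 2 + q ^+ 2 * y ^+ 2 + 1) * (a^-1 - b / 2)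
     - q ^+ 2 * y ^+ 2 * b)
  (3 * (q ^+ 2 / a) - q ^+ 2 * (a^-1 - b / 2) - (q ^+ 2 + q ^+ 2 * y ^+ 2 + 1) * b)
  (- (q ^+ 2 * b)) F0 k30.
set P := _ + _ in Fd.
have PE : P = (k - 3 * d) * (p - (1 + d) * q ^+ 2 / a) -
    ((1 + d) * q ^+ 2 * (d + y ^+ 2) + d) * (a^-1 - b * (1 - 2 * d) / 2).
  by rewrite /P; move: (a^-1) (b) (k) (y) => a' b' k' y'; field.
have d1 : d < 1 by move: k1 dk; lra_goal.
have kd : 0 <= k - 3 * d by move: dk; lra_goal.
have lamP lam : L / 2 <= lam -> 0 < lam by move: L0; lra_goal.
have Q0 : 0 <= p + 2 * q - 1 by move: q1 p1; lra_goal.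
have [K [M [cK KD M0 HM]]] := uniform_collar_bounds n2 sD p1 L0.
have [z [dz [d2z [cz sz z01 zK]]]] := cutoff_exists oD bD cK KD.
have [K1 K10 HK1] := weighted_stability oD bD cz sz z01 zK q1 M0 d0.
have [K2 K20 HK2] := weighted_bochner oD bD cz sz z01 zK q1 M0 d0.
have [K3 K30 HK3] := weighted_green oD bD cz sz z01 zK q1 M0 d0.
have [K4 K40 HK4] := momB_lower oD bD cz sz z01 zK p1 (ltW L0) q1 M0 d0 d1.
pose KK := K1 + K2 + K3 + K4.
have KK0 : 0 <= KK by rewrite !addr_ge0.
pose KE := (((1 + d) * q ^+ 2 * (d + y ^+ 2) + d) * (3 * KK) +
  (k - 3 * d) * (KK * ((1 + d) * q ^+ 2 + 1))) / P.
exists (2 / L * KE + M `^ (p + 2 * q - 1) * fine (lebesgue_rV n D)).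
move=> lam u du d2u v dv d2v /andP[l1 l2] sys st.
have lam0 : 0 < lam by exact: lamP.
have lamL : 0 < lam < L by rewrite lam0.
have [[[cu bu _ _] [cv bv _ _]] _ up eu ev] := sys.
have vp := system_v_pos oD bD lam0 sys.
have [_ HMc] := HM lam u du d2u v dv d2v lamL sys st.
have w1 x : D x -> 1 <= u x + 1 by move=> Dx; rewrite lerDr ltW// up.
have wp x : D x -> 0 < u x + 1 by move=> Dx; exact: lt_le_trans ltr01 (w1 x Dx).
have cw : C2 D (fun x => u x + 1) du d2u := system_w_C2 oD sys.
have eu' x : D x -> - lap d2u x = v x by move=> Dx; rewrite eu.
have gM x : D x -> ~ K x -> u x + 1 <= M /\ `|v x| <= M.
  by move=> Dx nK; have [h1 h2 _] := HMc x Dx nK; rewrite ger0_norm// ltW// vp.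
have T1 := HK1 p lam u _ du d2u v st cw wp eu' gM.
have T2 := HK2 _ du d2u v cw wp eu' gM.
have T3 := HK3 _ du d2u v dv d2v cw wp eu' cv gM.
have T4 := HK4 lam u du d2u v dv d2v lam0 (ltW l2) sys (fun x Dx nK => proj1 (gM x Dx nK)).
have C0' := momC_ge0 D z01 q (fun x => u x + 1) du.
set C := momC D z q _ du in T1 T2 T3 T4 C0'.
set B := momB D z q _ du v in T1 T2 T3 T4.
set A := momA D z q _ v in T1 T2 T3.
have bw (e : R) : BC D (fun x => (u x + 1) `^ e) by exact: (system_w_BC e sys).
have bz : BC D (fun x => z x ^+ 8 * (u x + 1) `^ (p + 2 * q - 1)).
  apply: BC_csMl; [by apply: C0X; exact: C2_C0 cz|by have [] := bw (p + 2 * q - 1)|].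
  exact: csX.
set F := itg D (fun x => z x ^+ 8 * (u x + 1) `^ (p + 2 * q - 1)) in T4.
have F0' : 0 <= F.
  apply: itg_ge0 => x _; rewrite mulr_ge0 ?powR_ge0// exprn_ge0//.
  by case/andP: (z01 x).
have WD x (e e' : R) : D x -> (u x + 1) `^ e * (u x + 1) `^ e' = (u x + 1) `^ (e + e').
  by move=> Dx; rewrite -powRD// (gt_eqF (wp x Dx)) implybT.
(* The left side of stability and, by the equation for v, the right side of Green's inequality
   involve the same moment [F]; this is why the system closes. *)
have E1 : itg D (fun x => (u x + 1) `^ (p - 1) * (z x ^+ 4 * (u x + 1) `^ q) ^+ 2) = F.
  apply: eq_itg => x Dx; rewrite exprMn -exprM mulrCA; congr (_ * _).
  by rewrite expr2 !WD//; congr (_ `^ _); ring.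
have E3 : itg D (fun x => z x ^+ 8 * (u x + 1) `^ (2 * q - 1) * - lap d2v x) = lam * F.
  rewrite -itgZ//; apply: eq_itg => x Dx; rewrite ev// mulrCA -mulrA WD//.
  by congr (_ * (_ * (_ `^ _))); ring.
rewrite E1 in T1; rewrite E3 in T3.
have T1' : p * (lam * F) <= (1 + d) * q ^+ 2 * ((A - 2 * (q - 1) * B) + y ^+ 2 * C) + d * C + KK.
  by rewrite mulrA [p * lam]mulrC; apply: (le_trans T1); rewrite lerD2l /KK -!addrA lerDl !addr_ge0.
have T2' : k * C <= (A - 2 * (q - 1) * B) - B / 2 + d * C + KK.
  apply: (le_trans T2).
  have -> : A + (3 / 2 - 2 * q) * B = A - 2 * (q - 1) * B - B / 2 by field.
  by rewrite lerD2l /KK addrAC -!addrA addrCA lerDl !addr_ge0.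
have T3' : a * (A - 2 * (q - 1) * B) <= lam * F + d * C + KK.
  by apply: (le_trans T3); rewrite lerD2l /KK addrAC lerDr !addr_ge0.
have T4' : b * (1 - 2 * d) * (lam * F) - d * C - KK <= B.
  by apply: le_trans T4; rewrite lerD2l lerN2 /KK lerDr !addr_ge0.
have EK : lam * F <= KE.
  by rewrite /KE ler_pdivlMr// PE; exact: (moment_w_closing a1 C0' KK0 d0 kd T1' T3' T2' T4').
have FE : F <= 2 / L * KE.
  apply: (@le_trans _ _ (2 / L * (lam * F))); last by rewrite ler_wpM2l// divr_ge0// ltW.
  rewrite mulrA ler_peMl// mulrAC ler_pdivlMr// mul1r.
  by move: l1; clear; lra.
apply: (@le_trans _ _ (F + M `^ (p + 2 * q - 1) * fine (lebesgue_rV n D))); last by rewrite lerD2r.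
rewrite /F -(itg_cst oD) -(itgD oD bD bz); last exact: BC_cst.
apply: itg_le => //; first by apply: BCD => //; exact: BC_cst.
move=> x Dx; have [Kx|nK] := pselect (K x).
  by have [zx _ _] := zK x Kx; rewrite zx expr1n mul1r lerDl powR_ge0.
have [h1 _ _] := HMc x Dx nK.
apply: (@le_trans _ _ (M `^ (p + 2 * q - 1))).
  by rewrite ge0_ler_powR ?nnegrE ?(ltW (wp x Dx)).
rewrite lerDr mulr_ge0 ?powR_ge0// exprn_ge0//.
by case/andP: (z01 x).
Qed.

Lemma least_root {R : realType} (f : R -> R) (a b : R) : continuous f -> a < b ->
  0 < f a -> f b < 0 -> exists r, [/\ a < r, r < b, f r = 0 & forall x, a <= x -> x < r -> 0 < f x].
Proof.
move=> cf ab fa fb; pose S := [set x | a <= x /\ f x <= 0].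
have S0 : S !=set0 by exists b; split; exact: ltW.
have lS : has_lbound S by exists a => x [].
have iS : has_inf S by [].
pose m := inf S.
have am : a <= m by apply: lb_le_inf => // x [].
have mb : m <= b by apply: ge_inf => //; split; exact: ltW.
have pos x : a <= x -> x < m -> 0 < f x.
  move=> ax xm; rewrite ltNge; apply/negP => fx.
  by have := ge_inf lS (conj ax fx : S x); rewrite leNgt xm.
have fm0 : f m <= 0.
  rewrite leNgt; apply/negP => fm.
  have : \forall x \near m, 0 < f x by exact: (cvgr_gt (f m) (cf m) 0 fm).
  move=> /nbhs_ballP[e /= e0 He].
  have [x Sx xm] := inf_adherent e0 iS.
  have mx := ge_inf lS Sx.
  have : 0 < f x by apply: He; rewrite /ball /= distrC ger0_norm ?subr_ge0// ltrBlDl.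
  by case: Sx => _; rewrite leNgt => /negP.
have am' : a < m.
  rewrite lt_neqAle am andbT; apply/eqP => e; move: fm0; rewrite -e; lra.
have fm : f m = 0.
  apply/eqP; rewrite eq_le fm0 /= leNgt; apply/negP => fm.
  have : \forall x \near m, f x < 0 by exact: (cvgr_lt (f m) (cf m) 0 fm).
  move=> /nbhs_ballP[e /= e0 He].
  pose x := Num.max a (m - e / 2).
  have xm : x < m by rewrite gt_max am' /=; lra.
  have ax : a <= x by rewrite le_max lexx.
  have : f x < 0.
    apply: He; rewrite /ball /= ger0_norm; last by lra.
    have : m - e / 2 <= x by rewrite le_max lexx orbT.
    lra.
  by rewrite ltNge (ltW (pos x ax xm)).
exists m; split => //; rewrite lt_neqAle mb andbT; apply/eqP => e.
by move: fb; rewrite -e fm ltxx.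
Qed.

(** * Exponents, the critical polynomial and the three cases *)

Section conclusion.
Context {R : realType}.

Definition closing_poly (p q : R) : R :=
  p * (p + 1) * (p + 4 * q - 3) * (2 * q - 1) ^+ 2 * (3 - 2 * q) -
    q ^+ 2 * (p + 1) * (p + 4 * q - 3) + 8 * q ^+ 2 * (q - 1) ^+ 2 * (2 * q - 1).

Lemma critical_polynomialE (n : nat) (x : R) : n%:R - 4 != 0 :> R ->
  critical_polynomial n x = (n%:R - 4) ^+ 3 / 4 * closing_poly (1 + 8 * x / (n%:R - 4)) x.
Proof.
move=> N4; rewrite /critical_polynomial /closing_poly /=; move: (n%:R : R) N4 => N N4.
by field.
Qed.

Lemma sextic_continuous (a b c d e f g : R) :
  continuous (fun x : R => a * x ^+ 6 + b * x ^+ 5 - c * x ^+ 4 + d * x ^+ 3 - e * x ^+ 2 + f * x - g).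
Proof.
rewrite (_ : (fun x => _) = horner (a%:P * 'X^6 + b%:P * 'X^5 - c%:P * 'X^4 + d%:P * 'X^3 -
  e%:P * 'X^2 + f%:P * 'X - g%:P)); first exact: continuous_horner.
by apply/funext => x; rewrite !(hornerD, hornerN, hornerM, hornerC, hornerXn, hornerX).
Qed.

Lemma closing_poly_continuous (p : R) : continuous (closing_poly p).
Proof.
rewrite (_ : closing_poly p = fun x => 0 * x ^+ 6 + 16 * x ^+ 5 - (32 * (p * (p + 1)) + 40) * x ^+ 4 +
  (p * (p + 1) * (104 - 8 * p) + 32 - 4 * (p + 1)) * x ^+ 3 -
  (p * (p + 1) * (116 - 20 * p) + 8 + (p + 1) * (p - 3)) * x ^+ 2 + (p * (p + 1) * (54 - 14 * p)) * x -
  3 * (p * (p + 1)) * (3 - p)); first exact: sextic_continuous.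
by apply/funext => q; rewrite /closing_poly; ring.
Qed.

Lemma critical_polynomial_continuous (n : nat) : continuous (@critical_polynomial R n).
Proof. exact: sextic_continuous. Qed.

(** Put e = 4/(n-8). The left end is x = 1 + e, for which p = 1 + 2 e = n/(n-8), and the closing
    polynomial there factors as 4 e times a quintic in e that is positive for e <= 1/3, that is n >=
    20. At 3/2 the main term vanishes and the value is negative, so the least root lies below
    3/2. *)
Lemma critical_polynomial_root (n : nat) : (20 <= n)%N -> exists r : R,
  [/\ (n%:R - 4) / (n%:R - 8) < r, r < 3 / 2, critical_polynomial n r = 0 &
      forall x : R, (n%:R - 4) / (n%:R - 8) <= x -> x < r -> 0 < critical_polynomial n x].
Proof.
move=> n20; have N20 : 20 <= n%:R :> R by rewrite ler_nat.
have N4 : n%:R - 4 != 0 :> R by rewrite gt_eqF//; lra.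
have N30 : 0 < (n%:R - 4) ^+ 3 / 4 :> R by rewrite divr_gt0// exprn_gt0//; lra.
have N8 : 0 < n%:R - 8 :> R by lra.
pose e : R := 4 / (n%:R - 8); have e0 : 0 < e by rewrite divr_gt0.
have e3 : e <= 3^-1 by rewrite ler_pdivrMr//; lra.
have xe : (n%:R - 4) / (n%:R - 8) = 1 + e by rewrite /e; field; rewrite gt_eqF.
apply: least_root.
- exact: critical_polynomial_continuous.
- by rewrite xe; lra.
- rewrite critical_polynomialE// mulr_gt0//.
  have -> : 1 + 8 * ((n%:R - 4) / (n%:R - 8)) / (n%:R - 4) = 1 + 2 * e.
    by rewrite /e; field; rewrite N4 gt_eqF.
  rewrite xe; have -> : closing_poly (1 + 2 * e) (1 + e) = 4 * e *
     (2 + 9 * e - 6 * e ^+ 2 - 73 * e ^+ 3 - 108 * e ^+ 4 - 48 * e ^+ 5).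
    by rewrite /closing_poly; move: (e) => t; ring.
  have h k : e ^+ k.+2 <= e ^+ k.+1 * 3^-1 by rewrite exprSr ler_wpM2l// exprn_ge0// ltW.
  have := h 0; have := h 1; have := h 2; have := h 3; rewrite expr1.
  move=> h3 h2 h1 h0; apply: mulr_gt0; first by rewrite mulr_gt0.
  move: e0 e3 h0 h1 h2 h3; clear; move: (e ^+ 2) (e ^+ 3) (e ^+ 4) (e ^+ 5) (e) => a b c d t; lra.
rewrite critical_polynomialE// pmulr_rlt0//.
set p := 1 + _; have p1 : 1 < p by rewrite /p ltrDl divr_gt0//; lra.
have -> : closing_poly p (3 / 2) = - (9 / 4 * ((p + 1) * (p + 3) - 4)).
  by rewrite /closing_poly; field.
by rewrite oppr_lt0 mulr_gt0//; nra.
Qed.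

Lemma crit_exp_gt4 (n : nat) : (4 < n)%N -> @crit_exp R n = n%:R / 4.
Proof. by rewrite /crit_exp ltnNge; case: ifP. Qed.

Lemma extremal_bounded_near (n : nat) : (9 <= n)%N -> exists eps : R, 0 < eps /\
  forall D : set 'rV[R]_n, smooth_bounded_convex_domain D ->
  forall p : R, 1 < p -> p < n%:R / (n%:R - 8) + eps -> extremal_solution_bounded p D.
Proof.
move=> n9; have N9 : 9 <= n%:R :> R by rewrite ler_nat.
have N8 : 0 < n%:R - 8 :> R by lra.
have n0 : (0 < n)%N by apply: leq_trans n9.
pose p0 : R := n%:R / (n%:R - 8).
have p0E : p0 * (n%:R - 8) = n%:R by rewrite divfK// gt_eqF.
have p01 : 1 < p0 by rewrite ltr_pdivlMr// mul1r; lra.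
have p01' : 0 < p0 - 1 by rewrite subr_gt0.
have h2 : (0 : R) < 1 / 2 by [].
(* The quadratic is 2 p0 (1 - 4 y^2) - (1 + y)^2 (p0 + 1), so the hypothesis of [moment_v] holds at
   p0 = n/(n-8), and then for every p >= p0. *)
have [y /andP[y0 y1] hy] := small_cubic (- 2 * (p0 + 1)) (- (9 * p0 + 1)) 0 p01' h2.
(* The order 2p + y (p+1) exceeds (p - 1) n/4 when p (n - 8) - n < 4 y (p + 1). The left side is (p
   - p0)(n - 8), so n (p - p0) < 4 y is enough. The choice depends on n only. *)
exists (4 * y / n%:R); split; first by rewrite divr_gt0 ?mulr_gt0//; lra.
move=> D sD p p1 pe; have [_ oD bD _ _] := sD.
have [pp|pp] := ltP p p0.
  apply: extremal_bounded_subcritical => //.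
  by rewrite -ltr_pdivlMr.
apply: (@extremal_bounded_of_moment R n D oD bD p (2 * p + y * (p + 1))) => //.
  rewrite crit_exp_gt4; last by apply: leq_trans n9.
  have h : (p - p0) * n%:R < 4 * y.
    by rewrite -ltr_pdivlMr; [rewrite ltrBlDl|lra].
  have h4 : (p - p0) * (n%:R - 8) <= (p - p0) * n%:R by rewrite ler_wpM2l//; move: pp; lra_goal.
  have h3 : 0 < y * p by rewrite mulr_gt0//; move: p1; lra_goal.
  move: h4 h3 h p0E; lra_goal.
move=> L L0; apply: moment_v => //.
  by apply: leq_trans n9.
nra.
Qed.

Lemma extremal_bounded_far (n : nat) (r : R) : (20 <= n)%N -> r < 3 / 2 ->
  (forall x : R, (n%:R - 4) / (n%:R - 8) <= x -> x < r -> 0 < critical_polynomial n x) ->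
  forall D : set 'rV[R]_n, smooth_bounded_convex_domain D ->
  forall p : R, 1 < p -> p < 1 + 8 * r / (n%:R - 4) -> extremal_solution_bounded p D.
Proof.
move=> n20 r3 rpos D sD p p1 pr; have [_ oD bD _ _] := sD.
have N20 : 20 <= n%:R :> R by rewrite ler_nat.
have N8 : 0 < n%:R - 8 :> R by lra.
have N4 : 0 < n%:R - 4 :> R by lra.
have n0 : (0 < n)%N by apply: leq_trans n20.
have [pp|pp] := ltP (p * (n%:R - 8)) n%:R.
  exact: extremal_bounded_subcritical.
(* The exponent q for which the order p + 2q - 1 equals the threshold (p - 1) n/4 exactly. *)
pose x := (p - 1) * (n%:R - 4) / 8.
have px : 1 + 8 * x / (n%:R - 4) = p by rewrite /x; field; rewrite gt_eqF.
have x0 : (n%:R - 4) / (n%:R - 8) <= x.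
  by rewrite ler_pdivrMr// /x; nra.
have xr : x < r.
  have : (p - 1) * (n%:R - 4) < 8 * r by rewrite -ltr_pdivlMr//; lra.
  by rewrite /x; lra.
have x1 : 1 <= x.
  by apply: le_trans x0; rewrite ler_pdivlMr// mul1r; lra.
have := rpos x x0 xr; rewrite critical_polynomialE ?gt_eqF// px pmulr_rgt0; last first.
  by rewrite divr_gt0// exprn_gt0.
move=> cx; have : \forall q \near x, 0 < closing_poly p q.
  exact: (cvgr_gt _ (@closing_poly_continuous p x) 0 cx).
move=> /nbhs_ballP[e /= e0 He].
(* The moment must exceed the threshold strictly, so q is taken slightly above [x], within the
   neighbourhood where the closing polynomial stays positive and below 3/2. *)
pose q := x + Num.min (e / 2) ((3 / 2 - x) / 2).
have [q1 q2 q3] : [/\ x < q, q < x + e & q < 3 / 2].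
  rewrite /q ltrDl lt_min; split; first by apply/andP; split; move: e0 xr r3; lra_goal.
    have : Num.min (e / 2) ((3 / 2 - x) / 2) <= e / 2 by rewrite ge_min lexx.
    lra.
  have : Num.min (e / 2) ((3 / 2 - x) / 2) <= (3 / 2 - x) / 2 by rewrite ge_min lexx orbT.
  lra.
have cq : 0 < closing_poly p q.
  by apply: He; rewrite /ball /= distrC ger0_norm; move: q2 q1; lra_goal.
apply: (@extremal_bounded_of_moment R n D oD bD p (p + 2 * q - 1)) => //.
  rewrite crit_exp_gt4; last by apply: leq_trans n20.
  by move: q1; rewrite /x; lra_goal.
move=> L L0; apply: moment_w => //; last by move: x1 q1; lra_goal.
by apply: leq_trans n20.
Qed.

End conclusion.


Unset Implicit Arguments.
Set Strict Implicit.
Set Printing Implicit Defensive.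
Theorem theorem1p2 (R : realType) (n : nat) (hn : (1 <= n)%N) :
  [/\ (n <= 8)%N ->
        forall D : set 'rV[R]_n, smooth_bounded_convex_domain D ->
        forall p : R, 1 < p -> extremal_solution_bounded p D,
      (9 <= n <= 19)%N ->
        exists eps : R, 0 < eps /\
        forall D : set 'rV[R]_n, smooth_bounded_convex_domain D ->
        forall p : R, 1 < p -> p < n%:R / (n%:R - 8) + eps ->
          extremal_solution_bounded p D &
      (20 <= n)%N ->
        exists ps : R, smallest_root_above n ps /\
        forall D : set 'rV[R]_n, smooth_bounded_convex_domain D ->
        forall p : R, 1 < p -> p < 1 + 8 * ps / (n%:R - 4) ->
          extremal_solution_bounded p D].
Proof.
split.
- move=> n8 D [_ oD bD _ _] p p1; apply: extremal_bounded_subcritical => //.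
  have n8' : (n%:R : R) <= 8 by rewrite (ler_nat R n 8).
  have n1 : (0 : R) < n%:R by rewrite ltr0n.
  apply: le_lt_trans n1; rewrite mulr_ge0_le0//; lra.
- by move=> /andP[n9 _]; exact: extremal_bounded_near.
move=> n20; have [r [x0 r3 cr pos]] := @critical_polynomial_root R n n20.
exists r; split; last exact: extremal_bounded_far pos.
split => // y y0 cy; rewrite leNgt; apply/negP => yr.
by have := pos y (ltW y0) yr; rewrite cy ltxx.
Qed.
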